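(* Let $dX_t=\mu_t\,dt+\sigma_t\,dB_t$ on $[0,T]$, where $(\mu,\sigma)$ satisfies the non-leverage condition, the moment bound, and the scaling condition with data $(\gamma,L,C_\gamma)$, and let $K$ be an admissible kernel for $(\gamma,C_\gamma)$. Then for every $\tau\in(0,T)$, as $n\to\infty$, $h\to0$, $\Delta/h\to0$, $$\Big(\frac{\Delta}{h}\Big)^{-1/2}\sum_{i=1}^nK_h(t_{i-1}-\tau)\Big((\Delta_iX)^2-\int_{t_{i-1}}^{t_i}\sigma_t^2dt\Big)\longrightarrow_D\delta_1\,\xi,$$ where $\delta_1^2=2\sigma_\tau^4\int K^2(x)dx$ and $\xi$ is a standard normal random variable independent of $\delta_1$. Moreover, $$\Big(\frac{\Delta}{h}\Big)^{-1/2}\Big[\sum_{i=1}^nK_h(t_{i-1}-\tau)(\Delta_iX)^2-\int_0^TK_h(t-\tau)\sigma_t^2dt\Big]\longrightarrow_D\delta_1\,\xi .$$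
   Context: Setting. On a complete filtered probability space $(\Omega,\mathscr F,\mathbb F=\{\mathscr F_t\}_{t\ge0},\mathbb P)$, $\mu,\sigma$ are $\mathbb F$-adapted processes and $B$ is a standard Brownian motion adapted to $\mathbb F$. $X$ is observed at $t_i=iT/n$, $0\le i\le n$; $\Delta=T/n$; $\Delta_iX=X_{t_i}-X_{t_{i-1}}$; $K_h(x)=K(x/h)/h$. $\to_D$ denotes convergence in distribution. Non-leverage condition: $(\mu,\sigma)$ is independent of $B$. Moment bound: there is $M_T>1$ with $\mathbb E[\mu_t^4+\sigma_t^4]<M_T$ for all $t\in[0,T]$. Scaling condition with data $(\gamma,L,C_\gamma)$: $\gamma>0$, $L$ is a nonnegative function of $t$, $C_\gamma:\mathbb R\times\mathbb R\to\mathbb R$ is not identically zero and satisfies $C_\gamma(hr,hs)=h^\gamma C_\gamma(r,s)$ for all $r,s\in\mathbb R$, $h>0$; and $V_t=\sigma_t^2$ satisfies, for each $t\in(0,T)$, $\mathbb E[(V_{t+r}-V_t)(V_{t+s}-V_t)]=L(t)C_\gamma(r,s)+o((r^2+s^2)^{\gamma/2})$ as $r,s\to0$. Admissible kernel for $(\gamma,C_\gamma)$: $K:\mathbb R\to\mathbb R$ such that (1) $\int K(x)dx=1$; (2) $K$ is Lipschitz and piecewise $C^1$ on its support $(A,B)$, where $-\infty\le A<0<B\le\infty$; (3) $\int|K(x)||x|^\gamma dx<\infty$, $K(x)x^{\gamma+1}\to0$ as $|x|\to\infty$, $\int|K'(x)|dx<\infty$, and the total variation of $|K'|$ over $(-\infty,\infty)$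 is finite; (4) $\iint K(x)K(y)C_\gamma(x,y)dxdy>0$. *)

(* Defs.v *)
From HB Require Import structures.
From mathcomp Require Export all_boot all_order all_algebra.
From mathcomp Require Export all_classical all_reals all_analysis.
Export Order.TTheory GRing.Theory Num.Theory.
Export numFieldNormedType.Exports.

Set Implicit Arguments.
Unset Strict Implicit.
Unset Printing Implicit Defensive.

Local Open Scope classical_set_scope.
Local Open Scope ring_scope.

(* A process is a function [R -> Omega -> R]; its values at negative times are
   never used.  A filtration is a family of classes of events indexed by
   [t : R], again only relevant for [0 <= t]. *)

Section Probability.
Context d (Omega : measurableType d) (R : realType).
Variable P : probability Omega R.

Definition indep_events (G H : set (set Omega)) : Prop :=
  forall A B, G A -> H B -> P (A `&` B) = (P A * P B)%E.

Definition rv_events (Y : Omega -> R) : set (set Omega) :=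
  preimage_set_system setT Y measurable.

Definition process_events (Y : R -> Omega -> R) : set (set Omega) :=
  [set A | exists2 t : R, 0 <= t & rv_events (Y t) A].

(* [normal_prob] is parametrized by the standard deviation [s]; [s != 0]. *)
Definition normal_rv (Y : Omega -> R) (m s : R) : Prop :=
  measurable_fun setT Y /\
  forall U, measurable U -> P (Y @^-1` U) = normal_prob m s U.

Record complete_filtration (FF : R -> set (set Omega)) : Prop := {
  filtration_complete : measure_is_complete P ;
  filtration_sigma : forall t : R, 0 <= t -> sigma_algebra setT (FF t) ;
  filtration_sub : forall t : R, 0 <= t -> FF t `<=` measurable ;
  filtration_mono : forall s t : R, 0 <= s -> s <= t -> FF s `<=` FF t ;
  filtration_null : forall N, P.-negligible N -> FF 0 N }.

Definition adapted (FF : R -> set (set Omega)) (Y : R -> Omega -> R) : Prop :=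
  forall t : R, 0 <= t -> rv_events (Y t) `<=` FF t.

(* Measurability in (t, omega), without which time integrals of the process
   are meaningless. *)
Definition measurable_process (Y : R -> Omega -> R) : Prop :=
  measurable_fun [set z : R * Omega | 0 <= z.1] (fun z : R * Omega => Y z.1 z.2).

Record brownian_motion (FF : R -> set (set Omega)) (B : R -> Omega -> R) :
    Prop := {
  bm_adapted : adapted FF B ;
  bm_start : {ae P, forall w, B 0 w = 0} ;
  bm_normal : forall s t : R, 0 <= s -> s < t ->
    normal_rv (fun w => B t w - B s w) 0 (Num.sqrt (t - s)) ;
  bm_indep : forall s t : R, 0 <= s -> s < t ->
    indep_events (rv_events (fun w => B t w - B s w)) (FF s) ;
  bm_continuous : {ae P, forall w, {within `[0, +oo[, continuous (B ^~ w)}} }.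

(* [(m, s, v)] encodes the process
     \sum_(j < m) v_j 1_{]s_j, s_(j+1)]},  0 = s_0 <= ... <= s_m = T,
   with v_j bounded and measurable with respect to FF (s_j). *)
Definition step_process : Type :=
  (nat * (nat -> R) * (nat -> Omega -> R))%type.

Definition simple_process (FF : R -> set (set Omega)) (T : R)
    (S : step_process) : Prop :=
  let: (m, s, v) := S in
  [/\ s 0%N = 0, s m = T, (forall j, (j < m)%N -> s j <= s j.+1) &
      forall j, (j < m)%N ->
        rv_events (v j) `<=` FF (s j) /\ exists M : R, forall w, `|v j w| <= M].

Definition step_value (S : step_process) (t : R) (w : Omega) : R :=
  let: (m, s, v) := S in
  \sum_(j < m) v j w * \1_(`]s j, s j.+1]) t.

Definition step_integral (B : R -> Omega -> R) (S : step_process)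
    (t : R) (w : Omega) : R :=
  let: (m, s, v) := S in
  \sum_(j < m) v j w * (B (Num.min (s j.+1) t) w - B (Num.min (s j) t) w).

(* [J t] is the Ito integral of [H] over [0, t], for 0 <= t <= T.  This is the
   L2 construction, hence for integrands with E \int_0^T H^2 dt < oo. *)
Definition ito_integral (FF : R -> set (set Omega)) (B : R -> Omega -> R)
    (T : R) (H J : R -> Omega -> R) : Prop :=
  adapted FF J /\
  exists S : nat -> step_process,
  [/\ forall k, simple_process FF T (S k),
      (\int[P]_w \int[lebesgue_measure]_(t in `[0%R, T])
         ((step_value (S k) t w - H t w) ^+ 2)%:E)%E @[k --> \oo] --> 0%E &
      forall t : R, 0 <= t <= T ->
        'E_P[fun w => ((step_integral B (S k) t w - J t w) ^+ 2)%R]%E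
          @[k --> \oo] --> 0%E].

(* dX_t = mu_t dt + sigma_t dB_t on [0, T] *)
Definition ito_process (FF : R -> set (set Omega)) (B : R -> Omega -> R)
    (T : R) (mu sigma X : R -> Omega -> R) : Prop :=
  [/\ forall t : R, 0 <= t <= T -> rv_events (X t) `<=` FF t,
      {ae P, forall w, {within `[0, T], continuous (X ^~ w)}},
      {ae P, forall w,
        lebesgue_measure.-integrable `[0, T] (fun t => (mu t w)%:E)} &
      exists2 J, ito_integral FF B T sigma J &
        forall t : R, 0 <= t <= T -> {ae P, forall w,
          X t w = X 0 w + \int[lebesgue_measure]_(s in `[0, t]) mu s w
                  + J t w}].

Definition non_leverage (mu sigma B : R -> Omega -> R) : Prop :=
  indep_events <<s process_events mu `|` process_events sigma >>
               <<s process_events B >>.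

Definition moment_bound (T : R) (mu sigma : R -> Omega -> R) : Prop :=
  exists2 M : R, 1 < M &
    forall t : R, 0 <= t <= T ->
      ('E_P[fun w => (mu t w ^+ 4 + sigma t w ^+ 4)%R] < M%:E)%E.

Record scaling_condition (T : R) (sigma : R -> Omega -> R)
    (gamma : R) (L : R -> R) (C : R -> R -> R) : Prop := {
  scaling_gamma : 0 < gamma ;
  scaling_L : forall t : R, 0 <= L t ;
  scaling_nonzero : exists r s, C r s != 0 ;
  scaling_homogeneous : forall h r s : R, 0 < h ->
    C (h * r) (h * s) = h `^ gamma * C r s ;
  scaling_expansion : forall t : R, 0 < t < T ->
    (fun p : R * R =>
       fine 'E_P[fun w => ((sigma (t + p.1) w ^+ 2 - sigma t w ^+ 2) *
                           (sigma (t + p.2) w ^+ 2 - sigma t w ^+ 2))%R]%E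
       - L t * C p.1 p.2)
    =o_ (0 : R * R) (fun p : R * R => (p.1 ^+ 2 + p.2 ^+ 2) `^ (gamma / 2)) }.

End Probability.

Arguments indep_events {d Omega R} P G H.
Arguments rv_events {d Omega R} Y.
Arguments complete_filtration {d Omega R} P FF.
Arguments brownian_motion {d Omega R} P FF B.

(* The limit may live on a different probability space. *)
Definition cvg_in_distribution (R : realType)
    d (Omega : measurableType d) (P : probability Omega R)
    d' (Omega' : measurableType d') (P' : probability Omega' R)
    (Y : nat -> Omega -> R) (Z : Omega' -> R) : Prop :=
  forall f : R -> R, continuous f -> (exists M : R, forall x, `|f x| <= M) ->
    'E_P[f \o Y n]%E @[n --> \oo] --> 'E_P'[f \o Z]%E.

(* [(Omega', P', rho)] is an extension of [(Omega, P)]: every random variable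
   [Y] on [Omega] is identified with [Y \o rho]. *)
Definition extension (R : realType)
    d (Omega : measurableType d) (P : probability Omega R)
    d' (Omega' : measurableType d') (P' : probability Omega' R)
    (rho : Omega' -> Omega) : Prop :=
  measurable_fun setT rho /\
  forall A, measurable A -> P' (rho @^-1` A) = P A.

Section Kernel.
Context (R : realType).
Local Notation leb := (@lebesgue_measure R).

Definition rescale (K : R -> R) (h x : R) : R := K (x / h) / h.

Definition eitv (A B : \bar R) : set R := [set x | (A < x%:E < B)%E].

(* [K] is C^1 with derivative [K'] on the open set [I], up to a locally finite
   set [D] of break points, at which [K'] has one-sided limits but its value is
   arbitrary.  [K'] vanishes off the closure of [I]. *)
Definition piecewise_C1 (I : set R) (K K' : R -> R) : Prop :=
  exists D : set R,
  [/\ forall a b : R, finite_set (D `&` `[a, b]),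
      forall x, I x -> ~ D x ->
        is_derive x (1 : R) K (K' x) /\ {for x, continuous K'},
      forall x, I x -> cvg (K' @ x^'-) /\ cvg (K' @ x^'+) &
      forall x : R, ~ closure I x -> K' x = 0].

Definition bounded_variation_line (f : R -> R) : Prop :=
  exists M : R, forall a b : R, a <= b -> (total_variation a b f <= M%:E)%E.

(* The support is taken up to closure, so the values of [K] at finite end
   points [A], [B] are unconstrained. *)
Definition admissible_kernel (gamma : R) (C : R -> R -> R) (K : R -> R) :
    Prop :=
  exists (A B : \bar R) (K' : R -> R),
  [/\ [/\ (A < 0%:E)%E, (0%:E < B)%E &
          closure [set x | K x != 0] = closure (eitv A B)],
      (\int[leb]_x (K x)%:E = 1)%E,
      [lipschitz K x | x in eitv A B] /\ piecewise_C1 (eitv A B) K K',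
      [/\ (\int[leb]_x (`|K x| * `|x| `^ gamma)%:E < +oo)%E,
          (K x * `|x| `^ (gamma + 1)) @[x --> +oo] --> (0 : R) /\
          (K x * `|x| `^ (gamma + 1)) @[x --> -oo] --> (0 : R),
          (\int[leb]_x (`|K' x|)%:E < +oo)%E &
          bounded_variation_line (fun x => `|K' x|)] &
      let F := fun z : R * R => (K z.1 * K z.2 * C z.1 z.2)%:E in
      (leb \x leb)%E.-integrable setT F /\
      (0 < \int[leb \x leb]_z F z)%E].

End Kernel.

Section Statistics.
Context d (Omega : measurableType d) (R : realType).
Variables (T tau : R) (K : R -> R) (sigma X : R -> Omega -> R).

Definition obs_time (n i : nat) : R := i%:R * T / n%:R.

Definition incr_sq (n i : nat) (w : Omega) : R :=
  (X (obs_time n i) w - X (obs_time n i.-1) w) ^+ 2.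

Definition local_sum (n : nat) (h : R) (w : Omega) : R :=
  ((T / n%:R) / h) `^ (- 2^-1) *
  \sum_(1 <= i < n.+1) rescale K h (obs_time n i.-1 - tau) *
    (incr_sq n i w -
     \int[lebesgue_measure]_(t in `[obs_time n i.-1, obs_time n i])
       sigma t w ^+ 2).

Definition kernel_error (n : nat) (h : R) (w : Omega) : R :=
  ((T / n%:R) / h) `^ (- 2^-1) *
  (\sum_(1 <= i < n.+1) rescale K h (obs_time n i.-1 - tau) * incr_sq n i w -
   \int[lebesgue_measure]_(t in `[0, T])
     (rescale K h (t - tau) * sigma t w ^+ 2)).

End Statistics.

(* Main.v *)
(** Write [t_i = i T / n], [eps = Delta / h] and [a_i = eps^(-1/2) K_h(t_i - tau)].

    On each cell [sigma] is replaced by a bounded step process with values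
    [clip (sigma s_ij)], on a grid fine enough that the resulting stochastic integral
    [J_i] and its variance [I_i] satisfy
    E|((Delta_i X)^2 - int sigma^2) - (J_i^2 - I_i)| = O(Delta^(3/2)); the drift is of the
    same order.  Summed against [|a_i|] these errors are O(sqrt h), and replacing
    [int K_h(t - tau) sigma_t^2 dt] by its Riemann sum costs O(sqrt eps) because [K] has
    bounded variation.

    The volatility being independent of [B], it can be frozen in
    sum_i a_i (J_i^2 - I_i), which becomes a sum of independent centred chi-squares with
    variances 2 a_i^2 I_i^2, and Lindeberg's argument compares its characteristic function
    with exp(- l^2 sum_i (a_i I_i)^2).  The scaling condition is used only through the
    L^2-continuity of sigma^2 at tau, which gives
    sum_i (a_i I_i)^2 -> sigma_tau^4 int K^2 in probability.  Hence the characteristic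
    functions converge to E exp(- l^2 delta_1^2 / 2), that of delta_1 xi. *)

From HB Require Import structures.
Require Import Defs.
From mathcomp Require Import measurable_realfun lra ring.

Set Implicit Arguments.
Unset Strict Implicit.
Unset Printing Implicit Defensive.

Local Open Scope classical_set_scope.
Local Open Scope ring_scope.

(** * Independence and elementary estimates *)

(** The conditional law of an increment of [X] given the volatility is not directly accessible:
    [ito_integral] provides only an L2 limit, along simple processes that may depend on [B]. The
    step process put on each cell is therefore built from [sigma] itself. Its values are measurable
    both for the filtration, as the isometry requires, and for the algebra generated by the
    coefficients, as freezing requires; once frozen, its integral is a finite sum of independent
    Gaussians.

    Only fourth moments of [sigma] are bounded, whereas the Lindeberg error contains cubes of cell
    variances, that is, sixth powers. This error is capped at 2, the trivial bound for a difference
    of cosines, and passes to the limit by bounded convergence.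

    The normal characteristic function comes from the convolution identity that Brownian increments
    supply. Convergence of characteristic functions becomes convergence in law by Gaussian
    smoothing; as the limit is a given random variable, a cut-off of the test functions takes the
    place of tightness. *)

Section Independence.
Context d (Omega : measurableType d) (R : realType) (P : probability Omega R).

Lemma bounded_integrable (f : Omega -> R) (M : R) :
  measurable_fun setT f -> (forall w, `|f w| <= M) ->
  P.-integrable setT (EFin \o f).
Proof.
move=> mf fM; apply: measurable_bounded_integrable => //.
- by rewrite (le_lt_trans (probability_le1 P measurableT)) ?ltry.
- exists M; split; first exact: num_real.
  by move=> x Mx w _ /=; rewrite (le_trans (fM w))// ltW.
Qed.

Lemma Rintegral_prob_cst (r : R) : \int[P]_w r = r.
Proof.
rewrite Rintegral_cst//; transitivity (r * fine (1%E : \bar R)); last exact: mulr1.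
by congr (_ * fine _); exact: probability_setT.
Qed.

Context d1 d2 (T1 : measurableType d1) (T2 : measurableType d2).

(** Arbitrary target types allow a sub-sigma-algebra to be treated as the random variable [id] into
    the sample space equipped with it. *)
Definition indep_rv (X : Omega -> T1) (Y : Omega -> T2) : Prop :=
  forall A B, measurable A -> measurable B ->
    P (X @^-1` A `&` Y @^-1` B) = (P (X @^-1` A) * P (Y @^-1` B))%E.

Variables (X : Omega -> T1) (Y : Omega -> T2).
Hypotheses (mX : measurable_fun setT X) (mY : measurable_fun setT Y).
Hypothesis XY : indep_rv X Y.

Let mfX : {mfun Omega >-> T1} := HB.pack X (isMeasurableFun.Build _ _ _ _ _ mX).
Let mfY : {mfun Omega >-> T2} := HB.pack Y (isMeasurableFun.Build _ _ _ _ _ mY).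
Let PX : probability T1 R := distribution P mfX.
Let PY : probability T2 R := distribution P mfY.

Let pair_measurable : measurable_fun setT (fun w => (X w, Y w)).
Proof. exact: measurable_fun_pair. Qed.
Let mfXY : {mfun Omega >-> (T1 * T2)%type} :=
  HB.pack (fun w => (X w, Y w)) (isMeasurableFun.Build _ _ _ _ _ pair_measurable).
Let PXY : probability _ R := distribution P mfXY.

(** Independence is agreement of the two laws on rectangles; uniqueness of the product measure
    extends it to all measurable sets. *)
Let PXYE A : measurable A -> (PX \x PY)%E A = PXY A.
Proof.
by move=> mA; apply: product_measure_unique => // B C mB mC; exact: XY.
Qed.

(** The form in which independence is exploited: [X] is frozen at [w] while [Y] runs over a second
    sample point [v] of the same space. *)
Lemma indep_integral_ge0 (F : T1 * T2 -> \bar R) :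
  measurable_fun setT F -> (forall z, (0 <= F z)%E) ->
  (\int[P]_w F (X w, Y w) = \int[P]_w \int[P]_v F (X w, Y v))%E.
Proof.
move=> mF F0.
transitivity (\int[PXY]_z F z)%E.
  by rewrite /PXY ge0_integral_distribution.
transitivity (\int[(PX \x PY)%E]_z F z)%E.
  by apply: eq_measure_integral => A mA _; exact/esym/PXYE.
rewrite fubini_tonelli1// /PX ge0_integral_distribution//; last 2 first.
- exact: (measurable_fun_fubini_tonelli_F F).
- by move=> y; apply: integral_ge0.
apply: eq_integral => w _ /=.
rewrite /fubini_F /PY ge0_integral_distribution//.
by apply: measurableT_comp => //; exact: pair1_measurable.
Qed.

Lemma indep_mul (f : T1 -> R) (g : T2 -> R) :
  measurable_fun setT f -> measurable_fun setT g ->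
  P.-integrable setT (EFin \o f \o X) -> P.-integrable setT (EFin \o g \o Y) ->
  P.-integrable setT (fun w => (f (X w) * g (Y w))%:E) /\
  \int[P]_w (f (X w) * g (Y w)) = (\int[P]_w f (X w)) * (\int[P]_w g (Y w)).
Proof.
move=> mf mg ifX igY.
pose F := fun z : T1 * T2 => (f z.1 * g z.2)%:E.
have mF : measurable_fun setT F.
  apply/measurable_EFinP; apply: measurable_funM.
    by apply: measurableT_comp => //; exact: measurable_fst.
  by apply: measurableT_comp => //; exact: measurable_snd.
(* Tonelli for the absolute value gives integrability, after which Fubini applies to the signed
   product. *)
have iF : P.-integrable setT (F \o (fun w => (X w, Y w))).
  apply/integrableP; split; first exact: measurableT_comp.
  rewrite /= (indep_integral_ge0 (F := abse \o F))//; last 2 first.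
  exact: measurableT_comp.
  by move=> z; exact: abse_ge0.
  under eq_integral.
    move=> w _; under eq_integral do rewrite /= normrM EFinM.
    rewrite ge0_integralZl_EFin//; last first.
      by apply/measurable_EFinP; apply: measurableT_comp => //; exact: measurableT_comp.
    over.
  have [_ ify] := integrableP _ _ _ igY.
  rewrite ge0_integralZr//.
  - have [_ ifx] := integrableP _ _ _ ifX.
    apply: lte_mul_pinfty => //; first exact: integral_ge0.
    rewrite ge0_fin_numE//; exact: integral_ge0.
  - by apply/measurable_EFinP; apply: measurableT_comp => //; exact: measurableT_comp.
  - exact: integral_ge0.
split => //.
rewrite /Rintegral -fineM; last 2 first.
- by apply: integrable_fin_num.
- by apply: integrable_fin_num.
congr fine.
transitivity (\int[PXY]_z F z)%E.
  by rewrite /PXY integral_distribution.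
transitivity (\int[(PX \x PY)%E]_z F z)%E.
  by apply: eq_measure_integral => A mA _; exact/esym/PXYE.
have iFp : (PX \x PY)%E.-integrable setT F.
  have : PXY.-integrable setT F.
    by rewrite /PXY /distribution; apply: integrable_pushforward.
  move=> /integrableP[_ h]; apply/integrableP; split=> //.
  apply: le_lt_trans h; rewrite le_eqVlt; apply/orP; left; apply/eqP.
  by apply: eq_measure_integral => A mA _; exact: PXYE.
rewrite -(integral12_prod_meas1 iFp) /fubini_F/=.
have iY : PY.-integrable setT (EFin \o g).
  rewrite /PY /distribution; apply: integrable_pushforward => //.
  exact/measurable_EFinP.
have iX : PX.-integrable setT (EFin \o f).
  rewrite /PX /distribution; apply: integrable_pushforward => //.
  exact/measurable_EFinP.
under eq_integral.
  move=> x _; under eq_integral do rewrite /F /= EFinM.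
  rewrite integralZl//; over.
have -> : (\int[P]_w (g (Y w))%:E = \int[PY]_y (g y)%:E)%E.
  by rewrite /PY integral_distribution//; exact/measurable_EFinP.
have -> : (\int[P]_w (f (X w))%:E = \int[PX]_y (f y)%:E)%E.
  by rewrite /PX integral_distribution//; exact/measurable_EFinP.
have : (\int[PY]_y (g y)%:E \is a fin_num)%E by exact: integrable_fin_num.
by move=> /fineK <-; rewrite integralZr.
Qed.

Lemma indep_Rintegral (F : T1 * T2 -> R) (M : R) :
  measurable_fun setT F -> (forall z, `|F z| <= M) ->
  \int[P]_w F (X w, Y w) = \int[P]_w \int[P]_v F (X w, Y v).
Proof.
move=> mF FM.
have mF1 x : measurable_fun setT (fun v => F (x, Y v)).
  apply: (measurableT_comp (f := fun y => F (x, y))) => //.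
  by apply: measurableT_comp => //; exact: pair1_measurable.
have iF1 x : P.-integrable setT (EFin \o (fun v => F (x, Y v))).
  exact: (@bounded_integrable _ M).
have iF : P.-integrable setT (EFin \o (fun v => F (X v, Y v))).
  by apply: (@bounded_integrable _ M) => //; exact: measurableT_comp.
(* Shifted by its bound, [F] is nonnegative and [indep_integral_ge0] applies; the constant cancels
   at the end because [P] has mass one. *)
have mG : measurable_fun setT (fun z => (F z + M)%:E).
  by apply/measurable_EFinP; exact: measurable_funD.
have G0 z : (0 <= (F z + M)%:E)%E.
  by rewrite lee_fin; have := FM z; rewrite ler_norml => /andP[]; lra.
have H := indep_integral_ge0 mG G0.
have cstP : \int[P]_w M = M by exact: Rintegral_prob_cst.
have icst : P.-integrable setT (EFin \o (fun=> M)).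
  by apply: (@bounded_integrable _ `|M|).
have H1 : \int[P]_w (F (X w, Y w) + M) = \int[P]_w F (X w, Y w) + M.
  by rewrite RintegralD// cstP.
have H2 x : (\int[P]_v (F (x, Y v) + M)%:E = (\int[P]_v F (x, Y v) + M)%:E)%E.
  have <- : \int[P]_v (F (x, Y v) + M) = \int[P]_v F (x, Y v) + M.
    by rewrite RintegralD// cstP.
  rewrite /Rintegral fineK//.
  apply: (@integrable_fin_num _ _ _ _ _ measurableT (fun v => (F (x, Y v))%:E + M%:E)%E).
  exact: (integrableD measurableT (iF1 x) icst).
have m2 : measurable_fun setT (fun w => \int[P]_v F (X w, Y v)).
  have -> : (fun w => \int[P]_v F (X w, Y v)) =
            (fun w => fine (\int[P]_v (F (X w, Y v) + M)%:E)%E - M).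
    by apply/funext => w; rewrite H2/=; lra.
  apply: measurable_funD => //; apply: measurableT_comp => //.
  have -> : (fun w => \int[P]_v (F (X w, Y v) + M)%:E)%E =
     fubini_F PY (fun z => (F z + M)%:E) \o X.
    apply/funext => w; rewrite /fubini_F/= /PY ge0_integral_distribution//.
    by apply: (measurableT_comp mG); exact: pair1_measurable.
  apply: measurableT_comp => //.
  exact: (measurable_fun_fubini_tonelli_F (fun z => (F z + M)%:E)).
have b2 x : `|\int[P]_v F (x, Y v)| <= M.
  apply: le_trans (le_normr_Rintegral _ (iF1 x)) _ => //.
  rewrite -[leRHS]cstP; apply: le_Rintegral => //.
  by apply: (@bounded_integrable _ M) => // [|w]; [exact: measurableT_comp|rewrite normr_id].
apply: (addIr M); rewrite -H1 /Rintegral H.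
have -> : (\int[P]_w \int[P]_v (F (X w, Y v) + M)%:E =
           \int[P]_w (\int[P]_v F (X w, Y v) + M)%:E)%E.
  by apply: eq_integral => w _; exact: H2.
have i2 : P.-integrable setT (EFin \o (fun w => \int[P]_v F (X w, Y v))).
  by apply: (@bounded_integrable _ M).
have : \int[P]_w ((\int[P]_v F (X w, Y v)) + M) =
  \int[P]_w (\int[P]_v F (X w, Y v)) + M.
  by rewrite RintegralD//; congr +%R.
by [].
Qed.

End Independence.

(** * Taylor bounds for sine, cosine and the exponential *)

Section Calculus.
Context (R : realType).
Implicit Types (u x : R).

(** Mean value theorem. The estimates that follow apply it to a remainder and take the sign of the
    derivative from a previous estimate. *)
Lemma ge0_of_derive_ge0 (f f' : R -> R) : f 0 = 0 ->
  (forall x, is_derive x (1 : R) f (f' x)) ->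
  (forall x, 0 <= x -> 0 <= f' x) -> forall x, 0 <= x -> 0 <= f x.
Proof.
move=> f0 df f'0 x; rewrite le_eqVlt => /predU1P[<-|x0]; first by rewrite f0.
have cf : {within `[0, x], continuous f}.
  apply: derivable_within_continuous => y _.
  exact: (@ex_derive _ _ _ _ _ _ _ (df y)).
have [c] := MVT x0 (fun y _ => df y) cf.
rewrite in_itv/= => /andP[c0 _]; rewrite f0 !subr0 => ->.
by rewrite mulr_ge0 ?f'0// ltW.
Qed.

Lemma sin_le u : 0 <= u -> 0 <= u - sin u.
Proof.
apply: (@ge0_of_derive_ge0 (fun x => x - sin x) (fun x => 1 - cos x)).
- by rewrite sin0 subrr.
- by move=> x _; rewrite subr_ge0 cos_le1.
Qed.

Lemma cos_ge_quad u : 0 <= u -> 0 <= cos u - 1 + u ^+ 2 / 2.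
Proof.
apply: (@ge0_of_derive_ge0 (fun x => cos x - 1 + x ^+ 2 / 2) (fun x => - sin x + x)).
- by rewrite cos0 expr0n/=; lra.
- move=> x; apply: is_derive_eq => //; rewrite /GRing.scale/=; lra.
- by move=> x /sin_le; lra.
Qed.

(** The derivative [3 x^2 - 1 + cos x] is nonnegative by [cos_ge_quad]. The coefficient 1 of the
    cube, larger than the sharp one sixth, keeps the constants simple. *)
Lemma sin_ge_cube u : 0 <= u -> 0 <= u ^+ 3 - u + sin u.
Proof.
apply: (@ge0_of_derive_ge0 (fun x => x ^+ 3 - x + sin x)
  (fun x => 3 * x ^+ 2 - 1 + cos x)).
- by rewrite sin0 expr0n/=; lra.
- move=> x; apply: is_derive_eq => //; rewrite /GRing.scale/=; ring.
- by move=> x /cos_ge_quad; have := sqr_ge0 x; lra.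
Qed.

Lemma cos_le_cube u : 0 <= u -> 0 <= u ^+ 3 - (cos u - 1 + u ^+ 2 / 2).
Proof.
have H3 : forall x, 0 <= x -> 0 <= 6 * x - 1 + cos x.
  apply: (@ge0_of_derive_ge0 (fun x => 6 * x - 1 + cos x) (fun x => 6 - sin x)).
  - by rewrite cos0; lra.
  - move=> x; apply: is_derive_eq => //; rewrite /GRing.scale/=; ring.
  - by move=> x _; have := sin_le1 x; lra.
have H2 : forall x, 0 <= x -> 0 <= 3 * x ^+ 2 - x + sin x.
  apply: (@ge0_of_derive_ge0 (fun x => 3 * x ^+ 2 - x + sin x)
    (fun x => 6 * x - 1 + cos x)) => //.
  - by rewrite sin0 expr0n/=; lra.
  - move=> x; apply: is_derive_eq => //; rewrite /GRing.scale/=; ring.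
apply: (@ge0_of_derive_ge0 (fun x => x ^+ 3 - (cos x - 1 + x ^+ 2 / 2))
  (fun x => 3 * x ^+ 2 - x + sin x)) => //.
- by rewrite cos0 expr0n/=; lra.
- move=> x; apply: is_derive_eq => //; rewrite /GRing.scale/=; by field.
Qed.

Lemma normr_sinB u : `|sin u - u| <= `|u| ^+ 3.
Proof.
wlog u0 : u / 0 <= u => [H|].
  have [/H//|u0] := leP 0 u.
  have := H (- u); rewrite oppr_ge0 (ltW u0) => /(_ isT).
  by rewrite sinN normrN -opprD normrN.
rewrite (ger0_norm u0) ler_norml.
by apply/andP; split; have := sin_le u0; have := sin_ge_cube u0; have := exprn_ge0 3 u0; lra.
Qed.

Lemma normr_cosB u : `|cos u - 1 + u ^+ 2 / 2| <= `|u| ^+ 3.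
Proof.
wlog u0 : u / 0 <= u => [H|].
  have [/H//|u0] := leP 0 u.
  have := H (- u); rewrite oppr_ge0 (ltW u0) => /(_ isT).
  by rewrite cosN normrN sqrrN.
rewrite (ger0_norm u0) ger0_norm; last exact: cos_ge_quad.
by have := cos_le_cube u0; lra.
Qed.

Lemma expRN_le_quad u : 0 <= u -> 0 <= 1 - u + u ^+ 2 / 2 - expR (- u).
Proof.
apply: (@ge0_of_derive_ge0 (fun x => 1 - x + x ^+ 2 / 2 - expR (- x))
  (fun x => - 1 + x + expR (- x))).
- by rewrite oppr0 expR0 expr0n/=; lra.
- move=> x; apply: is_derive_eq => //; rewrite /GRing.scale/=; by field.
- by move=> x _; have := expR_ge1Dx (- x); lra.
Qed.

(** Same cubic order as [normr_cosB], so a cosine average and an exponential with equal quadratic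
    terms differ by a cube. For [|x| <= 1] the fourth-order remainder is below the cube; beyond 1
    the quadratic term alone is. *)
Lemma normr_expRNsqr x : `|expR (- x ^+ 2) - 1 + x ^+ 2| <= `|x| ^+ 3.
Proof.
rewrite -(real_normK (num_real x)); move: (normr_ge0 x); move: `|x| => {}x x0.
have h0 := expR_ge1Dx (- x ^+ 2).
rewrite ger0_norm; last lra.
have [x1|x1] := leP x 1.
  have := expRN_le_quad (sqr_ge0 x).
  have : x ^+ 2 ^+ 2 <= x ^+ 3 by rewrite -exprM ler_wiXn2l.
  have := exprn_ge0 3 x0; lra.
have : expR (- x ^+ 2) <= 1 by rewrite expR_le1 oppr_le0 sqr_ge0.
have : x ^+ 2 <= x ^+ 3 by rewrite ler_weXn2l// ltW.
lra.
Qed.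

End Calculus.

(** * Densities and affine changes of variable *)

Section Density.
Context d (T : measurableType d) (R : realType).
Variables (mu nu : {measure set T -> \bar R}) (p : T -> R).
Hypotheses (p0 : forall x, 0 <= p x) (mp : measurable_fun setT p).
Hypothesis nuE : forall A, measurable A -> nu A = (\int[mu]_(x in A) (p x)%:E)%E.

Import HBNNSimple.

Let integral_density_nnsfun (f : {nnsfun T >-> R}) :
  (\int[nu]_x (f x)%:E = \int[mu]_x ((f x)%:E * (p x)%:E))%E.
Proof.
under eq_integral do rewrite fimfunE -fsumEFin//.
rewrite ge0_integral_fsum//; last 2 first.
  - by move=> r; exact/measurable_EFinP/measurableT_comp.
  - by move=> n x _; rewrite EFinM nnfun_muleindic_ge0.
transitivity (\int[mu]_x \sum_(y \in range f) ((y * \1_(f @^-1` [set y]) x)%:E * (p x)%:E))%E; last first.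
  apply: eq_integral => x _; rewrite [in RHS]fimfunE -fsumEFin// ge0_mule_fsuml//.
  by move=> r; rewrite EFinM nnfun_muleindic_ge0.
rewrite ge0_integral_fsum//; last 2 first.
  - move=> r; apply: emeasurable_funM; last exact/measurable_EFinP.
    by apply/measurable_EFinP/measurableT_comp.
  - move=> n x _; rewrite mule_ge0 ?lee_fin//.
    by have := nnfun_muleindic_ge0 f n x; rewrite -EFinM lee_fin.
apply: eq_fsbigr => r _.
rewrite integralZl_indic_nnsfun//= integral_indic//= setIT nuE//.
(* A negative value has empty preimage; it is set apart because [ge0_integralZl] asks for a
   nonnegative constant. *)
have [r0|r0] := ltP r 0.
  rewrite preimage_nnfun0// integral_set0 mule0.
  by apply/esym/integral0_eq => x _; rewrite indic0 mulr0 mul0e.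
under [RHS]eq_integral do rewrite EFinM -muleA.
rewrite ge0_integralZl//; last 2 first.
- apply: emeasurable_funM; last exact/measurable_EFinP.
  by apply/measurable_EFinP.
- by move=> x _; rewrite mule_ge0 ?lee_fin.
congr (_ * _)%E; rewrite integral_mkcond; apply: eq_integral => x _.
by rewrite patchE indicE; case: ifPn => _; rewrite ?mul1e ?mul0e.
Qed.

Lemma integral_density (f : T -> \bar R) :
  measurable_fun setT f -> (forall x, (0 <= f x)%E) ->
  (\int[nu]_x f x = \int[mu]_x (f x * (p x)%:E))%E.
Proof.
move=> mf f0.
pose f_ := nnsfun_approx measurableT mf.
transitivity (lim (\int[nu]_x (f_ n x)%:E @[n --> \oo])%E).
  rewrite -monotone_convergence//=.
  - apply: eq_integral => ? /[!inE] xD; apply/esym/cvg_lim => //=.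
    exact: cvg_nnsfun_approx.
  - by move=> n; exact/measurable_EFinP/measurable_funTS.
  - by move=> n ? _; rewrite lee_fin.
  - by move=> ? _ ? ? mn; rewrite lee_fin; exact/lefP/nd_nnsfun_approx.
transitivity (lim (\int[mu]_x ((f_ n x)%:E * (p x)%:E) @[n --> \oo])%E).
  by apply: congr_lim; apply/funext => n /=; exact: integral_density_nnsfun.
rewrite -monotone_convergence//=.
- apply: eq_integral => x _; apply/cvg_lim => //=.
  by apply: cvgeZr => //; exact: cvg_nnsfun_approx.
- move=> n; apply: emeasurable_funM; last exact/measurable_EFinP.
  by apply/measurable_EFinP.
- by move=> n x _; rewrite mule_ge0 ?lee_fin.
- by move=> x _ a b ab; rewrite lee_wpmul2r ?lee_fin//; exact/lefP/nd_nnsfun_approx.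
Qed.

End Density.

Section Affine.
Context (R : realType).
Notation leb := (@lebesgue_measure R).

(** The pushforward of Lebesgue measure under the affine map, multiplied by [a], has the right value
    on half-open intervals, hence is Lebesgue measure. *)
Lemma ge0_integral_affine (f : R -> \bar R) (a b : R) : 0 < a ->
  measurable_fun setT f -> (forall x, (0 <= f x)%E) ->
  (\int[leb]_x f (a * x + b)%R = a^-1%:E * \int[leb]_x f x)%E.
Proof.
move=> a0 mf f0.
pose phi x : measurableTypeR R := a * x + b.
have mphi : measurable_fun [set: measurableTypeR R] phi.
  by apply: measurable_funD => //; exact: measurable_funM.
pose a' := NngNum (ltW a0).
pose pf : {measure set (measurableTypeR R) -> \bar R} :=
  measure_function_pushforward__canonical__measure_function_Measure leb mphi.
pose m : {measure set (measurableTypeR R) -> \bar R} := mscale a' pf.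
have mE A : measurable A -> leb A = m A.
  apply: lebesgue_measure_unique => _ [[c e]] _ <-.
  have -> : m `]c, e]%classic = (a%:E * leb (phi @^-1` `]c, e]%classic))%E by [].
  have -> : phi @^-1` `]c, e]%classic = `]((c - b) / a), ((e - b) / a)]%classic.
    apply/seteqP; split => x /=; rewrite !in_itv/= /phi ltr_pdivrMr// ler_pdivlMr//;
      by rewrite ltrBlDr lerBrDr (mulrC x).
  rewrite !lebesgue_measure_itv/= !lte_fin ltr_pM2r ?invr_gt0// ltrD2r.
  case: ifPn => _; last by rewrite mule0.
  by rewrite -!EFinD -EFinM; congr EFin; field; lra.
have -> : (\int[leb]_x f x = \int[m]_x f x)%E.
  by apply: eq_measure_integral => A mA _; exact: mE.
rewrite ge0_integral_mscale//= muleA -EFinM mulVf ?gt_eqF// mul1e.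
by rewrite ge0_integral_pushforward.
Qed.

End Affine.

(** * The standard normal law *)

Lemma integral_prob_cst d (T : measurableType d) (R : realType)
    (P : probability T R) (c : \bar R) : (\int[P]_x c = c)%E.
Proof.
rewrite integral_cst//; transitivity (c * 1%E)%E; last exact: mule1.
by congr (_ * _)%E; exact: probability_setT.
Qed.

Lemma dominated_integrable d (T : measurableType d) (R : realType)
    (mu : {measure set T -> \bar R}) (f g : T -> R) :
  measurable_fun setT f -> (forall x, `|f x| <= g x) ->
  mu.-integrable setT (EFin \o g) -> mu.-integrable setT (EFin \o f).
Proof.
move=> mf fg; apply: le_integrable => //; first exact/measurable_EFinP.
by move=> x _; rewrite lee_fin (le_trans (fg x))// real_ler_norm// num_real.
Qed.

Section NormalLaw.
Context (R : realType).
Notation leb := (@lebesgue_measure R).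
Implicit Types (f : R -> \bar R) (r s x : R).

Definition std_normal : probability (measurableTypeR R) R := @normal_prob R 0 1.
Notation N := std_normal.

Lemma integral_normal_prob s f : s != 0 ->
  measurable_fun setT f -> (forall x, (0 <= f x)%E) ->
  (\int[normal_prob 0 s]_x f x = \int[leb]_x (f x * (normal_pdf 0 s x)%:E))%E.
Proof.
move=> s0 mf f0; apply: integral_density => //.
- by move=> x; exact: normal_pdf_ge0.
- exact: measurable_normal_pdf.
Qed.

Lemma integral_std_normal f :
  measurable_fun setT f -> (forall x, (0 <= f x)%E) ->
  (\int[N]_x f x = \int[leb]_x (f x * (normal_pdf 0 1 x)%:E))%E.
Proof. by move=> mf f0; apply: integral_normal_prob => //; exact: oner_neq0. Qed.

Lemma normal_pdf0E s x : s != 0 -> normal_pdf 0 s x =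
  (Num.sqrt (s ^+ 2 * pi *+ 2))^-1 * expR (- x ^+ 2 / (s ^+ 2 *+ 2)).
Proof.
by move=> s0; rewrite (normal_pdfE 0 s0) -[in RHS](subr0 x).
Qed.

Lemma sqrt_normal_peak s : 0 < s ->
  Num.sqrt (s ^+ 2 * pi *+ 2) = s * Num.sqrt (1 ^+ 2 * pi *+ 2) :> R.
Proof.
by move=> s0; rewrite -mulrnAr sqrtrM ?sqr_ge0// sqrtr_sqr gtr0_norm// expr1n mul1r.
Qed.

Lemma normal_pdf_scale s x : 0 < s -> normal_pdf 0 s (s * x) = s^-1 * normal_pdf 0 1 x.
Proof.
move=> s0; rewrite !normal_pdf0E ?gt_eqF ?oner_eq0// (sqrt_normal_peak s0) invfM.
rewrite mulrA; congr (_ * expR _).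
by rewrite expr1n; field; lra.
Qed.

Let measurable_pdf s : measurable_fun setT (fun x : R => (normal_pdf 0 s x)%:E).
Proof. by apply/measurable_EFinP; exact: measurable_normal_pdf. Qed.

Lemma integral_normal_scale s f : 0 < s ->
  measurable_fun setT f -> (forall x, (0 <= f x)%E) ->
  (\int[normal_prob 0 s]_x f x = \int[N]_x f (s * x)%R)%E.
Proof.
move=> s0 mf f0; rewrite (integral_normal_prob (lt0r_neq0 s0) mf f0).
have mfs : measurable_fun setT (fun x => f (s * x)).
  by apply: (measurableT_comp mf); exact: measurable_funM.
rewrite (integral_std_normal mfs (fun x => f0 (s * x))).
pose g x := (f x * (normal_pdf 0 s x)%:E)%E.
have mg : measurable_fun setT g by exact: emeasurable_funM.
have g0 x : (0 <= g x)%E by rewrite mule_ge0// lee_fin normal_pdf_ge0.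
have mgs : measurable_fun setT (fun x => g (s * x + 0)).
  by apply: (measurableT_comp mg); apply: measurable_funD => //; exact: measurable_funM.
have := @ge0_integral_affine R g s 0 s0 mg g0.
move=> H; have -> : (\int[leb]_x (f x * (normal_pdf 0 s x)%:E) =
    s%:E * (s^-1%:E * \int[leb]_x g x))%E.
  by rewrite muleA -EFinM (mulfV (lt0r_neq0 s0)) mul1e.
rewrite -H.
rewrite -(ge0_integralZl leb measurableT mgs (fun x _ => g0 (s * x + 0))); last by rewrite lee_fin ltW.
apply: eq_integral => x _; rewrite /g addr0 normal_pdf_scale// muleCA -EFinM.
by rewrite mulrA (mulfV (lt0r_neq0 s0)) mul1r.
Qed.

Let measurable_tilt r :
  measurable_fun setT (fun x : R => (expR (- ((r ^- 2 - 1) / 2 * x ^+ 2)))%:E).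
Proof.
apply/measurable_EFinP; apply: measurableT_comp => //.
apply: measurableT_comp => //; apply: measurable_funM => //.
Qed.

(** Exponential tilting: the factor turns the standard density into [r] times the density of
    standard deviation [r]. The value [r = sqrt 2] yields an exponential moment, and [r] tending to
    1 from below yields the even moments. *)
Lemma integral_normal_tilt r f : 0 < r ->
  measurable_fun setT f -> (forall x, (0 <= f x)%E) ->
  (\int[N]_x (f x * (expR (- ((r ^- 2 - 1) / 2 * x ^+ 2)))%:E) =
   r%:E * \int[N]_x f (r * x)%R)%E.
Proof.
move=> r0 mf f0; rewrite -integral_normal_scale//.
rewrite (integral_normal_prob (lt0r_neq0 r0) mf f0).
have mft := emeasurable_funM mf (measurable_tilt r).
have ft0 x : (0 <= f x * (expR (- ((r ^- 2 - 1) / 2 * x ^+ 2)))%:E)%E.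
  by rewrite mule_ge0// lee_fin expR_ge0.
rewrite (integral_std_normal mft ft0).
have mfp := emeasurable_funM mf (measurable_pdf r).
have fp0 x : (0 <= f x * (normal_pdf 0 r x)%:E)%E.
  by rewrite mule_ge0// lee_fin normal_pdf_ge0.
rewrite -(ge0_integralZl leb measurableT mfp (fun x _ => fp0 x)); last by rewrite lee_fin ltW.
apply: eq_integral => x _; rewrite -muleA [RHS]muleCA; congr (_ * _)%E.
rewrite -!EFinM; congr EFin.
rewrite (@normal_pdf0E 1 x (oner_neq0 _)) (@normal_pdf0E r x (lt0r_neq0 r0)).
rewrite (sqrt_normal_peak r0); set p := Num.sqrt _.
have p0 : p != 0 by rewrite gt_eqF// sqrtr_gt0 expr1n mul1r mulrn_wgt0// pi_gt0.
set e := expR (- (_ / 2 * _)); set e1 := expR (- _ / (1 ^+ 2 *+ 2)).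
have -> : r * ((r * p)^-1 * expR (- x ^+ 2 / (r ^+ 2 *+ 2))) =
  p^-1 * expR (- x ^+ 2 / (r ^+ 2 *+ 2)) by field; rewrite p0 lt0r_neq0.
rewrite mulrCA -expRD; congr (_ * expR _).
by rewrite expr1n; field; lra.
Qed.

(** Tilting the constant 1 by [r = sqrt 2], for which [(r^-2 - 1) / 2 = - 1/4]. *)
Lemma normal_exp_moment : (\int[N]_x (expR (x ^+ 2 / 4))%:E = (Num.sqrt 2)%:E)%E.
Proof.
have s0 : 0 < Num.sqrt 2 :> R by rewrite sqrtr_gt0.
have := @integral_normal_tilt (Num.sqrt 2) (cst 1%E) s0 (measurable_cst _).
rewrite integral_prob_cst mule1 => <-; last by move=> x; exact: lee01.
apply: eq_integral => x _; rewrite mul1e; congr (EFin (expR _)).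
by rewrite sqr_sqrtr//; field.
Qed.

Lemma normal_integrable_exp (f : R -> R) (c : R) : measurable_fun setT f ->
  (forall x, `|f x| <= c * expR (x ^+ 2 / 4)) -> N.-integrable setT (EFin \o f).
Proof.
move=> mf fc.
have me : measurable_fun setT (fun x : R => (expR (x ^+ 2 / 4))%:E).
  by apply/measurable_EFinP; apply: measurableT_comp => //; apply: measurable_funM => //.
have ie : N.-integrable setT (fun x : R => (expR (x ^+ 2 / 4))%:E).
  apply/integrableP; split => //.
  under eq_integral do rewrite gee0_abs ?lee_fin ?expR_ge0//.
  by rewrite normal_exp_moment ltry.
apply: (@dominated_integrable _ _ _ N f (fun x : R => c * expR (x ^+ 2 / 4)) mf fc).
exact: (integrableZl _ c ie).
Qed.

(** From [v ^+ 3 / 3! <= expR v] at [v = x ^+ 2 / 4] one gets [x^6 <= 6 * 64 * expR v], and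
    [384 + 1] also covers [|x| <= 1]. Degree six is what the third absolute moment of a chi-square
    asks for. *)
Lemma normal_moment_bound k x : (k <= 6)%N -> `|x ^+ k| <= 385 * expR (x ^+ 2 / 4).
Proof.
move=> k6; have v0 : 0 <= x ^+ 2 / 4 by rewrite divr_ge0// sqr_ge0.
have h := expR_ge1Dxn 2 v0.
have e6 : (x ^+ 2 / 4) ^+ 3 = `|x| ^+ 6 / 64.
  by rewrite -(real_normK (num_real x)); field.
have h6 : `|x| ^+ 6 <= 384 * expR (x ^+ 2 / 4).
  move: h; rewrite e6 (_ : 3`! = 6)%N//.
  by set y := `|x| ^+ 6; set e := expR _; lra.
rewrite normrX; have [x1|x1] := leP `|x| 1.
  apply: (@le_trans _ _ 1); first by rewrite exprn_ile1.
  have : 1 <= expR (x ^+ 2 / 4) by rewrite -[leLHS](@expR0 R) ler_expR.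
  lra.
apply: (@le_trans _ _ (`|x| ^+ 6)); first by rewrite ler_weXn2l// ltW.
have := expR_ge0 (x ^+ 2 / 4); lra.
Qed.

Lemma normal_integrable_pow k : (k <= 6)%N ->
  N.-integrable setT (EFin \o (fun x => x ^+ k)).
Proof.
move=> k6; apply: (@normal_integrable_exp _ 385) => //.
by move=> x; exact: normal_moment_bound.
Qed.

Definition normal_moment k := \int[N]_x (x ^+ k).

Lemma normal_momentE k : (k <= 6)%N ->
  (\int[N]_x (x ^+ k)%:E = (normal_moment k)%:E)%E.
Proof.
move=> k6; rewrite /normal_moment /Rintegral fineK//.
exact: (integrable_fin_num measurableT (normal_integrable_pow k6)).
Qed.

Let even_pow_ge0 k x : 0 <= x ^+ k.*2.
Proof. by rewrite -mul2n exprM exprn_ge0// sqr_ge0. Qed.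

Let tilt_moment k r : (k.*2 <= 6)%N -> 0 < r ->
  (\int[N]_x (x ^+ k.*2 * expR (- ((r ^- 2 - 1) / 2 * x ^+ 2)))%:E =
  (r ^+ k.*2.+1 * normal_moment k.*2)%:E)%E.
Proof.
move=> k6 r0; have mx : measurable_fun setT (fun x : R => (x ^+ k.*2)%:E).
  by apply/measurable_EFinP.
have := integral_normal_tilt r0 mx (fun x => even_pow_ge0 k x).
under eq_integral do rewrite -EFinM.
move=> ->; under eq_integral do rewrite exprMn EFinM.
rewrite ge0_integralZl//; last 2 first.
- by move=> x _; rewrite lee_fin.
- by rewrite lee_fin.
by rewrite normal_momentE// muleA -!EFinM exprS.
Qed.

(** Integrates [y e^(-y) <= 1 - e^(-y) <= y] at [y = u x^2], with [u = (r^-2 - 1) / 2], against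
    [x^(2k)]; [tilt_moment] evaluates the exponential terms. As [r] tends to 1 the two bounds force
    [m_(2k+2) = (2k+1) m_(2k)], without integration by parts. *)
Let sandwich k r : (k.*2.+2 <= 6)%N -> 0 < r < 1 ->
  (1 - r ^+ k.*2.+1) * normal_moment k.*2 <=
    (r ^- 2 - 1) / 2 * normal_moment k.*2.+2 /\
  (r ^- 2 - 1) / 2 * (r ^+ k.*2.+3 * normal_moment k.*2.+2) <=
    (1 - r ^+ k.*2.+1) * normal_moment k.*2.
Proof.
move=> k6 /andP[r0 r1].
have k6' : (k.*2 <= 6)%N by apply: leq_trans k6; rewrite -addn2 leq_addr.
set u := (r ^- 2 - 1) / 2.
have u0 : 0 <= u.
  rewrite divr_ge0// subr_ge0 invf_ge1 ?exprn_gt0//.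
  by rewrite exprn_ile1// ltW.
have m1 k' : measurable_fun setT (fun x : R => (x ^+ k'.*2 * expR (- (u * x ^+ 2)))%:E).
  have := emeasurable_funM (f := fun x : R => (x ^+ k'.*2)%:E) _ (measurable_tilt r).
  by apply; apply/measurable_EFinP.
have p2 x : x ^+ k.*2.+2 = x ^+ k.*2 * x ^+ 2 by rewrite -exprD addn2.
have E1 : (\int[N]_x (x ^+ k.*2 * (1 - expR (- (u * x ^+ 2))))%:E =
           ((1 - r ^+ k.*2.+1) * normal_moment k.*2)%:E)%E.
  under eq_integral do rewrite mulrBr mulr1 EFinB.
  rewrite integralB_EFin//; last 2 first.
  - exact: normal_integrable_pow.
  - apply: (@dominated_integrable _ _ _ N _ (fun x : R => x ^+ k.*2)).
    + by apply/measurable_EFinP; exact: m1.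
    + move=> x; rewrite normrM (ger0_norm (even_pow_ge0 k x)) ler_piMr//.
      by rewrite ger0_norm ?expR_ge0// expR_le1 oppr_le0 mulr_ge0// sqr_ge0.
    + exact: normal_integrable_pow.
  by rewrite normal_momentE// tilt_moment// -EFinB; congr EFin; ring.
have e0 x : 0 <= 1 - expR (- (u * x ^+ 2)).
  by rewrite subr_ge0 expR_le1 oppr_le0 mulr_ge0// sqr_ge0.
have mE1 : measurable_fun setT (fun x : R => (x ^+ k.*2 * (1 - expR (- (u * x ^+ 2))))%:E).
  have mt : measurable_fun setT (fun x : R => expR (- (u * x ^+ 2))).
    by apply/measurable_EFinP; exact: measurable_tilt.
  by apply/measurable_EFinP; apply: measurable_funM => //; exact: measurable_funB.
split.
- rewrite -lee_fin -E1.
  have -> : ((u * normal_moment k.*2.+2)%:E = \int[N]_x (u * (x ^+ k.*2.+2))%:E)%E.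
    under eq_integral do rewrite EFinM.
    rewrite ge0_integralZl ?lee_fin//; last 2 first.
    - by apply/measurable_EFinP.
    - by move=> x _; rewrite lee_fin; exact: (even_pow_ge0 k.+1).
    by rewrite normal_momentE.
  apply: ge0_le_integral => //.
  + by move=> x _; rewrite lee_fin mulr_ge0.
  + by apply/measurable_EFinP; exact: measurable_funM.
  + move=> x _; rewrite lee_fin p2.
    have -> : u * (x ^+ k.*2 * x ^+ 2) = x ^+ k.*2 * (u * x ^+ 2) by ring.
    apply: ler_wpM2l; first exact: even_pow_ge0.
    by have := expR_ge1Dx (- (u * x ^+ 2)); lra.
- rewrite -lee_fin -E1.
  have -> : ((u * (r ^+ k.*2.+3 * normal_moment k.*2.+2))%:E =
     \int[N]_x (u * (x ^+ k.*2.+2 * expR (- (u * x ^+ 2))))%:E)%E.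
    under eq_integral do rewrite EFinM.
    rewrite ge0_integralZl ?lee_fin//; last 2 first.
    - exact: (m1 k.+1).
    - by move=> x _; rewrite lee_fin mulr_ge0 ?expR_ge0//; exact: (even_pow_ge0 k.+1).
    by rewrite (tilt_moment (k := k.+1)).
  apply: ge0_le_integral => //.
  + by move=> x _; rewrite lee_fin mulr_ge0// mulr_ge0 ?expR_ge0//; exact: (even_pow_ge0 k.+1).
  + apply/measurable_EFinP; apply: measurable_funM => //.
    by apply/measurable_EFinP; exact: (m1 k.+1).
  + move=> x _; rewrite lee_fin p2.
    have -> : u * (x ^+ k.*2 * x ^+ 2 * expR (- (u * x ^+ 2))) =
      x ^+ k.*2 * (u * x ^+ 2 * expR (- (u * x ^+ 2))) by ring.
    apply: ler_wpM2l; first exact: even_pow_ge0.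
    have := expR_ge1Dx (u * x ^+ 2).
    have := expR_gt0 (- (u * x ^+ 2)).
    have := expRxMexpNx_1 (u * x ^+ 2).
    by set a := expR (u * _); set b := expR (- _); nra.
Qed.

Let le_at1 (f g : R -> R) : {for 1, continuous f} -> {for 1, continuous g} ->
  (forall r, 0 < r < 1 -> f r <= g r) -> f 1 <= g 1.
Proof.
move=> cf cg fg.
have cf' : f x @[x --> 1^'-] --> f 1 by exact: cvg_at_left_filter.
have cg' : g x @[x --> 1^'-] --> g 1 by exact: cvg_at_left_filter.
apply: (@ler_cvg_to _ _ _ _ f g _ _ cf' cg').
near=> r; apply: fg; apply/andP; split; near: r; last exact: nbhs_left_lt.
exact: nbhs_left_gt.
Unshelve. all: by end_near. Qed.

Lemma normal_moment2 : normal_moment 2 = 1.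
Proof.
have m0 : normal_moment 0 = 1.
  rewrite /normal_moment; under eq_Rintegral do rewrite expr0.
  exact: Rintegral_prob_cst.
have H r (r01 : 0 < r < 1) := @sandwich 0 r isT r01.
apply/eqP; rewrite eq_le; apply/andP; split.
(* The second bound of [sandwich] with its factor [1 - r] cleared; at [r = 1] it reads
   [2 * normal_moment 2 <= 2]. The other half clears the first bound in the same way. *)
- have := @le_at1 (fun r => r * (1 + r) * normal_moment 2) (fun=> 2).
  rewrite /= !mul1r => h; suff : (1 + 1) * normal_moment 2 <= 2 by lra.
  apply: h => //.
  + by apply: cvgM; [apply: cvgM; [exact: cvg_id|apply: cvgD; [exact: cvg_cst|exact: cvg_id]]|exact: cvg_cst].
  + exact: cvg_cst.
  + move=> r r01; have [_] := H r r01; case/andP: r01 => r0 r1.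
    rewrite m0 mulr1 expr1 => h2.
    have r2 : 0 < 1 - r by lra.
    rewrite -(ler_pM2l r2); apply: le_trans (_ : _ <= 2 * (1 - r)) _; last lra.
    have -> : (1 - r) * (r * (1 + r) * normal_moment 2) =
      2 * ((r ^- 2 - 1) / 2 * (r ^+ 3 * normal_moment 2)) by field; lra.
    lra.
- have := @le_at1 (fun r => 2 * r ^+ 2) (fun r => (1 + r) * normal_moment 2).
  rewrite /= expr1n => h; suff : 2 * 1 <= (1 + 1) * normal_moment 2 by lra.
  apply: h => //.
  + by apply: cvgM; [exact: cvg_cst|exact: sqr_continuous].
  + by apply: cvgM; [apply: cvgD; [exact: cvg_cst|exact: cvg_id]|exact: cvg_cst].
  + move=> r r01; have [+ _] := H r r01; case/andP: r01 => r0 r1.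
    rewrite m0 mulr1 expr1 => h2.
    have r2 : 0 < 1 - r by lra.
    rewrite -(ler_pM2l r2).
    have -> : (1 - r) * ((1 + r) * normal_moment 2) =
      2 * r ^+ 2 * ((r ^- 2 - 1) / 2 * normal_moment 2) by field; lra.
    have -> : (1 - r) * (2 * r ^+ 2) = 2 * r ^+ 2 * (1 - r) by ring.
    by rewrite ler_wpM2l// mulr_ge0// sqr_ge0.
Qed.

Lemma normal_moment4 : normal_moment 4 = 3.
Proof.
have H r (r01 : 0 < r < 1) := @sandwich 1 r isT r01.
apply/eqP; rewrite eq_le; apply/andP; split.
- have := @le_at1 (fun r => r ^+ 3 * (1 + r) * normal_moment 4)
    (fun r => 2 * (1 + r + r ^+ 2)).
  rewrite /= !expr1n !mul1r => h; suff : (1 + 1) * normal_moment 4 <= 2 * (1 + 1 + 1) by lra.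
  apply: h => //.
  + by apply: cvgM; [apply: cvgM; [exact: exprn_continuous|apply: cvgD; [exact: cvg_cst|exact: cvg_id]]|exact: cvg_cst].
  + apply: cvgM; first exact: cvg_cst.
    by apply: cvgD; [apply: cvgD; [exact: cvg_cst|exact: cvg_id]|exact: exprn_continuous].
  + move=> r r01; have [_] := H r r01; case/andP: r01 => r0 r1.
    rewrite normal_moment2 mulr1 => h2.
    have r2 : 0 < 1 - r by lra.
    rewrite -(ler_pM2l r2).
    have -> : (1 - r) * (r ^+ 3 * (1 + r) * normal_moment 4) =
      2 * ((r ^- 2 - 1) / 2 * (r ^+ 5 * normal_moment 4)) by field; lra.
    have -> : (1 - r) * (2 * (1 + r + r ^+ 2)) = 2 * (1 - r ^+ 3) by ring.
    by rewrite ler_wpM2l.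
- have := @le_at1 (fun r => 2 * r ^+ 2 * (1 + r + r ^+ 2)) (fun r => (1 + r) * normal_moment 4).
  rewrite /= !expr1n => h; suff : 2 * 1 * (1 + 1 + 1) <= (1 + 1) * normal_moment 4 by lra.
  apply: h => //.
  + apply: cvgM; first by apply: cvgM; [exact: cvg_cst|exact: sqr_continuous].
    by apply: cvgD; [apply: cvgD; [exact: cvg_cst|exact: cvg_id]|exact: exprn_continuous].
  + by apply: cvgM; [apply: cvgD; [exact: cvg_cst|exact: cvg_id]|exact: cvg_cst].
  + move=> r r01; have [+ _] := H r r01; case/andP: r01 => r0 r1.
    rewrite normal_moment2 mulr1 => h2.
    have r2 : 0 < 1 - r by lra.
    rewrite -(ler_pM2l r2).
    have -> : (1 - r) * ((1 + r) * normal_moment 4) =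
      2 * r ^+ 2 * ((r ^- 2 - 1) / 2 * normal_moment 4) by field; lra.
    have -> : (1 - r) * (2 * r ^+ 2 * (1 + r + r ^+ 2)) = 2 * r ^+ 2 * (1 - r ^+ 3) by ring.
    by rewrite ler_wpM2l// mulr_ge0// sqr_ge0.
Qed.

End NormalLaw.

Lemma integral_oppr (R : realType) (f : R -> \bar R) :
  measurable_fun setT f -> (forall x, (0 <= f x)%E) ->
  (\int[@lebesgue_measure R]_x f (- x)%R = \int[@lebesgue_measure R]_x f x)%E.
Proof.
move=> mf f0.
have mN : measurable_fun [set: measurableTypeR R] (-%R : R -> measurableTypeR R).
  exact: oppr_measurable.
pose pf : {measure set (measurableTypeR R) -> \bar R} :=
  measure_function_pushforward__canonical__measure_function_Measure
    (@lebesgue_measure R) mN.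
have -> : (\int[@lebesgue_measure R]_x f x = \int[pf]_x f x)%E.
  apply: eq_measure_integral => A mA _; exact/esym/lebesgue_measureN.
by rewrite ge0_integral_pushforward.
Qed.

Lemma measurable_cos (R : realType) : measurable_fun setT (@cos R).
Proof. by apply: continuous_measurable_fun; exact: continuous_cos. Qed.

Lemma measurable_sin (R : realType) : measurable_fun setT (@sin R).
Proof. by apply: continuous_measurable_fun; exact: continuous_sin. Qed.

Section NormalChar.
Context (R : realType).
Notation N := (std_normal R).
Implicit Types (x l : R).

Lemma integral_normal_oppr (f : R -> \bar R) :
  measurable_fun setT f -> (forall x, (0 <= f x)%E) ->
  (\int[N]_x f (- x)%R = \int[N]_x f x)%E.
Proof.
move=> mf f0.
have mfN : measurable_fun setT (fun x => f (- x)).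
  by apply: (measurableT_comp mf).
rewrite (integral_std_normal mfN (fun x => f0 (- x))) (integral_std_normal mf f0).
pose g x := (f x * (normal_pdf 0 1 x)%:E)%E.
have mg : measurable_fun setT g.
  by apply: emeasurable_funM => //; apply/measurable_EFinP; exact: measurable_normal_pdf.
have g0 x : (0 <= g x)%E by rewrite mule_ge0// lee_fin normal_pdf_ge0.
apply: eq_trans (integral_oppr mg g0).
by apply: eq_integral => x _; rewrite /g !normal_pdf0E ?oner_eq0// sqrrN.
Qed.

Lemma Rintegral_normal_oppr (f : R -> R) (M : R) :
  measurable_fun setT f -> (forall x, `|f x| <= M) ->
  \int[N]_x f (- x) = \int[N]_x f x.
Proof.
move=> mf fM.
have mfN : measurable_fun setT (fun x => f (- x)) by exact: measurableT_comp.
have if1 := @bounded_integrable _ _ _ N f M mf fM.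
have if2 := @bounded_integrable _ _ _ N (fun x => f (- x)) M mfN (fun x => fM (- x)).
have ic := @bounded_integrable _ _ _ N (fun=> M) `|M| (measurable_cst _) (fun=> lexx _).
have f0 x : (0 <= (f x + M)%:E)%E.
  by rewrite lee_fin; have := fM x; rewrite ler_norml => /andP[]; lra.
have mfD : measurable_fun setT (fun x => (f x + M)%:E).
  by apply/measurable_EFinP; exact: measurable_funD.
have := integral_normal_oppr mfD f0 => /(congr1 fine).
rewrite -[LHS]/(\int[N]_x (f (- x) + M)) -[RHS]/(\int[N]_x (f x + M)).
by rewrite RintegralD// RintegralD// => /addIr.
Qed.

Lemma normal_sin l : \int[N]_x sin (l * x) = 0.
Proof.
have := @Rintegral_normal_oppr (fun x => sin (l * x)) 1.
have ms : measurable_fun setT (fun x : R => sin (l * x)).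
  by apply: measurableT_comp => //; exact: measurable_sin.
move=> /(_ ms (fun x => sin_max (l * x))).
under eq_Rintegral do rewrite mulrN sinN -mulN1r.
have i1 := @bounded_integrable _ _ _ N _ 1 ms (fun x => sin_max (l * x)).
by rewrite RintegralZl// => h; lra.
Qed.

Lemma measurable_cosM l : measurable_fun setT (fun x => cos (l * x)).
Proof. by apply: measurableT_comp => //; exact: measurable_cos. Qed.

Lemma measurable_sinM l : measurable_fun setT (fun x => sin (l * x)).
Proof. by apply: measurableT_comp => //; exact: measurable_sin. Qed.

Lemma integrable_cosM l : N.-integrable setT (EFin \o (fun x => cos (l * x))).
Proof. exact: (@bounded_integrable _ _ _ N _ 1 (measurable_cosM l) (fun x => cos_max _)). Qed.

Lemma integrable_sinM l : N.-integrable setT (EFin \o (fun x => sin (l * x))).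
Proof. exact: (@bounded_integrable _ _ _ N _ 1 (measurable_sinM l) (fun x => sin_max _)). Qed.

Definition abs_moment3 := \int[N]_x (`|x| ^+ 3).

Lemma integrable_abs3 : N.-integrable setT (EFin \o (fun x => `|x| ^+ 3)).
Proof.
have : N.-integrable setT (EFin \o (fun x => `|x ^+ 3|)).
  by have := integrable_norm (normal_integrable_pow R (isT : (3 <= 6)%N)).
by under [X in _ -> N.-integrable _ (_ \o X)]eq_fun do rewrite -normrX.
Qed.

Lemma normal_cos_taylor l :
  `|\int[N]_x cos (l * x) - (1 - l ^+ 2 / 2)| <= `|l| ^+ 3 * abs_moment3.
Proof.
have i2 := normal_integrable_pow R (isT : (2 <= 6)%N).
have ic (c : R) := @bounded_integrable _ _ _ N (fun=> c) `|c| (measurable_cst _) (fun=> lexx _).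
have i2' : N.-integrable setT (EFin \o (fun x => l ^+ 2 / 2 * x ^+ 2)).
  exact: (integrableZl measurableT (l ^+ 2 / 2) i2).
have i3 : N.-integrable setT (EFin \o (fun x => cos (l * x) - 1)).
  exact: (integrableB measurableT (integrable_cosM l) (ic 1)).
have E : \int[N]_x (cos (l * x) - 1 + l ^+ 2 / 2 * x ^+ 2) =
    \int[N]_x cos (l * x) - (1 - l ^+ 2 / 2).
  rewrite (RintegralD measurableT i3 i2') (RintegralB measurableT (integrable_cosM l) (ic 1)).
  rewrite Rintegral_prob_cst RintegralZl//.
  have -> : \int[N]_x (x ^+ 2) = 1 := normal_moment2 R.
  by ring.
have i4 : N.-integrable setT (EFin \o (fun x => cos (l * x) - 1 + l ^+ 2 / 2 * x ^+ 2)).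
  exact: (integrableD measurableT i3 i2').
rewrite -E; apply: le_trans (le_normr_Rintegral measurableT i4) _.
rewrite /abs_moment3 -RintegralZl//; last exact: integrable_abs3.
apply: le_Rintegral => //.
- exact: integrable_norm.
- exact: (integrableZl measurableT (`|l| ^+ 3) integrable_abs3).
- move=> x _; rewrite -exprMn -normrM; apply: le_trans (normr_cosB (l * x)).
  by rewrite exprMn mulrAC.
Qed.

End NormalChar.

(** * Gaussian variables, degenerate ones included *)

Section BrownianGauss.
Context (R : realType) d (Omega : measurableType d) (P : probability Omega R).
Notation N := (std_normal R).

(** Unlike [normal_rv], parametrized by a nonzero standard deviation, this allows [v = 0], which
    occurs when a frozen volatility vanishes or a grid interval is empty. Stating the law through
    integrals makes it directly usable under Tonelli. *)
Definition gaussian (v : R) (Y : Omega -> R) : Prop :=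
  measurable_fun setT Y /\
  forall f : R -> \bar R, measurable_fun setT f -> (forall x, (0 <= f x)%E) ->
    (\int[P]_w f (Y w) = \int[N]_x f (Num.sqrt v * x)%R)%E.

Lemma normal_rv_gaussian (Y : Omega -> R) (s : R) : 0 < s ->
  normal_rv P Y 0 s -> gaussian (s ^+ 2) Y.
Proof.
move=> s0 [mY YE]; split=> // f mf f0.
rewrite sqrtr_sqr gtr0_norm// -(integral_normal_scale s0 mf f0).
pose mfY : {mfun Omega >-> measurableTypeR R} :=
  HB.pack Y (isMeasurableFun.Build _ _ Omega (measurableTypeR R) Y mY).
have <- : (\int[distribution P mfY]_y f y = \int[P]_w f (Y w))%E.
  exact: ge0_integral_distribution.
by apply: eq_measure_integral => A mA _; exact: YE.
Qed.

Lemma gaussian0 : gaussian 0 (fun=> 0).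
Proof.
split=> // f mf f0; rewrite sqrtr0; under [RHS]eq_integral do rewrite mul0r.
by rewrite !integral_prob_cst.
Qed.

Lemma gaussian_scale (c v : R) (Y : Omega -> R) : 0 <= v -> gaussian v Y ->
  gaussian (c ^+ 2 * v) (fun w => c * Y w).
Proof.
move=> v0 [mY YE]; split; first exact: measurable_funM.
move=> f mf f0; rewrite (YE (fun x => f (c * x))) //; last first.
  by apply: (measurableT_comp mf); exact: measurable_funM.
rewrite sqrtrM ?sqr_ge0// sqrtr_sqr.
have [c0|c0] := leP 0 c.
  by apply: eq_integral => x _; rewrite (ger0_norm c0) mulrA.
(* For negative [c], reflecting the symmetric normal law restores the positive square root of the
   variance. *)
pose g x := f (`|c| * Num.sqrt v * x).
have mg : measurable_fun setT g by apply: (measurableT_comp mf); exact: measurable_funM.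
rewrite -[RHS]/(\int[N]_x g x)%E.
rewrite -(integral_normal_oppr mg (fun x => f0 _)).
by apply: eq_integral => x _; rewrite /g (ltr0_norm c0); congr f; ring.
Qed.

Lemma gaussian_integral (v : R) (Y : Omega -> R) (f : R -> R) : gaussian v Y ->
  measurable_fun setT f -> N.-integrable setT (fun x => (f (Num.sqrt v * x))%:E) ->
  P.-integrable setT (fun w => (f (Y w))%:E) /\
  \int[P]_w f (Y w) = \int[N]_x f (Num.sqrt v * x).
Proof.
move=> [mY YE] mf /integrableP[_ ifv].
have mef : measurable_fun setT (EFin \o f) by exact/measurable_EFinP.
split.
  apply/integrableP; split.
    by apply/measurable_EFinP; exact: measurableT_comp.
  rewrite (YE (fun x => `|(f x)%:E|%E)) //; exact: measurableT_comp.
rewrite /Rintegral; congr fine; rewrite integralE [RHS]integralE; congr (_ - _)%E.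
- have := YE ((EFin \o f)^\+)%E (measurable_funepos mef) (fun x => funepos_ge0 _ _).
  move=> h; apply: (eq_trans (eq_trans _ h)); apply: eq_integral => x _; by rewrite !funeposE.
- have := YE ((EFin \o f)^\-)%E (measurable_funeneg mef) (fun x => funeneg_ge0 _ _).
  move=> h; apply: (eq_trans (eq_trans _ h)); apply: eq_integral => x _; by rewrite !funenegE.
Qed.

End BrownianGauss.

(** * Brownian increments *)

Section SubSigma.
Context (R : realType) d (Omega : measurableType d) (P : probability Omega R).

(** Bridge between two descriptions of a sub-sigma-algebra: a family of events [G], as in a
    filtration, and the type [g_sigma_algebraType G], on which measurability of composite
    expressions can be proved. *)
Lemma sub_measurable_fun (G : set (set Omega)) (Y : Omega -> R) :
  sigma_algebra setT G -> rv_events Y `<=` G ->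
  measurable_fun setT (Y : g_sigma_algebraType G -> R).
Proof.
move=> sG YG _ A mA; rewrite setTI; apply: sub_sigma_algebra; apply: YG.
by exists A => //; rewrite setTI.
Qed.

Lemma measurable_fun_sub (G : set (set Omega)) (Y : Omega -> R) :
  sigma_algebra setT G ->
  measurable_fun setT (Y : g_sigma_algebraType G -> R) -> rv_events Y `<=` G.
Proof.
move=> sG mY A [U mU <-]; rewrite -(sigma_algebra_id sG).
exact: mY.
Qed.

Lemma measurable_idsub (G : set (set Omega)) : G `<=` measurable ->
  measurable_fun setT (id : Omega -> g_sigma_algebraType G).
Proof.
move=> Gm _ A mA; rewrite setTI preimage_id.
have mA' : <<s G>> A := mA.
have := sub_sigma_algebra2 Gm mA'.
by rewrite sigma_algebra_id//; exact: sigma_algebra_measurable.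
Qed.

Lemma measurable_fun_of_sub (G : set (set Omega)) (Y : Omega -> R) :
  G `<=` measurable ->
  measurable_fun setT (Y : g_sigma_algebraType G -> R) -> measurable_fun setT Y.
Proof.
move=> Gm mY; exact: (measurableT_comp mY (measurable_idsub Gm)).
Qed.

Lemma indep_rv_sub (G : set (set Omega)) (Y : Omega -> R) :
  sigma_algebra setT G -> indep_events P (rv_events Y) G ->
  indep_rv P (id : Omega -> g_sigma_algebraType G) Y.
Proof.
move=> sG YG A U mA mU; rewrite preimage_id setIC muleC.
apply: YG; first by exists U => //; rewrite setTI.
by rewrite -(sigma_algebra_id sG).
Qed.

End SubSigma.

Section Brownian.
Context (R : realType) d (Omega : measurableType d) (P : probability Omega R).
Variables (FF : R -> set (set Omega)) (B : R -> Omega -> R).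
Hypotheses (HFF : complete_filtration P FF) (HB : brownian_motion P FF B).
Notation N := (std_normal R).

(** The sample space equipped with [FF t]: adaptedness at [t] becomes measurability from this type,
    and independence of [FF t] becomes independence of [id] into it. *)
Definition at_time (t : R) := g_sigma_algebraType (FF t).

Lemma brownian_measurable (s t : R) : 0 <= s -> s <= t ->
  measurable_fun setT (B s : at_time t -> R).
Proof.
move=> s0 st; apply: sub_measurable_fun.
  by apply: (filtration_sigma HFF); exact: le_trans st.
by apply: subset_trans (filtration_mono HFF s0 st); exact: (bm_adapted HB).
Qed.

Lemma at_time_mono (s t : R) (Y : Omega -> R) : 0 <= s -> s <= t ->
  measurable_fun setT (Y : at_time s -> R) -> measurable_fun setT (Y : at_time t -> R).
Proof.
move=> s0 st mY; apply: sub_measurable_fun.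
  by apply: (filtration_sigma HFF); exact: le_trans st.
apply: subset_trans (filtration_mono HFF s0 st).
by apply: measurable_fun_sub => //; exact: (filtration_sigma HFF).
Qed.

Lemma at_time_measurable (t : R) (Y : Omega -> R) : 0 <= t ->
  measurable_fun setT (Y : at_time t -> R) -> measurable_fun setT Y.
Proof. by move=> t0; apply: measurable_fun_of_sub; exact: (filtration_sub HFF t0). Qed.

Lemma at_time_id (t : R) : 0 <= t -> measurable_fun setT (id : Omega -> at_time t).
Proof. by move=> t0; apply: measurable_idsub; exact: (filtration_sub HFF t0). Qed.

Lemma gaussian_increment (s t : R) : 0 <= s -> s <= t ->
  gaussian P (t - s) (fun w => B t w - B s w).
Proof.
move=> s0; rewrite le_eqVlt => /predU1P[<-|st].
  rewrite subrr; under eq_fun do rewrite subrr; exact: gaussian0.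
have := normal_rv_gaussian _ (bm_normal HB s0 st).
by rewrite sqr_sqrtr ?subr_ge0 ?(ltW st)//; apply; rewrite sqrtr_gt0 subr_gt0.
Qed.

Lemma indep_increment (s t : R) : 0 <= s -> s <= t ->
  indep_rv P (id : Omega -> at_time s) (fun w => B t w - B s w).
Proof.
move=> s0; rewrite le_eqVlt => /predU1P[<-|st]; last first.
  apply: indep_rv_sub; first exact: (filtration_sigma HFF).
  exact: (bm_indep HB).
have -> : (fun w => B s w - B s w) = (fun=> 0) by apply/funext => w; rewrite subrr.
move=> A U mA mU.
have [U0|U0] := pselect (U 0).
  have -> : (fun=> 0) @^-1` U = [set: Omega] by apply/seteqP; split.
  by rewrite setIT (probability_setT P) mule1.
have -> : (fun=> 0) @^-1` U = (set0 : set Omega) by apply/seteqP; split.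
by rewrite setI0 measure0 mule0.
Qed.

(** No integral is computed: the increments of [B] over [[0, a]] and [[a, a + b]] are independent
    Gaussians, and their sum is an increment, hence Gaussian by the definition of Brownian
    motion. *)
Lemma gaussian_convolution (a b : R) (f : R -> \bar R) : 0 <= a -> 0 <= b ->
  measurable_fun setT f -> (forall x, (0 <= f x)%E) ->
  (\int[N]_x \int[N]_y f (Num.sqrt a * x + Num.sqrt b * y)%R =
   \int[N]_z f (Num.sqrt (a + b) * z)%R)%E.
Proof.
move=> a0 b0 mf f0.
have gX : gaussian P a (fun w => B a w - B 0 w).
  by have := gaussian_increment (lexx 0) a0; rewrite subr0.
have ab : a <= a + b by rewrite lerDl.
have gY : gaussian P b (fun w => B (a + b) w - B a w).
  by have := gaussian_increment a0 ab; rewrite addrAC subrr add0r.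
have gZ : gaussian P (a + b) (fun w => B (a + b) w - B 0 w).
  by have := gaussian_increment (lexx 0) (addr_ge0 a0 b0); rewrite subr0.
rewrite -(gZ.2 f mf f0).
have mX : measurable_fun setT ((fun w => B a w - B 0 w) : at_time a -> R).
  by apply: measurable_funB; exact: brownian_measurable.
pose F := fun z : at_time a * R => f ((B a z.1 - B 0 z.1) + z.2).
have mF : measurable_fun setT F.
  apply: (measurableT_comp mf); apply: measurable_funD => //.
  by apply: (measurableT_comp mX); exact: measurable_fst.
have := indep_integral_ge0 (at_time_id a0) gY.1 (indep_increment a0 ab) mF (fun z => f0 _).
rewrite /F /= => H.
have -> : (\int[P]_w f (B (a + b) w - B 0 w)%R =
    \int[P]_w f (B a w - B 0 w + (B (a + b) w - B a w))%R)%E.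
  by apply: eq_integral => w _; congr f; ring.
rewrite H.
pose g x := (\int[N]_y f (x + Num.sqrt b * y)%R)%E.
have mg2 : measurable_fun setT (fun z : R * measurableTypeR R => f (z.1 + Num.sqrt b * z.2)).
  apply: (measurableT_comp mf); apply: measurable_funD => //.
  by apply: measurable_funM => //; exact: measurable_snd.
have mg : measurable_fun setT g.
  exact: (measurable_fun_fubini_tonelli_F (m2 := N) _ mg2 (fun z => f0 _)).
have g0 x : (0 <= g x)%E by apply: integral_ge0.
rewrite -[LHS]/(\int[N]_x g (Num.sqrt a * x)%R)%E -(gX.2 g mg g0).
apply: eq_integral => w _; rewrite /g.
have mfw : measurable_fun setT (fun y => f (B a w - B 0 w + y)).
  by apply: (measurableT_comp mf); exact: measurable_funD.
by rewrite -(gY.2 _ mfw (fun y => f0 _)).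
Qed.

Lemma gaussian_add (s v w : R) (Y Z : Omega -> R) : 0 <= s -> 0 <= v -> 0 <= w ->
  gaussian P v Y -> gaussian P w Z ->
  measurable_fun setT (Y : at_time s -> R) ->
  indep_rv P (id : Omega -> at_time s) Z ->
  gaussian P (v + w) (fun o => Y o + Z o).
Proof.
move=> s0 v0 w0 gY gZ mY iZ; split; first exact: measurable_funD gY.1 gZ.1.
move=> f mf f0; rewrite -gaussian_convolution//.
pose F := fun z : at_time s * R => f (Y z.1 + z.2).
have mF : measurable_fun setT F.
  apply: (measurableT_comp mf); apply: measurable_funD => //.
  by apply: (measurableT_comp mY); exact: measurable_fst.
have := indep_integral_ge0 (at_time_id s0) gZ.1 iZ mF (fun z => f0 _).
rewrite /F /= => ->.
pose g x := (\int[N]_y f (x + Num.sqrt w * y)%R)%E.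
have mg2 : measurable_fun setT (fun z : R * measurableTypeR R => f (z.1 + Num.sqrt w * z.2)).
  apply: (measurableT_comp mf); apply: measurable_funD => //.
  by apply: measurable_funM => //; exact: measurable_snd.
have mg : measurable_fun setT g.
  exact: (measurable_fun_fubini_tonelli_F (m2 := N) _ mg2 (fun z => f0 _)).
have g0 x : (0 <= g x)%E by apply: integral_ge0.
rewrite -[RHS]/(\int[N]_x g (Num.sqrt v * x)%R)%E -(gY.2 g mg g0).
apply: eq_integral => o _; rewrite /g.
have mfw : measurable_fun setT (fun y => f (Y o + y)).
  by apply: (measurableT_comp mf); exact: measurable_funD.
by rewrite -(gZ.2 _ mfw (fun y => f0 _)).
Qed.

(** [Z] is integrated out conditionally on [FF s], which leaves a function of [Y] alone, and [Y] is
    independent of [FF r]. *)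
Lemma indep_rv_add (r s : R) (Y Z : Omega -> R) : 0 <= r -> r <= s ->
  measurable_fun setT (Y : at_time s -> R) -> measurable_fun setT Z ->
  indep_rv P (id : Omega -> at_time r) Y ->
  indep_rv P (id : Omega -> at_time s) Z ->
  indep_rv P (id : Omega -> at_time r) (fun o => Y o + Z o).
Proof.
move=> r0 rs mY mZ iY iZ A U mA mU.
have s0 := le_trans r0 rs.
have mYT := at_time_measurable s0 mY.
have mA' : measurable (A : set Omega).
  by have := at_time_id r0 measurableT mA; rewrite setTI preimage_id.
have mAs : measurable (A : set (at_time s)).
  apply: sub_sigma_algebra; apply: (filtration_mono HFF r0 rs).
  by rewrite -(sigma_algebra_id (filtration_sigma HFF r0)).
pose g x := (\int[P]_o (\1_U (x + Z o)%R)%:E)%E.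
have m1 : measurable_fun setT (fun x : R => (\1_U x : R)%:E).
  by apply/measurable_EFinP; exact: measurable_indic.
have mg2 : measurable_fun setT (fun z : R * Omega => (\1_U (z.1 + Z z.2) : R)%:E).
  apply: (measurableT_comp m1); apply: measurable_funD => //.
  by apply: (measurableT_comp mZ); exact: measurable_snd.
have mg : measurable_fun setT g.
  by apply: (measurable_fun_fubini_tonelli_F (m2 := P) _ mg2) => z; rewrite lee_fin.
have g0 x : (0 <= g x)%E by apply: integral_ge0 => o _; rewrite lee_fin.
have mS : measurable ((fun o => Y o + Z o) @^-1` U).
  by rewrite -[X in measurable X]setTI; apply: measurable_funD.
(* Applied twice: to the event [A] of [FF r], and to the whole space for the unconditional
   probability. *)
have E (C : set Omega) : measurable (C : set (at_time s)) -> measurable C ->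
   (P (C `&` ((fun o => Y o + Z o)%R @^-1` U)) = \int[P]_o ((\1_C o : R)%:E * g (Y o)))%E.
  move=> mC mC'; rewrite -[C `&` _]setIT -integral_indic//; last exact: measurableI.
  pose F := fun z : at_time s * R => ((\1_C z.1 : R)%:E * (\1_U (Y z.1 + z.2) : R)%:E)%E.
  have mF : measurable_fun setT F.
    apply: emeasurable_funM.
      apply/measurable_EFinP; apply: (measurableT_comp (f := \1_C : at_time s -> R)).
        exact: measurable_indic.
      exact: measurable_fst.
    apply: (measurableT_comp m1); apply: measurable_funD => //.
    by apply: (measurableT_comp mY); exact: measurable_fst.
  have F0 z : (0 <= F z)%E by rewrite mule_ge0// lee_fin.
  have := indep_integral_ge0 (at_time_id s0) mZ iZ mF F0.
  rewrite /F /= => H.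
  transitivity (\int[P]_o ((\1_C o : R)%:E * (\1_U (Y o + Z o)%R : R)%:E))%E.
    by apply: eq_integral => o _; rewrite -EFinM indicI.
  rewrite H; apply: eq_integral => o _; rewrite ge0_integralZl//.
  by apply: (measurableT_comp m1); exact: measurable_funD.
rewrite preimage_id E//.
have -> : (P ((fun o => Y o + Z o)%R @^-1` U) = \int[P]_o g (Y o))%E.
  rewrite -[X in P X]setTI E//.
  by apply: eq_integral => o _; rewrite indicT mul1e.
pose F := fun z : at_time r * R => ((\1_A z.1 : R)%:E * g z.2)%E.
have mF : measurable_fun setT F.
  apply: emeasurable_funM.
    apply/measurable_EFinP; apply: (measurableT_comp (f := \1_A : at_time r -> R)).
      exact: measurable_indic.
    exact: measurable_fst.
  by apply: (measurableT_comp mg); exact: measurable_snd.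
have F0 z : (0 <= F z)%E by rewrite mule_ge0// lee_fin.
have := indep_integral_ge0 (at_time_id r0) mYT iY mF F0.
rewrite /F /= => ->.
have mgY : measurable_fun setT (fun o => g (Y o)) by exact: measurableT_comp.
under eq_integral do rewrite ge0_integralZl ?lee_fin//.
rewrite ge0_integralZr//.
- by rewrite integral_indic// setIT.
- by apply/measurable_EFinP; exact: measurable_indic.
- exact: integral_ge0.
Qed.

Section Block.
Variables (s : nat -> R) (v : nat -> R).
Hypotheses (s0 : 0 <= s 0%N) (s_nd : forall j, s j <= s j.+1).

(** The Wiener integral of a deterministic step function: what the integral on a cell becomes once
    the volatility is frozen. *)
Definition block (m : nat) (w : Omega) : R :=
  \sum_(j < m) v j * (B (s j.+1) w - B (s j) w).

Definition block_var (m : nat) : R := \sum_(j < m) v j ^+ 2 * (s j.+1 - s j).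

Let s_ge0 j : 0 <= s j.
Proof. by elim: j => // j IH; exact: le_trans (s_nd j). Qed.

Let s_mono i j : (i <= j)%N -> s i <= s j.
Proof.
move=> ij; rewrite -(subnKC ij); elim: (j - i)%N => [|k IH]; rewrite ?addn0//.
by rewrite addnS; exact: le_trans (s_nd _).
Qed.

Let blockS m : block m.+1 = (fun w => block m w + v m * (B (s m.+1) w - B (s m) w)).
Proof. by apply/funext => w; rewrite /block big_ord_recr. Qed.

Let block0 : block 0 = (fun=> 0).
Proof. by apply/funext => w; rewrite /block big_ord0. Qed.

Lemma block_var_ge0 m : 0 <= block_var m.
Proof. by apply: sumr_ge0 => j _; rewrite mulr_ge0 ?sqr_ge0// subr_ge0. Qed.

Lemma block_at_time m : measurable_fun setT (block m : at_time (s m) -> R).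
Proof.
apply: measurable_sum => j; apply: measurable_funM => //.
have h : s j.+1 <= s m by exact: s_mono.
by apply: measurable_funB; apply: brownian_measurable => //; exact: le_trans h.
Qed.

Lemma block_gaussian m : gaussian P (block_var m) (block m).
Proof.
elim: m => [|m IH].
  by rewrite /block_var big_ord0 block0; exact: gaussian0.
rewrite /block_var big_ord_recr/= blockS.
apply: (gaussian_add (s := s m)) => //.
- exact: block_var_ge0.
- by rewrite mulr_ge0 ?sqr_ge0// subr_ge0.
- by apply: gaussian_scale; [rewrite subr_ge0|exact: gaussian_increment].
- exact: block_at_time.
- move=> A U mA mU.
  have mU' : measurable ((fun x => v m * x) @^-1` U).
    by rewrite -[X in measurable X]setTI; apply: (@mulrl_measurable _ _ (v m)).
  exact: (indep_increment (s_ge0 m) (s_nd m) mA mU').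
Qed.

(** Each increment is independent of the past at its own left end; [indep_rv_add] carries this back
    to the initial time. The empty sum is rewritten as a null increment for the base case. *)
Lemma block_indep m : indep_rv P (id : Omega -> at_time (s 0%N)) (block m).
Proof.
elim: m => [|m IH].
  rewrite block0.
  have -> : (fun=> 0) = (fun w => B (s 0%N) w - B (s 0%N) w).
    by apply/funext => w; rewrite subrr.
  exact: indep_increment.
rewrite blockS.
apply: (indep_rv_add (s := s m)) => //.
- exact: s_mono.
- exact: block_at_time.
- apply: measurable_funM => //; apply: at_time_measurable (s_ge0 m.+1) _.
  by apply: measurable_funB; exact: brownian_measurable.
- move=> A U mA mU.
  have mU' : measurable ((fun x => v m * x) @^-1` U).
    by rewrite -[X in measurable X]setTI; apply: (@mulrl_measurable _ _ (v m)).
  exact: (indep_increment (s_ge0 m) (s_nd m) mA mU').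
Qed.

End Block.
End Brownian.

(** * The normal characteristic function and a Lindeberg bound *)

Lemma EFin_Rintegral d (T : measurableType d) (R : realType)
    (mu : {measure set T -> \bar R}) (f : T -> R) :
  mu.-integrable setT (EFin \o f) -> (\int[mu]_x (f x)%:E = (\int[mu]_x f x)%:E)%E.
Proof. by move=> fi; rewrite /Rintegral fineK//; exact: (integrable_fin_num _ fi). Qed.

Lemma normr_Rintegral_le1 d (T : measurableType d) (R : realType)
    (P : probability T R) (f : T -> R) :
  measurable_fun setT f -> (forall x, `|f x| <= 1) -> `|\int[P]_x f x| <= 1.
Proof.
move=> mf f1; have fi := bounded_integrable P mf f1.
apply: le_trans (le_normr_Rintegral measurableT fi) _.
rewrite -[leRHS](Rintegral_prob_cst P); apply: le_Rintegral => //.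
- exact: integrable_norm.
- by apply: (@bounded_integrable _ _ _ P _ 1) => // x; rewrite normr1.
Qed.

Lemma geometric_le0 (R : realType) (x K q : R) : 0 <= q < 1 ->
  (forall n, x <= K * q ^+ n) -> x <= 0.
Proof.
move=> /andP[q0 q1] H.
have c : (K * q ^+ n) @[n --> \oo] --> (0 : R).
  rewrite -[0](mulr0 K); apply: cvgM; first exact: cvg_cst.
  by apply: cvg_expr; rewrite ger0_norm.
apply: (ler_cvg_to (cvg_cst x) c).
by apply: nearW => n; exact: H.
Qed.

Section CharBrownian.
Context (R : realType) d (Omega : measurableType d) (P : probability Omega R).
Variables (FF : R -> set (set Omega)) (B : R -> Omega -> R).
Hypotheses (HFF : complete_filtration P FF) (HB : brownian_motion P FF B).
Notation N := (std_normal R).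
Implicit Types (l : R).

Let phi l := \int[N]_x cos (l * x).

Let icst (c : R) := @bounded_integrable _ _ _ N (fun=> c) `|c| (measurable_cst _) (fun=> lexx _).

(* The law of [(x + y) / sqrt 2] under two independent normals is normal: this
   functional equation, iterated against the Taylor bound at [0], determines [phi]. *)
Let phi_half l : phi l = phi (l * Num.sqrt 2^-1) ^+ 2.
Proof.
set u := l * _.
have h2 : 0 <= 2^-1 :> R by rewrite invr_ge0.
(* Adding 1 makes the cosine nonnegative, as [gaussian_convolution] requires; the 1 is removed from
   both sides at the end. *)
have mf : measurable_fun setT (fun x : R => (cos (l * x) + 1)%:E).
  by apply/measurable_EFinP; apply: measurable_funD => //; exact: measurable_cosM.
have f0 x : (0 <= (cos (l * x) + 1)%:E)%E.
  by rewrite lee_fin; have := cos_geN1 (l * x); lra.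
have := gaussian_convolution HFF HB h2 h2 mf f0.
have -> : 2^-1 + 2^-1 = 1 :> R by lra.
rewrite sqrtr1.
have -> : (\int[N]_z (cos (l * (1 * z)) + 1)%:E = (phi l + 1)%:E)%E.
  rewrite EFin_Rintegral; last first.
    apply: (@bounded_integrable _ _ _ N _ 2).
      apply: measurable_funD => //; under eq_fun do rewrite mul1r; exact: measurable_cosM.
    by move=> x; rewrite (le_trans (ler_normD _ _))// normr1 lerD2r; exact: cos_max.
  under eq_Rintegral do rewrite mul1r.
  by rewrite (RintegralD measurableT (integrable_cosM l) (icst 1)) Rintegral_prob_cst.
have E x : (\int[N]_y (cos (l * (Num.sqrt 2^-1 * x + Num.sqrt 2^-1 * y)) + 1)%:E =
     (phi u * cos (u * x) + 1)%:E)%E.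
  have D y : cos (l * (Num.sqrt 2^-1 * x + Num.sqrt 2^-1 * y)) + 1 =
     cos (u * x) * cos (u * y) - sin (u * x) * sin (u * y) + 1.
    by rewrite -cosD mulrDr !mulrA.
  under eq_integral do rewrite D.
  have i1 : N.-integrable setT (EFin \o (fun y => cos (u * x) * cos (u * y))).
    exact: (integrableZl measurableT (cos (u * x)) (integrable_cosM u)).
  have i2 : N.-integrable setT (EFin \o (fun y => sin (u * x) * sin (u * y))).
    exact: (integrableZl measurableT (sin (u * x)) (integrable_sinM u)).
  have i3 : N.-integrable setT (EFin \o (fun y => cos (u * x) * cos (u * y) - sin (u * x) * sin (u * y))).
    exact: (integrableB measurableT i1 i2).
  rewrite EFin_Rintegral; last exact: (integrableD measurableT i3 (icst 1)).
  rewrite (RintegralD measurableT i3 (icst 1)) (RintegralB measurableT i1 i2) Rintegral_prob_cst.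
  rewrite RintegralZl//; last exact: integrable_cosM.
  rewrite RintegralZl//; last exact: integrable_sinM.
  by rewrite normal_sin mulr0 subr0 mulrC.
under eq_integral do rewrite E.
have i4 : N.-integrable setT (EFin \o (fun x => phi u * cos (u * x))).
  exact: (integrableZl measurableT (phi u) (integrable_cosM u)).
rewrite EFin_Rintegral; last exact: (integrableD measurableT i4 (icst 1)).
rewrite (RintegralD measurableT i4 (icst 1)) Rintegral_prob_cst.
rewrite RintegralZl//; last exact: integrable_cosM.
by move=> [] /addIr <-; rewrite expr2.
Qed.

Let q := Num.sqrt 2^-1 : R.

Let q2 : q ^+ 2 = 2^-1.
Proof. by rewrite sqr_sqrtr. Qed.

Let q0 : 0 <= q. Proof. exact: sqrtr_ge0. Qed.

Let q1 : q < 1.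
Proof. by rewrite -(@ltr_pXn2r _ 2)// ?nnegrE// q2 expr1n; lra. Qed.

(** Both sides satisfy [f l = f (l q)^2] with [q = sqrt (1/2)] and are bounded by 1, so passing from
    [l q] to [l] at most doubles their distance, while a cubic bound gains [q^3]. Since [2 q^3 = q],
    every iteration improves the bound by the factor [q < 1]. *)
Lemma normal_cos l : \int[N]_x cos (l * x) = expR (- (l ^+ 2 / 2)).
Proof.
apply/eqP; rewrite -subr_eq0 -normr_le0; rewrite -/(phi l).
(* [abs_moment3 R] comes from the Taylor bound of the cosine average and 1 from that of the
   exponential. *)
apply: (@geometric_le0 _ _ ((abs_moment3 R + 1) * `|l| ^+ 3) q); first by rewrite q0 q1.
move=> n; elim: n l => [|n IH] l.
  rewrite expr0 mulr1.
  have h1 := normal_cos_taylor l.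
  have h2 := normr_expRNsqr (q * l).
  rewrite exprMn q2 (_ : - (2^-1 * l ^+ 2) = - (l ^+ 2 / 2)) ?(mulrC 2^-1)// in h2.
  have h3 : `|q * l| ^+ 3 <= `|l| ^+ 3.
    by rewrite lerXn2r// ?nnegrE// normrM (ger0_norm q0) ler_piMl// ltW.
  rewrite -/(phi l) in h1.
  have -> : phi l - expR (- (l ^+ 2 / 2)) = (phi l - (1 - l ^+ 2 / 2)) -
     (expR (- (l ^+ 2 / 2)) - 1 + l ^+ 2 / 2) by ring.
  apply: le_trans (ler_normB _ _) _; lra.
rewrite phi_half -/q; set u := l * q.
have -> : expR (- (l ^+ 2 / 2)) = expR (- (u ^+ 2 / 2)) ^+ 2.
  by rewrite -expRM_natl; congr expR; rewrite /u exprMn q2; field.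
rewrite subr_sqr normrM.
have hu := IH u.
have l1 : `|phi u| <= 1.
  exact: (normr_Rintegral_le1 N (measurable_cosM u) (fun x => cos_max _)).
have l2 : `|expR (- (u ^+ 2 / 2))| <= 1.
  by rewrite ger0_norm ?expR_ge0// expR_le1 oppr_le0 divr_ge0// sqr_ge0.
have l3 : `|phi u + expR (- (u ^+ 2 / 2))| <= 2.
  by apply: le_trans (ler_normD _ _) _; lra.
apply: le_trans (ler_pM _ _ hu l3) _ => //.
rewrite /u normrM (ger0_norm q0) exprMn le_eqVlt; apply/orP; left; apply/eqP.
have q3 : q ^+ 3 = 2^-1 * q by rewrite exprS mulrC q2.
by rewrite q3 [q ^+ n.+1]exprS; field.
Qed.

End CharBrownian.

(** * Third-order expansion for a centred chi-square *)

Section ChiSquare.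
Context (R : realType).
Notation N := (std_normal R).
Implicit Types (l : R).

Definition chi_moment3 := \int[N]_x (`|x ^+ 2 - 1| ^+ 3).

Let mw : measurable_fun setT (fun x : R => x ^+ 2 - 1).
Proof. by apply: measurable_funB. Qed.

Let icst (c : R) := @bounded_integrable _ _ _ N (fun=> c) `|c| (measurable_cst _) (fun=> lexx _).

Let i2 := normal_integrable_pow R (isT : (2 <= 6)%N).
Let i4 := normal_integrable_pow R (isT : (4 <= 6)%N).
Let i6 := normal_integrable_pow R (isT : (6 <= 6)%N).

Let iw : N.-integrable setT (EFin \o (fun x => x ^+ 2 - 1)).
Proof. exact: (integrableB measurableT i2 (icst 1)). Qed.

Let Ew : \int[N]_x (x ^+ 2 - 1) = 0.
Proof.
rewrite (RintegralB measurableT i2 (icst 1)) Rintegral_prob_cst.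
have -> : \int[N]_x (x ^+ 2) = 1 := normal_moment2 R.
by rewrite subrr.
Qed.

(** With [y = x^2], the cube of [|y - 1|] is at most [y^3 + 1]; this is where the sixth moment is
    spent. *)
Let iw3 : N.-integrable setT (EFin \o (fun x => `|x ^+ 2 - 1| ^+ 3)).
Proof.
have ib : N.-integrable setT (EFin \o (fun x => x ^+ 6 + 1)).
  exact: (integrableD measurableT i6 (icst 1)).
apply: (@dominated_integrable _ _ _ N _ (fun x : R => x ^+ 6 + 1) _ _ ib).
  by apply: measurable_funX; exact: measurableT_comp.
move=> x; rewrite normrX normr_id (_ : x ^+ 6 = (x ^+ 2) ^+ 3); last by rewrite -exprM.
have := sqr_ge0 x; set y := x ^+ 2 => y0.
have [y1|y1] := leP 1 y.
  rewrite ger0_norm ?subr_ge0// (le_trans (_ : _ <= y ^+ 3))//.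
    by rewrite lerXn2r ?nnegrE ?subr_ge0//; lra.
  by rewrite lerDl.
rewrite ltr0_norm ?subr_lt0// opprB.
have h : (1 - y) ^+ 3 <= 1 by rewrite exprn_ile1//; lra.
by have := exprn_ge0 3 y0; lra.
Qed.

Let Ew2 : N.-integrable setT (EFin \o (fun x => (x ^+ 2 - 1) ^+ 2)) /\
  \int[N]_x ((x ^+ 2 - 1) ^+ 2) = 2.
Proof.
have E (x : R) : (x ^+ 2 - 1) ^+ 2 = x ^+ 4 - 2 * x ^+ 2 + 1 by ring.
have i22 : N.-integrable setT (EFin \o (fun x => 2 * x ^+ 2)).
  exact: (integrableZl measurableT 2 i2).
have i42 : N.-integrable setT (EFin \o (fun x => x ^+ 4 - 2 * x ^+ 2)).
  exact: (integrableB measurableT i4 i22).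
split.
  rewrite (_ : (fun x => _) = (fun x : R => x ^+ 4 - 2 * x ^+ 2 + 1)); last exact/funext.
  exact: (integrableD measurableT i42 (icst 1)).
under eq_Rintegral do rewrite E.
rewrite (RintegralD measurableT i42 (icst 1)) (RintegralB measurableT i4 i22) Rintegral_prob_cst.
rewrite RintegralZl//.
have -> : \int[N]_x (x ^+ 2) = 1 := normal_moment2 R.
have -> : \int[N]_x (x ^+ 4) = 3 := normal_moment4 R.
by lra.
Qed.

Let iw3' l : N.-integrable setT (EFin \o (fun x => `|l| ^+ 3 * `|x ^+ 2 - 1| ^+ 3)).
Proof. exact: (integrableZl measurableT (`|l| ^+ 3) iw3). Qed.

(** The mean of [x^2 - 1] vanishes, so subtracting the linear part does not change the integral and
    leaves a cubic remainder. *)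
Lemma chi_sin l : `|\int[N]_x sin (l * (x ^+ 2 - 1))| <= chi_moment3 * `|l| ^+ 3.
Proof.
have ms : measurable_fun setT (fun x : R => sin (l * (x ^+ 2 - 1))).
  by apply: (measurableT_comp (measurable_sinM l)).
have is_ := @bounded_integrable _ _ _ N _ 1 ms (fun x => sin_max _).
have ilw : N.-integrable setT (EFin \o (fun x => l * (x ^+ 2 - 1))).
  exact: (integrableZl measurableT l iw).
have -> : \int[N]_x sin (l * (x ^+ 2 - 1)) =
    \int[N]_x (sin (l * (x ^+ 2 - 1)) - l * (x ^+ 2 - 1)).
  by rewrite (RintegralB measurableT is_ ilw) RintegralZl// Ew mulr0 subr0.
have i5 : N.-integrable setT (EFin \o (fun x => sin (l * (x ^+ 2 - 1)) - l * (x ^+ 2 - 1))).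
  exact: (integrableB measurableT is_ ilw).
apply: le_trans (le_normr_Rintegral measurableT i5) _.
rewrite [leRHS]mulrC /chi_moment3 -RintegralZl//.
apply: le_Rintegral => //; first exact: integrable_norm.
by move=> x _; rewrite -exprMn -normrM; exact: normr_sinB.
Qed.

(** The variance of [x^2 - 1] is 2, so the quadratic Taylor term is exactly [l^2], the same as for
    [expR (- l ^+ 2)]. *)
Lemma chi_cos l :
  `|\int[N]_x cos (l * (x ^+ 2 - 1)) - expR (- l ^+ 2)| <= (chi_moment3 + 1) * `|l| ^+ 3.
Proof.
have mc : measurable_fun setT (fun x : R => cos (l * (x ^+ 2 - 1))).
  by apply: (measurableT_comp (measurable_cosM l)).
have ic := @bounded_integrable _ _ _ N _ 1 mc (fun x => cos_max _).
have [iw2 Ew2'] := Ew2.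
have iw2' : N.-integrable setT (EFin \o (fun x => l ^+ 2 / 2 * (x ^+ 2 - 1) ^+ 2)).
  exact: (integrableZl measurableT (l ^+ 2 / 2) iw2).
have i5 : N.-integrable setT (EFin \o (fun x => cos (l * (x ^+ 2 - 1)) - 1)).
  exact: (integrableB measurableT ic (icst 1)).
have i7 : N.-integrable setT
    (EFin \o (fun x => cos (l * (x ^+ 2 - 1)) - 1 + l ^+ 2 / 2 * (x ^+ 2 - 1) ^+ 2)).
  exact: (integrableD measurableT i5 iw2').
have E : \int[N]_x (cos (l * (x ^+ 2 - 1)) - 1 + l ^+ 2 / 2 * (x ^+ 2 - 1) ^+ 2) =
    \int[N]_x cos (l * (x ^+ 2 - 1)) - 1 + l ^+ 2.
  rewrite (RintegralD measurableT i5 iw2') (RintegralB measurableT ic (icst 1)).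
  by rewrite Rintegral_prob_cst RintegralZl// Ew2'; field.
have h1 : `|\int[N]_x cos (l * (x ^+ 2 - 1)) - 1 + l ^+ 2| <= chi_moment3 * `|l| ^+ 3.
  rewrite -E; apply: le_trans (le_normr_Rintegral measurableT i7) _.
  rewrite [leRHS]mulrC /chi_moment3 -RintegralZl//.
  apply: le_Rintegral => //; first exact: integrable_norm.
  move=> x _; rewrite -exprMn -normrM; apply: le_trans (normr_cosB (l * (x ^+ 2 - 1))).
  by rewrite exprMn mulrAC.
have h2 := normr_expRNsqr l.
have -> : \int[N]_x cos (l * (x ^+ 2 - 1)) - expR (- l ^+ 2) =
  (\int[N]_x cos (l * (x ^+ 2 - 1)) - 1 + l ^+ 2) - (expR (- l ^+ 2) - 1 + l ^+ 2) by ring.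
apply: le_trans (ler_normB _ _) _; lra.
Qed.

Lemma chi_moment3_ge0 : 0 <= chi_moment3.
Proof. by apply: Rintegral_ge0 => x _; rewrite exprn_ge0. Qed.

End ChiSquare.

(** * Sums of independent centred chi-squares with deterministic weights *)

Section Lindeberg.
Context (R : realType) d (Omega : measurableType d) (P : probability Omega R).
Variables (FF : R -> set (set Omega)).
Hypotheses (HFF : complete_filtration P FF).
Variables (t : nat -> R) (J : nat -> Omega -> R) (a I : nat -> R).
Hypotheses (t0 : 0 <= t 0%N) (t_nd : forall i, t i <= t i.+1).
Hypothesis I0 : forall i, 0 <= I i.
Hypothesis J_gauss : forall i, gaussian P (I i) (J i).
Hypothesis J_meas : forall i, measurable_fun setT (J i : at_time FF (t i.+1) -> R).
Hypothesis J_indep : forall i, indep_rv P (id : Omega -> at_time FF (t i)) (J i).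

Definition quad_sum n (w : Omega) : R := \sum_(i < n) a i * (J i w ^+ 2 - I i).

Let t_ge0 i : 0 <= t i.
Proof. by elim: i => // i IH; exact: le_trans (t_nd i). Qed.

Let quad_sum_meas n : measurable_fun setT (quad_sum n : at_time FF (t n) -> R).
Proof.
elim: n => [|n IH].
  rewrite (_ : quad_sum 0 = fun=> 0); last by apply/funext => w; rewrite /quad_sum big_ord0.
  exact: measurable_cst.
rewrite (_ : quad_sum n.+1 = fun w => quad_sum n w + a n * (J n w ^+ 2 - I n)); last first.
  by apply/funext => w; rewrite /quad_sum big_ord_recr.
apply: measurable_funD; first exact: (at_time_mono HFF (t_ge0 n) (t_nd n)).
by apply: measurable_funM => //; apply: measurable_funB => //; exact: measurable_funX.
Qed.

(** [J i] has the law of [Num.sqrt (I i) * x], which turns the term into a rescaled centred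
    chi-square. *)
Let term_cos (l : R) i :
  \int[P]_w cos (l * (a i * (J i w ^+ 2 - I i))) =
  \int[std_normal R]_x cos (l * (a i * I i) * (x ^+ 2 - 1)).
Proof.
have mf : measurable_fun setT (fun y : R => cos (l * (a i * (y ^+ 2 - I i)))).
  apply: (measurableT_comp (measurable_cosM l)); apply: measurable_funM => //.
  exact: measurable_funB.
have E x : cos (l * (a i * ((Num.sqrt (I i) * x) ^+ 2 - I i))) =
    cos (l * (a i * I i) * (x ^+ 2 - 1)).
  by congr cos; rewrite exprMn sqr_sqrtr//; ring.
have mf' : measurable_fun setT (fun x => cos (l * (a i * ((Num.sqrt (I i) * x) ^+ 2 - I i)))).
  by apply: (measurableT_comp mf); exact: measurable_funM.
have [_ ->] := gaussian_integral (J_gauss i) mf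
  (@bounded_integrable _ _ _ (std_normal R) _ 1 mf' (fun x => cos_max _)).
by apply: eq_Rintegral => x _; exact: E.
Qed.

Let term_sin (l : R) i :
  \int[P]_w sin (l * (a i * (J i w ^+ 2 - I i))) =
  \int[std_normal R]_x sin (l * (a i * I i) * (x ^+ 2 - 1)).
Proof.
have mf : measurable_fun setT (fun y : R => sin (l * (a i * (y ^+ 2 - I i)))).
  apply: (measurableT_comp (measurable_sinM l)); apply: measurable_funM => //.
  exact: measurable_funB.
have E x : sin (l * (a i * ((Num.sqrt (I i) * x) ^+ 2 - I i))) =
    sin (l * (a i * I i) * (x ^+ 2 - 1)).
  by congr sin; rewrite exprMn sqr_sqrtr//; ring.
have mf' : measurable_fun setT (fun x => sin (l * (a i * ((Num.sqrt (I i) * x) ^+ 2 - I i)))).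
  by apply: (measurableT_comp mf); exact: measurable_funM.
have [_ ->] := gaussian_integral (J_gauss i) mf
  (@bounded_integrable _ _ _ (std_normal R) _ 1 mf' (fun x => sin_max _)).
by apply: eq_Rintegral => x _; exact: E.
Qed.

(** The real and imaginary parts of a product of characteristic functions are compared with a
    product of Gaussian ones, one factor at a time. All factors have modulus at most 1, so the cubic
    errors of [chi_cos] and [chi_sin] simply add up. *)
Lemma lindeberg_quad (l : R) n :
  `|\int[P]_w cos (l * quad_sum n w) - expR (- (l ^+ 2 * \sum_(i < n) (a i * I i) ^+ 2))|
    <= 2 * (chi_moment3 R + 1) * (`|l| ^+ 3 * \sum_(i < n) `|a i * I i| ^+ 3) /\
  `|\int[P]_w sin (l * quad_sum n w)|
    <= (chi_moment3 R + 1) * (`|l| ^+ 3 * \sum_(i < n) `|a i * I i| ^+ 3).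
Proof.
elim: n => [|n [IHc IHs]].
  have E w : l * quad_sum 0 w = 0 by rewrite /quad_sum big_ord0 mulr0.
  under eq_Rintegral do rewrite E; under [in X in _ /\ X]eq_Rintegral do rewrite E.
  by rewrite cos0 sin0 !Rintegral_prob_cst !big_ord0 !mulr0 oppr0 expR0 subrr normr0.
set Y := fun w => l * quad_sum n w; set Z := fun w => l * (a n * (J n w ^+ 2 - I n)).
have YZ w : l * quad_sum n.+1 w = Y w + Z w.
  by rewrite /quad_sum big_ord_recr/= mulrDr.
under eq_Rintegral do rewrite YZ; under [in X in _ /\ X]eq_Rintegral do rewrite YZ.
have mY : measurable_fun setT (Y : at_time FF (t n) -> R).
  by apply: measurable_funM => //; exact: quad_sum_meas.
have mYT := at_time_measurable HFF (t_ge0 n) mY.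
have mJ := (J_gauss n).1.
pose g := fun y : R => l * (a n * (y ^+ 2 - I n)).
have mg : measurable_fun setT g.
  by apply: measurable_funM => //; apply: measurable_funM => //; exact: measurable_funB.
have mid := at_time_id HFF (t_ge0 n).
(* The partial sum [Y] is measurable at time [t n] and [J n] is independent of [FF (t n)], so the
   products given by the addition formulas factorize. *)
have prod (f1 f2 : R -> R) : measurable_fun setT f1 -> measurable_fun setT f2 ->
    (forall x, `|f1 x| <= 1) -> (forall x, `|f2 x| <= 1) ->
    P.-integrable setT (EFin \o (fun w => f1 (Y w) * f2 (Z w))) /\
    \int[P]_w (f1 (Y w) * f2 (Z w)) = \int[P]_w f1 (Y w) * \int[P]_w f2 (Z w).
  move=> m1 m2 b1 b2.
  have mf1 : measurable_fun setT ((fun w => f1 (Y w)) : at_time FF (t n) -> R).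
    exact: measurableT_comp.
  have mf2 : measurable_fun setT (fun y => f2 (g y)) by exact: measurableT_comp.
  have j1 : P.-integrable setT (EFin \o (fun w => f1 (Y w))).
    by apply: (@bounded_integrable _ _ _ P _ 1) => //; exact: measurableT_comp.
  have j2 : P.-integrable setT (EFin \o (fun w => f2 (g (J n w)))).
    by apply: (@bounded_integrable _ _ _ P _ 1) => //; exact: (measurableT_comp mf2 mJ).
  have [h1 h2] := indep_mul mid mJ (@J_indep n) mf1 mf2 j1 j2.
  split; [exact: h1|exact: h2].
have [icc Ecc] := prod _ _ (@measurable_cos R) (@measurable_cos R) (@cos_max R) (@cos_max R).
have [iss Ess] := prod _ _ (@measurable_sin R) (@measurable_sin R) (@sin_max R) (@sin_max R).
have [isc Esc] := prod _ _ (@measurable_sin R) (@measurable_cos R) (@sin_max R) (@cos_max R).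
have [ics Ecs] := prod _ _ (@measurable_cos R) (@measurable_sin R) (@cos_max R) (@sin_max R).
under eq_Rintegral do rewrite cosD; under [in X in _ /\ X]eq_Rintegral do rewrite sinD.
rewrite (RintegralB measurableT icc iss) (RintegralD measurableT isc ics).
rewrite Ecc Ess Esc Ecs !big_ord_recr/=.
rewrite [\int[P]_w cos (Z w)]term_cos [\int[P]_w sin (Z w)]term_sin.
set b := a n * I n; clearbody b.
have hc := chi_cos (l * b); have hs := chi_sin (l * b).
have lb2 : (l * b) ^+ 2 = l ^+ 2 * b ^+ 2 by exact: exprMn.
rewrite lb2 in hc.
have -> : expR (- (l ^+ 2 * (\sum_(i < n) (a i * I i) ^+ 2 + b ^+ 2))) =
   expR (- (l ^+ 2 * \sum_(i < n) (a i * I i) ^+ 2)) * expR (- (l ^+ 2 * b ^+ 2)).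
  by rewrite -expRD; congr expR; ring.
have lb3 : `|l * b| ^+ 3 = `|l| ^+ 3 * `|b| ^+ 3 by rewrite normrM exprMn.
rewrite lb3 in hc; rewrite lb3 in hs.
set p := \int[_]_x cos _ in hc *; set r := \int[_]_x sin _ in hs *.
set c := \int[P]_w cos (Y w); set s := \int[P]_w sin (Y w).
rewrite -/c in IHc; rewrite -/s in IHs.
set e := expR (- (l ^+ 2 * \sum_(i < n) _ ^+ 2)) in IHc *.
set f := expR (- (l ^+ 2 * b ^+ 2)) in hc *.
set S := \sum_(i < n) `|_| ^+ 3 in IHc IHs *.
have c1 : `|c| <= 1.
  by apply: normr_Rintegral_le1; [exact: (measurableT_comp (@measurable_cos R))|move=> x; exact: cos_max].
have s1 : `|s| <= 1.
  by apply: normr_Rintegral_le1; [exact: (measurableT_comp (@measurable_sin R))|move=> x; exact: sin_max].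
have mch : measurable_fun setT (fun x : R => l * b * (x ^+ 2 - 1)).
  by apply: measurable_funM => //; exact: measurable_funB.
have p1 : `|p| <= 1.
  apply: (normr_Rintegral_le1 (std_normal R)) => [|x]; last exact: cos_max.
  exact: (measurableT_comp (@measurable_cos R) mch).
have f1 : `|f| <= 1.
  by rewrite ger0_norm ?expR_ge0// expR_le1 oppr_le0 mulr_ge0 ?sqr_ge0.
have k0 := chi_moment3_ge0 R.
set k := chi_moment3 R in k0 hc hs IHc IHs *.
set L := `|l| ^+ 3 in hc hs IHc IHs *.
have bL0 : 0 <= L * `|b| ^+ 3 by rewrite mulr_ge0// exprn_ge0.
set bb := `|b| ^+ 3 in bL0 hc hs *.
have mul1 (x y z : R) : `|x| <= 1 -> `|y| <= z -> `|x * y| <= z.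
  by move=> x1 yz; rewrite normrM (le_trans _ yz)// ler_piMl.
split.
(* Replacing [p] by [f] costs one cubic term, [c] by [e] is the induction hypothesis, and [s * r]
   costs a second cubic term, whence the factor 2 in the bound for the cosine. *)
- have -> : c * p - s * r - e * f = (c * (p - f) + f * (c - e)) - s * r by ring.
  have H1 := mul1 _ _ _ c1 hc; have H2 := mul1 _ _ _ f1 IHc.
  have H3 := mul1 _ _ _ s1 hs.
  apply: le_trans (ler_normB _ _) _; apply: le_trans (lerD (ler_normD _ _) (lexx _)) _.
  have E2 : 2 * (k + 1) * (L * (S + bb)) = 2 * (k + 1) * (L * S) + 2 * (k + 1) * (L * bb) by ring.
  have E3 : 0 <= (k + 1) * (L * bb) - k * (L * bb) by rewrite -mulrBl mulr_ge0//; lra.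
  lra.
- have H1 := mul1 _ _ _ p1 IHs; have H2 := mul1 _ _ _ c1 hs.
  rewrite [s * p]mulrC; apply: le_trans (ler_normD _ _) _.
  have E2 : (k + 1) * (L * (S + bb)) = (k + 1) * (L * S) + (k + 1) * (L * bb) by ring.
  have E3 : 0 <= (k + 1) * (L * bb) - k * (L * bb) by rewrite -mulrBl mulr_ge0//; lra.
  lra.
Qed.

End Lindeberg.

(** * Convergence in distribution from characteristic functions *)

Lemma Rintegral_dct d (T : measurableType d) (R : realType)
    (mu : {measure set T -> \bar R}) (f_ : nat -> T -> R) (f g : T -> R) :
  (forall n, measurable_fun setT (f_ n)) -> measurable_fun setT f ->
  (forall x, f_ n x @[n --> \oo] --> f x) ->
  mu.-integrable setT (EFin \o g) -> (forall n x, `|f_ n x| <= g x) ->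
  \int[mu]_x f_ n x @[n --> \oo] --> \int[mu]_x f x.
Proof.
move=> mf_ mf ff ig fg.
have mef n : measurable_fun setT (EFin \o f_ n) by exact/measurable_EFinP.
have mf' : measurable_fun setT (EFin \o f) by exact/measurable_EFinP.
have h1 x : setT x -> (EFin \o f_ n) x @[n --> \oo] --> (EFin \o f) x.
  by move=> _; apply/cvg_EFin; [exact: nearW|exact: ff].
have h2 x n : setT x -> (`|(EFin \o f_ n) x| <= (EFin \o g) x)%E.
  by move=> _; rewrite lee_fin.
have [if_ _ c] := dominated_convergence measurableT mef mf' (aeW mu h1) ig (aeW mu h2).
have c' : (fine (\int[mu]_x (EFin \o f_ n) x) @[n --> \oo] --> fine (\int[mu]_x (EFin \o f) x))%E.
  apply: fine_cvg; rewrite fineK//.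
  exact: (integrable_fin_num measurableT if_).
exact: c'.
Qed.

Lemma bounded_cvg_Rintegral d (T : measurableType d) (R : realType)
    (P : probability T R) (f_ : nat -> T -> R) (f : T -> R) (M : R) :
  (forall n, measurable_fun setT (f_ n)) -> measurable_fun setT f ->
  (forall x, f_ n x @[n --> \oo] --> f x) -> (forall n x, `|f_ n x| <= M) ->
  \int[P]_x f_ n x @[n --> \oo] --> \int[P]_x f x.
Proof.
move=> mf_ mf ff fM; apply: (@Rintegral_dct _ _ _ P _ _ (fun=> M)) => //.
exact: (@bounded_integrable _ _ _ P (fun=> M) `|M| (measurable_cst _) (fun=> lexx _)).
Qed.

Section BoundedFubini.
Context (R : realType) d1 d2 (T1 : measurableType d1) (T2 : measurableType d2).
Variables (P1 : probability T1 R) (P2 : probability T2 R).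
Variables (F : T1 * T2 -> R) (M : R).
Hypotheses (mF : measurable_fun setT F) (FM : forall z, `|F z| <= M).

Let mEF : measurable_fun setT (EFin \o F). Proof. exact/measurable_EFinP. Qed.

Let iF : (P1 \x P2)%E.-integrable setT (EFin \o F).
Proof.
apply/integrable12ltyP => //=.
apply: (@le_lt_trans _ _ (\int[P1]_x (M%:E))%E); last by rewrite integral_prob_cst ltry.
apply: ge0_le_integral => //.
- by move=> x _; apply: integral_ge0.
- apply: (measurable_fun_fubini_tonelli_F (m2 := P2) (fun z => `|(F z)%:E|)%E) => //.
  exact: measurableT_comp.
- move=> x _; rewrite -[leRHS](integral_prob_cst P2).
  apply: ge0_le_integral => //.
  + apply/measurable_EFinP; apply: measurableT_comp => //.
    exact: (measurableT_comp mF (pair1_measurable x)).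
  + by move=> y _; rewrite lee_fin.
Qed.

Let iF1 x : P2.-integrable setT (EFin \o (fun y => F (x, y))).
Proof.
apply: (@bounded_integrable _ _ _ P2 _ M) => //.
by apply: measurableT_comp => //; exact: pair1_measurable.
Qed.

Let iF2 y : P1.-integrable setT (EFin \o (fun x => F (x, y))).
Proof.
apply: (@bounded_integrable _ _ _ P1 _ M) => //.
by apply: measurableT_comp => //; exact: pair2_measurable.
Qed.

Lemma measurable_bounded_fubini1 : measurable_fun setT (fun x => \int[P2]_y F (x, y)).
Proof.
have := measurable_fubini_F iF; rewrite /fubini_F => m.
by apply: measurableT_comp m.
Qed.

Lemma measurable_bounded_fubini2 : measurable_fun setT (fun y => \int[P1]_x F (x, y)).
Proof.
have := measurable_fubini_G iF; rewrite /fubini_G => m.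
by apply: measurableT_comp m.
Qed.

Lemma bounded_Fubini :
  \int[P1]_x \int[P2]_y F (x, y) = \int[P2]_y \int[P1]_x F (x, y).
Proof.
rewrite /Rintegral; congr fine; have := Fubini iF => /=.
under eq_integral do rewrite (EFin_Rintegral (iF1 _)).
by under [X in _ = X -> _]eq_integral do rewrite (EFin_Rintegral (iF2 _)).
Qed.

End BoundedFubini.

(** Heine-Cantor with only [x] confined to the compact interval and [y] free; half radii and half
    tolerances make the local condition uniform near each point. *)
Lemma unif_continuous_itv (R : realType) (f : R -> R) (M e : R) : continuous f -> 0 < e ->
  exists2 r, 0 < r & forall x y, `|x| <= M -> `|x - y| < r -> `|f x - f y| <= e.
Proof.
move=> cf e0.
have cK : compact `[- M, M]%classic := @segment_compact R (- M) M.
have := (compact_near_coveringP `[- M, M]%classic).1 cK R (0^'+)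
  (fun r x => forall y, `|x - y| < r -> `|f x - f y| <= e) _.
have H : forall x, `[- M, M]%classic x ->
    \forall x' \near x & r \near (0^'+ : set_system R), forall y, `|x' - y| < r -> `|f x' - f y| <= e.
  move=> x _.
  have e20 : 0 < e / 2 by rewrite divr_gt0.
  have /cvgrPdist_le/(_ _ e20) := cf x.
  move=> /nbhs_ballP[r /= r0 rB].
  have r20 : 0 < r / 2 by rewrite divr_gt0.
  exists (ball x (r / 2), [set s | s < r / 2]) => /=.
    split; first exact: nbhsx_ballx.
    exact: nbhs_right_lt.
  move=> [x' s] /= [xx' sr] y x'y.
  have h1 : `|f x - f x'| <= e / 2.
    by apply: rB => /=; apply: lt_le_trans xx' _; lra.
  have h2 : `|f x - f y| <= e / 2.
    apply: rB => /=; rewrite /ball/=.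
    have -> : x - y = (x - x') + (x' - y) by ring.
    by apply: le_lt_trans (ler_normD _ _) _; have : `|x - x'| < r / 2 := xx'; lra.
  have -> : f x' - f y = (f x - f y) - (f x - f x') by ring.
  by apply: le_trans (ler_normB _ _) _; lra.
move=> /(_ _ H) near_r.
have [r /= [r0 rP]] : exists r, 0 < r /\ `[- M, M] `<=` (fun x : R => forall y, `|x - y| < r -> `|f x - f y| <= e).
  near (0 : R)^'+ => r; exists r; split; near: r; first exact: nbhs_right_gt.
  exact: near_r.
exists r => // x y xM xy; apply: rP => //.
by rewrite /= in_itv/= -ler_norml.
Unshelve. all: by end_near. Qed.

(** * Gaussian smoothing and characteristic functions *)

Section Continuity.
Context (R : realType).
Context d (Omega : measurableType d) (P : probability Omega R).
Context d' (Omega' : measurableType d') (P' : probability Omega' R).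
Variables (Y : nat -> Omega -> R) (Z : Omega' -> R).
Hypotheses (mY : forall n, measurable_fun setT (Y n)) (mZ : measurable_fun setT Z).
Notation N := (std_normal R).
Notation leb := (@lebesgue_measure R).
(** Its proof, [normal_cos], runs through a Brownian motion; taken as a hypothesis, it keeps the
    continuity theorem free of any filtration. *)
Hypothesis normal_char : forall l : R, \int[N]_x cos (l * x) = expR (- (l ^+ 2 / 2)).
Hypothesis char_cos : forall l : R,
  \int[P]_w cos (l * Y n w) @[n --> \oo] --> \int[P']_w cos (l * Z w).
Hypothesis char_sin : forall l : R,
  \int[P]_w sin (l * Y n w) @[n --> \oo] --> \int[P']_w sin (l * Z w).

Section Smoothing.
Variable e : R.
Hypothesis e0 : 0 < e.

Let c := (Num.sqrt (e ^+ 2 * pi *+ 2))^-1 : R.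
Let p := normal_pdf 0 e : R -> R.

Let c0 : 0 <= c. Proof. by rewrite invr_ge0 sqrtr_ge0. Qed.

(** The Gaussian density is its own Fourier transform up to scale: this is the only Fourier
    inversion required. *)
Let pE u : p u = c * \int[N]_z cos (u / e * z).
Proof.
rewrite /p normal_pdf0E ?gt_eqF// normal_char; congr (_ * expR _).
by field; rewrite gt_eqF.
Qed.

Let p_ge0 u : 0 <= p u. Proof. exact: normal_pdf_ge0. Qed.

Let p_le u : p u <= c.
Proof. by rewrite /p normal_pdf0E ?gt_eqF// ler_piMr// expR_le1 mulNr oppr_le0 divr_ge0 ?sqr_ge0// mulrn_wge0// sqr_ge0. Qed.

Let mp : measurable_fun setT p. Proof. exact: measurable_normal_pdf. Qed.

Section OneVariable.
Context d1 (T : measurableType d1) (Q : probability T R) (X : T -> R).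
Hypothesis mX : measurable_fun setT X.

Let mcosX : measurable_fun setT (fun z : T * measurableTypeR R => cos (z.2 * X z.1)).
Proof.
apply: (measurableT_comp (@measurable_cos R)); apply: measurable_funM.
  exact: measurable_snd.
by apply: (measurableT_comp mX); exact: measurable_fst.
Qed.

Let msinX : measurable_fun setT (fun z : T * measurableTypeR R => sin (z.2 * X z.1)).
Proof.
apply: (measurableT_comp (@measurable_sin R)); apply: measurable_funM.
  exact: measurable_snd.
by apply: (measurableT_comp mX); exact: measurable_fst.
Qed.

(** The mean of [cos (z * (X w - y))] expanded by the addition formula, so that [X] enters only
    through its characteristic function. *)
Definition char_mix (y z : R) : R :=
  cos (z * y) * \int[Q]_w cos (z * X w) + sin (z * y) * \int[Q]_w sin (z * X w).

Let integrable_cosX (z : R) : Q.-integrable setT (EFin \o (fun w => cos (z * X w))).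
Proof.
apply: (@bounded_integrable _ _ _ Q _ 1) => [|w]; last exact: cos_max.
exact: (measurableT_comp (measurable_cosM z) mX).
Qed.

Let integrable_sinX (z : R) : Q.-integrable setT (EFin \o (fun w => sin (z * X w))).
Proof.
apply: (@bounded_integrable _ _ _ Q _ 1) => [|w]; last exact: sin_max.
exact: (measurableT_comp (measurable_sinM z) mX).
Qed.

Lemma measurable_char_cos : measurable_fun setT (fun z : R => \int[Q]_w cos (z * X w)).
Proof. exact: (measurable_bounded_fubini2 Q N (M := 1) mcosX (fun z => cos_max _)). Qed.

Lemma measurable_char_sin : measurable_fun setT (fun z : R => \int[Q]_w sin (z * X w)).
Proof. exact: (measurable_bounded_fubini2 Q N (M := 1) msinX (fun z => sin_max _)). Qed.

Lemma measurable_char_mix y : measurable_fun setT (char_mix y).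
Proof.
apply: measurable_funD; apply: measurable_funM.
- by apply: (measurableT_comp (@measurable_cos R)); exact: measurable_funM.
- exact: measurable_char_cos.
- by apply: (measurableT_comp (@measurable_sin R)); exact: measurable_funM.
- exact: measurable_char_sin.
Qed.

Lemma normr_char_mix y z : `|char_mix y z| <= 2.
Proof.
have h1 : `|\int[Q]_w cos (z * X w)| <= 1.
  by apply: normr_Rintegral_le1 => [|w]; [exact: (measurableT_comp (measurable_cosM z) mX)|exact: cos_max].
have h2 : `|\int[Q]_w sin (z * X w)| <= 1.
  by apply: normr_Rintegral_le1 => [|w]; [exact: (measurableT_comp (measurable_sinM z) mX)|exact: sin_max].
apply: le_trans (ler_normD _ _) _; rewrite !normrM.
have := ler_pM (normr_ge0 _) (normr_ge0 _) (cos_max (z * y)) h1.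
have := ler_pM (normr_ge0 _) (normr_ge0 _) (sin_max (z * y)) h2.
by rewrite mul1r; lra.
Qed.

Let char_mixE y z : \int[Q]_w cos (z * (X w - y)) = char_mix y z.
Proof.
have E w : cos (z * (X w - y)) = cos (z * y) * cos (z * X w) + sin (z * y) * sin (z * X w).
  by rewrite mulrBr cosB; ring.
under eq_Rintegral do rewrite E.
have i1 : Q.-integrable setT (EFin \o (fun w => cos (z * y) * cos (z * X w))).
  exact: (integrableZl measurableT (cos (z * y)) (integrable_cosX z)).
have i2 : Q.-integrable setT (EFin \o (fun w => sin (z * y) * sin (z * X w))).
  exact: (integrableZl measurableT (sin (z * y)) (integrable_sinX z)).
by rewrite (RintegralD measurableT i1 i2) RintegralZl// RintegralZl.
Qed.

(** The left side is the density at [y] of [X] plus an independent normal of standard deviation [e];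
    Fubini expresses it through the characteristic function of [X]. *)
Lemma smooth_density y : \int[Q]_w p (X w - y) = c * \int[N]_z char_mix y (z / e).
Proof.
have mF : measurable_fun setT (fun z : T * measurableTypeR R => cos ((X z.1 - y) / e * z.2)).
  apply: (measurableT_comp (@measurable_cos R)); apply: measurable_funM; last exact: measurable_snd.
  apply: measurable_funM => //; apply: measurable_funB => //.
  by apply: (measurableT_comp mX); exact: measurable_fst.
have iw : Q.-integrable setT (EFin \o (fun w => \int[N]_z cos ((X w - y) / e * z))).
  apply: (@bounded_integrable _ _ _ Q _ 1).
    exact: (measurable_bounded_fubini1 Q N (M := 1) mF (fun z => cos_max _)).
  move=> w; apply: (normr_Rintegral_le1 N) => [|x]; last exact: cos_max.
  exact: measurable_cosM.
under eq_Rintegral do rewrite pE.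
rewrite RintegralZl//; congr (_ * _).
rewrite (bounded_Fubini Q N (M := 1) mF (fun z => cos_max _)).
apply: eq_Rintegral => z _; rewrite -char_mixE.
by apply: eq_Rintegral => w _ /=; congr cos; ring.
Qed.

Variables (f : R -> R) (C : R).
Hypotheses (mf : measurable_fun setT f) (f0 : forall x, 0 <= f x).
Hypothesis fC : forall x, f x <= C.

Definition smooth (x : R) : R := \int[leb]_y (f y * p (x - y)).

Let mfp : measurable_fun setT (fun z : T * measurableTypeR R => (f z.2 * p (X z.1 - z.2))%:E).
Proof.
apply/measurable_EFinP; apply: measurable_funM.
  by apply: (measurableT_comp mf); exact: measurable_snd.
apply: (measurableT_comp mp); apply: measurable_funB; last exact: measurable_snd.
by apply: (measurableT_comp mX); exact: measurable_fst.
Qed.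

Lemma smooth_Tonelli :
  (\int[Q]_w \int[leb]_y (f y * p (X w - y))%:E =
   \int[leb]_y (f y * \int[Q]_w p (X w - y))%:E)%E.
Proof.
rewrite (fubini_tonelli _ mfp)/=; last by move=> z; rewrite lee_fin mulr_ge0.
apply: eq_integral => y _.
have iQ : Q.-integrable setT (EFin \o (fun w => p (X w - y))).
  apply: (@bounded_integrable _ _ _ Q _ c).
    by apply: (measurableT_comp mp); exact: measurable_funB.
  by move=> w; rewrite ger0_norm.
under eq_integral do rewrite EFinM.
rewrite ge0_integralZl//.
- by rewrite (EFin_Rintegral iQ).
- by apply/measurable_EFinP; apply: (measurableT_comp mp); exact: measurable_funB.
- by move=> w _; rewrite lee_fin.
- by rewrite lee_fin.
Qed.

End OneVariable.

(** Characteristic functions converge at each frequency, and the frequencies are averaged under a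
    probability, so bounded convergence suffices. *)
Lemma smooth_density_cvg y :
  \int[P]_w p (Y n w - y) @[n --> \oo] --> \int[P']_w p (Z w - y).
Proof.
rewrite (smooth_density P' mZ); under eq_fun do rewrite (smooth_density P (mY _)).
apply: cvgM; first exact: cvg_cst.
apply: (@bounded_cvg_Rintegral _ _ _ N _ _ 2).
- move=> n; apply: (measurableT_comp (measurable_char_mix P (mY n) y)).
  exact: measurable_funM.
- apply: (measurableT_comp (measurable_char_mix P' mZ y)).
  exact: measurable_funM.
- by move=> x; apply: cvgD; apply: cvgM; [exact: cvg_cst|exact: char_cos|exact: cvg_cst|exact: char_sin].
- by move=> n x; apply: normr_char_mix; exact: mY.
Qed.

End Smoothing.
End Continuity.

Section GaussianSmoothing.
Context (R : realType).
Notation N := (std_normal R).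
Notation leb := (@lebesgue_measure R).
Variables (f : R -> R) (C : R).
Hypotheses (mf : measurable_fun setT f) (f0 : forall x, 0 <= f x).
Hypothesis fC : forall x, f x <= C.

Let fnorm x : `|f x| <= C. Proof. by rewrite ger0_norm. Qed.

Let mshift (e x : R) : measurable_fun setT (fun z => f (x + e * z)).
Proof. by apply: (measurableT_comp mf); apply: measurable_funD => //; exact: measurable_funM. Qed.

Let ishift (e x : R) : N.-integrable setT (EFin \o (fun z => f (x + e * z))).
Proof. exact: (@bounded_integrable _ _ _ N _ C (mshift e x) (fun z => fnorm _)). Qed.

Lemma gaussian_smoothE (e x : R) : 0 < e ->
  (\int[leb]_y (f y * normal_pdf 0 e (x - y))%:E = (\int[N]_z f (x + e * z))%:E)%E.
Proof.
move=> e0; rewrite -(EFin_Rintegral (ishift e x)).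
have mef : measurable_fun setT (fun z => (f (x + e * z))%:E).
  by apply/measurable_EFinP; exact: mshift.
rewrite (integral_std_normal mef); last by move=> z; rewrite lee_fin.
pose G y := (f y * normal_pdf 0 e (x - y))%:E.
have mG : measurable_fun setT G.
  apply/measurable_EFinP; apply: measurable_funM => //.
  apply: (measurableT_comp (measurable_normal_pdf 0 e)); exact: measurable_funB.
have G0 y : (0 <= G y)%E by rewrite lee_fin mulr_ge0// normal_pdf_ge0.
have H := @ge0_integral_affine R G e x e0 mG G0.
have -> : (\int[leb]_y (f y * normal_pdf 0 e (x - y))%:E = e%:E * (e^-1%:E * \int[leb]_y G y))%E.
  by rewrite muleA -EFinM (mulfV (lt0r_neq0 e0)) mul1e.
rewrite -H.
have mGs : measurable_fun setT (fun z => G (e * z + x)).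
  by apply: (measurableT_comp mG); apply: measurable_funD => //; exact: measurable_funM.
rewrite -(ge0_integralZl leb measurableT mGs (fun z _ => G0 _)); last by rewrite lee_fin ltW.
apply: eq_integral => z _; rewrite /G -!EFinM; congr EFin.
have -> : x - (e * z + x) = - (e * z) by ring.
have -> : normal_pdf 0 e (- (e * z)) = normal_pdf 0 e (e * z).
  by rewrite !normal_pdf0E ?gt_eqF// sqrrN.
rewrite normal_pdf_scale// addrC; field.
by rewrite gt_eqF.
Qed.

Lemma gaussian_smooth_close (e x r eta : R) : 0 < e -> 0 < r -> 0 <= eta ->
  (forall y, `|x - y| < r -> `|f x - f y| <= eta) ->
  `|\int[N]_z f (x + e * z) - f x| <= eta + C / r ^+ 2 * e ^+ 2.
Proof.
move=> e0 r0 eta0 fr.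
have ic (a : R) := @bounded_integrable _ _ _ N (fun=> a) `|a| (measurable_cst _) (fun=> lexx _).
have i1 : N.-integrable setT (EFin \o (fun z => f (x + e * z) - f x)).
  exact: (integrableB measurableT (ishift e x) (ic (f x))).
have -> : \int[N]_z f (x + e * z) - f x = \int[N]_z (f (x + e * z) - f x).
  by rewrite (RintegralB measurableT (ishift e x) (ic _)) Rintegral_prob_cst.
apply: le_trans (le_normr_Rintegral measurableT i1) _.
have i2 := normal_integrable_pow R (isT : (2 <= 6)%N).
have i3 : N.-integrable setT (EFin \o (fun z => C / r ^+ 2 * e ^+ 2 * z ^+ 2)).
  exact: (integrableZl measurableT (C / r ^+ 2 * e ^+ 2) i2).
have E : eta + C / r ^+ 2 * e ^+ 2 = \int[N]_z (eta + C / r ^+ 2 * e ^+ 2 * z ^+ 2).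
  rewrite (RintegralD measurableT (ic eta) i3) Rintegral_prob_cst RintegralZl//.
  have -> : \int[N]_z (z ^+ 2) = 1 := normal_moment2 R.
  by rewrite mulr1.
rewrite E; apply: le_Rintegral => //.
- exact: integrable_norm.
- exact: (integrableD measurableT (ic eta) i3).
move=> z _; have C0 : 0 <= C by exact: le_trans (f0 0) (fC 0).
have q0 : 0 <= C / r ^+ 2 * e ^+ 2 * z ^+ 2.
  by rewrite mulr_ge0 ?sqr_ge0// mulr_ge0 ?sqr_ge0// divr_ge0// sqr_ge0.
have [h|h] := ltP `|e * z| r.
  have : `|x - (x + e * z)| < r by rewrite opprD addNKr normrN.
  by move=> /fr; rewrite distrC; lra.
(* Chebyshev in pointwise form: beyond distance [r] the oscillation of [f], at most [C], is paid by
   the square of [e * z / r], whose mean uses the unit second moment. *)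
have h1 : C <= C / r ^+ 2 * e ^+ 2 * z ^+ 2.
  have -> : C / r ^+ 2 * e ^+ 2 * z ^+ 2 = C * (e * z) ^+ 2 / r ^+ 2 by rewrite exprMn; ring.
  rewrite ler_pdivlMr ?exprn_gt0// ler_wpM2l//.
  by rewrite -(real_normK (num_real (e * z))) lerXn2r// nnegrE// ltW.
have h2 : `|f (x + e * z) - f x| <= C.
  by rewrite ler_norml; apply/andP; split;
    have := f0 x; have := fC x; have := f0 (x + e * z); have := fC (x + e * z); lra.
lra.
Qed.

End GaussianSmoothing.

Section ContinuityTheorem.
Context (R : realType).
Context d (Omega : measurableType d) (P : probability Omega R).
Context d' (Omega' : measurableType d') (P' : probability Omega' R).
Variables (Y : nat -> Omega -> R) (Z : Omega' -> R).
Hypotheses (mY : forall n, measurable_fun setT (Y n)) (mZ : measurable_fun setT Z).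
Notation N := (std_normal R).
Notation leb := (@lebesgue_measure R).
Hypothesis normal_char : forall l : R, \int[N]_x cos (l * x) = expR (- (l ^+ 2 / 2)).
Hypothesis char_cos : forall l : R,
  \int[P]_w cos (l * Y n w) @[n --> \oo] --> \int[P']_w cos (l * Z w).
Hypothesis char_sin : forall l : R,
  \int[P]_w sin (l * Y n w) @[n --> \oo] --> \int[P']_w sin (l * Z w).

Section CompactSupport.
Variables (f : R -> R) (C M : R).
Hypotheses (cf : continuous f) (f0 : forall x, 0 <= f x).
Hypotheses (fC : forall x, f x <= C) (fM : forall x, M < `|x| -> f x = 0).

Let mf : measurable_fun setT f.
Proof. exact: continuous_measurable_fun. Qed.

Let fnorm x : `|f x| <= C. Proof. by rewrite ger0_norm. Qed.

Let if_ : leb.-integrable setT (EFin \o f).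
Proof.
have iM : leb.-integrable setT (EFin \o (fun x => C * \1_(`[- M, M]) x)).
  exact: (integrableZl measurableT C (integrable_indic_itv (- M) M true false)).
apply: (@dominated_integrable _ _ _ leb f (fun x : R => C * \1_(`[- M, M]) x) mf _ iM) => x.
have C0 : 0 <= C by exact: le_trans (f0 0) (fC 0).
have [h|h] := ltP M `|x|; first by rewrite fM// normr0 mulr_ge0// indicE.
by rewrite indicE mem_set ?mulr1//= in_itv/= -ler_norml.
Qed.

Let smooth e x := \int[N]_z f (x + e * z).

Let msmooth e : measurable_fun setT (smooth e).
Proof.
have mF : measurable_fun setT (fun z : R * measurableTypeR R => f (z.1 + e * z.2)).
  apply: (measurableT_comp mf); apply: measurable_funD => //.
  by apply: measurable_funM => //; exact: measurable_snd.
have mG := measurable_fun_fubini_tonelli_F (m2 := N) (fun z : R * measurableTypeR R => (f (z.1 + e * z.2))%:E)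
  ((measurable_EFinP _ _).2 mF) (fun z => f0 _).
by apply: measurableT_comp mG.
Qed.

Let smooth_le e x : `|smooth e x| <= C.
Proof.
have m1 : measurable_fun setT (fun z => f (x + e * z)).
  by apply: (measurableT_comp mf); apply: measurable_funD => //; exact: measurable_funM.
have i1 := @bounded_integrable _ _ _ N _ C m1 (fun z => fnorm _).
apply: le_trans (le_normr_Rintegral measurableT i1) _.
rewrite -[leRHS](Rintegral_prob_cst N); apply: le_Rintegral => //.
- exact: integrable_norm.
- exact: (@bounded_integrable _ _ _ N (fun=> C) `|C| (measurable_cst _) (fun=> lexx _)).
Qed.

Let smooth_int e d1 (T : measurableType d1) (Q : probability T R) (X : T -> R) :
  0 < e -> measurable_fun setT X ->
  \int[Q]_w smooth e (X w) = \int[leb]_y (f y * \int[Q]_w normal_pdf 0 e (X w - y)).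
Proof.
move=> e0 mX; rewrite /Rintegral; congr fine.
rewrite -(smooth_Tonelli e0 Q mX mf f0).
by apply: eq_integral => w _; rewrite (gaussian_smoothE mf f0 fC).
Qed.

(** The smoothed densities are bounded by the peak [c], so [c * f] dominates; it is Lebesgue
    integrable because [f] has compact support. *)
Let smooth_cvg e : 0 < e ->
  \int[P]_w smooth e (Y n w) @[n --> \oo] --> \int[P']_w smooth e (Z w).
Proof.
move=> e0; rewrite smooth_int//; under eq_fun do rewrite smooth_int//.
set c := (Num.sqrt (e ^+ 2 * pi *+ 2))^-1.
have pc u : 0 <= normal_pdf 0 e u <= c.
  rewrite normal_pdf_ge0 normal_pdf0E ?gt_eqF//= ler_piMr ?invr_ge0 ?sqrtr_ge0//.
  by rewrite expR_le1 mulNr oppr_le0 divr_ge0 ?sqr_ge0// mulrn_wge0// sqr_ge0.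
have mp d1 (T : measurableType d1) (Q : probability T R) (X : T -> R) : measurable_fun setT X ->
    measurable_fun setT (fun y => f y * \int[Q]_w normal_pdf 0 e (X w - y)).
  move=> mX; apply: measurable_funM => //.
  have mF : measurable_fun setT (fun z : T * measurableTypeR R => normal_pdf 0 e (X z.1 - z.2)).
    apply: (measurableT_comp (measurable_normal_pdf 0 e)); apply: measurable_funB.
      by apply: (measurableT_comp mX); exact: measurable_fst.
    exact: measurable_snd.
  apply: (measurable_bounded_fubini2 Q N (M := c) mF).
  by move=> z; rewrite ger0_norm//; [case/andP: (pc (X z.1 - z.2))|exact: normal_pdf_ge0].
have ig : leb.-integrable setT (EFin \o (fun y => c * f y)).
  exact: (integrableZl measurableT c if_).
apply: (Rintegral_dct _ _ _ ig).
- by move=> n; exact: mp.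
- exact: mp.
- move=> y; apply: cvgM; first exact: cvg_cst.
  exact: smooth_density_cvg.
- move=> n y; rewrite normrM (ger0_norm (f0 y)) mulrC ler_wpM2r//.
  have m1 : measurable_fun setT (fun w => normal_pdf 0 e (Y n w - y)).
    by apply: (measurableT_comp (measurable_normal_pdf 0 e)); exact: measurable_funB.
  have b1 w : `|normal_pdf 0 e (Y n w - y)| <= c.
    by rewrite ger0_norm; [case/andP: (pc (Y n w - y))|exact: normal_pdf_ge0].
  have i1 := @bounded_integrable _ _ _ P _ c m1 b1.
  apply: le_trans (le_normr_Rintegral measurableT i1) _.
  rewrite -[leRHS](Rintegral_prob_cst P); apply: le_Rintegral => //.
  + exact: integrable_norm.
  + exact: (@bounded_integrable _ _ _ P (fun=> c) `|c| (measurable_cst _) (fun=> lexx _)).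
Qed.

Lemma compact_support_cvg : \int[P]_w f (Y n w) @[n --> \oo] --> \int[P']_w f (Z w).
Proof.
have C0 : 0 <= C by exact: le_trans (f0 0) (fC 0).
apply/cvgrPdist_le => eps eps0.
(* Two smoothing errors of at most [2 * eta] each and one convergence error of [eta] fit into
   [6 * eta]. *)
pose eta := eps / 6.
have eta0 : 0 < eta by rewrite divr_gt0.
have [r r0 fr] := @unif_continuous_itv R f M eta cf eta0.
have fr' x y : `|x - y| < r -> `|f x - f y| <= eta.
  move=> xy; have [xM|xM] := leP `|x| M; first exact: fr.
  have [yM|yM] := leP `|y| M; first by rewrite distrC; apply: fr => //; rewrite distrC.
  by rewrite !fM// subrr normr0 ltW.
(* The smoothing scale solves [D * e^2 = eta] with [D = C / r^2 + 1], the 1 making [D] positive when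
   [C] is 0. *)
have [e e0 eP] : exists2 e, 0 < e & C / r ^+ 2 * e ^+ 2 <= eta.
  pose D := C / r ^+ 2 + 1.
  have D0 : 0 < D by rewrite ltr_wpDl// divr_ge0// sqr_ge0.
  exists (Num.sqrt (eta / D)); first by rewrite sqrtr_gt0 divr_gt0.
  rewrite sqr_sqrtr; last by rewrite divr_ge0// ltW.
  have -> : C / r ^+ 2 * (eta / D) = eta * (C / r ^+ 2 / D) by ring.
  by rewrite ler_piMr ?(ltW eta0)// ler_pdivrMr// mul1r /D lerDl.
have close x : `|smooth e x - f x| <= 2 * eta.
  apply: le_trans (gaussian_smooth_close mf f0 fC e0 r0 (ltW eta0) (fr' x)) _; lra.
have closeE d1 (T : measurableType d1) (Q : probability T R) (X : T -> R) : measurable_fun setT X ->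
    `|\int[Q]_w smooth e (X w) - \int[Q]_w f (X w)| <= 2 * eta.
  move=> mX.
  have i1 := @bounded_integrable _ _ _ Q _ C (measurableT_comp (msmooth e) mX) (fun w => smooth_le _ _).
  have i2 := @bounded_integrable _ _ _ Q _ C (measurableT_comp mf mX) (fun w => fnorm _).
  rewrite -(RintegralB measurableT i1 i2).
  have i3 := integrableB measurableT i1 i2.
  apply: le_trans (le_normr_Rintegral measurableT i3) _.
  rewrite -[leRHS](Rintegral_prob_cst Q); apply: le_Rintegral => //.
  + exact: (integrable_norm (f := fun w => smooth e (X w) - f (X w))).
  + exact: (@bounded_integrable _ _ _ Q (fun=> 2 * eta) `|2 * eta| (measurable_cst _) (fun=> lexx _)).
  + by move=> w _; exact: close.
have /cvgrPdist_le/(_ _ eta0) := smooth_cvg e0.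
apply: filterS => n hn.
have h1 := closeE _ _ P _ (mY n); have h2 := closeE _ _ P' _ mZ.
set A := \int[P']_w f (Z w) in h2 *; set A' := \int[P']_w smooth e (Z w) in h2 hn.
set D := \int[P]_w f (Y n w) in h1 *; set D' := \int[P]_w smooth e (Y n w) in h1 hn.
have -> : A - D = (A' - D') - (A' - A) + (D' - D) by ring.
apply: le_trans (ler_normD _ _) _; apply: le_trans (lerD (ler_normB _ _) (lexx _)) _.
have : 6 * eta = eps by rewrite /eta; field.
lra.
Qed.

End CompactSupport.

Let pospart (y : R) : R := (y + `|y|) / 2.

(** A continuous trapezoid: 1 on [[-M, M]], 0 beyond [M + 1], linear in between. *)
Let cutoff (M x : R) : R := pospart (M + 1 - `|x|) - pospart (M - `|x|).

Let pospart_ge0 y : 0 <= y -> pospart y = y.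
Proof. by move=> y0; rewrite /pospart ger0_norm//; field. Qed.

Let pospart_le0 y : y <= 0 -> pospart y = 0.
Proof. by move=> y0; rewrite /pospart ler0_norm// subrr mul0r. Qed.

Let cutoff_cont M : continuous (cutoff M).
Proof.
have cpos (g : R -> R) : continuous g -> continuous (fun x => pospart (g x)).
  move=> cg x; apply: cvgM; last exact: cvg_cst.
  by apply: cvgD; [exact: cg|apply: cvg_norm; exact: cg].
have cn (a : R) : continuous (fun x : R => a - `|x|).
  by move=> x; apply: cvgB; [exact: cvg_cst|exact: norm_continuous].
by move=> x; apply: cvgB; [exact: (cpos _ (cn _) x)|exact: (cpos _ (cn _) x)].
Qed.

Let cutoff01 M x : 0 <= cutoff M x <= 1.
Proof.
rewrite /cutoff; have [h1|h1] := leP 0 (M + 1 - `|x|); have [h2|h2] := leP 0 (M - `|x|).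
- by rewrite (pospart_ge0 h1) (pospart_ge0 h2); apply/andP; split; lra.
- by rewrite (pospart_ge0 h1) (pospart_le0 (ltW h2)); apply/andP; split; lra.
- lra.
- by rewrite (pospart_le0 (ltW h1)) (pospart_le0 (ltW h2)); apply/andP; split; lra.
Qed.

Let cutoff1 M x : `|x| <= M -> cutoff M x = 1.
Proof. by move=> h; rewrite /cutoff !pospart_ge0; lra. Qed.

Let cutoff0 M x : M + 1 < `|x| -> cutoff M x = 0.
Proof. by move=> h; rewrite /cutoff !pospart_le0; lra. Qed.

(** Cutting off only decreases a nonnegative [f], so a lower bound survives for the laws of [Y n]
    with no control of their tails; the cut-off level is chosen from the law of [Z] alone. *)
Let lower (f : R -> R) (C eps : R) : continuous f -> (forall x, 0 <= f x) ->
  (forall x, f x <= C) -> 0 < eps ->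
  \forall n \near \oo, \int[P']_w f (Z w) - eps <= \int[P]_w f (Y n w).
Proof.
move=> cf f0 fC eps0.
have mf : measurable_fun setT f by exact: continuous_measurable_fun.
have cg M : continuous (fun x => f x * cutoff M x).
  by move=> x; apply: cvgM; [exact: cf|exact: cutoff_cont].
have mg M : measurable_fun setT (fun x => f x * cutoff M x).
  exact: continuous_measurable_fun.
have g0 M x : 0 <= f x * cutoff M x.
  by rewrite mulr_ge0//; case/andP: (cutoff01 M x).
have gf M x : f x * cutoff M x <= f x.
  by rewrite ler_piMr//; case/andP: (cutoff01 M x).
have gC M x : f x * cutoff M x <= C by apply: le_trans (gf M x) (fC x).
have gM (M : R) x : M + 1 < `|x| -> f x * cutoff M x = 0.
  by move=> h; rewrite cutoff0// mulr0.
have lim : \int[P']_w (f (Z w) * cutoff k%:R (Z w)) @[k --> \oo] --> \int[P']_w f (Z w).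
  apply: (@bounded_cvg_Rintegral _ _ _ P' _ _ C).
  - by move=> k; exact: (measurableT_comp (mg k%:R) mZ).
  - exact: measurableT_comp.
  - move=> w; apply: cvg_near_cst.
    near=> k; rewrite cutoff1 ?mulr1//.
    by near: k; exact: nbhs_infty_ger.
  - by move=> k w; rewrite ger0_norm.
have eps20 : 0 < eps / 2 by rewrite divr_gt0.
have /cvgrPdist_le/(_ _ eps20) := lim.
case=> k _ /(_ k (leqnn k)) /= hk.
have /cvgrPdist_le/(_ _ eps20) := compact_support_cvg (cg k%:R) (g0 k%:R) (gC k%:R) (gM k%:R).
apply: filterS => n hn.
have le1 : \int[P]_w (f (Y n w) * cutoff k%:R (Y n w)) <= \int[P]_w f (Y n w).
  apply: le_Rintegral => //.
  - apply: (@bounded_integrable _ _ _ P _ C); first exact: (measurableT_comp (mg k%:R) (mY n)).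
    by move=> w; rewrite ger0_norm.
  - apply: (@bounded_integrable _ _ _ P (fun w => f (Y n w)) C (measurableT_comp mf (mY n))).
    by move=> w; rewrite ger0_norm.
move: hk hn; rewrite !ler_norml => /andP[_ hk] /andP[_ hn]; lra.
Unshelve. all: by end_near. Qed.

Theorem continuity_theorem : cvg_in_distribution P P' Y Z.
Proof.
move=> f cf [M fM].
have mf : measurable_fun setT f by exact: continuous_measurable_fun.
have iY n : P.-integrable setT (EFin \o (f \o Y n)).
  exact: (@bounded_integrable _ _ _ P (f \o Y n) M (measurableT_comp mf (mY n)) (fun w => fM _)).
have iZ : P'.-integrable setT (EFin \o (f \o Z)).
  exact: (@bounded_integrable _ _ _ P' (f \o Z) M (measurableT_comp mf mZ) (fun w => fM _)).
have EY n : ('E_P[f \o Y n] = (\int[P]_w f (Y n w))%:E)%E.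
  by rewrite unlock (EFin_Rintegral (iY n)).
have EZ : ('E_P'[f \o Z] = (\int[P']_w f (Z w))%:E)%E.
  by rewrite unlock (EFin_Rintegral iZ).
rewrite EZ; under eq_fun do rewrite EY.
apply: cvg_EFin; first exact: nearW.
rewrite /comp /=.
apply/cvgrPdist_le => eps eps0.
have bnd x : - M <= f x <= M by rewrite -ler_norml.
have ic d1 (T : measurableType d1) (Q : probability T R) :=
  @bounded_integrable _ _ _ Q (fun=> M) `|M| (measurable_cst _) (fun=> lexx _).
(* Both [M + f] and [M - f] are nonnegative and bounded; their lower bounds together give the
   two-sided estimate for [f]. *)
have cp : continuous (fun x => M + f x).
  by move=> x; apply: cvgD; [exact: cvg_cst|exact: cf].
have cm : continuous (fun x => M - f x).
  by move=> x; apply: cvgB; [exact: cvg_cst|exact: cf].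
have p0 x : 0 <= M + f x by case/andP: (bnd x); lra.
have m0 x : 0 <= M - f x by case/andP: (bnd x); lra.
have pM x : M + f x <= 2 * M by case/andP: (bnd x); lra.
have mM x : M - f x <= 2 * M by case/andP: (bnd x); lra.
have h1 := lower cp p0 pM eps0; have h2 := lower cm m0 mM eps0.
near=> n.
have /= l1 : \int[P']_w (M + f (Z w)) - eps <= \int[P]_w (M + f (Y n w)) by near: n.
have /= l2 : \int[P']_w (M - f (Z w)) - eps <= \int[P]_w (M - f (Y n w)) by near: n.
move: l1 l2.
rewrite (RintegralD measurableT (ic _ _ P') iZ) (RintegralD measurableT (ic _ _ P) (iY n)).
rewrite (RintegralB measurableT (ic _ _ P') iZ) (RintegralB measurableT (ic _ _ P) (iY n)).
rewrite !Rintegral_prob_cst ler_norml => l1 l2; apply/andP; split; lra.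
Unshelve. all: by end_near. Qed.

End ContinuityTheorem.

(** * Kernels of bounded variation and Riemann sums *)

(** The integral of a nonnegative function is a supremum over the simple functions below it, which
    is monotone by itself. This dispenses with measurability proofs for pointwise bounds under an
    outer integral. *)
Lemma ge0_le_integral_nonmeas d (T : measurableType d) (R : realType)
    (mu : {measure set T -> \bar R}) (f g : T -> \bar R) :
  (forall x, (0 <= f x)%E) -> (forall x, (f x <= g x)%E) ->
  (\int[mu]_x f x <= \int[mu]_x g x)%E.
Proof.
move=> f0 fg; rewrite !ge0_integralTE//; last by move=> x; exact: le_trans (fg x).
apply: le_ereal_sup => _ [h hf <-]; exists h => // x.
exact: le_trans (fg x).
Qed.

Section KernelVariation.
Context (R : realType).
Notation leb := (@lebesgue_measure R).
Implicit Types (x y : R).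

(** Bounded variation through a bounded nondecreasing [Psi] that plays the variation function. This
    form is stable under affine changes of variable, absolute values and squares, and its sums over
    a grid telescope. *)
Definition dominated_variation (K Psi : R -> R) (M : R) : Prop :=
  (forall x, 0 <= Psi x <= M) /\ (forall x y, x <= y -> `|K x - K y| <= Psi y - Psi x).

Section OnInterval.
Variables (A B : \bar R) (K K' : R -> R) (D : set R) (k : R).
Let I := eitv A B.
Hypothesis k0 : 0 <= k.
Hypothesis K_lip : forall x y, I x -> I y -> `|K x - K y| <= k * `|x - y|.
Hypothesis D_fin : forall a b : R, finite_set (D `&` `[a, b]).
Hypothesis K_der : forall x, I x -> ~ D x ->
  is_derive x (1 : R) K (K' x) /\ {for x, continuous K'}.
Hypothesis K'_int : (\int[leb]_x (`|K' x|)%:E < +oo)%E.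

Let I_itv x y z : I x -> I y -> x <= z <= y -> I z.
Proof.
move=> /andP[Ax _] /andP[_ yB] /andP[xz zy]; apply/andP; split.
  by apply: (lt_le_trans Ax); rewrite lee_fin.
by apply: (le_lt_trans _ yB); rewrite lee_fin.
Qed.

Let measurable_I : measurable I.
Proof. by apply: is_interval_measurable => x y Ix Iy z; exact: I_itv. Qed.

Let measurable_D : measurable (D : set R).
Proof.
have -> : D = \bigcup_n (D `&` `[- n%:R, n%:R]).
  apply/seteqP; split => [x Dx|x [n _ []//]].
  near \oo => n; exists n => //; split => //=.
  by rewrite in_itv/= -ler_norml; near: n; exact: nbhs_infty_ger.
apply: bigcup_measurable => n _; apply: countable_measurable => //.
exact/finite_set_countable/D_fin.
Unshelve. all: by end_near. Qed.

Let ID := I `\` D.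

Let measurable_ID : measurable ID. Proof. exact: measurableD. Qed.

(** The derivative is arbitrary at the break points and is continuous on [I] minus [D]; setting it
    to 0 elsewhere makes it measurable and leaves its integrals over subintervals of [I] without
    break points unchanged. *)
Let psi := (fun x => `|K' x|) \_ ID.

Let psi0 x : 0 <= psi x.
Proof. by rewrite /psi patchE; case: ifPn. Qed.

Let mpsi : measurable_fun setT psi.
Proof.
apply/(measurable_restrictT _ measurable_ID).
apply: measurableT_comp => //.
apply: subspace_continuous_measurable_fun => //.
by apply: continuous_in_subspaceT => x /set_mem[Ix Dx]; exact: (K_der Ix Dx).2.
Qed.

Let ipsi : leb.-integrable setT (EFin \o psi).
Proof.
apply/integrableP; split; first exact/measurable_EFinP.
apply: le_lt_trans K'_int; apply: ge0_le_integral_nonmeas => // x.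
by rewrite lee_fin ger0_norm// /psi patchE; case: ifPn => // _; exact: normr_ge0.
Qed.

Let ipsiS (S : set R) : measurable S -> leb.-integrable S (EFin \o psi).
Proof. by move=> mS; apply: integrableS ipsi. Qed.

Let Phi x := \int[leb]_(y in `]-oo, x]) psi y.
Let PhiM := \int[leb]_y psi y.

Let PhiB x y : x <= y -> Phi y - Phi x = \int[leb]_(z in `]x, y]) psi z.
Proof. by move=> xy; apply: Rintegral_itvB => //; exact: ipsiS. Qed.

Let Rint_subset (S T : set R) : measurable S -> measurable T -> S `<=` T ->
  \int[leb]_(y in S) psi y <= \int[leb]_(y in T) psi y.
Proof.
move=> mS mT ST; rewrite Rintegral_mkcond [leRHS]Rintegral_mkcond.
have iR (U : set R) : measurable U -> leb.-integrable setT (EFin \o (psi \_ U)).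
  move=> mU; apply: (@dominated_integrable _ _ _ leb _ psi _ _ ipsi).
    by apply/(measurable_restrictT _ mU); exact: measurable_funTS.
  by move=> x; rewrite patchE; case: ifPn => _; rewrite ger0_norm.
have iS := iR _ mS; have iT := iR _ mT.
apply: le_Rintegral => // x _; rewrite !patchE.
have [xS|xS] := boolP (x \in S).
  by rewrite ifT// inE; apply: ST; exact: set_mem.
by case: ifPn.
Qed.

Let Phi_bnd x : 0 <= Phi x <= PhiM.
Proof.
apply/andP; split; first exact: Rintegral_ge0.
by rewrite /Phi /PhiM; apply: Rint_subset.
Qed.

Let Phi_nd x y : x <= y -> Phi x <= Phi y.
Proof. by move=> xy; rewrite -subr_ge0 PhiB//; exact: Rintegral_ge0. Qed.

Let FTC_inner x y : I x -> I y -> x < y -> (forall z, x <= z <= y -> ~ D z) ->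
  `|K y - K x| <= Phi y - Phi x.
Proof.
move=> Ix Iy xy nD.
have II z : x <= z <= y -> I z by exact: I_itv Ix Iy.
have der z : x <= z <= y -> is_derive z (1 : R) K (K' z) /\ {for z, continuous K'}.
  by move=> h; apply: K_der; [exact: II|exact: nD].
have cK' : {within `[x, y], continuous K'}.
  by apply: continuous_in_subspaceT => z /set_mem/=; rewrite in_itv/= => /der[].
have Kc z : x <= z <= y -> {for z, continuous K}.
  move=> /der[dz _]; apply: differentiable_continuous.
  exact/derivable1_diffP/(@ex_derive _ _ _ _ _ _ _ dz).
have dK : derivable_oo_LRcontinuous K x y.
  split.
  - move=> z; rewrite in_itv/= => /andP[xz zy].
    by have [dz _] := der z (introT andP (conj (ltW xz) (ltW zy))); exact: ex_derive.
  - by apply: cvg_at_right_filter; apply: Kc; rewrite lexx ltW.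
  - by apply: cvg_at_left_filter; apply: Kc; rewrite lexx ltW.
have dE : {in `]x, y[, (K^`())%classic =1 K'}.
  move=> z; rewrite in_itv/= => /andP[xz zy].
  have [dz _] := der z (introT andP (conj (ltW xz) (ltW zy))).
  by rewrite derive1E; exact: derive_val.
have FTC := continuous_FTC2 xy cK' dK dE.
have iK' : leb.-integrable `[x, y] (EFin \o K').
  by apply: continuous_compact_integrable => //; exact: segment_compact.
have E : \int[leb]_(z in `[x, y]) K' z = K y - K x by rewrite /Rintegral FTC -EFinB.
rewrite -E; apply: le_trans (le_normr_Rintegral _ iK') _ => //.
rewrite (PhiB (ltW xy)) Rintegral_itv_obnd_cbnd; last exact: ipsiS.
rewrite le_eqVlt; apply/orP; left; apply/eqP; apply: eq_Rintegral => z /set_mem/=.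
rewrite in_itv/= => h; rewrite /psi patchE mem_set//; split; [exact: II|exact: nD].
Qed.

(** The end points may be break points: they are moved inwards by [dl], the fundamental theorem
    applies in between, and the Lipschitz bound pays for the displacement. *)
Let FTC_open x y : I x -> I y -> x < y -> (forall z, x < z < y -> ~ D z) ->
  `|K y - K x| <= Phi y - Phi x.
Proof.
move=> Ix Iy xy nD; apply/ler_addgt0Pr => e e0.
(* The first bound keeps [x + dl < y - dl]; the second makes the cost [2 * k * dl] of moving both
   ends at most [e]. *)
pose dl := Num.min ((y - x) / 3) (e / (2 * k + 1)).
have k1 : 0 < 2 * k + 1 by rewrite ltr_wpDl// mulr_ge0.
have dl0 : 0 < dl by rewrite lt_min !divr_gt0// subr_gt0.
have dl1 : dl <= (y - x) / 3 by rewrite ge_min lexx.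
have dl2 : 2 * k * dl <= e.
  have h : dl <= e / (2 * k + 1) by rewrite ge_min lexx orbT.
  rewrite ler_pdivlMr// in h; apply: le_trans h; rewrite mulrC ler_wpM2l ?ltW//; lra.
have Ix' : I (x + dl) by apply: (I_itv Ix Iy); apply/andP; split; lra.
have Iy' : I (y - dl) by apply: (I_itv Ix Iy); apply/andP; split; lra.
have xy' : x + dl < y - dl by lra.
have H : `|K (y - dl) - K (x + dl)| <= Phi (y - dl) - Phi (x + dl).
  by apply: FTC_inner => // z /andP[h1 h2]; apply: nD; apply/andP; split; lra.
have P1 : Phi (y - dl) <= Phi y by apply: Phi_nd; lra.
have P2 : Phi x <= Phi (x + dl) by apply: Phi_nd; lra.
have L1 := K_lip Iy Iy'; have L2 := K_lip Ix' Ix.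
have e1 : `|y - (y - dl)| = dl by rewrite opprB addrC subrK gtr0_norm.
have e2 : `|x + dl - x| = dl by rewrite addrAC subrr add0r gtr0_norm.
rewrite e1 in L1; rewrite e2 in L2.
have -> : K y - K x = (K y - K (y - dl)) + (K (y - dl) - K (x + dl)) + (K (x + dl) - K x) by ring.
apply: le_trans (ler_normD _ _) _; apply: le_trans (lerD (ler_normD _ _) (lexx _)) _.
lra.
Qed.

(** Induction on a list of candidate break points: one lying strictly inside splits the interval,
    any other is dropped. *)
Let FTC_seq (s : seq R) x y : I x -> I y -> x <= y ->
  (forall z, x < z < y -> D z -> z \in s) -> `|K y - K x| <= Phi y - Phi x.
Proof.
elim: s x y => [|d s IH] x y Ix Iy.
  rewrite le_eqVlt => /predU1P[->|xy] H; first by rewrite !subrr normr0.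
  by apply: FTC_open => // z /H h /h.
move=> xy H; have [dxy|dxy] := boolP (x < d < y); last first.
  apply: IH => // z zxy /(H _ zxy); rewrite in_cons => /orP[/eqP zd|//].
  by rewrite -zd zxy in dxy.
have /andP[xd dy] := dxy.
have Id : I d by apply: (I_itv Ix Iy); rewrite !ltW.
have h1 : `|K d - K x| <= Phi d - Phi x.
  apply: IH => //; first exact: ltW.
  move=> z /andP[xz zd] Dz.
  have : z \in d :: s by apply: H => //; rewrite xz (lt_trans zd).
  by rewrite in_cons (lt_eqF zd).
have h2 : `|K y - K d| <= Phi y - Phi d.
  apply: IH => //; first exact: ltW.
  move=> z /andP[dz zy] Dz.
  have : z \in d :: s by apply: H => //; rewrite zy (lt_trans xd).
  by rewrite in_cons (gt_eqF dz).
have -> : K y - K x = (K y - K d) + (K d - K x) by ring.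
by apply: le_trans (ler_normD _ _) _; lra.
Qed.

Lemma variation_on_interval : exists (Phi : R -> R) (M : R),
  [/\ forall x, 0 <= Phi x <= M, forall x y, x <= y -> Phi x <= Phi y &
      forall x y, I x -> I y -> x <= y -> `|K y - K x| <= Phi y - Phi x].
Proof.
exists Phi, PhiM; split=> // x y Ix Iy xy.
have /finite_seqP[s sE] := D_fin x y.
apply: (FTC_seq (s := s)) => // z /andP[xz zy] Dz.
have : (D `&` `[x, y]) z by split=> //=; rewrite in_itv/= !ltW.
by rewrite sE.
Qed.

End OnInterval.

(** At [A] and at [B] the kernel may jump, and its value there is free. Adding to [Phi] a step of
    height [2 * M0] whenever one of these thresholds is crossed dominates the jumps. *)
Lemma jumps_variation (A B : \bar R) (K Phi : R -> R) (M M0 : R) :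
  (A < 0%:E)%E -> (0%:E < B)%E ->
  (forall x, 0 <= Phi x <= M) -> (forall x y, x <= y -> Phi x <= Phi y) ->
  (forall x y, eitv A B x -> eitv A B y -> x <= y -> `|K y - K x| <= Phi y - Phi x) ->
  (forall x, `|K x| <= M0) ->
  (forall x, (x%:E < A)%E \/ (B < x%:E)%E -> K x = 0) ->
  exists Psi M', dominated_variation K Psi M'.
Proof.
move=> A0 B0 Phi_b Phi_nd PhiK KM0 K0.
have M00 : 0 <= M0 by exact: le_trans (KM0 0).
(* Each end point counts twice, for reaching it and for leaving it, because the kernel may jump on
   either side. If [cnt] agrees at two ordered points, then both lie in the same piece: outside, at
   an end point, or in the open interval. *)
pose cnt x := ((A <= x%:E)%E + (A < x%:E)%E + (B <= x%:E)%E + (B < x%:E)%E)%N.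
exists (fun x => Phi x + 2 * M0 * (cnt x)%:R), (M + 2 * M0 * 4); split.
  move=> x; have /andP[p0 pM] := Phi_b x.
  have c4 : (cnt x)%:R <= 4 :> R.
    rewrite ler_nat /cnt.
    by case: (A <= _)%E; case: (A < _)%E; case: (B <= _)%E; case: (B < _)%E.
  apply/andP; split; first by rewrite addr_ge0// !mulr_ge0.
  by rewrite lerD// ler_wpM2l// mulr_ge0.
move=> x y xy.
have mle (C : \bar R) : (C <= x%:E)%E -> (C <= y%:E)%E.
  by move=> h; apply: (le_trans h); rewrite lee_fin.
have mlt (C : \bar R) : (C < x%:E)%E -> (C < y%:E)%E.
  by move=> h; apply: (lt_le_trans h); rewrite lee_fin.
have cases : [/\ (A <= x%:E) = (A <= y%:E), (A < x%:E) = (A < y%:E),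
    (B <= x%:E) = (B <= y%:E) & (B < x%:E) = (B < y%:E)]%E \/ (cnt x < cnt y)%N.
  rewrite /cnt; move: (mle A) (mlt A) (mle B) (mlt B).
  case: (A <= x%:E)%E; case: (A < x%:E)%E; case: (B <= x%:E)%E; case: (B < x%:E)%E;
  case: (A <= y%:E)%E; case: (A < y%:E)%E; case: (B <= y%:E)%E; case: (B < y%:E)%E => h1 h2 h3 h4;
    first [by left|by right|by have := h1 isT|by have := h2 isT|by have := h3 isT|by have := h4 isT].
case: cases => [[e1 e2 e3 e4]|lt]; last first.
  have h : 1 <= (cnt y)%:R - (cnt x)%:R :> R by rewrite -natrB 1?ltnW// ler1n subn_gt0.
  have h' : 2 * M0 <= 2 * M0 * ((cnt y)%:R - (cnt x)%:R) by rewrite ler_peMr// mulr_ge0.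
  apply: le_trans (ler_normB _ _) _.
  have := KM0 x; have := KM0 y; have := Phi_nd _ _ xy; lra.
have ce : cnt x = cnt y by rewrite /cnt e1 e2 e3 e4.
have -> : Phi y + 2 * M0 * (cnt y)%:R - (Phi x + 2 * M0 * (cnt x)%:R) = Phi y - Phi x.
  by rewrite ce; ring.
have [xA|Ax] := ltP x%:E A.
  have yA : (y%:E < A)%E by move: e1; rewrite leNgt xA /= leNgt; case: (y%:E < A)%E.
  by rewrite !K0 ?subrr ?normr0 ?subr_ge0 ?Phi_nd//; left.
have [Bx|xB] := ltP B x%:E.
  by rewrite !K0 ?subrr ?normr0 ?subr_ge0 ?Phi_nd//; right => //; exact: mlt.
move: Ax; rewrite le_eqVlt => /predU1P[Ae|Ax].
  have yA : ~~ (A < y%:E)%E by rewrite -e2 Ae ltxx.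
  have : y%:E = A by apply/eqP; rewrite eq_le (leNgt y%:E) yA/= (mle A)// Ae.
  by rewrite Ae => -[->]; rewrite !subrr normr0.
move: xB; rewrite le_eqVlt => /predU1P[Be|xB].
  have yB : ~~ (B < y%:E)%E by rewrite -e4 Be ltxx.
  have : y%:E = B by apply/eqP; rewrite eq_le (leNgt y%:E) yB/= (mle B)// Be.
  by rewrite -Be => -[->]; rewrite !subrr normr0.
have yB : (y%:E < B)%E by rewrite ltNge -e3 -ltNge.
rewrite distrC; apply: PhiK => //; apply/andP; split => //; exact: mlt.
Qed.

Lemma admissible_variation (gamma : R) (C : R -> R -> R) (K : R -> R) :
  admissible_kernel gamma C K -> exists Psi M, dominated_variation K Psi M.
Proof.
move=> [A [B [K' [[A0 B0 supp] _ [lipK [D [Dfin Kder _ _]]] [_ _ K'int _] _]]]].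
have [k k0 Klip] : exists2 k, 0 <= k & forall x y, eitv A B x -> eitv A B y ->
    `|K x - K y| <= k * `|x - y|.
  (* The Lipschitz hypothesis supplies every constant strictly above some real [k0]; the maximum
     with 0 makes the chosen one nonnegative. *)
  move: lipK => [k0 [_ H]]; exists (Num.max 0 (k0 + 1)); first by rewrite le_max lexx.
  move=> x y Ix Iy.
  by have := H (Num.max 0 (k0 + 1)) _ (x, y) (conj Ix Iy); apply; rewrite lt_max ltrDl ltr01 orbT.
have [Phi [M [Phi_b Phi_nd PhiK]]] := variation_on_interval k0 Klip Dfin Kder K'int.
have K0 x : (x%:E < A)%E \/ (B < x%:E)%E -> K x = 0.
  move=> h; apply: contrapT => /eqP Kx.
  have : closure (eitv A B) x by rewrite -supp; exact: subset_closure.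
  case: h => h.
  - case: A A0 supp h {lipK Klip PhiK Kder} => [a| |]//= _ _; rewrite lte_fin => xa.
    by move=> /(_ _ (lt_nbhsl xa))[z [/andP[]]]; rewrite lte_fin => /lt_trans h _ /h; rewrite ltxx.
  - case: B B0 supp h {lipK Klip PhiK Kder} => [b| |]//= _ _; rewrite lte_fin => bx.
    by move=> /(_ _ (lt_nbhsr bx))[z [/andP[_]]]; rewrite lte_fin => h /(lt_trans h); rewrite ltxx.
have I0 : eitv A B 0 by apply/andP.
have M_ge0 : 0 <= M by have /andP[h1 h2] := Phi_b 0; exact: le_trans h2.
(* Inside the interval [K] is bounded by [|K 0| + M]; the two other terms cover finite end points.
   For an infinite end point [fine] is 0, which only enlarges the bound. *)
apply: (@jumps_variation A B K Phi M (`|K 0| + M + `|K (fine A)| + `|K (fine B)|)) => // x.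
have na := normr_ge0 (K (fine A)); have nb := normr_ge0 (K (fine B)); have n0 := normr_ge0 (K 0).
have [xA|Ax] := ltP x%:E A; first by rewrite K0 ?normr0; [lra|left].
have [Bx|xB] := ltP B x%:E; first by rewrite K0 ?normr0; [lra|right].
move: Ax; rewrite le_eqVlt => /predU1P[->/=|Ax]; first lra.
move: xB; rewrite le_eqVlt => /predU1P[<-/=|xB]; first lra.
have Ix : eitv A B x by apply/andP.
have h : `|K x - K 0| <= M.
  have [x0|x0] := leP 0 x.
    apply: le_trans (PhiK _ _ I0 Ix x0) _.
    by have /andP[_ h1] := Phi_b x; have /andP[h2 _] := Phi_b 0; lra.
  rewrite distrC; apply: le_trans (PhiK _ _ Ix I0 (ltW x0)) _.
  by have /andP[_ h1] := Phi_b 0; have /andP[h2 _] := Phi_b x; lra.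
have : `|K x| <= `|K x - K 0| + `|K 0| by rewrite -{1}(subrK (K 0) (K x)) ler_normD.
lra.
Qed.

(** Jordan decomposition: [K] is the difference of the nondecreasing functions [K + Psi] and
    [Psi]. *)
Lemma dominated_variation_measurable (K Psi : R -> R) (M : R) :
  dominated_variation K Psi M -> measurable_fun setT K.
Proof.
move=> [_ H].
have nd1 : nondecreasing_fun Psi.
  by move=> x y xy; rewrite -subr_ge0; exact: le_trans (H _ _ xy).
have nd2 : nondecreasing_fun (fun x => K x + Psi x).
  by move=> x y xy; have := H _ _ xy; rewrite ler_norml => /andP[h1 h2]; lra.
have -> : K = (fun x => (K x + Psi x) - Psi x) by apply/funext => x; ring.
by apply: measurable_funB; exact: nondecreasing_measurable.
Qed.

Lemma dominated_variation_bounded (K Psi : R -> R) (M : R) :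
  dominated_variation K Psi M -> forall x, `|K x| <= `|K 0| + M.
Proof.
move=> [b H] x.
have h : `|K x - K 0| <= M.
  have [x0|x0] := leP 0 x.
    rewrite distrC; apply: le_trans (H _ _ x0) _.
    by have /andP[_ h1] := b x; have /andP[h2 _] := b 0; lra.
  apply: le_trans (H _ _ (ltW x0)) _.
  by have /andP[_ h1] := b 0; have /andP[h2 _] := b x; lra.
have : `|K x| <= `|K x - K 0| + `|K 0| by rewrite -{1}(subrK (K 0) (K x)) ler_normD.
lra.
Qed.

(** An infinite positive or negative part would make their difference infinite, and it equals 1;
    hence both are finite. *)
Lemma integrable_of_integral1 (K : R -> R) : measurable_fun setT K ->
  (\int[leb]_x (K x)%:E = 1)%E -> leb.-integrable setT (EFin \o K).
Proof.
move=> mK; rewrite integralE => H.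
have mEK : measurable_fun setT (EFin \o K) by exact/measurable_EFinP.
set p := (\int[leb]_x (EFin \o K)^\+ x)%E.
set m := (\int[leb]_x (EFin \o K)^\- x)%E.
have Hpm : (p - m = 1)%E by exact: H.
have p0 : (0 <= p)%E by apply: integral_ge0.
have m0 : (0 <= m)%E by apply: integral_ge0.
have [pf mf] : (p < +oo)%E /\ (m < +oo)%E.
  by move: Hpm p0 m0; clear; case: p => [p| |]; case: m => [m| |] //=; rewrite !ltry.
apply/integrableP; split => //.
rewrite (_ : (fun x => _) = (fun x => (EFin \o K)^\+ x + (EFin \o K)^\- x)%E); last first.
  exact: (fune_abse (EFin \o K)).
rewrite ge0_integralD//; first exact: lte_add_pinfty.
- exact: measurable_funepos.
- exact: measurable_funeneg.
Qed.

End KernelVariation.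

(** * Riemann sums against a rescaled kernel *)

Section RiemannSums.
Context (R : realType).
Notation leb := (@lebesgue_measure R).

Lemma integrable_mul_bounded (S : set R) (phi g : R -> R) (G : R) : measurable S ->
  leb.-integrable S (EFin \o phi) -> measurable_fun setT phi -> measurable_fun setT g ->
  (forall x, `|g x| <= G) -> leb.-integrable S (EFin \o (fun x => phi x * g x)).
Proof.
move=> mS iphi mphi mg gG.
apply: (@le_integrable _ _ _ leb S mS _ (fun x => (G * phi x)%:E)).
- by apply/measurable_EFinP; apply: measurable_funTS; exact: measurable_funM.
- move=> x _; rewrite lee_fin !normrM mulrC ler_wpM2r//.
  by rewrite (le_trans (gG x))// ler_norm.
- exact: (integrableZl _ G iphi).
Qed.

Lemma leb_itv_oc (a b : R) : a <= b -> fine (leb `]a, b]%classic) = b - a.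
Proof.
rewrite le_eqVlt => /predU1P[->|ab].
  by rewrite lebesgue_measure_itv/= ltxx subrr.
by rewrite lebesgue_measure_itv/= lte_fin ab -EFinB.
Qed.

(** On a cell, [phi] differs from its left value by at most the increment of [Psi]; these increments
    telescope, so the error is one mesh times the total variation, however many cells there are. *)
Lemma riemann_sum_close (phi Psi g : R -> R) (M G D : R) (t : nat -> R) :
  dominated_variation phi Psi M ->
  leb.-integrable setT (EFin \o phi) -> measurable_fun setT phi ->
  measurable_fun setT g -> (forall x, 0 <= g x <= G) ->
  (forall i, t i <= t i.+1) -> (forall i, t i.+1 - t i <= D) ->
  forall n, `|\sum_(i < n) phi (t i) * \int[leb]_(s in `]t i, t i.+1]) g s -
     \int[leb]_(s in `]t 0%N, t n]) (phi s * g s)| <= G * D * (Psi (t n) - Psi (t 0%N)).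
Proof.
move=> [_ dv] iphi mphi mg gG t_nd tD n.
have g0 x : 0 <= g x by case/andP: (gG x).
have gn x : `|g x| <= G by rewrite ger0_norm//; case/andP: (gG x).
have G0 : 0 <= G := le_trans (g0 0) (le_trans (ler_norm _) (gn 0)).
have iS (S : set R) : measurable S -> leb.-integrable S (EFin \o (fun s => phi s * g s)).
  move=> mS; apply: integrable_mul_bounded (gn) => //.
  by apply: integrableS iphi.
have t_mono m : t 0%N <= t m by elim: m => // m IH; exact: le_trans (t_nd m).
elim: n => [|n IH].
  by rewrite big_ord0 set_itv_ge ?bnd_simp ?ltxx// Rintegral_set0 !subrr mulr0 normr0.
rewrite big_ord_recr/=.
have -> : \int[leb]_(s in `]t 0%N, t n.+1]) (phi s * g s) =
    \int[leb]_(s in `]t 0%N, t n]) (phi s * g s) + \int[leb]_(s in `]t n, t n.+1]) (phi s * g s).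
  rewrite -(@Rintegral_itvB _ _ (BRight (t 0%N)) (BRight (t n.+1)) (t n)) ?bnd_simp//.
    by rewrite addrC subrK.
  exact: iS.
have fin : (leb `]t n, t n.+1]%classic < +oo)%E.
  by rewrite lebesgue_measure_itv/=; case: ifPn; rewrite ?ltry// -EFinB ltry.
have ig : leb.-integrable `]t n, t n.+1] (EFin \o g).
  apply: measurable_bounded_integrable => //; first exact: measurable_funTS.
  exists G; split; first exact: num_real.
  by move=> x Gx y _ /=; exact: le_trans (gn y) (ltW Gx).
have ic (c : R) : leb.-integrable `]t n, t n.+1] (EFin \o (fun s => c * g s)).
  exact: (integrableZl _ c ig).
set S1 := \sum_(i < n) _; set I1 := \int[leb]_(s in _) (phi s * g s).
have E : phi (t n) * \int[leb]_(s in `]t n, t n.+1]) g s -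
    \int[leb]_(s in `]t n, t n.+1]) (phi s * g s) =
    \int[leb]_(s in `]t n, t n.+1]) ((phi (t n) - phi s) * g s).
  rewrite -RintegralZl// -RintegralB//; last exact: iS.
  by apply: eq_Rintegral => s _; rewrite mulrBl.
have -> : S1 + phi (t n) * \int[leb]_(s in `]t n, t n.+1]) g s -
    (I1 + \int[leb]_(s in `]t n, t n.+1]) (phi s * g s)) =
    (S1 - I1) + (phi (t n) * \int[leb]_(s in `]t n, t n.+1]) g s -
    \int[leb]_(s in `]t n, t n.+1]) (phi s * g s)) by ring.
rewrite E; apply: le_trans (ler_normD _ _) _.
have iE : leb.-integrable `]t n, t n.+1] (EFin \o (fun s => (phi (t n) - phi s) * g s)).
  rewrite (_ : (fun s => _) = (fun s => phi (t n) * g s - phi s * g s)); last first.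
    by apply/funext => s; rewrite mulrBl.
  exact: (integrableB _ (ic _) (iS _ _)).
have p0 : 0 <= Psi (t n.+1) - Psi (t n) := le_trans (normr_ge0 _) (dv _ _ (t_nd n)).
have H : `|\int[leb]_(s in `]t n, t n.+1]) ((phi (t n) - phi s) * g s)| <=
    G * D * (Psi (t n.+1) - Psi (t n)).
  apply: le_trans (le_normr_Rintegral _ iE) _ => //.
  apply: (@le_trans _ _ (\int[leb]_(s in `]t n, t n.+1]) ((Psi (t n.+1) - Psi (t n)) * G))).
    apply: le_Rintegral => //.
    - exact: integrable_norm.
    - apply: measurable_bounded_integrable => //.
      exists `|(Psi (t n.+1) - Psi (t n)) * G|; split; first exact: num_real.
      by move=> x Gx y _ /=; exact: ltW.
    - move=> s /=; rewrite in_itv/= => /andP[ts st].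
      rewrite normrM ler_pM//.
      apply: le_trans (dv _ _ (ltW ts)) _; rewrite lerD2r.
      by rewrite -subr_ge0; exact: le_trans (normr_ge0 _) (dv _ _ st).
  rewrite Rintegral_cst// leb_itv_oc//.
  have -> : G * D * (Psi (t n.+1) - Psi (t n)) = (Psi (t n.+1) - Psi (t n)) * G * D by ring.
  by rewrite ler_wpM2l ?tD// mulr_ge0.
have -> : G * D * (Psi (t n.+1) - Psi (t 0%N)) =
  G * D * (Psi (t n) - Psi (t 0%N)) + G * D * (Psi (t n.+1) - Psi (t n)) by ring.
exact: lerD.
Qed.

Lemma dominated_variation_affine (K Psi : R -> R) (M tau h : R) : 0 < h ->
  dominated_variation K Psi M ->
  dominated_variation (fun t => K ((t - tau) / h)) (fun t => Psi ((t - tau) / h)) M.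
Proof.
move=> h0 [b dv]; split=> [x|x y xy]; first exact: b.
by apply: dv; rewrite ler_pM2r ?invr_gt0// lerD2r.
Qed.

Lemma dominated_variation_norm (K Psi : R -> R) (M : R) :
  dominated_variation K Psi M -> dominated_variation (fun x => `|K x|) Psi M.
Proof.
move=> [b dv]; split=> // x y xy; apply: le_trans (dv _ _ xy).
exact: ler_dist_dist.
Qed.

Lemma dominated_variation_sqr (K Psi : R -> R) (M C : R) : 0 <= C ->
  (forall x, `|K x| <= C) -> dominated_variation K Psi M ->
  dominated_variation (fun x => K x ^+ 2) (fun x => 2 * C * Psi x) (2 * C * M).
Proof.
move=> C0 KC [b dv]; split=> [x|x y xy].
  have /andP[p0 pM] := b x; apply/andP; split; first by rewrite !mulr_ge0.
  by rewrite ler_wpM2l// mulr_ge0.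
rewrite subr_sqr normrM -mulrBr mulrC ler_pM//; last exact: dv.
by apply: le_trans (ler_normD _ _) _; have := KC x; have := KC y; lra.
Qed.

Lemma Rintegral_affine (f : R -> R) (a b : R) : 0 < a ->
  measurable_fun setT f -> (forall x, 0 <= f x) ->
  \int[leb]_x f (a * x + b) = a^-1 * \int[leb]_x f x.
Proof.
move=> a0 mf f0; rewrite /Rintegral.
have mef : measurable_fun setT (EFin \o f) by exact/measurable_EFinP.
rewrite (@ge0_integral_affine R (EFin \o f) a b a0 mef (fun x => f0 x)).
have : (0 <= \int[leb]_x (EFin \o f) x)%E by apply: integral_ge0 => x _; rewrite lee_fin.
(* If the integral is infinite, both sides are 0 by the convention for [fine]. *)
case: (\int[leb]_x (EFin \o f) x)%E => [r| |]//= _.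
by rewrite gt0_muley ?lte_fin ?invr_gt0//= mulr0.
Qed.

Section Limit.
Variables (T tau : R) (h : nat -> R).
Hypotheses (T0 : 0 < T) (Htau : 0 < tau < T).
Hypotheses (h0 : forall n, 0 < h n) (hlim : h n @[n --> \oo] --> (0 : R)).
Hypothesis Dh : (T / n%:R) / h n @[n --> \oo] --> (0 : R).
Variables (phi Psi g : R -> R) (M G g0 : R).
Hypotheses (phi0 : forall x, 0 <= phi x) (mphi : measurable_fun setT phi).
Hypothesis iphi : leb.-integrable setT (EFin \o phi).
Hypothesis dv : dominated_variation phi Psi M.
Hypotheses (mg : measurable_fun setT g) (gG : forall x, 0 <= g x <= G).
Hypothesis gtau : g x @[x --> tau] --> g0.

Let obs_nd n i : obs_time T n i <= obs_time T n i.+1.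
Proof. by rewrite /obs_time ler_wpM2r ?invr_ge0// ler_wpM2r ?ler_nat// ltW. Qed.

Let obs_step n i : obs_time T n i.+1 - obs_time T n i = T / n%:R.
Proof. by rewrite /obs_time -!mulrBl -natrB// subSnn mul1r. Qed.

Let step_le n i : obs_time T n i.+1 - obs_time T n i <= T / n%:R.
Proof. by rewrite obs_step. Qed.

Let integral_local n : (0 < n)%N ->
  \int[leb]_(s in `]obs_time T n 0, obs_time T n n]) (phi ((s - tau) / h n) * g s) =
  h n * \int[leb]_x (phi x * (g (tau + h n * x) * \1_(`]0, T]) (tau + h n * x))).
Proof.
move=> n0.
have -> : obs_time T n 0 = 0 by rewrite /obs_time !mul0r.
have -> : obs_time T n n = T.
  by rewrite /obs_time mulrAC mulfV ?mul1r// pnatr_eq0 -lt0n.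
pose F s := phi ((s - tau) / h n) * (g s * \1_(`]0, T]) s).
have mF : measurable_fun setT F.
  apply: measurable_funM.
    by apply: (measurableT_comp mphi); apply: measurable_funM => //; exact: measurable_funB.
  by apply: measurable_funM.
have F0 s : 0 <= F s by rewrite !mulr_ge0//; case/andP: (gG s).
have := Rintegral_affine tau (h0 n) mF F0.
move=> /(congr1 (fun z => h n * z)); rewrite mulrA mulfV ?gt_eqF// mul1r => E.
rewrite Rintegral_mkcond.
transitivity (\int[leb]_x F x).
  apply: eq_Rintegral => s _; rewrite patchE /F indicE.
  by case: ifPn => _; rewrite ?mulr1 ?mulr0.
rewrite -E; congr (_ * _); apply: eq_Rintegral => x _; rewrite /F [h n * x + tau]addrC.
by congr (phi _ * _); field; rewrite gt_eqF.
Qed.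

(** Dominated convergence with majorant [G * phi]; the indicator is eventually 1 at each [x] because
    [tau] is interior to [[0, T]]. *)
Let cvg_local :
  \int[leb]_x (phi x * (g (tau + h n * x) * \1_(`]0, T]) (tau + h n * x))) @[n --> \oo]
   --> \int[leb]_x (phi x * g0).
Proof.
have G0 : 0 <= G by case/andP: (gG 0) => h1 h2; exact: le_trans h2.
apply: (@Rintegral_dct _ _ _ leb _ _ (fun x => G * phi x)).
- move=> n; apply: measurable_funM => //; apply: measurable_funM.
    by apply: (measurableT_comp mg); apply: measurable_funD => //; exact: measurable_funM.
  have m1 : measurable_fun setT (\1_(`]0, T]) : R -> R) by exact: measurable_indic.
  by apply: (measurableT_comp m1); apply: measurable_funD => //; exact: measurable_funM.
- exact: measurable_funM.
- move=> x; apply: cvgM; first exact: cvg_cst.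
  have cx : tau + h n * x @[n --> \oo] --> tau.
    rewrite -[X in _ --> X]addr0; apply: cvgD; first exact: cvg_cst.
    by rewrite -(mul0r x); apply: cvgM; [exact: hlim|exact: cvg_cst].
  rewrite -[g0]mulr1; apply: cvgM; first exact: (cvg_comp _ _ cx gtau).
  apply: cvg_near_cst; case/andP: Htau => tau0 tauT.
  have : \forall n \near \oo, 0 < tau + h n * x by exact: (cvgr_gt tau).
  have : \forall n \near \oo, tau + h n * x < T by exact: (cvgr_lt tau).
  move=> H1 H2; near=> n; rewrite indicE mem_set//= in_itv/=.
  apply/andP; split; first by near: n.
  by apply: ltW; near: n.
- exact: (integrableZl measurableT G iphi).
- move=> n x; rewrite normrM (ger0_norm (phi0 x)) mulrC ler_wpM2r//.
  have /andP[ga gb] := gG (tau + h n * x).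
  rewrite ger0_norm; last by rewrite mulr_ge0.
  by rewrite indicE; case: (_ \in _); rewrite ?mulr1 ?mulr0.
Unshelve. all: by end_near. Qed.

(** The rescaled [phi] is an approximate identity at [tau]. Its variation does not depend on the
    bandwidth, so the discretization error after division by [h n] is of order mesh over
    bandwidth. *)
Lemma riemann_local_limit :
  (h n)^-1 * \sum_(i < n) phi ((obs_time T n i - tau) / h n) *
     \int[leb]_(s in `]obs_time T n i, obs_time T n i.+1]) g s @[n --> \oo]
  --> g0 * \int[leb]_x phi x.
Proof.
have -> : g0 * \int[leb]_x phi x = \int[leb]_x (phi x * g0) by rewrite RintegralZr// mulrC.
set a := fun n : nat => _; set b := fun n => \int[leb]_x (phi x * (g (tau + h n * x) * \1_(`]0, T]) (tau + h n * x))).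
have cb : b n @[n --> \oo] --> \int[leb]_x (phi x * g0) by exact: cvg_local.
have G0 : 0 <= G by case/andP: (gG 0) => h1 h2; exact: le_trans h2.
have M0 : 0 <= M by case: dv => bd _; case/andP: (bd 0) => h1 h2; exact: le_trans h2.
have close n : (0 < n)%N -> `|a n - b n| <= G * M * ((T / n%:R) / h n).
  move=> n0; have hn := h0 n; have hv : 0 < (h n)^-1 by rewrite invr_gt0.
  have maff : measurable_fun setT (fun t : R => phi ((t - tau) / h n)).
    by apply: (measurableT_comp mphi); apply: measurable_funM => //; exact: measurable_funB.
  have iaff : leb.-integrable setT (EFin \o (fun t => phi ((t - tau) / h n))).
    apply/integrableP; split; first exact/measurable_EFinP.
    have mef : measurable_fun setT (fun x : R => `|(phi x)%:E|%E).
      by apply: measurableT_comp => //; exact/measurable_EFinP.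
    have E := @ge0_integral_affine R (fun x => `|(phi x)%:E|%E) (h n)^-1 (- tau / h n) hv mef (fun x => abse_ge0 _).
    have [_ fi] := integrableP _ _ _ iphi.
    rewrite (_ : (\int[leb]_x _ = \int[leb]_x `|(phi ((h n)^-1 * x + - tau / h n))%:E|)%E); last first.
      by apply: eq_integral => x _ /=; congr (`|(phi _)%:E|)%E; ring.
    by rewrite E lte_mul_pinfty// ?lee_fin ?invr_ge0 ltW.
  have H := riemann_sum_close (dominated_variation_affine tau hn dv) iaff
    maff mg gG (obs_nd n) (fun i => step_le n i) n.
  rewrite integral_local// in H.
  have -> : a n - b n = (h n)^-1 * (h n * a n - h n * b n).
    by rewrite -mulrBr mulrA mulVf ?mul1r ?gt_eqF.
  rewrite normrM (gtr0_norm hv).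
  have -> : h n * a n = \sum_(i < n) phi ((obs_time T n i - tau) / h n) *
         \int[leb]_(s in `]obs_time T n i, obs_time T n i.+1]) g s.
    by rewrite /a mulrA mulfV ?mul1r// gt_eqF.
  apply: (@le_trans _ _ ((h n)^-1 * (G * (T / n%:R) * M))).
    rewrite ler_wpM2l ?(ltW hv)//; apply: le_trans H _.
    rewrite ler_wpM2l//; first by rewrite !mulr_ge0 ?invr_ge0 ?(ltW T0).
    case: dv => bd _; have := bd ((obs_time T n n - tau) / h n).
    have := bd ((obs_time T n 0 - tau) / h n); lra.
  by rewrite le_eqVlt; apply/orP; left; apply/eqP; ring.
rewrite -[X in _ --> X]addr0.
have -> : a = b \+ (fun n => a n - b n) by apply/funext => n /=; rewrite addrC subrK.
apply: cvgD => //; apply/norm_cvg0P.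
apply: (@squeeze_cvgr _ _ _ _ (fun=> 0) (fun n => G * M * ((T / n%:R) / h n))).
- by near=> n; rewrite normr_ge0/= close//; near: n; exists 1%N.
- exact: cvg_cst.
- by rewrite -(mulr0 (G * M)); apply: cvgM => //; exact: cvg_cst.
Unshelve. all: by end_near. Qed.

End Limit.
End RiemannSums.

(** * Step approximation of the volatility *)

Section Tonelli.
Context d (Omega : measurableType d) (R : realType) (P : probability Omega R).
Notation leb := (@lebesgue_measure R).

(** Processes are measurable at nonnegative times only, so Tonelli is applied to the extension of
    [F] by zero. The measurability of both partial integrals is recorded along with the exchange. *)
Lemma Tonelli_restrict (F : R * Omega -> \bar R) (D : set R) :
  measurable D -> measurable_fun (D `*` setT) F ->
  (forall z, (0 <= F z)%E) ->
  (\int[P]_w \int[leb]_(t in D) F (t, w) = \int[leb]_(t in D) \int[P]_w F (t, w))%E /\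
  measurable_fun setT (fun w => \int[leb]_(t in D) F (t, w))%E /\
  measurable_fun D (fun t : R => \int[P]_w F (t, w))%E.
Proof.
move=> mD mF F0; pose G := F \_ (D `*` setT).
have mDT : measurable (D `*` [set: Omega]) by exact: measurableX.
have mG : measurable_fun [set: measurableTypeR R * Omega] G.
  exact: (measurable_restrictT F mDT).1 mF.
have G0 z : (0 <= G z)%E by rewrite /G patchE; case: ifPn.
have GE t w : G (t, w) = ((fun s => F (s, w)) \_ D) t.
  rewrite /G !patchE; congr (if _ then _ else _).
  by apply/idP/idP; rewrite !in_setE => //= -[].
have E1 w : (\int[leb]_(t in D) F (t, w) = \int[leb]_t G (t, w))%E.
  by rewrite integral_mkcond; apply: eq_integral => t _; rewrite GE.
have E2 t : ((fun s => \int[P]_w F (s, w)) \_ D)%E t = (\int[P]_w G (t, w))%E.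
  rewrite patchE; case: ifPn => Dt.
    by apply: eq_integral => w _; rewrite GE patchE Dt.
  transitivity (\int[P]_w (0 : \bar R))%E; first by rewrite integral0.
  by apply: eq_integral => w _; rewrite GE patchE (negbTE Dt).
split.
  rewrite [RHS]integral_mkcond.
  transitivity (\int[leb]_t \int[P]_w G (t, w))%E; last by apply: eq_integral => t _; rewrite E2.
  rewrite (@fubini_tonelli _ _ _ _ _ leb P G mG G0).
  by apply: eq_integral => w _; rewrite E1.
split.
  rewrite (_ : (fun w => _) = fubini_G leb G); last by apply/funext => w; rewrite E1.
  exact: measurable_fun_fubini_tonelli_G.
apply/(measurable_restrictT _ mD).
rewrite (_ : _ \_ _ = fubini_F P G); last by apply/funext => t; rewrite E2.
exact: measurable_fun_fubini_tonelli_F.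
Qed.

End Tonelli.

(** * Mean oscillation of bounded paths *)

Section Oscillation.
Context d (Omega : measurableType d) (R : realType) (P : probability Omega R).
Notation leb := (@lebesgue_measure R).
Variables (f : R -> Omega -> R) (M : R).
Hypothesis mf : measurable_fun setT (fun z : R * Omega => f z.1 z.2).
Hypothesis fM : forall t w, `|f t w| <= M.

Let mft w : measurable_fun setT (fun t : R => f t w).
Proof. by apply: (measurableT_comp mf (g := fun t => (t, w))); exact: pair2_measurable. Qed.

Let mfw t : measurable_fun setT (f t).
Proof. by apply: (measurableT_comp mf (g := fun w => (t, w))); exact: pair1_measurable. Qed.

Let M0 : 0 <= M := le_trans (normr_ge0 _) (fM 0 point).

Let f2M t u w : `|f u w - f t w| <= 2 * M.
Proof. by apply: le_trans (ler_normB _ _) _; have := fM t w; have := fM u w; lra. Qed.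

(** The unnormalized mean oscillation around [t]. The ball is expressed by an indicator of [t - u]
    so that the integrand is jointly measurable in [t], [w] and [u]. *)
Definition oscillation (r t : R) (w : Omega) : \bar R :=
  (\int[leb]_u (`|f u w - f t w| * \1_(ball (0 : R) r) (t - u))%:E)%E.

Lemma oscillation_ge0 r t w : (0 <= oscillation r t w)%E.
Proof. by apply: integral_ge0 => u _; rewrite lee_fin mulr_ge0. Qed.

Lemma measurable_oscillation r :
  measurable_fun setT (fun z : R * Omega => oscillation r z.1 z.2).
Proof.
pose F (z : (R * Omega) * measurableTypeR R) : \bar R :=
  (`|f z.2 z.1.2 - f z.1.1 z.1.2| * \1_(ball (0 : R) r) (z.1.1 - z.2))%:E.
apply: (@measurable_fun_fubini_tonelli_F _ _ _ _ _ leb F); last first.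
  by move=> z; rewrite lee_fin mulr_ge0.
have ms : measurable_fun setT (fun z : (R * Omega) * measurableTypeR R => z.2 : measurableTypeR R).
  exact: measurable_snd.
apply/measurable_EFinP; apply: measurable_funM.
  apply: measurableT_comp => //; apply: measurable_funB.
    apply: (measurableT_comp mf (g := fun z : (R * Omega) * measurableTypeR R => (z.2, z.1.2))).
    apply: measurable_fun_pair; first exact: ms.
    exact: (measurableT_comp measurable_snd measurable_fst).
  exact: (measurableT_comp mf measurable_fst).
have m1 : measurable_fun setT (\1_(ball (0 : R) r) : R -> R).
  by apply: measurable_indic; rewrite ball_itv.
apply: (measurableT_comp m1); apply: measurable_funB => //.
exact: (measurableT_comp measurable_fst measurable_fst).
Qed.

Let indic_ball r t u : \1_(ball (0 : R) r) (t - u) = \1_(ball t r) u :> R.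
Proof.
rewrite !indicE; congr (_ %:R); congr nat_of_bool.
by apply/idP/idP; rewrite !in_setE /ball/= sub0r normrN.
Qed.

Lemma oscillation_davg r t w : 0 < r ->
  ((r *+ 2)^-1%:E * oscillation r t w)%E = davg (f ^~ w) t r.
Proof.
move=> r0; rewrite /davg /iavg lebesgue_measure_ball ?ltW// inver ifF; last first.
  by apply/negbTE; rewrite gt_eqF// pmulrn_lgt0.
congr (_ * _)%E; rewrite /oscillation [RHS]integral_mkcond.
apply: eq_integral => u _; rewrite indic_ball patchE indicE.
by case: ifPn => _; rewrite ?mulr1 ?mulr0.
Qed.

Lemma oscillation_le r t w : 0 < r -> (oscillation r t w <= (2 * M * (r *+ 2))%:E)%E.
Proof.
move=> r0; apply: (@le_trans _ _ (\int[leb]_u ((2 * M)%:E * (\1_(ball t r) u)%:E))%E).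
  apply: ge0_le_integral => //.
  - apply/measurable_EFinP; apply: measurable_funM.
      have m1 : measurable_fun setT (fun x : R => f x w - f t w) by exact: measurable_funB.
      exact: (measurableT_comp (@normr_measurable R setT) m1).
    rewrite (_ : (fun x => _) = \1_(ball t r)); last by apply/funext => u; rewrite indic_ball.
    by apply: measurable_indic; rewrite ball_itv.
  - apply/measurable_EFinP; apply: measurable_funM => //.
    by apply: measurable_indic; rewrite ball_itv.
  - by move=> u _; rewrite -EFinM lee_fin indic_ball ler_wpM2r.
rewrite ge0_integralZl_EFin//; last 2 first.
- by apply/measurable_EFinP; apply: measurable_indic; rewrite ball_itv.
- by rewrite mulr_ge0.
have mb : measurable (ball t r) by rewrite ball_itv.
have -> : (\int[leb]_u (\1_(ball t r) u)%:E)%E = (r *+ 2)%:E.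
  apply: eq_trans (integral_indic leb measurableT mb) _.
  by apply: eq_trans (lebesgue_measure_ball t (ltW r0)); congr (leb _); exact: setIT.
by rewrite -EFinM.
Qed.

Let locint w : locally_integrable setT (f ^~ w).
Proof.
split; [exact: mft|exact: openT|move=> C _ cC].
apply: (@le_lt_trans _ _ (\int[leb]_(x in C) M%:E)%E).
  apply: ge0_le_integral => //.
  - exact: compact_measurable.
  - by apply/measurable_EFinP; apply: measurableT_comp => //; exact: (measurable_funTS (mft w)).
  - by move=> x _; rewrite lee_fin.
rewrite integral_cst ?lte_mul_pinfty ?lee_fin//; last exact: compact_measurable.
exact: compact_finite_measure.
Qed.

(** Along each path, Lebesgue differentiation gives convergence for almost every [t]; the bound
    [2 * M] then allows dominated convergence in [t] and afterwards in [w]. *)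
Lemma mean_oscillation_cvg (a b : R) (r : nat -> R) :
  (forall n, 0 < r n) -> r n @[n --> \oo] --> (0 : R) ->
  (\int[P]_w \int[leb]_(t in `[a, b]) ((r n *+ 2)^-1%:E * oscillation (r n) t w))%E
    @[n --> \oo] --> 0%E.
Proof.
move=> r0 rlim.
pose q n t w := ((r n *+ 2)^-1%:E * oscillation (r n) t w)%E.
have rp n : 0 < r n *+ 2 by rewrite pmulrn_lgt0.
have q0 n t w : (0 <= q n t w)%E.
  by rewrite mule_ge0 ?oscillation_ge0// lee_fin invr_ge0 ltW.
have qM n t w : (q n t w <= (2 * M)%:E)%E.
  apply: (@le_trans _ _ ((r n *+ 2)^-1%:E * (2 * M * (r n *+ 2))%:E)%E).
    by apply: lee_wpmul2l; [rewrite lee_fin invr_ge0 ltW|exact: oscillation_le].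
  by rewrite -EFinM mulrCA mulVf ?mulr1// gt_eqF.
have mq n : measurable_fun setT (fun z : R * Omega => q n z.1 z.2).
  by apply: measurable_funeM; exact: measurable_oscillation.
have qn n t w : (`|q n t w| <= (2 * M)%:E)%E by rewrite gee0_abs.
have fin : (leb `[a, b]%classic < +oo)%E.
  by rewrite lebesgue_measure_itv/=; case: ifPn; rewrite ?ltry// -EFinB ltry.
have icst : leb.-integrable `[a, b] (cst (2 * M)%:E).
  by apply/integrableP; split => //; rewrite integral_cst//= lte_mul_pinfty// lee_fin.
have mqw n w : measurable_fun `[a, b] (fun t : R => q n t w).
  apply: measurable_funTS.
  by apply: (measurableT_comp (mq n) (g := fun t => (t, w))); exact: pair2_measurable.
have cw w : (\int[leb]_(t in `[a, b]) q n t w)%E @[n --> \oo] --> 0%E.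
  have ae1 : {ae leb, forall t : R, `[a, b]%classic t -> q n t w @[n --> \oo] --> 0%E}.
    apply: (@filterS _ _ (ae_filter_ringOfSetsType leb) _ _ _ (lebesgue_differentiation (locint w))) => t Lt _.
    have /cvge_at_rightP/(_ r) := Lt => /(_ (conj r0 rlim)) H.
    rewrite (_ : (fun n => q n t w) = (fun n => davg (f^~ w) t (r n)))//.
    by apply/funext => n; exact: oscillation_davg.
  have ae2 : {ae leb, forall t : R, forall n, `[a, b]%classic t -> (`|q n t w| <= cst (2 * M)%:E t)%E}.
    by apply: aeW => t n _ /=.
  have [_ _] := @dominated_convergence _ _ _ leb _ (measurable_itv _) (fun n t => q n t w)
    (cst 0%E) _ (mqw ^~ w) (measurable_cst _) ae1 icst ae2.
  by rewrite integral0.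
have mI n : measurable_fun setT (fun w => \int[leb]_(t in `[a, b]) q n t w)%E.
  have [_ [H _]] := Tonelli_restrict P (measurable_itv `[a, b]) (F := fun z => q n z.1 z.2)
    (measurable_funTS (mq n)) (fun z => q0 n z.1 z.2).
  exact: H.
have CE : ((2 * M)%:E * leb `[a, b]%classic)%E \is a fin_num.
  by rewrite fin_numM// ge0_fin_numE.
have iC : P.-integrable setT (cst ((2 * M)%:E * leb `[a, b]%classic)%E).
  by apply/integrableP; split => //; rewrite integral_prob_cst ltey_eq abse_fin_num CE.
rewrite -[X in _ --> X](@integral0 _ _ _ P setT).
apply: (@dominated_cvg _ _ _ P setT measurableT _ _ _ mI _ _ iC) => // n w _.
rewrite gee0_abs; last by apply: integral_ge0 => t _.
apply: (@le_trans _ _ (\int[leb]_(t in `[a, b]) cst (2 * M)%:E t)%E).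
  by apply: ge0_le_integral => //; exact: mqw.
by rewrite integral_cst.
Qed.

End Oscillation.

Lemma cvge0_near_le (R : realType) (u : nat -> \bar R) (eps : R) :
  u n @[n --> \oo] --> 0%E -> 0 < eps -> \forall n \near \oo, (u n <= eps%:E)%E.
Proof.
move=> /fine_cvgP[ufin u0] e0.
have N2 : \forall n \near \oo, (fine \o u) n <= eps by exact: cvgr_le u0 _ e0.
by near=> n; rewrite -[u n]fineK ?lee_fin//; near: n.
Unshelve. all: by end_near. Qed.

Section StepSums.
Context (R : realType).
Notation leb := (@lebesgue_measure R).
Implicit Types (s v : nat -> R) (m : nat) (t : R).

Lemma step_sum_out s v m t : (forall j, s j <= s j.+1) -> (t <= s 0%N) || (s m < t) ->
  \sum_(i < m) v i * \1_(`]s i, s i.+1]) t = 0.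
Proof.
move=> snd ht; apply: big1 => i _; rewrite indicE memNset ?mulr0//= in_itv/=.
have sm j k : (j <= k)%N -> s j <= s k by exact: (homo_leq (@lexx _ _) (@le_trans _ _) snd).
move=> /andP[s1 s2]; case/orP: ht => ht.
  by have := sm 0%N i (leq0n _); lra.
by have := sm i.+1 m (ltn_ord i); lra.
Qed.

Lemma step_sum_in s v m t : (forall j, s j <= s j.+1) -> s 0%N < t <= s m ->
  exists j, [/\ (j < m)%N, s j < t <= s j.+1 &
    \sum_(i < m) v i * \1_(`]s i, s i.+1]) t = v j].
Proof.
move=> snd; elim: m => [|m IH] /andP[t0 tm]; first by have := lt_le_trans t0 tm; rewrite ltxx.
rewrite big_ord_recr/=; have [tsm|smt] := leP t (s m).
  have [|j [jm tj ->]] := IH; first by rewrite t0.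
  exists j; split=> //; first exact: ltnW.
  by rewrite indicE memNset ?mulr0 ?addr0//= in_itv/= ltNge tsm.
exists m; split=> //; first by rewrite smt.
rewrite step_sum_out ?smt ?orbT// add0r indicE mem_set ?mulr1//=.
by rewrite in_itv/= smt.
Qed.

Lemma sum_integral_cells (H : R -> \bar R) (c : nat -> R) m :
  (forall j, c j <= c j.+1) -> measurable_fun setT H -> (forall t, (0 <= H t)%E) ->
  (\sum_(j < m) \int[leb]_(t in `[c j, c j.+1[) H t = \int[leb]_(t in `[c 0%N, c m[) H t)%E.
Proof.
move=> cnd mH H0; elim: m => [|m IH].
  by rewrite big_ord0 set_itv_ge ?bnd_simp ?ltxx// integral_set0.
rewrite big_ord_recr/= IH.
have cm j k : (j <= k)%N -> c j <= c k by exact: (homo_leq (@lexx _ _) (@le_trans _ _) cnd).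
rewrite -ge0_integral_setU//=.
- by rewrite -itv_bndbnd_setU ?bnd_simp// cm.
- exact: measurable_funTS.
- apply/disj_setPRL => x /=; rewrite !in_itv/= => /andP[h1 _] /andP[_ h2].
  by move: (lt_le_trans h2 h1); rewrite ltxx.
Qed.

(** A function cannot exceed its mean everywhere by a fixed positive amount; the slack [eta] turns
    the comparison of integrals into a contradiction. *)
Lemma cell_point (H : R -> \bar R) (c e eta : R) : c < e -> measurable_fun setT H ->
  (forall t, (0 <= H t)%E) -> 0 < eta -> (\int[leb]_(t in `[c, e[) H t < +oo)%E ->
  exists2 s, c <= s < e & (H s * (e - c)%:E <= \int[leb]_(t in `[c, e[) H t + eta%:E)%E.
Proof.
move=> ce mH H0 eta0; set I := (\int[leb]_(t in `[c, e[) H t)%E => Ifin.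
have I0 : (0 <= I)%E by apply: integral_ge0 => t _.
case IE : I I0 Ifin => [i| |]// i0 _.
apply: contrapT => hn.
have H1 (s : R) : `[c, e[%classic s -> (((i + eta) / (e - c))%:E <= H s)%E.
  rewrite /= in_itv/= => hs; rewrite leNgt; apply/negP => lts; apply: hn.
  exists s => //; move: lts (H0 s); case: (H s) => [x| |]//=; rewrite !lte_fin lee_fin => hx x0.
  rewrite -EFinM -EFinD lee_fin ltW// -ltr_pdivlMr//; lra.
have : (\int[leb]_(t in `[c, e[) ((i + eta) / (e - c))%:E <= I)%E.
  apply: ge0_le_integral => //.
  - move=> t _; rewrite lee_fin; apply: divr_ge0; last by rewrite subr_ge0; exact: ltW.
    by apply: addr_ge0; [exact: i0|exact: ltW].
  - exact: measurable_funTS.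
rewrite integral_cst//= lebesgue_measure_itv/= lte_fin ce IE -EFinM lee_fin.
by rewrite divfK ?gt_eqF//; lra.
Qed.

End StepSums.

Section StepApproximation.
Context d (Omega : measurableType d) (R : realType) (P : probability Omega R).
Notation leb := (@lebesgue_measure R).
Variables (f : R -> Omega -> R) (M : R).
Hypothesis mf : measurable_fun setT (fun z : R * Omega => f z.1 z.2).
Hypothesis fM : forall t w, `|f t w| <= M.

Let mft w : measurable_fun setT (fun t : R => f t w).
Proof. by apply: (measurableT_comp mf (g := fun t => (t, w))); exact: pair2_measurable. Qed.

Let mfw t : measurable_fun setT (f t).
Proof. by apply: (measurableT_comp mf (g := fun w => (t, w))); exact: pair1_measurable. Qed.

Let M0 : 0 <= M := le_trans (normr_ge0 _) (fM 0 point).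

Definition step_path (m : nat) (s : nat -> R) (g : R -> Omega -> R) (t : R) (w : Omega) : R :=
  \sum_(i < m) g (s i) w * \1_(`]s i, s i.+1]) t.

Lemma measurable_step_path m s (g : R -> Omega -> R) :
  (forall j, measurable_fun setT (g (s j))) ->
  measurable_fun setT (fun z : R * Omega => step_path m s g z.1 z.2).
Proof.
move=> mg; apply: measurable_sum => j; apply: measurable_funM.
  exact: (measurableT_comp (mg j) measurable_snd).
have m1 : measurable_fun setT (\1_(`]s j, s j.+1]) : R -> R) by exact: measurable_indic.
exact: (measurableT_comp m1 measurable_fst).
Qed.

(** Before [s 0] the step path is 0 and the error is at most [M] over a length [dl]; after [s j] the
    path stays within distance [r] of [s j], so the oscillation there controls the error up to
    [s j.+1]. *)
Let step_error (m : nat) (s : nat -> R) (a b r dl : R) w :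
  (forall j, s j <= s j.+1) -> a <= s 0%N <= a + dl -> s m = b ->
  (forall j, (j < m)%N -> s j.+1 - s j < r) ->
  (\int[leb]_(t in `]a, b]) (`|step_path m s f t w - f t w|)%:E <=
    (M * dl)%:E + \sum_(j < m) oscillation f r (s j) w)%E.
Proof.
move=> snd /andP[as0 s0a] smb sr.
have dl0 : 0 <= dl by lra.
have m1 j : measurable_fun setT (fun u : R => `|f u w - f (s j) w| * \1_(ball (0 : R) r) (s j - u)).
  apply: measurable_funM.
    have m1 : measurable_fun setT (fun x : R => f x w - f (s j) w) by exact: measurable_funB.
    exact: (measurableT_comp (@normr_measurable R setT) m1).
  have m1 : measurable_fun setT (\1_(ball (0 : R) r) : R -> R).
    by apply: measurable_indic; rewrite ball_itv.
  by apply: (measurableT_comp m1); exact: measurable_funB.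
pose G t := (M * \1_(`]a, a + dl]) t + \sum_(j < m)
   `|f t w - f (s j) w| * \1_(ball (0 : R) r) (s j - t)).
have ms : measurable_fun setT (fun t : R => \sum_(j < m)
   `|f t w - f (s j) w| * \1_(ball (0 : R) r) (s j - t)).
  by apply: measurable_sum => j; exact: m1.
have mi : measurable_fun setT (fun t : R => M * \1_(`]a, a + dl]) t).
  by apply: measurable_funM.
have sum0 t : 0 <= \sum_(j < m) `|f t w - f (s j) w| * \1_(ball (0 : R) r) (s j - t).
  by apply: sumr_ge0 => j _; rewrite mulr_ge0.
apply: (@le_trans _ _ (\int[leb]_t (G t)%:E)%E).
  apply: (@le_trans _ _ (\int[leb]_(t in `]a, b]) (G t)%:E)%E); last first.
    apply: ge0_subset_integral => //.
      by apply/measurable_EFinP; apply: measurable_funD; [exact: mi|exact: ms].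
    by move=> t _; rewrite lee_fin addr_ge0// mulr_ge0.
  apply: ge0_le_integral => //.
  - apply/measurable_EFinP; apply: measurable_funTS.
    have m2 : measurable_fun setT (fun t : R => step_path m s f t w - f t w).
      by apply: measurable_funB => //; apply: measurable_sum => j; apply: measurable_funM.
    exact: (measurableT_comp (@normr_measurable R setT) m2).
  - by apply/measurable_EFinP; apply: measurable_funTS; apply: measurable_funD; [exact: mi|exact: ms].
  - move=> t /=; rewrite in_itv/= => /andP[at_ tb]; rewrite lee_fin /G.
    have [ts0|s0t] := leP t (s 0%N).
      have -> : step_path m s f t w = 0.
        by apply: (@step_sum_out R s (fun i => f (s i) w)) => //; rewrite ts0.
      rewrite sub0r normrN.
      apply: (@le_trans _ _ (M * \1_(`]a, a + dl]) t)).
        rewrite indicE mem_set ?mulr1//= in_itv/= at_/=; lra.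
      by rewrite lerDl.
    have [|j [jm /andP[tj1 tj2] E]] := @step_sum_in R s (fun i => f (s i) w) m t snd.
      by rewrite s0t smb.
    rewrite /step_path E (bigD1 (Ordinal jm))//= distrC.
    rewrite [\1_(ball _ _) _]indicE mem_set; last first.
      rewrite /ball/= sub0r opprB ltr_distl; have := sr j jm; lra.
    rewrite mulr1 addrCA lerDl addr_ge0 ?mulr_ge0//.
    by apply: sumr_ge0 => i _; rewrite mulr_ge0.
rewrite (_ : (fun t => (G t)%:E) = (fun t => (M * \1_(`]a, a + dl]) t)%:E +
   (\sum_(j < m) `|f t w - f (s j) w| * \1_(ball (0 : R) r) (s j - t))%:E)%E)//.
rewrite ge0_integralD//.
- apply: leeD.
    rewrite (_ : (fun t => _) = (fun t => M%:E * (\1_(`]a, a + dl]) t)%:E)%E)//.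
    rewrite ge0_integralZl_EFin//; last by apply/measurable_EFinP; exact: measurable_indic.
      rewrite integral_indic// setIT EFinM lee_wpmul2l ?lee_fin//.
      apply: (@le_trans _ _ (leb `]a, (a + dl)%R]%classic)) => //.
      by rewrite lebesgue_measure_itv/=; case: ifPn => _; rewrite -?EFinB lee_fin//; lra.
  rewrite (_ : (fun t => _) = (fun t => \sum_(j < m) (`|f t w - f (s j) w| * \1_(ball (0 : R) r) (s j - t))%:E)%E).
    rewrite ge0_integral_sum//.
    by move=> j; apply/measurable_EFinP; exact: m1.
  by apply/funext => t; rewrite sumEFin.
- by move=> t _; rewrite lee_fin mulr_ge0.
- exact/measurable_EFinP.
- by move=> t _; rewrite lee_fin.
- exact/measurable_EFinP.
Qed.

(* By Lebesgue differentiation the mean oscillation at scale [r] is small on average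
   over [t]; each cell therefore contains a grid point where it is at most average. *)
Lemma step_approximation (a b eps : R) : a < b -> 0 < eps ->
  exists m s, [/\ (forall j, s j <= s j.+1), a <= s 0%N, s m = b &
   (\int[P]_w \int[leb]_(t in `]a, b]) (`|step_path m s f t w - f t w|)%:E <= eps%:E)%E].
Proof.
move=> ab eps0.
pose dl n : R := (b - a) / n.+1%:R.
have dl0 n : 0 < dl n by rewrite divr_gt0 ?subr_gt0.
have dlim : dl n @[n --> \oo] --> (0 : R).
  by rewrite -(mulr0 (b - a)); apply: cvgM; [exact: cvg_cst|exact: cvg_harmonic].
(* Points chosen in two adjacent cells of length [dl n] are less than [2 * dl n] apart. *)
pose r n := dl n *+ 2.
have r0 n : 0 < r n by rewrite pmulrn_lgt0.
have rlim : r n @[n --> \oo] --> (0 : R).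
  by rewrite -(mul0rn _ 2); apply: cvgMn.
pose osc n t w := oscillation f (r n) t w.
have mosc n : measurable_fun setT (fun z : R * Omega => osc n z.1 z.2).
  exact: measurable_oscillation.
have osc0 n t w : (0 <= osc n t w)%E := oscillation_ge0 _ _ _ _.
pose H n t := (\int[P]_w osc n t w)%E.
have H0 n t : (0 <= H n t)%E by apply: integral_ge0 => w _.
pose A n := (\int[P]_w \int[leb]_(t in `[a, b]) ((r n *+ 2)^-1%:E * osc n t w))%E.
have Alim : A n @[n --> \oo] --> 0%E := mean_oscillation_cvg P mf fM a b r0 rlim.
have AE n : A n = ((r n *+ 2)^-1%:E * \int[leb]_(t in `[a, b]) H n t)%E.
  have ri : 0 <= (r n *+ 2)^-1 by rewrite invr_ge0 mulrn_wge0 ?ltW.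
  have [T1 [T2 T3]] := Tonelli_restrict P (measurable_itv `[a, b]) (F := fun z => osc n z.1 z.2)
    (measurable_funTS (mosc n)) (fun z => osc0 n z.1 z.2).
  rewrite /H -T1 -ge0_integralZl_EFin//; last by move=> w _; apply: integral_ge0.
  apply: eq_integral => w _; rewrite -ge0_integralZl_EFin//.
  apply: measurable_funTS.
  by apply: (measurableT_comp (mosc n) (g := fun t => (t, w))); exact: pair2_measurable.
have mH n : measurable_fun setT (H n).
  have [_ [_]] := Tonelli_restrict P measurableT (F := fun z => osc n z.1 z.2)
    (measurable_funTS (mosc n)) (fun z => osc0 n z.1 z.2).
  exact.
have Hle n t : (H n t <= (2 * M * (r n *+ 2))%:E)%E.
  apply: (@le_trans _ _ (\int[P]_w (2 * M * (r n *+ 2))%:E)%E); last by rewrite integral_prob_cst.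
  apply: ge0_le_integral => //.
  - by apply: (measurableT_comp (mosc n) (g := fun w => (t, w))); exact: pair1_measurable.
  - by move=> w _; exact: oscillation_le.
(* Normalizing by [r n *+ 2 = 4 * dl n], the bound [eps / 8] on the mean oscillation contributes
   [eps / 2] to the sum over grid points. The term before [s 0] gives [M * dl n] and the slacks of
   [cell_point] give [(b - a) * dl n], which share the other half. *)
have [n [An dn]] : exists n, (A n <= (eps / 8)%:E)%E /\ (M + (b - a)) * dl n <= eps / 2.
  have e8 : 0 < eps / 8 by rewrite divr_gt0.
  have cM : (M + (b - a)) * dl n @[n --> \oo] --> (0 : R).
    by rewrite -(mulr0 (M + (b - a))); apply: cvgM => //; exact: cvg_cst.
  have e2 : 0 < eps / 2 by rewrite divr_gt0.
  have N1 : \forall n \near \oo, (A n <= (eps / 8)%:E)%E by exact: cvge0_near_le.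
  have N2 : \forall n \near \oo, (M + (b - a)) * dl n <= eps / 2 by exact: cvgr_le cM _ e2.
  have [N _ HN] : \forall n \near \oo, (A n <= (eps / 8)%:E)%E /\ (M + (b - a)) * dl n <= eps / 2.
    by near=> n; split; near: n.
  by exists N; apply: HN => /=.
pose m := n.+1; pose c j : R := a + j%:R * dl n.
have cS j : c j.+1 = c j + dl n by rewrite /c -natr1 mulrDl mul1r addrA.
have cm : c m = b by rewrite /c /dl mulrC divfK// addrC subrK.
have cnd j : c j <= c j.+1 by rewrite cS lerDl ltW.
have cfin j : (\int[leb]_(t in `[c j, c j.+1[) H n t < +oo)%E.
  apply: (@le_lt_trans _ _ (\int[leb]_(t in `[c j, c j.+1[) cst (2 * M * (r n *+ 2))%:E t)%E).
    by apply: ge0_le_integral => //; apply: (measurable_funTS (mH n)).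
  rewrite integral_cst//= lebesgue_measure_itv/=; case: ifPn => _; last by rewrite mule0.
  by rewrite -EFinB -EFinM ltry.
(* A slack of [dl^3] per cell adds up to [(b - a) * dl^2], still small after division by [dl]. *)
have d3 : 0 < dl n ^+ 3 by rewrite exprn_gt0.
have [u Hu] : {u : nat -> R & forall j, c j <= u j < c j.+1 /\
    (H n (u j) * (dl n)%:E <= \int[leb]_(t in `[c j, c j.+1[) H n t + (dl n ^+ 3)%:E)%E}.
  apply: (@choice _ _ (fun j x => c j <= x < c j.+1 /\
    (H n x * (dl n)%:E <= \int[leb]_(t in `[c j, c j.+1[) H n t + (dl n ^+ 3)%:E)%E)) => j.
  have [|x xc xH] := cell_point _ (mH n) (H0 n) d3 (cfin j); first by rewrite cS ltrDl.
  exists x; split=> //; move: xH; rewrite (_ : c j.+1 - c j = dl n)// cS; lra.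
(* Continuing the grid by the constant [b] ends it exactly at [b] and keeps it nondecreasing at all
   indices. *)
pose s j := if (j < m)%N then u j else b.
have sE j : (j < m)%N -> s j = u j by rewrite /s => ->.
have sm : s m = b by rewrite /s ltnn.
have cmono j k : (j <= k)%N -> c j <= c k by exact: (homo_leq (@lexx _ _) (@le_trans _ _) cnd).
have uc j : c j <= u j < c j.+1 by case: (Hu j).
have snd j : s j <= s j.+1.
  rewrite /s; case: (ltnP j.+1 m) => jm.
    by rewrite (ltn_trans (ltnSn j) jm); have := uc j; have := uc j.+1; lra.
  case: ifPn => // jm'; have := uc j; have := cmono j.+1 m jm'; rewrite cm; lra.
have sr j : (j < m)%N -> s j.+1 - s j < r n.
  move=> jm; rewrite (sE j jm) /r mulr2n; have := uc j; rewrite cS => uj.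
  rewrite /s; case: (ltnP j.+1 m) => jm'.
    by have := uc j.+1; rewrite !cS; lra.
  have -> : b = c j.+1 by rewrite -cm; congr c; apply/eqP; rewrite eqn_leq jm jm'.
  have := dl0 n; rewrite cS; lra.
have s0 : a <= s 0%N <= a + dl n.
  have := uc 0%N; rewrite sE// cS.
  have -> : c 0%N = a by rewrite /c mul0r addr0.
  by move=> /andP[-> /ltW ->].
exists m, s; split => //; first by case/andP: s0.
apply: (@le_trans _ _ (\int[P]_w ((M * dl n)%:E + \sum_(j < m) osc n (s j) w))%E).
  apply: ge0_le_integral => //.
  - by move=> w _; apply: integral_ge0.
  - have mS : measurable_fun setT (fun z : R * Omega => `|step_path m s f z.1 z.2 - f z.1 z.2|%:E).
      apply/measurable_EFinP.
      have m2 : measurable_fun setT (fun z : R * Omega => step_path m s f z.1 z.2 - f z.1 z.2).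
        by apply: measurable_funB => //; apply: measurable_step_path => j; exact: mfw.
      exact: (measurableT_comp (@normr_measurable R setT) m2).
    have [_ [T2 _]] := Tonelli_restrict P (measurable_itv `]a, b])
      (F := fun z => `|step_path m s f z.1 z.2 - f z.1 z.2|%:E)
      (measurable_funTS mS) (fun z => normr_ge0 _).
    exact: T2.
  - apply: emeasurable_funD => //; apply: emeasurable_sum => j.
    by apply: (measurableT_comp (mosc n) (g := fun w => (s j, w))); exact: pair1_measurable.
  - by move=> w _; exact: step_error.
have mow j : measurable_fun setT (osc n (s j)).
  by apply: (measurableT_comp (mosc n) (g := fun w => (s j, w))); exact: pair1_measurable.
rewrite ge0_integralD//; last 3 first.
- by move=> w _; rewrite lee_fin mulr_ge0 ?(ltW (dl0 _)).
- by move=> w _; apply: sume_ge0.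
- by apply: emeasurable_sum => j.
rewrite integral_prob_cst ge0_integral_sum//.
have sumH : ((\sum_(j < m) H n (s j)) * (dl n)%:E <=
    \int[leb]_(t in `[a, b]) H n t + (m%:R * dl n ^+ 3)%:E)%E.
  rewrite ge0_sume_distrl//.
  apply: (@le_trans _ _ (\sum_(j < m) (\int[leb]_(t in `[c j, c j.+1[) H n t + (dl n ^+ 3)%:E))%E).
    by apply: lee_sum => j _; rewrite sE//; case: (Hu j).
  rewrite big_split/= sum_integral_cells// sumEFin sumr_const card_ord mulr_natl leeD2r//.
  apply: ge0_subset_integral => //; first exact: (measurable_funTS (mH n)).
  rewrite cm (_ : c 0%N = a) /c ?mul0r ?addr0//; exact: subset_itv_co_cc.
have : (\int[leb]_(t in `[a, b]) H n t <= (4 * dl n * (eps / 8))%:E)%E.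
  have r4 : r n *+ 2 = 4 * dl n by rewrite /r; lra.
  have d4 : 0 < 4 * dl n by rewrite mulr_gt0.
  move: An; rewrite AE r4 => /(lee_wpmul2l (_ : 0 <= (4 * dl n)%:E)%E).
  by rewrite muleA -!EFinM mulfV ?gt_eqF// mul1e lee_fin (ltW d4) => /(_ isT).
move=> /(leeD2r ((m%:R * dl n ^+ 3)%:E)) /(le_trans sumH).
have : (0 <= \sum_(j < m) H n (s j))%E by apply: sume_ge0.
rewrite /H; case: (\sum_(j < m) _)%E => [x| |]//.
  rewrite -!EFinM -!EFinD !lee_fin => x0.
  have -> : m%:R * dl n ^+ 3 = (b - a) * dl n * dl n.
    by rewrite /dl /m; field.
  have -> : 4 * dl n * (eps / 8) + (b - a) * dl n * dl n = (eps / 2 + (b - a) * dl n) * dl n by lra.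
  rewrite ler_pM2r// => xle; apply: le_trans (lerD (lexx _) xle) _.
  by move: dn; lra.
by rewrite mulyr gtr0_sg// mul1e -EFinD leye_eq.
Unshelve. all: by end_near. Qed.

End StepApproximation.

(** * Truncation of the volatility *)

Section Clip.
Context (R : realType).

Definition clip (N x : R) : R := Num.max (- N) (Num.min N x).

Lemma clip_bound N x : 0 <= N -> `|clip N x| <= N.
Proof.
move=> N0; rewrite ler_norml /clip le_max lexx/= ge_max ge_min lexx/= andbT; lra.
Qed.

Lemma clip_id N x : `|x| <= N -> clip N x = x.
Proof. by rewrite ler_norml /clip => /andP[h1 h2]; rewrite (min_r h2) (max_r h1). Qed.

Lemma normr_clip N x : 0 <= N -> `|clip N x| <= `|x|.
Proof.
move=> N0; have [xN|Nx] := leP `|x| N; first by rewrite clip_id.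
exact: le_trans (clip_bound _ N0) (ltW Nx).
Qed.

Lemma measurable_clip N : measurable_fun setT (clip N).
Proof. by apply: measurable_maxr => //; exact: measurable_minr. Qed.

(** The two errors needed later: that of the value enters the stochastic integral through the
    isometry, that of the square enters the integrated variance. *)
Definition clip_error N x : R := (clip N x - x) ^+ 2 + (clip N x ^+ 2 - x ^+ 2) ^+ 2.

Lemma clip_error_ge0 N x : 0 <= clip_error N x.
Proof. by rewrite addr_ge0 ?sqr_ge0. Qed.

Lemma clip_error_le N x : 0 <= N -> clip_error N x <= 2 + 3 * x ^+ 4.
Proof.
move=> N0; rewrite /clip_error.
have h : clip N x ^+ 2 <= x ^+ 2.
  by rewrite -[clip N x ^+ 2]real_normK ?num_real// -[x ^+ 2]real_normK ?num_real// lerXn2r ?nnegrE// normr_clip.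
have h0 := sqr_ge0 (clip N x).
have h1 : (clip N x - x) ^+ 2 <= 4 * x ^+ 2 by have := sqr_ge0 (clip N x + x); nra.
have h2 : (clip N x ^+ 2 - x ^+ 2) ^+ 2 <= x ^+ 2 ^+ 2 by nra.
have -> : x ^+ 4 = x ^+ 2 ^+ 2 by rewrite -exprM.
have := sqr_ge0 (x ^+ 2 - 1); nra.
Qed.

Lemma clip_error_cvg x : clip_error n%:R x @[n --> \oo] --> (0 : R).
Proof.
apply: cvg_near_cst; near=> n; rewrite /clip_error clip_id ?subrr ?expr0n ?addr0//.
by near: n; exact: nbhs_infty_ger.
Unshelve. all: by end_near. Qed.

Lemma measurable_clip_error N : measurable_fun setT (clip_error N).
Proof.
by apply: measurable_funD; apply: measurable_funX; apply: measurable_funB => //;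
  rewrite ?(measurable_clip N)//; first [exact: measurable_clip | apply: measurable_funX; exact: measurable_clip].
Qed.

End Clip.

Section VolatilityApproximation.
Context d (Omega : measurableType d) (R : realType) (P : probability Omega R).
Notation leb := (@lebesgue_measure R).
Variables (sigma : R -> Omega -> R) (T M : R).
Hypothesis msigma : measurable_process sigma.
Hypothesis sigma4 : forall t, 0 <= t <= T -> (\int[P]_w (sigma t w ^+ 4)%:E <= M%:E)%E.

(** Extension to negative times by the initial value, to obtain joint measurability on the whole
    product space. *)
Let sigmap t w := sigma (Num.max 0 t) w.

Let sigmapE t : 0 <= t -> sigmap t = sigma t.
Proof. by move=> t0; apply/funext => w; rewrite /sigmap max_r. Qed.

Let msigmap : measurable_fun setT (fun z : R * Omega => sigmap z.1 z.2).
Proof.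
apply: (measurable_comp (F := [set z : R * Omega | 0 <= z.1]) (f := fun z : R * Omega => sigma z.1 z.2)
  (g := fun z : R * Omega => (Num.max 0 z.1, z.2))) => //.
- rewrite (_ : [set z | _] = (`[0, +oo[ `*` setT)%classic); first exact: measurableX.
  by apply/seteqP; split=> -[x y]/=; rewrite in_itv/= andbT => //; case.
- by move=> _ [z _ <-]/=; rewrite le_max lexx.
- by apply: measurable_fun_pair => //; exact: measurable_maxr.
Qed.

(** Dominated convergence first in [w], then in [t]; the fourth moment integrates the majorant
    [2 + 3 x^4] of [clip_error], uniformly in time. *)
Let clip_cvg (a b : R) : 0 <= a -> b <= T ->
  (\int[P]_w \int[leb]_(t in `]a, b]) (clip_error n%:R (sigmap t w))%:E)%E @[n --> \oo] --> 0%E.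
Proof.
move=> a0 bT.
have mc n : measurable_fun setT (fun z : R * Omega => (clip_error n%:R (sigmap z.1 z.2))%:E).
  by apply/measurable_EFinP; exact: (measurableT_comp (measurable_clip_error _) msigmap).
have T1 n := Tonelli_restrict P (measurable_itv `]a, b]) (measurable_funTS (mc n))
  (fun z => clip_error_ge0 _ _).
rewrite (_ : (fun n => _) = (fun n => (\int[leb]_(t in `]a, b]) \int[P]_w (clip_error n%:R (sigmap t w))%:E)%E)); last first.
  by apply/funext => n; have [] := T1 n.
have ab t : `]a, b]%classic t -> 0 <= t <= T.
  by rewrite /= in_itv/= => /andP[]; lra.
have ms t : measurable_fun setT (sigmap t).
  by apply: (measurableT_comp msigmap (g := fun w => (t, w))); exact: pair1_measurable.
have E4 t : 0 <= t <= T -> (\int[P]_w (2 + 3 * sigmap t w ^+ 4)%:E <= (2 + 3 * M)%:E)%E.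
  move=> tT.
  have m4 : measurable_fun setT (fun w => (sigmap t w ^+ 4)%:E).
    by apply/measurable_EFinP; exact: measurable_funX.
  have e4 w : (0 <= (sigmap t w ^+ 4)%:E)%E by rewrite lee_fin exprn_even_ge0.
  rewrite (_ : (fun w => _) = (fun w => (2 : R)%:E + (3 : R)%:E * (sigmap t w ^+ 4)%:E)%E)//.
  rewrite ge0_integralD//; last 2 first.
  - by move=> w _; rewrite mule_ge0.
  - exact: measurable_funeM.
  rewrite integral_prob_cst ge0_integralZl_EFin//.
  rewrite (EFinD 2 (3 * M)); apply: leeD => //; rewrite EFinM; apply: lee_wpmul2l => //.
  by rewrite sigmapE; [exact: sigma4|case/andP: tT].
have bound n t : `]a, b]%classic t ->
    (\int[P]_w (clip_error n%:R (sigmap t w))%:E <= (2 + 3 * M)%:E)%E.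
  move=> /ab tT; apply: le_trans (E4 t tT); apply: ge0_le_integral => //.
  - by move=> w _; rewrite lee_fin clip_error_ge0.
  - by apply/measurable_EFinP; exact: (measurableT_comp (measurable_clip_error _) (ms t)).
  - apply/measurable_EFinP; apply: measurable_funD => //.
    by apply: measurable_funM => //; exact: measurable_funX.
  - by move=> w _; rewrite lee_fin clip_error_le.
rewrite -[X in _ --> X](@integral0 _ _ _ leb `]a, b]%classic).
apply: (@dominated_cvg _ _ _ leb _ (measurable_itv _) _ _ (cst (2 + 3 * M)%:E)) => //.
- by move=> n; have [_ []] := T1 n.
- move=> t /ab tT; rewrite -(@integral0 _ _ _ P setT).
  apply: (@dominated_cvg _ _ _ P _ measurableT _ _ (fun w => (2 + 3 * sigmap t w ^+ 4)%:E)) => //.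
  + by move=> n; apply/measurable_EFinP; exact: (measurableT_comp (measurable_clip_error _) (ms t)).
  + by move=> w _; apply: cvg_EFin; [exact: nearW|exact: clip_error_cvg].
  + apply/integrableP; split.
      apply/measurable_EFinP; apply: measurable_funD => //.
      by apply: measurable_funM => //; exact: measurable_funX.
    rewrite (eq_integral (fun w => (2 + 3 * sigmap t w ^+ 4)%:E)).
      by apply: le_lt_trans (E4 t tT) _; rewrite ltry.
    by move=> w _; rewrite gee0_abs// lee_fin addr_ge0// mulr_ge0// exprn_even_ge0.
  + by move=> n w _; rewrite gee0_abs ?lee_fin ?clip_error_ge0 ?clip_error_le.
- apply/integrableP; split => //; rewrite integral_cst//= lte_mul_pinfty//.
  by rewrite lebesgue_measure_itv/=; case: ifPn; rewrite ?ltry// -EFinB ltry.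
- move=> n t tab; rewrite gee0_abs ?bound//.
  by apply: integral_ge0 => w _; rewrite lee_fin clip_error_ge0.
Qed.

Lemma step_path_bound (N : R) m s (f : R -> Omega -> R) t w : 0 <= N ->
  (forall j, s j <= s j.+1) -> (forall u v, `|f u v| <= N) -> `|step_path m s f t w| <= N.
Proof.
move=> N0 snd fN; rewrite /step_path.
have [/andP[h1 h2]|h] := boolP (s 0%N < t <= s m).
  have [|j [_ _ ->]] := @step_sum_in R s (fun i => f (s i) w) m t snd; last exact: fN.
  by rewrite h1.
rewrite (@step_sum_out R s (fun i => f (s i) w)) ?normr0//.
by move: h; rewrite negb_and -leNgt -ltNge.
Qed.

(** For values bounded by [N], squares are controlled by the distance itself, so closeness in L1 is
    enough: [2 * 2 N + 2 * 8 N^3] is the resulting factor, and the extra 1 keeps it positive. *)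
Let approx_pointwise (N S f x : R) : `|S| <= N -> `|f| <= N ->
  (S - x) ^+ 2 + (S ^+ 2 - x ^+ 2) ^+ 2 <= (4 * N + 16 * N ^+ 3 + 1) * `|S - f| +
    2 * ((f - x) ^+ 2 + (f ^+ 2 - x ^+ 2) ^+ 2).
Proof.
move=> SN fN; have N0 : 0 <= N := le_trans (normr_ge0 _) SN.
have h0 := normr_ge0 (S - f).
have h1 : `|S - f| <= 2 * N by apply: le_trans (ler_normB _ _) _; lra.
have h2 : (S - f) ^+ 2 <= 2 * N * `|S - f|.
  by rewrite -[(S - f) ^+ 2]real_normK ?num_real// expr2 ler_wpM2r.
have h3 : (S + f) ^+ 2 <= 4 * N ^+ 2.
  have : `|S + f| <= 2 * N by apply: le_trans (ler_normD _ _) _; lra.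
  rewrite -[(S + f) ^+ 2]real_normK ?num_real//; have := normr_ge0 (S + f); nra.
have h4 : (S ^+ 2 - f ^+ 2) ^+ 2 <= 8 * N ^+ 3 * `|S - f|.
  rewrite subr_sqr exprMn.
  have -> : 8 * N ^+ 3 * `|S - f| = (2 * N * `|S - f|) * (4 * N ^+ 2) by ring.
  by rewrite ler_pM ?sqr_ge0.
have h5 : (S - x) ^+ 2 <= 2 * (S - f) ^+ 2 + 2 * (f - x) ^+ 2.
  by have := sqr_ge0 ((S - f) - (f - x)); lra.
have h6 : (S ^+ 2 - x ^+ 2) ^+ 2 <= 2 * (S ^+ 2 - f ^+ 2) ^+ 2 + 2 * (f ^+ 2 - x ^+ 2) ^+ 2.
  by have := sqr_ge0 ((S ^+ 2 - f ^+ 2) - (f ^+ 2 - x ^+ 2)); lra.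
lra.
Qed.

(** The truncation level is fixed first, since the oscillation argument requires bounded paths and
    the factor converting L1 closeness to L2 depends on the level; the grid is chosen afterwards. *)
Lemma volatility_approximation (a b eps : R) : 0 <= a -> a < b -> b <= T -> 0 < eps ->
  exists N m s, let S := step_path m s (fun t w => clip N (sigma t w)) in
  [/\ 0 <= N, forall j, s j <= s j.+1, a <= s 0%N, s m = b &
   (\int[P]_w \int[leb]_(t in `]a, b]) ((S t w - sigma t w) ^+ 2 +
     (S t w ^+ 2 - sigma t w ^+ 2) ^+ 2)%:E <= eps%:E)%E].
Proof.
move=> a0 ab bT eps0.
have e4 : 0 < eps / 4 by rewrite divr_gt0.
have [n _ Hn] : \forall n \near \oo, (\int[P]_w \int[leb]_(t in `]a, b])
    (clip_error n%:R (sigmap t w))%:E <= (eps / 4)%:E)%E.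
  exact: cvge0_near_le (clip_cvg a0 bT) e4.
have {Hn} := Hn n (leqnn n); set N : R := n%:R => HN.
have N0 : 0 <= N by exact: ler0n.
pose C := 4 * N + 16 * N ^+ 3 + 1.
have C0 : 0 < C by rewrite /C ltr_wpDl// addr_ge0 ?mulr_ge0 ?exprn_ge0.
pose f t w := clip N (sigmap t w).
have mf : measurable_fun setT (fun z : R * Omega => f z.1 z.2).
  exact: (measurableT_comp (measurable_clip _) msigmap).
have fN t w : `|f t w| <= N by exact: clip_bound.
(* Budget: [C * (eps / (2 * C))] from the grid and [2 * (eps / 4)] from the truncation. *)
have eC : 0 < eps / (2 * C) by rewrite divr_gt0// mulr_gt0.
have [m [s [snd as0 smb Hs]]] := step_approximation P mf fN ab eC.
have sa j : a <= s j.
  by apply: le_trans as0 _; exact: (homo_leq (@lexx _ _) (@le_trans _ _) snd).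
exists N, m, s => S; split=> //.
have SE t w : S t w = step_path m s f t w.
  apply: eq_bigr => j _; rewrite /f sigmapE//; exact: le_trans a0 (sa _).
have mstep : measurable_fun setT (fun z : R * Omega => step_path m s f z.1 z.2).
  apply: measurable_step_path => j.
  by apply: (measurableT_comp mf (g := fun w => (s j, w))); exact: pair1_measurable.
have mD : measurable_fun setT (fun z : R * Omega => `|step_path m s f z.1 z.2 - f z.1 z.2|).
  have m2 : measurable_fun setT (fun z : R * Omega => step_path m s f z.1 z.2 - f z.1 z.2).
    exact: measurable_funB.
  exact: (measurableT_comp (@normr_measurable R setT) m2).
have mD' : measurable_fun setT (fun z : R * Omega => `|step_path m s f z.1 z.2 - f z.1 z.2|%:E).
  exact/measurable_EFinP.
have mE : measurable_fun setT (fun z : R * Omega => (clip_error N (sigmap z.1 z.2))%:E).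
  by apply/measurable_EFinP; exact: (measurableT_comp (measurable_clip_error _) msigmap).
have [_ [TD _]] := Tonelli_restrict P (measurable_itv `]a, b]) (measurable_funTS mD')
  (fun z => normr_ge0 _).
have [_ [TE _]] := Tonelli_restrict P (measurable_itv `]a, b]) (measurable_funTS mE)
  (fun z => clip_error_ge0 _ _).
have mtD w : measurable_fun `]a, b] (fun t : R => `|step_path m s f t w - f t w|%:E).
  apply: measurable_funTS.
  by apply: (measurableT_comp mD' (g := fun t : R => (t, w))); exact: pair2_measurable.
have mtE w : measurable_fun `]a, b] (fun t : R => (clip_error N (sigmap t w))%:E).
  apply: measurable_funTS.
  by apply: (measurableT_comp mE (g := fun t : R => (t, w))); exact: pair2_measurable.
have D0 t w : (0 <= `|step_path m s f t w - f t w|%:E)%E by rewrite lee_fin.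
have E0 t w : (0 <= (clip_error N (sigmap t w))%:E)%E by rewrite lee_fin clip_error_ge0.
apply: (@le_trans _ _ (\int[P]_w (C%:E * \int[leb]_(t in `]a, b]) `|step_path m s f t w - f t w|%:E +
    (2 : R)%:E * \int[leb]_(t in `]a, b]) (clip_error N (sigmap t w))%:E))%E); last first.
  rewrite ge0_integralD//; last 4 first.
  - by move=> w _; rewrite mule_ge0 ?lee_fin ?(ltW C0)//; apply: integral_ge0.
  - exact: measurable_funeM.
  - by move=> w _; rewrite mule_ge0 ?lee_fin//; apply: integral_ge0.
  - exact: measurable_funeM.
  rewrite !ge0_integralZl_EFin ?(ltW C0)//; last 2 first.
  - by move=> w _; apply: integral_ge0.
  - by move=> w _; apply: integral_ge0.
  apply: (@le_trans _ _ (C%:E * (eps / (2 * C))%:E + (2 : R)%:E * (eps / 4)%:E)%E).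
    by apply: leeD; apply: lee_wpmul2l => //; rewrite lee_fin ?(ltW C0).
  rewrite -!EFinM -EFinD lee_fin le_eqVlt; apply/orP; left; apply/eqP.
  by field; rewrite gt_eqF.
apply: ge0_le_integral_nonmeas => w.
- by apply: integral_ge0 => t _; rewrite lee_fin addr_ge0 ?sqr_ge0.
have -> : (C%:E * \int[leb]_(t in `]a, b]) `|step_path m s f t w - f t w|%:E +
    2%:E * \int[leb]_(t in `]a, b]) (clip_error N (sigmap t w))%:E =
    \int[leb]_(t in `]a, b]) (C%:E * `|step_path m s f t w - f t w|%:E +
      2%:E * (clip_error N (sigmap t w))%:E))%E.
  rewrite ge0_integralD//; last 4 first.
  - by move=> t _; rewrite mule_ge0 ?lee_fin ?(ltW C0).
  - exact: (measurable_funeM _ (mtD w)).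
  - by move=> t _; rewrite mule_ge0.
  - exact: (measurable_funeM _ (mtE w)).
  congr (_ + _)%E; apply/esym.
    exact: (ge0_integralZl_EFin leb (measurable_itv _) (fun t _ => D0 t w) (mtD w) (ltW C0)).
  exact: (ge0_integralZl_EFin leb (measurable_itv _) (fun t _ => E0 t w) (mtE w) (ler0n _ 2)).
have -> : (\int[leb]_(t in `]a, b]) ((S t w - sigma t w) ^+ 2 +
      (S t w ^+ 2 - sigma t w ^+ 2) ^+ 2)%:E =
    \int[leb]_(t in `]a, b]) ((step_path m s f t w - sigmap t w) ^+ 2 +
      (step_path m s f t w ^+ 2 - sigmap t w ^+ 2) ^+ 2)%:E)%E.
  apply: eq_integral => t; rewrite inE/= in_itv/= => /andP[at_ _]; rewrite SE sigmapE//.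
  by apply: ltW; exact: le_lt_trans at_.
apply: ge0_le_integral => //.
- by move=> t _; rewrite lee_fin addr_ge0 ?sqr_ge0.
- apply/measurable_EFinP; apply: measurable_funTS.
  have ms1 : measurable_fun setT (fun t : R => step_path m s f t w).
    by apply: (measurableT_comp mstep (g := fun t : R => (t, w))); exact: pair2_measurable.
  have ms2 : measurable_fun setT (fun t : R => sigmap t w).
    by apply: (measurableT_comp msigmap (g := fun t : R => (t, w))); exact: pair2_measurable.
  by apply: measurable_funD; apply: measurable_funX; apply: measurable_funB => //; exact: measurable_funX.
- by apply: emeasurable_funD; [exact: (measurable_funeM _ (mtD w))|exact: (measurable_funeM _ (mtE w))].
- move=> t _; rewrite -!EFinM -EFinD lee_fin; apply: approx_pointwise => //.
  by apply: step_path_bound.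
Qed.

End VolatilityApproximation.

(** * Ito isometry and the error on one observation cell *)

Lemma integral_normal_id (R : realType) : \int[std_normal R]_x x = 0.
Proof.
have i1 : (std_normal R).-integrable setT (EFin \o (fun x => x)).
  by have := @normal_integrable_pow R 1 isT.
have mE : measurable_fun setT (EFin \o (fun x : R => x)) by exact/measurable_EFinP.
have fp : (\int[std_normal R]_x (EFin \o (fun x : R => x))^\+ x)%E \is a fin_num.
  exact: integrable_pos_fin_num i1.
have E : (\int[std_normal R]_x (EFin \o (fun x : R => x))^\- x =
    \int[std_normal R]_x (EFin \o (fun x : R => x))^\+ x)%E.
  rewrite -[RHS](@integral_normal_oppr R)//; last exact: measurable_funepos.
  by apply: eq_integral => x _; rewrite funenegE funeposE/= EFinN.
by rewrite /Rintegral integralE E subee.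
Qed.

Section IncrementMoments.
Context d (Omega : measurableType d) (R : realType) (P : probability Omega R).
Variables (FF : R -> set (set Omega)) (B : R -> Omega -> R).
Hypotheses (HFF : complete_filtration P FF) (HB : brownian_motion P FF B).
Local Notation at_time := (at_time FF).
Local Notation dB a b := (fun w => B b w - B a w).

Let N := std_normal R.

Lemma increment_mean (a b : R) : 0 <= a -> a <= b ->
  P.-integrable setT (EFin \o dB a b) /\ \int[P]_w dB a b w = 0.
Proof.
move=> a0 ab; have gB := gaussian_increment HB a0 ab.
have i1 : N.-integrable setT (fun x => (Num.sqrt (b - a) * x)%:E).
  exact: (integrableZl _ _ (@normal_integrable_pow R 1 isT)).
have [H1 H2] := gaussian_integral gB (@measurable_id _ _ setT) i1.
split=> //; rewrite H2 RintegralZl ?integral_normal_id ?mulr0//.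
exact: (@normal_integrable_pow R 1 isT).
Qed.

Lemma increment_var (a b : R) : 0 <= a -> a <= b ->
  P.-integrable setT (EFin \o (fun w => dB a b w ^+ 2)) /\ \int[P]_w (dB a b w ^+ 2) = b - a.
Proof.
move=> a0 ab; have gB := gaussian_increment HB a0 ab.
have E x : (Num.sqrt (b - a) * x) ^+ 2 = (b - a) * x ^+ 2.
  by rewrite exprMn sqr_sqrtr// subr_ge0.
have i2 : N.-integrable setT (EFin \o (fun x => (Num.sqrt (b - a) * x) ^+ 2)).
  rewrite (_ : (fun x => _) = (fun x => (b - a) * x ^+ 2)); last exact/funext.
  exact: (integrableZl _ _ (@normal_integrable_pow R 2 isT)).
have [H1 H2] := gaussian_integral gB (@exprn_measurable R setT 2) i2.
split=> //; rewrite H2; under eq_Rintegral do rewrite E.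
rewrite RintegralZl//; last exact: (@normal_integrable_pow R 2 isT).
by have := normal_moment2 R; rewrite /normal_moment => ->; rewrite mulr1.
Qed.

Lemma increment_mul (a b : R) (Y : Omega -> R) : 0 <= a -> a <= b ->
  measurable_fun setT (Y : at_time a -> R) -> P.-integrable setT (EFin \o Y) ->
  [/\ P.-integrable setT (EFin \o (fun w => Y w * dB a b w)),
      \int[P]_w (Y w * dB a b w) = 0,
      P.-integrable setT (EFin \o (fun w => Y w * dB a b w ^+ 2)) &
      \int[P]_w (Y w * dB a b w ^+ 2) = (\int[P]_w Y w) * (b - a)].
Proof.
move=> a0 ab mY iY; have gB := gaussian_increment HB a0 ab.
have mid := at_time_id HFF a0.
have ind := indep_increment HFF HB a0 ab.
have [i1 E1] := increment_mean a0 ab.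
have [i2 E2] := increment_var a0 ab.
have [j1 F1] := indep_mul mid gB.1 ind mY (@measurable_id _ _ setT) iY i1.
have [j2 F2] := indep_mul mid gB.1 ind mY (@exprn_measurable R setT 2) iY i2.
split=> //; first by rewrite -[RHS](mulr0 (\int[P]_w Y w)) -E1.
by rewrite -E2.
Qed.

Let mdB a b t : 0 <= a -> a <= b -> b <= t ->
  measurable_fun setT (dB a b : at_time t -> R).
Proof.
move=> a0 ab bt; apply: measurable_funB.
  by apply: (brownian_measurable HFF HB) => //; exact: le_trans ab.
by apply: (brownian_measurable HFF HB) => //; exact: le_trans bt.
Qed.

Lemma increment_pair_same (a b c K : R) (u : Omega -> R) : 0 <= a -> a <= b -> a <= c ->
  measurable_fun setT (u : at_time a -> R) -> (forall w, `|u w| <= K) ->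
  P.-integrable setT (EFin \o (fun w => u w * (dB a b w * dB a c w))) /\
  \int[P]_w (u w * (dB a b w * dB a c w)) = (\int[P]_w u w) * (Num.min b c - a).
Proof.
move=> a0; wlog bc : b c / b <= c => [H ab ac mu uK|ab ac mu uK].
  have [bc|cb] := leP b c; first by have := H b c bc ab ac mu uK; rewrite (min_l bc).
  have [] := H c b (ltW cb) ac ab mu uK; rewrite (min_l (ltW cb)) => H1 H2.
  have E : (fun w => u w * (dB a b w * dB a c w)) = (fun w => u w * (dB a c w * dB a b w)).
    by apply/funext => w; rewrite [dB a b w * _]mulrC.
  by rewrite E; split.
rewrite (min_l bc); have b0 := le_trans a0 ab.
have iu : P.-integrable setT (EFin \o u).
  by apply: (@bounded_integrable _ _ _ P u K) => //; exact: (at_time_measurable HFF a0 mu).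
have [i1 _ i2 E2] := increment_mul a0 ab mu iu.
have mub : measurable_fun setT ((fun w => u w * dB a b w) : at_time b -> R).
  by apply: measurable_funM; [exact: (at_time_mono HFF a0 ab mu)|exact: mdB].
have [i3 E3 _ _] := increment_mul b0 bc mub i1.
have E : (fun w => u w * (dB a b w * dB a c w)) =
    (fun w => u w * dB a b w ^+ 2 + u w * dB a b w * dB b c w).
  by apply/funext => w; ring.
rewrite E; split.
  exact: (integrableD _ i2 i3).
by rewrite RintegralD// E3 addr0.
Qed.

(** The part of the first increment before [a'] is uncorrelated with the second one; the part after
    [a'] starts at the same time as the second and is treated by [increment_pair_same]. *)
Lemma increment_pair (a b a' b' K K' : R) (v v' : Omega -> R) :
  0 <= a -> a <= a' -> a <= b -> a' <= b' ->
  measurable_fun setT (v : at_time a -> R) -> (forall w, `|v w| <= K) ->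
  measurable_fun setT (v' : at_time a' -> R) -> (forall w, `|v' w| <= K') ->
  P.-integrable setT (EFin \o (fun w => (v w * dB a b w) * (v' w * dB a' b' w))) /\
  \int[P]_w ((v w * dB a b w) * (v' w * dB a' b' w)) =
    (\int[P]_w (v w * v' w)) * Num.max 0 (Num.min b b' - Num.max a a').
Proof.
move=> a0 aa' ab ab' mv vK mv' vK'; have a0' := le_trans a0 aa'.
(* With these, the increment over [[a, b]] is the one over [[a, e]] plus the one over [[a', c]],
   whether or not [b] exceeds [a']; one of the pieces is null when the intervals do not overlap. *)
pose c := Num.max b a'; pose e := Num.min b a'.
have a'c : a' <= c by rewrite /c le_max lexx orbT.
have ae : a <= e by rewrite /e le_min ab.
have ea' : e <= a' by rewrite /e ge_min lexx orbT.
have mva := at_time_mono HFF a0 aa' mv.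
have mvv : measurable_fun setT ((fun w => v w * v' w) : at_time a' -> R).
  exact: measurable_funM.
have vvK w : `|v w * v' w| <= K * K' by rewrite normrM ler_pM.
have [i1 E1] := increment_pair_same a0' a'c ab' mvv vvK.
have ie : P.-integrable setT (EFin \o (fun w => (v w * v' w) * dB a e w)).
  apply: (@dominated_integrable _ _ _ P _ (fun w => (K * K') * (dB a e w ^+ 2 + 1))).
  - apply: measurable_funM; first exact: (at_time_measurable HFF a0' mvv).
    exact: (gaussian_increment HB a0 ae).1.
  - move=> w; rewrite normrM ler_pM//.
    have h := sqr_ge0 (`|dB a e w| - 1).
    by rewrite -[(_ - _) ^+ 2 as X in _ <= X + _]real_normK ?num_real//; have := normr_ge0 (dB a e w); nra.
  - have i1c : P.-integrable setT (EFin \o (fun=> 1)).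
      by apply: (@bounded_integrable _ _ _ P (fun=> 1) 1) => // w; rewrite normr1.
    have id1 := integrableD measurableT (increment_var a0 ae).1 i1c.
    exact: (integrableZl _ (K * K') id1).
have me : measurable_fun setT ((fun w => (v w * v' w) * dB a e w) : at_time a' -> R).
  by apply: measurable_funM => //; exact: mdB.
have [i2 E2 _ _] := increment_mul a0' ab' me ie.
have E : (fun w => (v w * dB a b w) * (v' w * dB a' b' w)) =
    (fun w => (v w * v' w) * dB a e w * dB a' b' w + v w * v' w * (dB a' c w * dB a' b' w)).
  apply/funext => w.
  have -> : dB a b w = dB a e w + dB a' c w.
    by rewrite /e /c; have [ba'|a'b] := leP b a'; ring.
  ring.
rewrite E; split; first exact: (integrableD _ i2 i1).
rewrite RintegralD// E2 add0r E1; congr (_ * _).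
rewrite (max_r aa') /c; have [ba'|a'b] := leP b a'.
  rewrite (min_l ab') subrr max_l// subr_le0; apply: le_trans ba'.
  by rewrite ge_min lexx.
by rewrite max_r// subr_ge0 le_min (ltW a'b).
Qed.

End IncrementMoments.

(** * Isometry for elementary integrands *)

Section ElementaryIsometry.
Context d (Omega : measurableType d) (R : realType) (P : probability Omega R).
Notation leb := (@lebesgue_measure R).
Variables (FF : R -> set (set Omega)) (B : R -> Omega -> R).
Hypotheses (HFF : complete_filtration P FF) (HB : brownian_motion P FF B).
Variables (I : finType) (lo hi : I -> R) (v : I -> Omega -> R) (K : R).
Hypotheses (lo0 : forall i, 0 <= lo i) (lohi : forall i, lo i <= hi i).
Hypothesis mv : forall i, measurable_fun setT (v i : at_time FF (lo i) -> R).
Hypothesis vK : forall i w, `|v i w| <= K.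

(** The intervals may overlap and the index type is arbitrary, so the difference of two step
    integrals on different grids is again of this form, indexed by a disjoint sum. *)
Definition elementary_integral w := \sum_i v i w * (B (hi i) w - B (lo i) w).
Definition elementary_value t w := \sum_i v i w * \1_(`]lo i, hi i]) t.

(** The length of the intersection of two intervals; it is both the covariance factor of the
    increments and the integral of the product of the indicators, which is the whole isometry. *)
Let overlap i j := Num.max 0 (Num.min (hi i) (hi j) - Num.max (lo i) (lo j)).

Let mvT i : measurable_fun setT (v i).
Proof. exact: (at_time_measurable HFF (lo0 i) (@mv i)). Qed.

Let vv_int i j : P.-integrable setT (EFin \o (fun w => v i w * v j w)).
Proof.
apply: (@bounded_integrable _ _ _ P _ (K * K)); first exact: measurable_funM.
by move=> w; rewrite normrM ler_pM.
Qed.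

Let pair i j :
  P.-integrable setT (EFin \o (fun w => (v i w * (B (hi i) w - B (lo i) w)) *
    (v j w * (B (hi j) w - B (lo j) w)))) /\
  \int[P]_w ((v i w * (B (hi i) w - B (lo i) w)) * (v j w * (B (hi j) w - B (lo j) w))) =
    \int[P]_w (v i w * v j w * overlap i j).
Proof.
rewrite RintegralZr//.
wlog ij : i j / lo i <= lo j => [H|].
  have [ij|ji] := leP (lo i) (lo j); first exact: H.
  have [] := H j i (ltW ji).
  have -> : overlap j i = overlap i j by rewrite /overlap minC [Num.max (lo j) _]maxC.
  have -> : (fun w => v j w * (B (hi j) w - B (lo j) w) * (v i w * (B (hi i) w - B (lo i) w))) =
    (fun w => v i w * (B (hi i) w - B (lo i) w) * (v j w * (B (hi j) w - B (lo j) w))).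
    by apply/funext => w; rewrite mulrC.
  have -> : (fun w => v j w * v i w) = (fun w => v i w * v j w).
    by apply/funext => w; rewrite mulrC.
  by split.
exact: (increment_pair HFF HB).
Qed.

Let indic_pair i j :
  (\int[leb]_t (\1_(`]lo i, hi i]) t * \1_(`]lo j, hi j]) t)%:E = (overlap i j)%:E)%E.
Proof.
pose a := Num.max (lo i) (lo j); pose b := Num.min (hi i) (hi j).
transitivity (\int[leb]_t (\1_(`]a, b]) t)%:E)%E.
  apply: eq_integral => t _; rewrite !indicE -natrM mulnb; congr (_ %:R)%:E; congr nat_of_bool.
  apply/idP/idP.
    move=> /andP[]; rewrite !inE/= !in_itv/= /a /b gt_max le_min => /andP[-> ->] /andP[-> ->]//.
  rewrite !inE/= !in_itv/= /a /b gt_max le_min => /andP[/andP[h1 h2] /andP[h3 h4]].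
  by apply/andP; rewrite !inE/= !in_itv/= h1 h2 h3 h4.
rewrite integral_indic// setIT.
apply: (@eq_trans _ _ (leb `]a, b]%classic)); first by [].
rewrite lebesgue_measure_itv/= lte_fin; have [ab|ba] := ltP a b.
  by rewrite -EFinD /overlap -/a -/b max_r// subr_ge0 ltW.
by rewrite /overlap -/a -/b max_l// subr_le0.
Qed.

Let indic_int i j :
  leb.-integrable setT (fun t : R => (\1_(`]lo i, hi i]) t * \1_(`]lo j, hi j]) t)%:E).
Proof.
apply/integrableP; split; first by apply/measurable_EFinP; apply: measurable_funM.
have -> : (\int[leb]_t `|(\1_(`]lo i, hi i]) t * \1_(`]lo j, hi j]) t)%:E| =
    \int[leb]_t (\1_(`]lo i, hi i]) t * \1_(`]lo j, hi j]) t)%:E)%E.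
  by apply: eq_integral => t _; rewrite gee0_abs// lee_fin mulr_ge0.
by rewrite indic_pair ltry.
Qed.

Lemma elementary_value_int w :
  (\int[leb]_t (elementary_value t w ^+ 2)%:E =
   (\sum_i \sum_j v i w * v j w * overlap i j)%:E)%E.
Proof.
have iI i j : leb.-integrable setT (fun t : R => (v i w * v j w * (\1_(`]lo i, hi i]) t * \1_(`]lo j, hi j]) t))%:E).
  exact: (integrableZl _ (v i w * v j w) (indic_int i j)).
rewrite (_ : (fun t => _) = (fun t => \sum_i \sum_j
    (v i w * v j w * (\1_(`]lo i, hi i]) t * \1_(`]lo j, hi j]) t))%:E)%E); last first.
  apply/funext => t; rewrite /elementary_value expr2 big_distrlr/= -sumEFin.
  apply: eq_bigr => i _; rewrite -sumEFin; apply: eq_bigr => j _; congr _%:E; ring.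
rewrite integral_sum//; last by move=> i; apply: integrable_sum.
rewrite -sumEFin; apply: eq_bigr => i _; rewrite integral_sum// -sumEFin; apply: eq_bigr => j _.
rewrite (_ : (fun t => _) = (fun t => (v i w * v j w)%:E *
  (\1_(`]lo i, hi i]) t * \1_(`]lo j, hi j]) t)%:E)%E); last first.
  by apply/funext => t; rewrite EFinM.
by rewrite integralZl ?indic_pair -?EFinM//; exact: indic_int.
Qed.

Lemma elementary_isometry :
  (\int[P]_w (elementary_integral w ^+ 2)%:E =
   \int[P]_w \int[leb]_t (elementary_value t w ^+ 2)%:E)%E.
Proof.
transitivity (\int[P]_w (\sum_i \sum_j v i w * v j w * overlap i j)%:E)%E; last first.
  by apply: eq_integral => w _; rewrite elementary_value_int.
pose f i j w := (v i w * (B (hi i) w - B (lo i) w)) * (v j w * (B (hi j) w - B (lo j) w)).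
pose g i j w := v i w * v j w * overlap i j.
have ig i j : P.-integrable setT (EFin \o g i j) by exact: (integrableZr _ (overlap i j) (vv_int i j)).
have fg i j : (\int[P]_w (f i j w)%:E = \int[P]_w (g i j w)%:E)%E.
  by rewrite (EFin_Rintegral (pair i j).1) (EFin_Rintegral (ig i j)) (pair i j).2.
transitivity (\int[P]_w (\sum_i \sum_j (f i j w)%:E))%E.
  apply: eq_integral => w _; rewrite /elementary_integral expr2 big_distrlr/= -sumEFin.
  by apply: eq_bigr => i _; rewrite -sumEFin.
transitivity (\int[P]_w (\sum_i \sum_j (g i j w)%:E))%E; last first.
  apply: eq_integral => w _; rewrite -sumEFin.
  by apply: eq_bigr => i _; rewrite -sumEFin.
have if' i j : P.-integrable setT (EFin \o f i j) := (pair i j).1.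
rewrite integral_sum//; last by move=> i; apply: integrable_sum => // j _; exact: if'.
rewrite integral_sum//; last by move=> i; apply: integrable_sum => // j _; exact: ig.
apply: eq_bigr => i _; rewrite integral_sum//; last by move=> j; exact: if'.
rewrite integral_sum//; last by move=> j; exact: ig.
by apply: eq_bigr => j _; exact: fg.
Qed.

End ElementaryIsometry.

Section ItoApproximation.
Context d (Omega : measurableType d) (R : realType) (P : probability Omega R).
Notation leb := (@lebesgue_measure R).
Variables (FF : R -> set (set Omega)) (B : R -> Omega -> R).
Hypotheses (HFF : complete_filtration P FF) (HB : brownian_motion P FF B).
Variables (T : R) (H J : R -> Omega -> R).
Hypothesis mH : measurable_process H.
Hypothesis HJ : ito_integral P FF B T H J.
Variables (a b : R).
Hypotheses (a0 : 0 <= a) (ab : a < b) (bT : b <= T).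

Let split_error (A : \bar R) (e : R) : (0 <= A)%E -> 0 < e ->
  (4%:E * (e / 12)%:E + (4%:E * (e / 12)%:E + 2%:E * ((2 * (e / 12))%:E + 2%:E * A)) <=
   4%:E * A + e%:E)%E.
Proof.
case: A => [r| |]//= r0 e0; last first.
  by rewrite [in leRHS]gt0_muley ?lte_fin// addye// leey.
by do ![rewrite -EFinM | rewrite -EFinD]; rewrite lee_fin; lra.
Qed.

Let b0 : 0 <= b := le_trans a0 (ltW ab).

(** Clamping grid points to [[a, b]] restricts a simple process given on [[0, T]] to the cell. *)
Let trunc x := Num.max a (Num.min x b).

Let trunc_itv x : a <= trunc x <= b.
Proof. by rewrite /trunc le_max lexx/= ge_max ge_min lexx orbT andbT (ltW ab). Qed.

Let trunc_mono x y : x <= y -> trunc x <= trunc y.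
Proof.
move=> xy; rewrite /trunc ge_max !le_max lexx/=; apply/orP.
have [ayb|yba] := leP a (Num.min y b); first by right; rewrite le_min !ge_min xy lexx orbT.
by left; rewrite ge_min; apply/orP; move: yba; rewrite gt_min => /orP[h|h]; [left|right]; lra.
Qed.

Let trunc_ge x : x <= b -> x <= trunc x.
Proof. by move=> xb; rewrite /trunc (min_l xb) le_max lexx orbT. Qed.

Let trunc_diff w x : B (Num.min x b) w - B (Num.min x a) w = B (trunc x) w - B a w.
Proof.
rewrite /trunc; have [xb|bx] := leP x b.
  by have [xa|ax] := leP x a; rewrite ?subrr.
by rewrite (min_r (ltW (lt_trans ab bx))) (max_r (ltW ab)).
Qed.

Let trunc_indic x y t : a < t <= b ->
  \1_(`]trunc x, trunc y]) t = \1_(`]x, y]) t :> R.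
Proof.
move=> /andP[at_ tb]; rewrite !indicE; congr (_ %:R); congr nat_of_bool.
rewrite /trunc; apply/idP/idP; rewrite !inE/= !in_itv/= gt_max le_max at_ gt_min le_min tb andbT/=.
  by rewrite (leNgt t a) at_/= => /andP[/orP[h|h] ->]; rewrite ?h//; lra.
by move=> /andP[-> ->]; rewrite orbT.
Qed.

Variables (m : nat) (s : nat -> R) (v : nat -> Omega -> R) (K : R).
Hypotheses (s_nd : forall j, s j <= s j.+1) (as0 : a <= s 0%N) (smb : s m = b).
Hypothesis mv : forall j, measurable_fun setT (v j : at_time FF (s j) -> R).
Hypothesis vK : forall j w, `|v j w| <= K.

Let S t w := \sum_(j < m) v j w * \1_(`]s j, s j.+1]) t.
Let X w := \sum_(j < m) v j w * (B (s j.+1) w - B (s j) w).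

Let s_mono i j : (i <= j)%N -> s i <= s j.
Proof. exact: (homo_leq (@lexx _ _) (@le_trans _ _) s_nd). Qed.

Let s_ge j : a <= s j.
Proof. exact: le_trans as0 (s_mono (leq0n j)). Qed.

(** The approximant of the Ito integral and the step process of the cell live on unrelated grids;
    their difference is one elementary integrand indexed by the disjoint sum of the two index
    sets. *)
Let simple_isometry (Sk : step_process Omega R) : simple_process FF T Sk ->
  (\int[P]_w ((step_integral B Sk b w - step_integral B Sk a w - X w) ^+ 2)%:E =
   \int[P]_w \int[leb]_(t in `]a, b]) ((step_value Sk t w - S t w) ^+ 2)%:E)%E.
Proof.
case: Sk => -[m' s'] v' [s'0 s'm s'nd Hv'].
have [K' vK'] : exists K' : R, forall j, (j < m')%N -> forall w, `|v' j w| <= K'.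
  have : forall k, (k <= m')%N -> exists K' : R, forall j, (j < k)%N -> forall w, `|v' j w| <= K'.
    elim=> [|k IH] km; first by exists 0.
    have [K1 H1] := IH (ltnW km); have [_ [K2 H2]] := Hv' k km.
    exists (Num.max K1 K2) => j; rewrite ltnS leq_eqVlt => /predU1P[->|jk] w.
      by rewrite le_max H2 orbT.
    by rewrite le_max H1.
  by move=> /(_ m' (leqnn _)).
have s'ge j : (j <= m')%N -> 0 <= s' j.
  elim: j => [|j IH] jm; first by rewrite s'0.
  by apply: le_trans (IH (ltnW jm)) _; exact: s'nd.
pose I : finType := ('I_m' + 'I_m)%type.
pose lo (i : I) := match i with inl j => trunc (s' j) | inr j => s j end.
pose hi (i : I) := match i with inl j => trunc (s' j.+1) | inr j => s j.+1 end.
(* A grid point beyond [b] is clamped to [b], at which [v' j] need not be measurable yet; its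
   clamped interval is empty, so its coefficient is set to 0. The minus sign realizes the
   difference. *)
pose u (i : I) : Omega -> R := match i with
  | inl j => if s' j <= b then v' j else (fun=> 0) | inr j => fun w => - v j w end.
have lo0 i : 0 <= lo i.
  case: i => j /=; last exact: le_trans a0 (s_ge j).
  by case/andP: (trunc_itv (s' j)) => h _; exact: le_trans h.
have lohi i : lo i <= hi i by case: i => j //=; apply: trunc_mono; exact: s'nd.
have mu i : measurable_fun setT (u i : at_time FF (lo i) -> R).
  case: i => j /=; last exact: measurableT_comp.
  case: ifPn => // sb; have s'j := s'ge j (ltnW (ltn_ord j)).
  apply: (at_time_mono HFF s'j (trunc_ge sb)).
  apply: sub_measurable_fun; first exact: (filtration_sigma HFF).
  by case: (Hv' j (ltn_ord j)).
have uK i w : `|u i w| <= Num.max K K'.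
  case: i => j /=; last by rewrite normrN le_max vK.
  have k0 := le_trans (normr_ge0 _) (vK' j (ltn_ord j) w).
  case: ifPn => _; first by rewrite le_max (vK' _ (ltn_ord j)) orbT.
  by rewrite normr0 le_max k0 orbT.
have := elementary_isometry HFF HB lo0 lohi mu uK.
have -> : (fun w => (elementary_integral B lo hi u w ^+ 2)%:E) = (fun w =>
    ((step_integral B (m', s', v') b w - step_integral B (m', s', v') a w - X w) ^+ 2)%:E).
  apply/funext => w; congr ((_ ^+ 2)%:E).
  rewrite /elementary_integral /step_integral big_sumType/= /X -sumrB -sumrN; congr (_ + _).
    apply: eq_bigr => j _; rewrite -mulrBr opprB.
    have E1 := trunc_diff w (s' j); have E2 := trunc_diff w (s' j.+1).
    case: ifPn => sb; first by congr (_ * _); lra.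
    have bs : b < s' j by rewrite ltNge.
    have bs1 : b < s' j.+1 by apply: lt_le_trans bs _; exact: s'nd.
    rewrite !(min_r (ltW bs)) !(min_r (ltW bs1)) !(min_r (ltW (lt_trans ab bs))).
    by rewrite !(min_r (ltW (lt_trans ab bs1))) mul0r; ring.
  by apply: eq_bigr => j _; rewrite mulNr.
move=> ->; apply: eq_integral => w _; rewrite [RHS]integral_mkcond.
apply: eq_integral => t _; rewrite patchE.
case: ifPn => [|nt].
  rewrite inE/= in_itv/= => tab; congr ((_ ^+ 2)%:E).
  rewrite /elementary_value big_sumType/= /S -sumrN; congr (_ + _).
    apply: eq_bigr => j _; rewrite trunc_indic//.
    case: ifPn => // sb; rewrite mul0r indicE memNset ?mulr0//= in_itv/=.
    by apply/negP; rewrite negb_and -leNgt ltW//; move: sb tab; rewrite -ltNge; lra.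
  by apply: eq_bigr => j _; rewrite mulNr.
rewrite /elementary_value big1 ?expr0n// => i _.
rewrite indicE memNset ?mulr0//= in_itv/= => /andP[h1 h2]; move: nt; rewrite notin_setE/= in_itv/=.
have : a <= lo i /\ hi i <= b.
  case: i h1 h2 => j /= _ _; last by rewrite s_ge -smb s_mono.
  by case/andP: (trunc_itv (s' j)); case/andP: (trunc_itv (s' j.+1)).
by case=> h3 h4; apply; apply/andP; split; [exact: le_lt_trans h1|exact: le_trans h4].
Qed.

Let mvT j : measurable_fun setT (v j).
Proof. exact: (at_time_measurable HFF (le_trans a0 (s_ge j)) (@mv j)). Qed.

Let mB t : 0 <= t -> measurable_fun setT (B t).
Proof. by move=> t0; exact: (at_time_measurable HFF t0 (brownian_measurable HFF HB t0 (lexx t))). Qed.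

Let mJ t : 0 <= t -> measurable_fun setT (J t).
Proof.
move=> t0; apply: (at_time_measurable HFF t0); apply: sub_measurable_fun.
  exact: (filtration_sigma HFF).
by case: HJ => adJ _; exact: adJ.
Qed.

Let mX : measurable_fun setT X.
Proof.
apply: measurable_sum => j; apply: measurable_funM => //.
by apply: measurable_funB; apply: mB; apply: le_trans a0 (s_ge _).
Qed.

Let mS : measurable_fun setT (fun z : R * Omega => S z.1 z.2).
Proof.
apply: measurable_sum => j; apply: measurable_funM.
  exact: (measurableT_comp (@mvT j) measurable_snd).
have m1 : measurable_fun setT (\1_(`]s j, s j.+1]) : R -> R) by exact: measurable_indic.
exact: (measurableT_comp m1 measurable_fst).
Qed.

Let mHab : measurable_fun (`]a, b] `*` setT) (fun z : R * Omega => H z.1 z.2).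
Proof.
apply: measurable_funS mH => //.
  rewrite (_ : [set z | _] = (`[0, +oo[ `*` setT)%classic); first exact: measurableX.
  by apply/seteqP; split=> -[x y]/=; rewrite in_itv/= andbT => //; case.
by move=> -[t w] [/=]; rewrite in_itv/= => /andP[h _] _; exact: ltW (le_lt_trans a0 h).
Qed.

(** The isometry is available for step processes only, so the simple processes defining the Ito
    integral serve as a bridge: close to [H] and [J] by definition, and compared with the step
    process of the cell by [simple_isometry]. *)
Lemma ito_step_error :
  (\int[P]_w ((J b w - J a w - X w) ^+ 2)%:E <=
   4%:E * \int[P]_w \int[leb]_(t in `]a, b]) ((S t w - H t w) ^+ 2)%:E)%E.
Proof.
set A := (\int[P]_w \int[leb]_(t in _) _)%E.
case: HJ => _ [Sk [HSk cS cJ]].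
have abT t : `]a, b]%classic t -> 0 <= t <= T by rewrite /= in_itv/= => /andP[h1 h2]; rewrite (ltW (le_lt_trans a0 h1)) (le_trans h2 bT).
apply/lee_addgt0Pr => e e0; have e12 : 0 < e / 12 by rewrite divr_gt0.
have aT : 0 <= a <= T by rewrite a0 (le_trans (ltW ab) bT).
have bT' : 0 <= b <= T by rewrite b0.
have N1 := cvge0_near_le cS e12.
have N2 := cvge0_near_le (cJ _ aT) e12.
have N3 := cvge0_near_le (cJ _ bT') e12.
have [k [_ Hk]] : exists k, True /\ [/\
   (\int[P]_w \int[leb]_(t in `[0%R, T]) ((step_value (Sk k) t w - H t w) ^+ 2)%:E <= (e / 12)%:E)%E,
   ('E_P[fun w => ((step_integral B (Sk k) a w - J a w) ^+ 2)%R] <= (e / 12)%:E)%E &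
   ('E_P[fun w => ((step_integral B (Sk k) b w - J b w) ^+ 2)%R] <= (e / 12)%:E)%E].
  have [k _ Hk] : \forall k \near \oo, [/\
   (\int[P]_w \int[leb]_(t in `[0%R, T]) ((step_value (Sk k) t w - H t w) ^+ 2)%:E <= (e / 12)%:E)%E,
   ('E_P[fun w => ((step_integral B (Sk k) a w - J a w) ^+ 2)%R] <= (e / 12)%:E)%E &
   ('E_P[fun w => ((step_integral B (Sk k) b w - J b w) ^+ 2)%R] <= (e / 12)%:E)%E].
    by near=> k; split; near: k.
  by exists k; split=> //; apply: Hk => /=.
case: Hk; rewrite unlock => h1 h2 h3.
have iso := simple_isometry (HSk k).
move: (HSk k) h1 h2 h3 iso; set Z := Sk k => Zs h1 h2 h3 iso.
have mZv : measurable_fun setT (fun z : R * Omega => step_value Z z.1 z.2) /\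
    forall t, 0 <= t -> measurable_fun setT (step_integral B Z t).
  case: Z Zs {h1 h2 h3 iso} => -[m' s'] v' [s'0 s'm s'nd Hv'].
  have s'ge j : (j <= m')%N -> 0 <= s' j.
    elim: j => [|j IH] jm; first by rewrite s'0.
    by apply: le_trans (IH (ltnW jm)) _; exact: s'nd.
  have mv' (j : 'I_m') : measurable_fun setT (v' j).
    have s'j := s'ge j (ltnW (ltn_ord j)).
    apply: (at_time_measurable HFF s'j); apply: sub_measurable_fun.
      exact: (filtration_sigma HFF).
    by case: (Hv' j (ltn_ord j)).
  split=> [|t t0].
    apply: measurable_sum => j; apply: measurable_funM.
      exact: (measurableT_comp (mv' j) measurable_snd).
    have m1 : measurable_fun setT (\1_(`]s' j, s' j.+1]) : R -> R) by exact: measurable_indic.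
    exact: (measurableT_comp m1 measurable_fst).
  apply: measurable_sum => j; apply: measurable_funM => //.
  by apply: measurable_funB; apply: mB; rewrite le_min t0 s'ge// ltnW.
case: mZv => mZ mI.
pose F z := ((step_value Z z.1 z.2 - H z.1 z.2) ^+ 2)%:E.
pose G z := ((S z.1 z.2 - H z.1 z.2) ^+ 2)%:E.
have mF : measurable_fun (`]a, b] `*` setT) F.
  by apply/measurable_EFinP; apply: measurable_funX; apply: measurable_funB => //; exact: measurable_funTS.
have mG : measurable_fun (`]a, b] `*` setT) G.
  by apply/measurable_EFinP; apply: measurable_funX; apply: measurable_funB => //; exact: measurable_funTS.
have [_ [TF _]] := Tonelli_restrict P (measurable_itv `]a, b]) mF (fun z => sqr_ge0 _).
have [_ [TG _]] := Tonelli_restrict P (measurable_itv `]a, b]) mG (fun z => sqr_ge0 _).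
have mFt w : measurable_fun `]a, b] (fun t : R => F (t, w)).
  apply: (measurable_comp (F := (`]a, b] `*` setT)%classic) (f := F)) => //.
  - exact: measurableX.
  - by move=> _ [t ht <-].
  - by apply: measurable_funTS; exact: pair2_measurable.
have mGt w : measurable_fun `]a, b] (fun t : R => G (t, w)).
  apply: (measurable_comp (F := (`]a, b] `*` setT)%classic) (f := G)) => //.
  - exact: measurableX.
  - by move=> _ [t ht <-].
  - by apply: measurable_funTS; exact: pair2_measurable.
have F0 z : (0 <= F z)%E by rewrite lee_fin sqr_ge0.
have G0 z : (0 <= G z)%E by rewrite lee_fin sqr_ge0.
have iF : (\int[P]_w \int[leb]_(t in `]a, b]) F (t, w) <= (e / 12)%:E)%E.
  apply: le_trans h1; apply: ge0_le_integral_nonmeas => w; first exact: integral_ge0.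
  rewrite [leLHS]integral_mkcond [leRHS]integral_mkcond.
  apply: ge0_le_integral_nonmeas => t; first by rewrite patchE; case: ifPn.
  rewrite !patchE; case: ifPn => [|_]; last by case: ifPn => // _; rewrite lee_fin sqr_ge0.
  by rewrite inE => /abT tT; rewrite mem_set//= in_itv.
have iD : (\int[P]_w ((step_integral B Z b w - step_integral B Z a w - X w) ^+ 2)%:E <=
    (2 * (e / 12))%:E + 2%:E * A)%E.
  rewrite iso; apply: (@le_trans _ _ (\int[P]_w (2%:E * \int[leb]_(t in `]a, b]) F (t, w) +
      2%:E * \int[leb]_(t in `]a, b]) G (t, w)))%E).
    apply: ge0_le_integral_nonmeas => w; first by apply: integral_ge0 => t _; rewrite lee_fin sqr_ge0.
    rewrite -(ge0_integralZl_EFin leb (measurable_itv _) (fun t _ => F0 (t, w)) (mFt w) (ler0n R 2)).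
    rewrite -(ge0_integralZl_EFin leb (measurable_itv _) (fun t _ => G0 (t, w)) (mGt w) (ler0n R 2)).
    rewrite -ge0_integralD//; last 4 first.
    - by move=> t _; rewrite mule_ge0.
    - exact: (measurable_funeM _ (mFt w)).
    - by move=> t _; rewrite mule_ge0.
    - exact: (measurable_funeM _ (mGt w)).
    rewrite [leLHS]integral_mkcond [leRHS]integral_mkcond.
    apply: ge0_le_integral_nonmeas => t; rewrite !patchE; case: ifPn => // _.
      by rewrite lee_fin sqr_ge0.
    rewrite /F /G -!EFinM -EFinD lee_fin/=.
    by have := sqr_ge0 ((step_value Z t w - H t w) + (S t w - H t w)); lra.
  rewrite ge0_integralD//; last 4 first.
  - by move=> w _; rewrite mule_ge0//; exact: integral_ge0.
  - exact: (measurable_funeM _ TF).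
  - by move=> w _; rewrite mule_ge0//; exact: integral_ge0.
  - exact: (measurable_funeM _ TG).
  rewrite (ge0_integralZl_EFin P measurableT _ TF (ler0n R 2)); last first.
    by move=> w _; exact: integral_ge0.
  rewrite (ge0_integralZl_EFin P measurableT _ TG (ler0n R 2)); last first.
    by move=> w _; exact: integral_ge0.
  by apply: leeD => //; rewrite EFinM; apply: lee_wpmul2l.
have mJa := mJ a0; have mJb := mJ b0; have mIa := mI a a0; have mIb := mI b b0.
pose u w := (step_integral B Z a w - J a w) ^+ 2.
pose u' w := (step_integral B Z b w - J b w) ^+ 2.
pose u'' w := (step_integral B Z b w - step_integral B Z a w - X w) ^+ 2.
have mu1 : measurable_fun setT (EFin \o u).
  by apply/measurable_EFinP; apply: measurable_funX; exact: measurable_funB.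
have mu2 : measurable_fun setT (EFin \o u').
  by apply/measurable_EFinP; apply: measurable_funX; exact: measurable_funB.
have mu3 : measurable_fun setT (EFin \o u'').
  apply/measurable_EFinP; apply: measurable_funX; apply: measurable_funB => //.
  exact: measurable_funB.
have u0 w : (0 <= (EFin \o u) w)%E by rewrite lee_fin sqr_ge0.
have u'0 w : (0 <= (EFin \o u') w)%E by rewrite lee_fin sqr_ge0.
have u''0 w : (0 <= (EFin \o u'') w)%E by rewrite lee_fin sqr_ge0.
(* The difference is [(J b - y) - (J a - x) + (y - x - X)], whence the weights 4, 4 and 2. With the
   bounds [e / 12], [e / 12] and [2 * (e / 12) + 2 * A] the total is [4 * A + e]. *)
apply: (@le_trans _ _ (\int[P]_w (4%:E * (EFin \o u) w + (4%:E * (EFin \o u') w + 2%:E * (EFin \o u'') w)))%E).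
  apply: ge0_le_integral_nonmeas => w; first by rewrite lee_fin sqr_ge0.
  rewrite /= -!EFinM -!EFinD lee_fin /u /u' /u''.
  set x := step_integral B Z a w; set y := step_integral B Z b w.
  have := sqr_ge0 ((J b w - y) - (J a w - x) - (y - x - X w)).
  by have := sqr_ge0 ((J b w - y) + (J a w - x)); lra.
rewrite ge0_integralD//; last 4 first.
- by move=> w _; rewrite mule_ge0.
- exact: measurable_funeM.
- by move=> w _; rewrite adde_ge0// mule_ge0.
- by apply: emeasurable_funD; exact: measurable_funeM.
rewrite ge0_integralD//; last 4 first.
- by move=> w _; rewrite mule_ge0.
- exact: measurable_funeM.
- by move=> w _; rewrite mule_ge0.
- exact: measurable_funeM.
rewrite (ge0_integralZl_EFin P measurableT (fun w _ => u0 w) mu1 (ler0n R 4)).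
rewrite (ge0_integralZl_EFin P measurableT (fun w _ => u'0 w) mu2 (ler0n R 4)).
rewrite (ge0_integralZl_EFin P measurableT (fun w _ => u''0 w) mu3 (ler0n R 2)).
have A0 : (0 <= A)%E by apply: integral_ge0 => w _; apply: integral_ge0 => t _; exact: (G0 (t, w)).
apply: (@le_trans _ _ (4%:E * (e / 12)%:E + (4%:E * (e / 12)%:E + 2%:E * ((2 * (e / 12))%:E + 2%:E * A)))%E).
  by apply: leeD; [exact: lee_wpmul2l|apply: leeD; exact: lee_wpmul2l].
exact: split_error.
Unshelve. all: by end_near. Qed.

End ItoApproximation.

(** * Freezing the volatility *)

Section Decoupling.
Context d (Omega : measurableType d) (R : realType) (P : probability Omega R).
Variables (FF : R -> set (set Omega)) (B : R -> Omega -> R).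
Hypotheses (HFF : complete_filtration P FF) (HB : brownian_motion P FF B).
Variables (mu sigma : R -> Omega -> R).
Hypothesis mmu : forall t, 0 <= t -> measurable_fun setT (mu t).
Hypothesis msigma : forall t, 0 <= t -> measurable_fun setT (sigma t).
Hypothesis Hlev : non_leverage P mu sigma B.

Definition coefficient_algebra := g_sigma_algebraType (process_events mu `|` process_events sigma).
Definition noise_algebra := g_sigma_algebraType (process_events B).

Let mB t : 0 <= t -> measurable_fun setT (B t).
Proof. by move=> t0; exact: (at_time_measurable HFF t0 (brownian_measurable HFF HB t0 (lexx t))). Qed.

Lemma coefficient_id : measurable_fun setT (id : Omega -> coefficient_algebra).
Proof.
apply: measurable_idsub => A [] [t t0 [U mU <-]]; rewrite setTI.
  by rewrite -[_ @^-1` _]setTI; exact: mmu.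
by rewrite -[_ @^-1` _]setTI; exact: msigma.
Qed.

Lemma noise_id : measurable_fun setT (id : Omega -> noise_algebra).
Proof.
apply: measurable_idsub => A [t t0 [U mU <-]]; rewrite setTI.
by rewrite -[_ @^-1` _]setTI; exact: mB.
Qed.

Lemma coefficient_noise_indep :
  indep_rv P (id : Omega -> coefficient_algebra) (id : Omega -> noise_algebra).
Proof. by move=> A C mA mC; exact: Hlev. Qed.

Lemma sigma_coefficient t : 0 <= t -> measurable_fun setT (sigma t : coefficient_algebra -> R).
Proof.
move=> t0 _ U mU; rewrite setTI; apply: sub_sigma_algebra; right; exists t => //.
by exists U => //; rewrite setTI.
Qed.

Lemma brownian_noise t : 0 <= t -> measurable_fun setT (B t : noise_algebra -> R).
Proof.
move=> t0 _ U mU; rewrite setTI; apply: sub_sigma_algebra; exists t => //.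
by exists U => //; rewrite setTI.
Qed.

Variables (t : nat -> R) (m : nat -> nat) (s : nat -> nat -> R) (v : nat -> nat -> Omega -> R).
Hypotheses (t0 : forall i, 0 <= t i) (s_nd : forall i j, s i j <= s i j.+1).
Hypotheses (ts : forall i, t i <= s i 0%N) (st : forall i, s i (m i) = t i.+1).
Hypothesis mv : forall i j, measurable_fun setT (v i j : coefficient_algebra -> R).
Variables (a : nat -> R) (n : nat) (l : R).

Definition cell_integral i w := \sum_(j < m i) v i j w * (B (s i j.+1) w - B (s i j) w).
Definition cell_var i w := \sum_(j < m i) v i j w ^+ 2 * (s i j.+1 - s i j).
Definition cell_quad w := \sum_(i < n) a i * (cell_integral i w ^+ 2 - cell_var i w).

Let rate w := `|l| ^+ 3 * \sum_(i < n) `|a i * cell_var i w| ^+ 3.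
Let limit w := expR (- (l ^+ 2 * \sum_(i < n) (a i * cell_var i w) ^+ 2)).

Let s_mono i j k : (j <= k)%N -> s i j <= s i k.
Proof. exact: (homo_leq (@lexx _ _) (@le_trans _ _) (s_nd i)). Qed.

Let s0 i j : 0 <= s i j.
Proof. exact: le_trans (t0 i) (le_trans (ts i) (s_mono i (leq0n j))). Qed.

(** Coefficients read the first coordinate and Brownian increments the second; the diagonal gives
    back [cell_integral]. *)
Let J i (z : coefficient_algebra * noise_algebra) :=
  \sum_(j < m i) v i j z.1 * (B (s i j.+1) z.2 - B (s i j) z.2).
Let U z := \sum_(i < n) a i * (J i z ^+ 2 - cell_var i z.1).

Let mvar i : measurable_fun setT (cell_var i : coefficient_algebra -> R).
Proof. by apply: measurable_sum => j; apply: measurable_funM => //; apply: measurable_funX. Qed.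

Let mU : measurable_fun setT U.
Proof.
apply: measurable_sum => i; apply: measurable_funM => //; apply: measurable_funB.
  apply: measurable_funX; apply: measurable_sum => j; apply: measurable_funM.
    exact: (measurableT_comp (@mv i j) measurable_fst).
  apply: measurable_funB.
    exact: (measurableT_comp (brownian_noise (s0 i j.+1)) measurable_snd).
  exact: (measurableT_comp (brownian_noise (s0 i j)) measurable_snd).
exact: (measurableT_comp (mvar i) measurable_fst).
Qed.

(** For a fixed first coordinate the coefficients are numbers, so each cell carries a Wiener
    integral: [block] supplies the Gaussian law, the adaptedness and the independence that
    [lindeberg_quad] asks for. *)
Let inner w :
  `|\int[P]_u cos (l * U (w, u)) - limit w| <= 2 * (chi_moment3 R + 1) * rate w /\
  `|\int[P]_u sin (l * U (w, u))| <= (chi_moment3 R + 1) * rate w.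
Proof.
pose Jw i u := block B (s i) (fun j => v i j w) (m i) u.
have J1 i : gaussian P (cell_var i w) (Jw i).
  exact: (block_gaussian HFF HB (s := s i) (fun j => v i j w) (s0 i 0%N) (s_nd i) (m i)).
have J2 i : measurable_fun setT (Jw i : at_time FF (t i.+1) -> R).
  rewrite -st.
  exact: (block_at_time HFF HB (s := s i) (fun j => v i j w) (s0 i 0%N) (s_nd i)).
have J3 i : indep_rv P (id : Omega -> at_time FF (t i)) (Jw i).
  have ind := block_indep HFF HB (s := s i) (fun j => v i j w) (s0 i 0%N) (s_nd i) (m i).
  move=> A C mA mC; apply: ind => //.
  have h := filtration_mono HFF (t0 i) (ts i).
  apply: sub_sigma_algebra; apply: h.
  by rewrite -(sigma_algebra_id (filtration_sigma HFF (t0 i))).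
have V0 i : 0 <= cell_var i w.
  by apply: sumr_ge0 => j _; rewrite mulr_ge0 ?sqr_ge0// subr_ge0.
have t_nd i : t i <= t i.+1 by rewrite -st; apply: le_trans (ts i) (s_mono i (leq0n _)).
have [H1 H2] := lindeberg_quad HFF a (t0 0%N) t_nd V0 J1 J2 J3 l n.
by split; [exact: H1|exact: H2].
Qed.

Let mrate : measurable_fun setT (rate : coefficient_algebra -> R).
Proof.
apply: measurable_funM => //; apply: measurable_sum => i; apply: measurable_funX.
by apply: measurableT_comp => //; apply: measurable_funM.
Qed.

Let mlimit : measurable_fun setT (limit : coefficient_algebra -> R).
Proof.
apply: measurableT_comp => //; apply: measurableT_comp => //; apply: measurable_funM => //.
by apply: measurable_sum => i; apply: measurable_funX; apply: measurable_funM.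
Qed.

Let rate_ge0 w : 0 <= rate w.
Proof. by rewrite mulr_ge0 ?exprn_ge0//; apply: sumr_ge0 => i _; rewrite exprn_ge0. Qed.

Let limit01 w : 0 <= limit w <= 1.
Proof.
rewrite expR_ge0 -expR0 ler_expR oppr_le0 mulr_ge0 ?sqr_ge0//.
by apply: sumr_ge0 => i _; rewrite sqr_ge0.
Qed.

Let C0 : 0 <= chi_moment3 R + 1.
Proof. by rewrite addr_ge0// chi_moment3_ge0. Qed.

(** The cap is the trivial bound for a difference of values in [[-1, 1]]; it makes the error
    integrable without third moments of the cell variances. *)
Let bound w := Num.min 2 (2 * (chi_moment3 R + 1) * rate w).

Let mbound : measurable_fun setT bound.
Proof.
apply: measurable_minr => //; apply: measurable_funM => //.
exact: (measurableT_comp mrate coefficient_id).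
Qed.

Let bound_int : P.-integrable setT (EFin \o bound).
Proof.
apply: (@bounded_integrable _ _ _ P _ 2) => // w.
rewrite ger0_norm /bound; first by rewrite ge_min lexx.
by rewrite le_min ler0n mulr_ge0// mulr_ge0.
Qed.

(* Under [P], the coefficients [v] and the noise [B] have the joint law of their
   independent product, so [v] may be frozen when integrating over the noise. *)
Lemma decoupled_lindeberg :
  `|\int[P]_w cos (l * cell_quad w) - \int[P]_w limit w| <= \int[P]_w bound w /\
  `|\int[P]_w sin (l * cell_quad w)| <= \int[P]_w bound w.
Proof.
have mc : measurable_fun setT (fun z => cos (l * U z)) by exact: (measurableT_comp (measurable_cosM l) mU).
have ms : measurable_fun setT (fun z => sin (l * U z)) by exact: (measurableT_comp (measurable_sinM l) mU).
have Ec := indep_Rintegral coefficient_id noise_id coefficient_noise_indep mc (fun z => cos_max _).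
have Es := indep_Rintegral coefficient_id noise_id coefficient_noise_indep ms (fun z => sin_max _).
have mid : measurable_fun setT (fun z : Omega * Omega => (z.1, z.2) : coefficient_algebra * noise_algebra).
  apply: measurable_fun_pair; first exact: (measurableT_comp coefficient_id measurable_fst).
  exact: (measurableT_comp noise_id measurable_snd).
have mic : measurable_fun setT (fun w : Omega => \int[P]_u cos (l * U (w, u)) : R).
  apply: (@measurable_bounded_fubini1 _ _ _ _ _ P P (fun z : Omega * Omega => cos (l * U (z.1, z.2))) 1).
    exact: (measurableT_comp mc mid).
  by move=> z; exact: cos_max.
have mis : measurable_fun setT (fun w : Omega => \int[P]_u sin (l * U (w, u)) : R).
  apply: (@measurable_bounded_fubini1 _ _ _ _ _ P P (fun z : Omega * Omega => sin (l * U (z.1, z.2))) 1).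
    exact: (measurableT_comp ms mid).
  by move=> z; exact: sin_max.
have mcu w : measurable_fun setT (fun u : Omega => cos (l * U (w, u))).
  apply: (measurableT_comp (f := fun y => cos (l * U (w, y))) _ noise_id).
  by apply: (measurableT_comp mc (g := fun y => (w, y))); exact: pair1_measurable.
have msu w : measurable_fun setT (fun u : Omega => sin (l * U (w, u))).
  apply: (measurableT_comp (f := fun y => sin (l * U (w, y))) _ noise_id).
  by apply: (measurableT_comp ms (g := fun y => (w, y))); exact: pair1_measurable.
have c1 w : `|\int[P]_u cos (l * U (w, u))| <= 1.
  by apply: normr_Rintegral_le1 => // u; exact: cos_max.
have s1 w : `|\int[P]_u sin (l * U (w, u))| <= 1.
  by apply: normr_Rintegral_le1 => // u; exact: sin_max.
have ml : measurable_fun setT limit by exact: (measurableT_comp mlimit coefficient_id).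
have ic : P.-integrable setT (EFin \o (fun w => \int[P]_u cos (l * U (w, u)))).
  exact: (@bounded_integrable _ _ _ P _ 1).
have is_ : P.-integrable setT (EFin \o (fun w => \int[P]_u sin (l * U (w, u)))).
  exact: (@bounded_integrable _ _ _ P _ 1).
have il : P.-integrable setT (EFin \o limit).
  apply: (@bounded_integrable _ _ _ P _ 1) => // w.
  by have /andP[h1 h2] := limit01 w; rewrite ger0_norm.
have -> : \int[P]_w cos (l * cell_quad w) = \int[P]_w \int[P]_u cos (l * U (w, u)) by exact: Ec.
have -> : \int[P]_w sin (l * cell_quad w) = \int[P]_w \int[P]_u sin (l * U (w, u)) by exact: Es.
split.
  rewrite -RintegralB//; apply: le_trans (le_normr_Rintegral _ _) _ => //.
    exact: (integrableB _ ic il).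
  apply: le_Rintegral => //; first by apply: integrable_norm; exact: (integrableB _ ic il).
  move=> w _; rewrite /bound le_min (inner w).1 andbT.
  apply: le_trans (ler_normB _ _) _; have /andP[h1 h2] := limit01 w.
  by rewrite (ger0_norm h1); have := c1 w; lra.
apply: le_trans (le_normr_Rintegral _ is_) _ => //.
apply: le_Rintegral => //; first exact: integrable_norm.
move=> w _; rewrite /bound le_min; apply/andP; split; first by have := s1 w; lra.
apply: le_trans (inner w).2 _.
by have := mulr_ge0 C0 (rate_ge0 w); lra.
Qed.

End Decoupling.

Lemma ge0_integral_le_lin d (T : measurableType d) (R : realType)
    (mu : {measure set T -> \bar R}) (D : set T) (I : Type) (r : seq I)
    (c : I -> R) (g : I -> T -> \bar R) (f : T -> \bar R) : measurable D ->
  (forall x, D x -> (0 <= f x)%E) -> (forall i, 0 <= c i) ->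
  (forall i, measurable_fun D (g i)) -> (forall i x, (0 <= g i x)%E) ->
  (forall x, D x -> (f x <= \sum_(i <- r) (c i)%:E * g i x)%E) ->
  (\int[mu]_(x in D) f x <= \sum_(i <- r) (c i)%:E * \int[mu]_(x in D) g i x)%E.
Proof.
move=> mD f0 c0 mg g0 fg.
have -> : (\sum_(i <- r) (c i)%:E * \int[mu]_(x in D) g i x =
    \int[mu]_(x in D) (\sum_(i <- r) (c i)%:E * g i x))%E.
  rewrite ge0_integral_sum//; last 2 first.
  - by move=> i; apply: measurable_funeM.
  - by move=> i x _; rewrite mule_ge0 ?lee_fin.
  by apply: eq_bigr => i _; rewrite ge0_integralZl_EFin.
rewrite [leLHS]integral_mkcond [leRHS]integral_mkcond.
apply: ge0_le_integral_nonmeas => x; rewrite !patchE; case: ifPn => //.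
  by rewrite inE => /f0.
by rewrite inE => /fg.
Qed.

(** * Cauchy-Schwarz on a time interval *)

Section PathIntegrals.
Context (R : realType).
Notation leb := (@lebesgue_measure R).
Variables (a b : R).
Hypothesis ab : a < b.
Let D : set R := `]a, b]%classic.

Let lebD : leb D = (b - a)%:E.
Proof. by rewrite /D lebesgue_measure_itv/= lte_fin ab -EFinB. Qed.

Let lebDfin : (leb D < +oo)%E. Proof. by rewrite lebD ltry. Qed.

Let mD : measurable D. Proof. exact: measurable_itv. Qed.

Lemma itv_cst_integrable (c : R) : leb.-integrable D (EFin \o (fun=> c)).
Proof.
apply: measurable_bounded_integrable => //.
exists `|c|; split; first exact: num_real.
by move=> x cx y _ /=; exact: ltW.
Qed.

Lemma itv_integral_cst (c : R) : (\int[leb]_(t in D) c%:E = (c * (b - a))%:E)%E.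
Proof. by rewrite integral_cst//= lebD. Qed.

Lemma sqr_integrable (f : R -> R) : measurable_fun D f ->
  (\int[leb]_(t in D) (f t ^+ 2)%:E < +oo)%E -> leb.-integrable D (EFin \o f).
Proof.
move=> mf f2; apply/integrableP; split; first exact/measurable_EFinP.
apply: (@le_lt_trans _ _ (\int[leb]_(t in D) (1%:E + (f t ^+ 2)%:E))%E).
  apply: ge0_le_integral => //.
  - by apply: measurableT_comp => //; exact/measurable_EFinP.
  - by apply: emeasurable_funD => //; apply/measurable_EFinP; exact: measurable_funX.
  - move=> t _; rewrite /= -EFinD lee_fin.
    rewrite -[f t ^+ 2]real_normK ?num_real//; have := sqr_ge0 (`|f t| - 1).
    have := normr_ge0 (f t); nra.
rewrite ge0_integralD//; last 2 first.
- by move=> t _; rewrite lee_fin sqr_ge0.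
- by apply/measurable_EFinP; exact: measurable_funX.
by rewrite itv_integral_cst lte_add_pinfty// ltry.
Qed.

(** Cauchy-Schwarz against the constant 1, read off from the nonnegativity of the integral of
    [(f - c)^2] with [c] the mean value of [f]. *)
Lemma sqr_Rintegral_le (f : R -> R) : measurable_fun D f ->
  (((\int[leb]_(t in D) f t) ^+ 2)%:E <= (b - a)%:E * \int[leb]_(t in D) (f t ^+ 2)%:E)%E.
Proof.
move=> mf; have ba : 0 < b - a by rewrite subr_gt0.
have i20 : (0 <= \int[leb]_(t in D) (f t ^+ 2)%:E)%E.
  by apply: integral_ge0 => t _; rewrite lee_fin sqr_ge0.
have [f2|] := ltP (\int[leb]_(t in D) (f t ^+ 2)%:E)%E +oo%E; last first.
  by rewrite leye_eq => /eqP ->; rewrite gt0_muley ?lte_fin// leey.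
have i1 := sqr_integrable mf f2.
have i2 : leb.-integrable D (EFin \o (fun t => f t ^+ 2)).
  apply/integrableP; split; first by apply/measurable_EFinP; exact: measurable_funX.
  rewrite (_ : (\int[leb]_(x in D) _)%E = (\int[leb]_(t in D) (f t ^+ 2)%:E)%E)//.
  by apply: eq_integral => t _ /=; rewrite ger0_norm// sqr_ge0.
set I1 := \int[leb]_(t in D) f t; pose c := I1 / (b - a).
have E2 : (\int[leb]_(t in D) (f t ^+ 2)%:E = (\int[leb]_(t in D) (f t ^+ 2))%:E)%E.
  by rewrite /Rintegral fineK// ge0_fin_numE.
rewrite E2 -EFinM lee_fin.
have ic : leb.-integrable D (EFin \o (fun t => (2 * c) * f t)) by exact: (integrableZl _ (2 * c) i1).
have icc := itv_cst_integrable (c ^+ 2).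
have H : 0 <= \int[leb]_(t in D) (f t ^+ 2 - (2 * c) * f t + c ^+ 2).
  apply: Rintegral_ge0 => t _.
  have -> : f t ^+ 2 - (2 * c) * f t + c ^+ 2 = (f t - c) ^+ 2 by ring.
  exact: sqr_ge0.
have i3 : leb.-integrable D (EFin \o (fun t => f t ^+ 2 - (2 * c) * f t)).
  exact: (integrableB _ i2 ic).
have cE : \int[leb]_(t in D) (c ^+ 2) = c ^+ 2 * (b - a).
  by rewrite /D Rintegral_cst// leb_itv_oc// ltW.
move: H; rewrite RintegralD// RintegralB// RintegralZl// cE.
rewrite -/I1; set I2 := \int[leb]_(t in D) _ => H.
have -> : I1 ^+ 2 = (b - a) * (2 * c * I1 - c ^+ 2 * (b - a)).
  by rewrite /c; field; rewrite gt_eqF.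
by rewrite ler_wpM2l ?(ltW ba)//; lra.
Qed.

(** If the right side is finite, [f - g] is square integrable, hence [f] is integrable and the two
    integrals may be subtracted; otherwise there is nothing to prove. *)
Lemma sqr_RintegralB_le (f g : R -> R) : measurable_fun D f -> leb.-integrable D (EFin \o g) ->
  (((\int[leb]_(t in D) f t - \int[leb]_(t in D) g t) ^+ 2)%:E <=
    (b - a)%:E * \int[leb]_(t in D) ((f t - g t) ^+ 2)%:E)%E.
Proof.
move=> mf ig; have mg : measurable_fun D g.
  by have /measurable_EFinP := measurable_int _ ig.
have mfg : measurable_fun D (fun t => f t - g t) by exact: measurable_funB.
have [f2|] := ltP (\int[leb]_(t in D) ((f t - g t) ^+ 2)%:E)%E +oo%E; last first.
  by rewrite leye_eq => /eqP ->; rewrite gt0_muley ?lte_fin ?subr_gt0// leey.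
have ifg := sqr_integrable mfg f2.
have if_ : leb.-integrable D (EFin \o f).
  have := integrableD _ ifg ig => /(_ mD).
  by apply: eq_integrable => // t _; rewrite /= -EFinD subrK.
by have := sqr_Rintegral_le mfg; rewrite RintegralB.
Qed.

End PathIntegrals.

Lemma measurable_path_Rintegral d (Omega : measurableType d) (R : realType)
    (F : R * Omega -> R) (E : set R) : measurable E ->
  measurable_fun (E `*` setT) F ->
  measurable_fun setT (fun w => \int[@lebesgue_measure R]_(t in E) F (t, w)).
Proof.
move=> mE mF.
pose Fp z := (Num.max (F z) 0)%:E; pose Fn z := (Num.max (- F z) 0)%:E.
have mFp : measurable_fun (E `*` setT) Fp.
  by apply/measurable_EFinP; apply: measurable_maxr.
have mFn : measurable_fun (E `*` setT) Fn.
  by apply/measurable_EFinP; apply: measurable_maxr => //; exact: measurableT_comp.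
have p0 z : (0 <= Fp z)%E by rewrite lee_fin le_max lexx orbT.
have n0 z : (0 <= Fn z)%E by rewrite lee_fin le_max lexx orbT.
(* Only measurability in [w] is extracted here; the Dirac mass merely supplies some probability on
   [Omega]. *)
have [_ [mp _]] := Tonelli_restrict (dirac (point : Omega) : probability Omega R) mE mFp p0.
have [_ [mn _]] := Tonelli_restrict (dirac (point : Omega) : probability Omega R) mE mFn n0.
rewrite (_ : (fun w => _) = (fun w => fine (\int[@lebesgue_measure R]_(t in E) Fp (t, w) -
    \int[@lebesgue_measure R]_(t in E) Fn (t, w))%E)); last first.
  apply/funext => w; rewrite /Rintegral integralE; congr (fine (_ - _)%E).
    by apply: eq_integral => t _; rewrite funeposE/= -EFin_max.
  by apply: eq_integral => t _; rewrite funenegE/= -EFin_max.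
apply: measurableT_comp => //; exact: emeasurable_funB.
Qed.

(** * One observation cell *)

Section CellError.
Context d (Omega : measurableType d) (R : realType) (P : probability Omega R).
Notation leb := (@lebesgue_measure R).
Variables (FF : R -> set (set Omega)) (B : R -> Omega -> R).
Hypotheses (HFF : complete_filtration P FF) (HB : brownian_motion P FF B).
Variables (T M : R) (mu sigma X : R -> Omega -> R).
Hypotheses (mu_measurable : measurable_process mu) (sigma_measurable : measurable_process sigma).
Hypothesis sigma_adapted : adapted FF sigma.
Hypothesis HX : ito_process P FF B T mu sigma X.
Hypothesis M1 : 1 <= M.
Hypothesis mu4 : forall t, 0 <= t <= T -> (\int[P]_w (mu t w ^+ 4)%:E <= M%:E)%E.
Hypothesis sigma4 : forall t, 0 <= t <= T -> (\int[P]_w (sigma t w ^+ 4)%:E <= M%:E)%E.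

Lemma process_on (Y : R -> Omega -> R) (E : set R) : measurable_process Y ->
  (forall t, E t -> 0 <= t) -> measurable E ->
  measurable_fun (E `*` setT) (fun z : R * Omega => Y z.1 z.2).
Proof.
move=> mY E0 mE; apply: measurable_funS mY.
- rewrite (_ : [set z | _] = (`[0, +oo[ `*` setT)%classic); first exact: measurableX.
  by apply/seteqP; split=> -[x y]/=; rewrite in_itv/= andbT => //; case.
- by move=> -[t w] [/= /E0].
Qed.

Lemma process_section (Y : R -> Omega -> R) (E : set R) w : measurable_process Y ->
  (forall t, E t -> 0 <= t) -> measurable E -> measurable_fun E (Y ^~ w).
Proof.
move=> mY E0 mE.
apply: (measurable_comp (F := (E `*` setT)%classic) (f := fun z : R * Omega => Y z.1 z.2)
  (g := fun t : R => (t, w))).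
- exact: measurableX.
- by move=> _ [t ht <-].
- exact: process_on.
- by apply: measurable_funTS; exact: pair2_measurable.
Qed.

Lemma process_at (Y : R -> Omega -> R) t : measurable_process Y -> 0 <= t ->
  measurable_fun setT (Y t).
Proof.
move=> mY t0.
apply: (measurable_comp (F := [set z : R * Omega | 0 <= z.1]) (f := fun z : R * Omega => Y z.1 z.2)
  (g := fun w => (t, w))).
- rewrite (_ : [set z | _] = (`[0, +oo[ `*` setT)%classic); first exact: measurableX.
  by apply/seteqP; split=> -[x y]/=; rewrite in_itv/= andbT => //; case.
- by move=> _ [w _ <-].
- exact: mY.
- exact: pair1_measurable.
Qed.

Let sqr_moment (Y : R -> Omega -> R) : measurable_process Y ->
  (forall t, 0 <= t <= T -> (\int[P]_w (Y t w ^+ 4)%:E <= M%:E)%E) ->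
  forall t, 0 <= t <= T -> (\int[P]_w (Y t w ^+ 2)%:E <= M%:E)%E.
Proof.
move=> mY Y4 t tT; have t0 : 0 <= t by case/andP: tT.
have mYt := process_at mY t0.
have arith2 : 2^-1 + 2^-1 * M <= M by move: M1; lra.
have arith (y : R) : y <= 2^-1 * 1 + 2^-1 * y ^+ 2 by have := sqr_ge0 (y - 1); lra.
have := @ge0_integral_le_lin _ _ _ P setT bool [:: true; false] (fun=> 2^-1)
  (fun b w => if b then 1%:E else (Y t w ^+ 4)%:E) (fun w => (Y t w ^+ 2)%:E) measurableT.
rewrite !big_cons big_nil/= integral_prob_cst adde0 => H.
apply: (@le_trans _ _ ((2^-1)%:E * 1%:E + (2^-1)%:E * M%:E)%E).
  apply: le_trans (H _ _ _ _ _) _.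
  - by move=> w _; rewrite lee_fin sqr_ge0.
  - by move=> _; rewrite invr_ge0.
  - by case=> //; apply/measurable_EFinP; exact: measurable_funX.
  - by case=> w; rewrite lee_fin// exprn_even_ge0.
  - move=> w _; rewrite !big_cons big_nil adde0 -!EFinM -EFinD lee_fin.
    have -> : Y t w ^+ 4 = Y t w ^+ 2 ^+ 2 by rewrite -exprM.
    exact: arith.
  by apply: leeD => //; apply: lee_wpmul2l; [rewrite lee_fin invr_ge0|exact: Y4].
by rewrite mule1 -EFinM -EFinD lee_fin.
Qed.

Lemma sqr_moment_itv (Y : R -> Omega -> R) (a b : R) : measurable_process Y ->
  (forall t, 0 <= t <= T -> (\int[P]_w (Y t w ^+ 4)%:E <= M%:E)%E) ->
  0 <= a -> a < b -> b <= T ->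
  (\int[P]_w \int[leb]_(t in `]a, b]) (Y t w ^+ 2)%:E <= (M * (b - a))%:E)%E /\
  measurable_fun setT (fun w => \int[leb]_(t in `]a, b]) (Y t w ^+ 2)%:E)%E.
Proof.
move=> mY Y4 a0 ab bT.
have ab0 t : `]a, b]%classic t -> 0 <= t <= T.
  by rewrite /= in_itv/= => /andP[h1 h2]; rewrite (ltW (le_lt_trans a0 h1)) (le_trans h2 bT).
have m2 : measurable_fun (`]a, b] `*` setT) (fun z : R * Omega => (Y z.1 z.2 ^+ 2)%:E).
  apply/measurable_EFinP; apply: measurable_funX; apply: process_on => // t /ab0.
  by case/andP.
have [-> [H1 H2]] := Tonelli_restrict P (measurable_itv `]a, b]) m2 (fun z => sqr_ge0 _).
split; last exact: H1.
rewrite -(itv_integral_cst ab); apply: ge0_le_integral => //.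
- by move=> t _; apply: integral_ge0 => w _; rewrite lee_fin sqr_ge0.
- by move=> t /ab0; exact: sqr_moment.
Qed.

Variables (a b : R).
Hypotheses (a0 : 0 <= a) (ab : a < b) (bT : b <= T).
Variables (N : R) (m : nat) (s : nat -> R).
Hypotheses (N0 : 0 <= N) (s_nd : forall j, s j <= s j.+1) (as0 : a <= s 0%N) (smb : s m = b).

Let v j w := clip N (sigma (s j) w).
Let S t w := step_path m s (fun t w => clip N (sigma t w)) t w.
Let Jc w := \sum_(j < m) v j w * (B (s j.+1) w - B (s j) w).
Let Ic w := \sum_(j < m) v j w ^+ 2 * (s j.+1 - s j).

Let s_mono i j : (i <= j)%N -> s i <= s j.
Proof. exact: (homo_leq (@lexx _ _) (@le_trans _ _) s_nd). Qed.

Let s_ge j : a <= s j. Proof. exact: le_trans as0 (s_mono (leq0n j)). Qed.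
Let s0 j : 0 <= s j. Proof. exact: le_trans a0 (s_ge j). Qed.

(** The intervals are disjoint, so at most one term is nonzero at any [t]. This identifies [Ic] as
    the time integral of the squared step process. *)
Let step_sqr t w : S t w ^+ 2 = \sum_(j < m) v j w ^+ 2 * \1_(`]s j, s j.+1]) t.
Proof.
rewrite /S /step_path.
have [/andP[h1 h2]|h] := boolP (s 0%N < t <= s m).
  have [|j [jm tj E]] := @step_sum_in R s (v ^~ w) m t s_nd; first by rewrite h1.
  have [|k [km tk E2]] := @step_sum_in R s (fun j => v j w ^+ 2) m t s_nd; first by rewrite h1.
  rewrite [X in X ^+ 2 = _]E E2.
  suff -> : j = k by [].
  apply/eqP; rewrite eqn_leq; apply/andP; split; rewrite leqNgt; apply/negP => jk.
    by have := s_mono jk; lra.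
  by have := s_mono jk; lra.
have {}h : (t <= s 0%N) || (s m < t) by move: h; rewrite negb_and -leNgt -ltNge.
by rewrite (@step_sum_out R s (v ^~ w))// (@step_sum_out R s (fun j => v j w ^+ 2))// expr0n.
Qed.

Let step_sqr_int (E : set R) w : measurable E -> `]a, b]%classic `<=` E ->
  (\int[leb]_(t in E) (S t w ^+ 2)%:E = (Ic w)%:E)%E.
Proof.
move=> mE abE.
rewrite (_ : (fun t => _) = (fun t => \sum_(j < m) (v j w ^+ 2)%:E * (\1_(`]s j, s j.+1]) t)%:E)%E); last first.
  by apply/funext => t; rewrite step_sqr -sumEFin.
have m1 j : measurable_fun E (fun t : R => (\1_(`]s j, s j.+1]) t : R)%:E).
  by apply/measurable_EFinP; apply: measurable_funTS; exact: measurable_indic.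
rewrite ge0_integral_sum//; last 2 first.
- by move=> j; exact: (measurable_funeM _ (m1 j)).
- by move=> j t _; rewrite -EFinM lee_fin mulr_ge0// sqr_ge0.
rewrite -sumEFin; apply: eq_bigr => j _.
have i0 (t : R) : E t -> (0 <= (\1_(`]s j, s j.+1]) t : R)%:E)%E by rewrite lee_fin.
apply: eq_trans (ge0_integralZl_EFin leb mE i0 (m1 j) (sqr_ge0 (v j w))) _.
rewrite integral_indic// setIidl.
  rewrite (EFinM (v j w ^+ 2)); congr (_ * _)%E.
  apply: (@eq_trans _ _ (leb `]s j, s j.+1]%classic)); first by [].
  rewrite lebesgue_measure_itv/=; case: ifPn; rewrite ?EFinB// -leNgt => ss.
  move: ss; rewrite lee_fin => ss.
  have -> : s j.+1 = s j by apply/le_anti; rewrite ss s_nd.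
  by rewrite -EFinB subrr.
move=> t; rewrite /= in_itv/= => /andP[h1 h2]; apply: abE; rewrite /= in_itv/=.
by rewrite (le_lt_trans (s_ge j) h1)/= -smb (le_trans h2)// s_mono.
Qed.

Let mvs j : measurable_fun setT (v j : at_time FF (s j) -> R).
Proof.
apply: (measurableT_comp (measurable_clip N)); apply: sub_measurable_fun.
  exact: (filtration_sigma HFF).
exact: sigma_adapted.
Qed.

Let vN j w : `|v j w| <= N. Proof. exact: clip_bound. Qed.

Let mv j : measurable_fun setT (v j).
Proof. exact: (measurableT_comp (measurable_clip N) (process_at sigma_measurable (s0 j))). Qed.

Let mIc : measurable_fun setT Ic.
Proof. by apply: measurable_sum => j; apply: measurable_funM => //; exact: measurable_funX. Qed.

Let mB t : 0 <= t -> measurable_fun setT (B t).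
Proof. by move=> t0; exact: (at_time_measurable HFF t0 (brownian_measurable HFF HB t0 (lexx t))). Qed.

Let mJc : measurable_fun setT Jc.
Proof.
by apply: measurable_sum => j; apply: measurable_funM => //; apply: measurable_funB; exact: mB.
Qed.

Variable eta : R.
Hypothesis S_approx : (\int[P]_w \int[leb]_(t in `]a, b]) ((S t w - sigma t w) ^+ 2 +
     (S t w ^+ 2 - sigma t w ^+ 2) ^+ 2)%:E <= eta%:E)%E.

Let ab0 t : `]a, b]%classic t -> 0 <= t.
Proof. by rewrite /= in_itv/= => /andP[h1 h2]; exact: ltW (le_lt_trans a0 h1). Qed.

Let mS : measurable_fun (`]a, b] `*` setT) (fun z : R * Omega => S z.1 z.2).
Proof. by apply: measurable_funTS; apply: measurable_step_path => j; exact: mv. Qed.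

Let ms : measurable_fun (`]a, b] `*` setT) (fun z : R * Omega => sigma z.1 z.2).
Proof. exact: process_on. Qed.

Let dif1 z := ((S z.1 z.2 - sigma z.1 z.2) ^+ 2)%:E.
Let dif2 z := ((S z.1 z.2 ^+ 2 - sigma z.1 z.2 ^+ 2) ^+ 2)%:E.

Let approx1 : (\int[P]_w \int[leb]_(t in `]a, b]) dif1 (t, w) <= eta%:E)%E /\
  measurable_fun setT (fun w => \int[leb]_(t in `]a, b]) dif1 (t, w))%E.
Proof.
have m1 : measurable_fun (`]a, b] `*` setT) dif1.
  by apply/measurable_EFinP; apply: measurable_funX; exact: measurable_funB.
have [_ [H _]] := Tonelli_restrict P (measurable_itv `]a, b]) m1 (fun z => sqr_ge0 _).
split; last exact: H.
apply: le_trans S_approx; apply: ge0_le_integral_nonmeas => w.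
  by apply: integral_ge0 => t _; rewrite lee_fin sqr_ge0.
rewrite [leLHS]integral_mkcond [leRHS]integral_mkcond.
apply: ge0_le_integral_nonmeas => t; rewrite !patchE; case: ifPn => // _; rewrite lee_fin ?sqr_ge0//.
by rewrite lerDl sqr_ge0.
Qed.

Let approx2 : (\int[P]_w \int[leb]_(t in `]a, b]) dif2 (t, w) <= eta%:E)%E /\
  measurable_fun setT (fun w => \int[leb]_(t in `]a, b]) dif2 (t, w))%E.
Proof.
have m1 : measurable_fun (`]a, b] `*` setT) dif2.
  by apply/measurable_EFinP; apply: measurable_funX; apply: measurable_funB; exact: measurable_funX.
have [_ [H _]] := Tonelli_restrict P (measurable_itv `]a, b]) m1 (fun z => sqr_ge0 _).
split; last exact: H.
apply: le_trans S_approx; apply: ge0_le_integral_nonmeas => w.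
  by apply: integral_ge0 => t _; rewrite lee_fin sqr_ge0.
rewrite [leLHS]integral_mkcond [leRHS]integral_mkcond.
apply: ge0_le_integral_nonmeas => t; rewrite !patchE; case: ifPn => // _; rewrite lee_fin ?sqr_ge0//.
by rewrite lerDr sqr_ge0.
Qed.

(** The isometry turns this into the mean of the integral of [S^2], and
    [S^2 <= 2 sigma^2 + 2 (S - sigma)^2]. *)
Let J_sqr : (\int[P]_w (Jc w ^+ 2)%:E <= (2 * M * (b - a) + 2 * eta)%:E)%E.
Proof.
have lohi (j : 'I_m) : s j <= s j.+1 by exact: s_nd.
have iso := @elementary_isometry _ _ _ P FF B HFF HB 'I_m (fun j => s j) (fun j => s j.+1)
  (fun j => v j) N (fun j => s0 j) lohi (fun j => @mvs j) (fun j w => vN j w).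
rewrite (_ : (fun w => (Jc w ^+ 2)%:E) =
  (fun w => (elementary_integral B (fun j : 'I_m => s j) (fun j => s j.+1) (fun j => v j) w ^+ 2)%:E))// iso.
have [D1 mD1] := approx1.
have [D3 mD3] := sqr_moment_itv sigma_measurable sigma4 a0 ab bT.
apply: (@le_trans _ _ (\int[P]_w (2%:E * \int[leb]_(t in `]a, b]) (sigma t w ^+ 2)%:E +
   2%:E * \int[leb]_(t in `]a, b]) dif1 (t, w)))%E).
  apply: ge0_le_integral_nonmeas => w; first by apply: integral_ge0 => t _; rewrite lee_fin sqr_ge0.
  have E1 := @step_sqr_int setT w measurableT (@subsetT _ _).
  have E2 := @step_sqr_int `]a, b]%classic w (measurable_itv _) (fun _ => id).
  have msw : measurable_fun `]a, b] (sigma ^~ w) by exact: process_section.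
  have mSw : measurable_fun `]a, b] (S ^~ w).
    apply: (measurable_comp (F := (`]a, b] `*` setT)%classic) (f := fun z : R * Omega => S z.1 z.2)
      (g := fun t : R => (t, w))).
    - exact: measurableX.
    - by move=> _ [t ht <-].
    - exact: mS.
    - by apply: measurable_funTS; exact: pair2_measurable.
  have := @ge0_integral_le_lin _ _ _ leb `]a, b]%classic bool [:: true; false] (fun=> 2)
    (fun c t => if c then (sigma t w ^+ 2)%:E else dif1 (t, w)) (fun t => (S t w ^+ 2)%:E) (measurable_itv _).
  rewrite !big_cons big_nil/= adde0 E2 -E1; apply.
  - by move=> t _; rewrite lee_fin sqr_ge0.
  - by [].
  - case; apply/measurable_EFinP; apply: measurable_funX => //; exact: measurable_funB.
  - by case=> t; rewrite lee_fin sqr_ge0.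
  - move=> t _; rewrite !big_cons big_nil adde0 -!EFinM -EFinD lee_fin.
    by have := sqr_ge0 (sigma t w - (S t w - sigma t w)); rewrite /=; lra.
have := @ge0_integral_le_lin _ _ _ P setT bool [:: true; false] (fun=> 2)
  (fun c w => if c then \int[leb]_(t in `]a, b]) (sigma t w ^+ 2)%:E else \int[leb]_(t in `]a, b]) dif1 (t, w))%E
  (fun w => 2%:E * \int[leb]_(t in `]a, b]) (sigma t w ^+ 2)%:E +
   2%:E * \int[leb]_(t in `]a, b]) dif1 (t, w))%E measurableT.
rewrite !big_cons big_nil/= adde0 => H; apply: le_trans (H _ _ _ _ _) _.
- by move=> w _; rewrite adde_ge0// mule_ge0//; apply: integral_ge0 => t _; rewrite lee_fin sqr_ge0.
- by [].
- by case.
- by case=> w; apply: integral_ge0 => t _; rewrite lee_fin sqr_ge0.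
- by move=> w _; rewrite !big_cons big_nil adde0.
rewrite -mulrA (EFinD (2 * (M * (b - a)))) (EFinM 2 (M * _)) (EFinM 2 eta).
by apply: leeD; apply: lee_wpmul2l.
Qed.

Let D_sqr (J : R -> Omega -> R) : ito_integral P FF B T sigma J ->
  (\int[P]_w ((J b w - J a w - Jc w) ^+ 2)%:E <= (4 * eta)%:E)%E.
Proof.
move=> HJ.
have H := @ito_step_error _ _ _ P FF B HFF HB T sigma J sigma_measurable HJ a b a0 ab bT m s v N
  s_nd as0 smb (fun j => @mvs j) vN.
have [H1 _] := approx1.
by apply: (le_trans H); rewrite EFinM; apply: lee_wpmul2l => //; exact: H1.
Qed.

Let A_sqr : (\int[P]_w ((\int[leb]_(t in `]a, b]) mu t w) ^+ 2)%:E <= (M * (b - a) ^+ 2)%:E)%E.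
Proof.
have [D3 mD3] := sqr_moment_itv mu_measurable mu4 a0 ab bT.
apply: (@le_trans _ _ (\int[P]_w ((b - a)%:E * \int[leb]_(t in `]a, b]) (mu t w ^+ 2)%:E))%E).
  apply: ge0_le_integral_nonmeas => w; first by rewrite lee_fin sqr_ge0.
  by apply: sqr_Rintegral_le => //; exact: process_section.
have ba : 0 <= b - a by rewrite subr_ge0 ltW.
rewrite ge0_integralZl_EFin//; last by move=> w _; apply: integral_ge0 => t _; rewrite lee_fin sqr_ge0.
have -> : M * (b - a) ^+ 2 = (b - a) * (M * (b - a)) by ring.
by rewrite EFinM; apply: lee_wpmul2l.
Qed.

Let V_sqr : (\int[P]_w ((\int[leb]_(t in `]a, b]) (sigma t w ^+ 2) - Ic w) ^+ 2)%:E <=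
  ((b - a) * eta)%:E)%E.
Proof.
have [D2 mD2] := approx2.
have ba : 0 <= b - a by rewrite subr_ge0 ltW.
apply: (@le_trans _ _ (\int[P]_w ((b - a)%:E * \int[leb]_(t in `]a, b]) dif2 (t, w)))%E).
  apply: ge0_le_integral_nonmeas => w; first by rewrite lee_fin sqr_ge0.
  have E2 := @step_sqr_int `]a, b]%classic w (measurable_itv _) (fun _ => id).
  have mSw : measurable_fun `]a, b] (S ^~ w).
    apply: (measurable_comp (F := (`]a, b] `*` setT)%classic) (f := fun z : R * Omega => S z.1 z.2)
      (g := fun t : R => (t, w))).
    - exact: measurableX.
    - by move=> _ [t ht <-].
    - exact: mS.
    - by apply: measurable_funTS; exact: pair2_measurable.
  have iS : leb.-integrable `]a, b] (EFin \o (fun t => S t w ^+ 2)).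
    apply/integrableP; split; first by apply/measurable_EFinP; exact: measurable_funX.
    rewrite (_ : (\int[leb]_(x in _) _)%E = (\int[leb]_(t in `]a, b]) (S t w ^+ 2)%:E)%E); last first.
      by apply: eq_integral => t _ /=; rewrite ger0_norm// sqr_ge0.
    by rewrite E2 ltry.
  have msw : measurable_fun `]a, b] (fun t => sigma t w ^+ 2).
    by apply: measurable_funX; exact: process_section.
  have -> : Ic w = \int[leb]_(t in `]a, b]) (S t w ^+ 2) by rewrite /Rintegral E2.
  apply: le_trans (sqr_RintegralB_le ab msw iS) _; apply: lee_wpmul2l => //.
  rewrite le_eqVlt; apply/orP; left; apply/eqP; apply: eq_integral => t _.
  by rewrite /dif2/= -sqrrN opprB.
rewrite ge0_integralZl_EFin//; last by move=> w _; apply: integral_ge0 => t _; rewrite lee_fin sqr_ge0.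
by rewrite EFinM; apply: lee_wpmul2l.
Qed.

(** Cauchy-Schwarz in time, the discrepancy being split into the step approximation of [sigma^2] on
    the cell and the change of [sigma^2] between the cell and [tau]. *)
Lemma cell_var_error (tau : R) : 0 <= tau ->
  (\int[P]_w ((Ic w - (b - a) * sigma tau w ^+ 2) ^+ 2)%:E <=
   (b - a)%:E * (2%:E * eta%:E +
     2%:E * \int[leb]_(t in `]a, b]) \int[P]_w ((sigma t w ^+ 2 - sigma tau w ^+ 2) ^+ 2)%:E))%E.
Proof.
move=> tau0; have ba : 0 <= b - a by rewrite subr_ge0 ltW.
have [D2 mD2] := approx2.
pose dif3 (z : R * Omega) := ((sigma z.1 z.2 ^+ 2 - sigma tau z.2 ^+ 2) ^+ 2)%:E.
have mtau := process_at sigma_measurable tau0.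
have m3 : measurable_fun (`]a, b] `*` setT) dif3.
  apply/measurable_EFinP; apply: measurable_funX; apply: measurable_funB; first exact: measurable_funX.
  by apply: measurable_funX; apply: measurable_funTS; exact: (measurableT_comp mtau measurable_snd).
have [T1 [T2 _]] := Tonelli_restrict P (measurable_itv `]a, b]) m3 (fun z => sqr_ge0 _).
rewrite -T1.
have msect (F : R * Omega -> R) w : measurable_fun (`]a, b] `*` setT) F ->
    measurable_fun `]a, b] (fun t : R => F (t, w)).
  move=> mF; apply: (measurable_comp (F := (`]a, b] `*` setT)%classic) (f := F)
    (g := fun t : R => (t, w))) => //.
  - exact: measurableX.
  - by move=> _ [t ht <-].
  - by apply: measurable_funTS; exact: pair2_measurable.
pose G w := (2%:E * \int[leb]_(t in `]a, b]) dif2 (t, w) + 2%:E * \int[leb]_(t in `]a, b]) dif3 (t, w))%E.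
have mG : measurable_fun setT G.
  by apply: emeasurable_funD; [exact: (measurable_funeM _ mD2)|exact: (measurable_funeM _ T2)].
have i20 w : (0 <= \int[leb]_(t in `]a, b]) dif2 (t, w))%E.
  by apply: integral_ge0 => t _; rewrite lee_fin sqr_ge0.
have i30 w : (0 <= \int[leb]_(t in `]a, b]) dif3 (t, w))%E.
  by apply: integral_ge0 => t _; rewrite lee_fin sqr_ge0.
have G0 w : (0 <= G w)%E by rewrite adde_ge0// mule_ge0.
apply: (@le_trans _ _ (\int[P]_w ((b - a)%:E * G w))%E); last first.
  rewrite ge0_integralZl_EFin//; apply: lee_wpmul2l => //.
  rewrite ge0_integralD//; last 4 first.
  - by move=> w _; rewrite mule_ge0.
  - exact: (measurable_funeM _ mD2).
  - by move=> w _; rewrite mule_ge0.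
  - exact: (measurable_funeM _ T2).
  rewrite (ge0_integralZl_EFin P measurableT (fun w _ => i20 w) mD2 (ler0n R 2)).
  rewrite (ge0_integralZl_EFin P measurableT (fun w _ => i30 w) T2 (ler0n R 2)).
  by apply: leeD => //; apply: lee_wpmul2l.
apply: ge0_le_integral_nonmeas => w; first by rewrite lee_fin sqr_ge0.
have E2 := @step_sqr_int `]a, b]%classic w (measurable_itv _) (fun _ => id).
have mSw : measurable_fun `]a, b] (fun t => S t w ^+ 2).
  by apply: (msect (fun z => S z.1 z.2 ^+ 2)); exact: measurable_funX.
have -> : Ic w = \int[leb]_(t in `]a, b]) (S t w ^+ 2) by rewrite /Rintegral E2.
have <- : \int[leb]_(t in `]a, b]) (sigma tau w ^+ 2) = (b - a) * sigma tau w ^+ 2.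
  by rewrite Rintegral_cst// leb_itv_oc ?(ltW ab)// mulrC.
have ic := itv_cst_integrable ab (sigma tau w ^+ 2).
apply: le_trans (sqr_RintegralB_le ab mSw ic) _; apply: lee_wpmul2l => //.
have := @ge0_integral_le_lin _ _ _ leb `]a, b]%classic bool [:: true; false] (fun=> 2)
  (fun c t => if c then dif2 (t, w) else dif3 (t, w)) (fun t => ((S t w ^+ 2 - sigma tau w ^+ 2) ^+ 2)%:E)
  (measurable_itv _).
rewrite !big_cons big_nil/= adde0; apply.
- by move=> t _; rewrite lee_fin sqr_ge0.
- by [].
- case.
    apply/measurable_EFinP; apply: (msect (fun z => (S z.1 z.2 ^+ 2 - sigma z.1 z.2 ^+ 2) ^+ 2)).
    by apply: measurable_funX; apply: measurable_funB; exact: measurable_funX.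
  apply/measurable_EFinP; apply: (msect (fun z => (sigma z.1 z.2 ^+ 2 - sigma tau z.2 ^+ 2) ^+ 2)).
  exact/measurable_EFinP.
- by case=> t; rewrite lee_fin sqr_ge0.
- move=> t _; rewrite !big_cons big_nil adde0 -!EFinM -EFinD lee_fin/=.
  by have := sqr_ge0 ((S t w ^+ 2 - sigma t w ^+ 2) - (sigma t w ^+ 2 - sigma tau w ^+ 2)); lra.
Qed.

(* Young's inequality with weights [r] and [r ^+ 3], where [r ^+ 2] is the length of
   the cell: each term on the right is then O([r ^+ 3]) in mean. *)
Let pointwise_error (r A D Jv V Iv : R) : 0 < r ->
  `|((A + D + Jv) ^+ 2 - V) - (Jv ^+ 2 - Iv)| <= (2 + 2 / r) * A ^+ 2 + ((2 + 2 / r) * D ^+ 2 +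
    (r * Jv ^+ 2 + (r ^+ 3 + (r ^+ 3)^-1 * (V - Iv) ^+ 2))).
Proof.
move=> r0; have r3 : 0 < r ^+ 3 by rewrite exprn_gt0.
have -> : ((A + D + Jv) ^+ 2 - V) - (Jv ^+ 2 - Iv) = ((A + D) ^+ 2 + 2 * Jv * (A + D)) - (V - Iv) by ring.
apply: le_trans (ler_normB _ _) _.
have h1 : `|V - Iv| <= r ^+ 3 + (r ^+ 3)^-1 * (V - Iv) ^+ 2.
  rewrite -[(V - Iv) ^+ 2]real_normK ?num_real//; set y := `|V - Iv|.
  have -> : r ^+ 3 + (r ^+ 3)^-1 * y ^+ 2 = y + (r ^+ 3)^-1 * ((y - r ^+ 3) ^+ 2 + y * r ^+ 3).
    by field; rewrite gt_eqF.
  rewrite lerDl mulr_ge0 ?invr_ge0 ?(ltW r3)// addr_ge0 ?sqr_ge0// mulr_ge0 ?(ltW r3)//.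
  exact: normr_ge0.
have h2 : `|(A + D) ^+ 2 + 2 * Jv * (A + D)| <= (1 + 1 / r) * (A + D) ^+ 2 + r * Jv ^+ 2.
  have e1 : (1 + 1 / r) * (A + D) ^+ 2 + r * Jv ^+ 2 - ((A + D) ^+ 2 + 2 * Jv * (A + D)) =
    r^-1 * ((A + D) - r * Jv) ^+ 2 by field; rewrite gt_eqF.
  have e2 : (1 + 1 / r) * (A + D) ^+ 2 + r * Jv ^+ 2 + ((A + D) ^+ 2 + 2 * Jv * (A + D)) =
    r^-1 * ((A + D) + r * Jv) ^+ 2 + 2 * (A + D) ^+ 2 by field; rewrite gt_eqF.
  have p1 : 0 <= r^-1 * ((A + D) - r * Jv) ^+ 2 by rewrite mulr_ge0 ?sqr_ge0 ?invr_ge0 ?(ltW r0).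
  have p2 : 0 <= r^-1 * ((A + D) + r * Jv) ^+ 2 by rewrite mulr_ge0 ?sqr_ge0 ?invr_ge0 ?(ltW r0).
  have p3 := sqr_ge0 (A + D).
  by rewrite ler_norml; apply/andP; split; lra.
have h3 : (1 + 1 / r) * (A + D) ^+ 2 <= (2 + 2 / r) * A ^+ 2 + (2 + 2 / r) * D ^+ 2.
  have -> : (2 + 2 / r) * A ^+ 2 + (2 + 2 / r) * D ^+ 2 =
    (1 + 1 / r) * (A + D) ^+ 2 + (1 + 1 / r) * (A - D) ^+ 2 by field; rewrite gt_eqF.
  by rewrite lerDl mulr_ge0 ?sqr_ge0// addr_ge0// divr_ge0// ltW.
lra.
Qed.

Let final_bound (r : R) : 0 < r -> r <= 1 -> 2 * M * r ^+ 4 + 2 * M * r ^+ 3 +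
  (8 * r ^+ 4 + 8 * r ^+ 3 + (2 * M * r ^+ 3 + 2 * r ^+ 5 + (r ^+ 3 + r ^+ 3))) <=
  (6 * M + 20) * r ^+ 3.
Proof.
move=> r0 r1.
have p4 : r ^+ 4 <= r ^+ 3 by rewrite ler_wiXn2l// ltW.
have p5 : r ^+ 5 <= r ^+ 3 by rewrite ler_wiXn2l// ltW.
have h : M * r ^+ 4 <= M * r ^+ 3 by rewrite ler_wpM2l// (le_trans _ M1).
by move: p4 p5 h; set x3 := r ^+ 3; set x4 := r ^+ 4; set x5 := r ^+ 5; lra.
Qed.

(** With [r^2] the mesh and [eta = r^4], the means of [A^2] and [D^2] are of order [r^4], that of
    [Jc^2] of order [r^2], and that of the squared variance error at most [r^6]. The weights of
    [pointwise_error] bring each to [r^3], and [6 * M + 20] collects the constants. *)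
Lemma cell_error (r : R) : 0 < r <= 1 -> b - a = r ^+ 2 -> eta = r ^+ 4 ->
  (\int[P]_w (`|((X b w - X a w) ^+ 2 - \int[leb]_(t in `[a, b]) (sigma t w ^+ 2))
     - (Jc w ^+ 2 - Ic w)|)%:E <= ((6 * M + 20) * r ^+ 3)%:E)%E.
Proof.
move=> /andP[r0 r1] bar etar.
case: HX => adX _ imu [J HJ Xdef].
have b0 : 0 <= b := le_trans a0 (ltW ab).
have aT : 0 <= a <= T by rewrite a0 (le_trans (ltW ab) bT).
have bT' : 0 <= b <= T by rewrite b0.
have mX t : 0 <= t <= T -> measurable_fun setT (X t).
  move=> tT; have t0 : 0 <= t by case/andP: tT.
  apply: (at_time_measurable HFF t0); apply: sub_measurable_fun; last exact: adX.
  exact: (filtration_sigma HFF).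
have mJ t : 0 <= t -> measurable_fun setT (J t).
  move=> t0; apply: (at_time_measurable HFF t0); apply: sub_measurable_fun.
    exact: (filtration_sigma HFF).
  by case: HJ => adJ _; exact: adJ.
pose A w := \int[leb]_(t in `]a, b]) mu t w.
pose D w := J b w - J a w - Jc w.
pose V w := \int[leb]_(t in `]a, b]) (sigma t w ^+ 2).
have mA : measurable_fun setT A.
  apply: (measurable_path_Rintegral (F := fun z => mu z.1 z.2) (measurable_itv _)).
  exact: process_on.
have mV : measurable_fun setT V.
  apply: (measurable_path_Rintegral (F := fun z => sigma z.1 z.2 ^+ 2) (measurable_itv _)).
  by apply: measurable_funX.
have mD : measurable_fun setT D.
  by apply: measurable_funB => //; apply: measurable_funB; exact: mJ.
have VE w : \int[leb]_(t in `[a, b]) (sigma t w ^+ 2) = V w.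
  rewrite /V /Rintegral integral_itv_obnd_cbnd//.
  by apply/measurable_EFinP; apply: measurable_funX; exact: process_section.
pose F w := ((A w + D w + Jc w) ^+ 2 - V w) - (Jc w ^+ 2 - Ic w).
have mF : measurable_fun setT F.
  apply: measurable_funB; last by apply: measurable_funB => //; exact: measurable_funX.
  apply: measurable_funB => //; apply: measurable_funX; apply: measurable_funD => //.
  exact: measurable_funD.
pose F0 w := ((X b w - X a w) ^+ 2 - V w) - (Jc w ^+ 2 - Ic w).
have mF0 : measurable_fun setT F0.
  apply: measurable_funB; last by apply: measurable_funB => //; exact: measurable_funX.
  by apply: measurable_funB => //; apply: measurable_funX; apply: measurable_funB; exact: mX.
(* The equation defining [X] holds almost surely at each fixed time, so the decomposition into drift
   [A], step-integral error [D] and [Jc] is substituted only up to a null set. *)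
have aeE : {ae P, forall w, X b w - X a w = A w + D w + Jc w}.
  have Xa := Xdef a aT; have Xb := Xdef b bT'.
  apply: filterS3 imu Xa Xb => w iw -> ->.
  have i0b : leb.-integrable `[0, b] (fun t => (mu t w)%:E).
    by apply: integrableS iw => //; apply: subset_itvl; rewrite bnd_simp.
  have := @Rintegral_itvB R (mu ^~ w) (BLeft 0) (BRight b) a i0b.
  by rewrite !bnd_simp => /(_ a0 (ltW ab)); rewrite /A /D => <-; lra.
have -> : (\int[P]_w (`|((X b w - X a w) ^+ 2 - \int[leb]_(t in `[a, b]) (sigma t w ^+ 2))
     - (Jc w ^+ 2 - Ic w)|)%:E = \int[P]_w (`|F w|)%:E)%E.
  transitivity (\int[P]_w (`|F0 w|)%:E)%E.
    by apply: eq_integral => w _; rewrite VE.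
  apply: ge0_ae_eq_integral => //.
  - by apply/measurable_EFinP; exact: measurableT_comp.
  - by apply/measurable_EFinP; exact: measurableT_comp.
  - by apply: filterS aeE => w E _; rewrite /F0 /F E.
(* The five weights and terms of [pointwise_error]; beyond index 4 both lists default to 0, so the
   side conditions over all indices hold. *)
pose c (i : nat) : R := nth 0 [:: 2 + 2 / r; 2 + 2 / r; r; r ^+ 3; (r ^+ 3)^-1] i.
pose g (i : nat) (w : Omega) : R :=
  nth 0 [:: A w ^+ 2; D w ^+ 2; Jc w ^+ 2; 1; (V w - Ic w) ^+ 2] i.
have rV : 0 <= 2 + 2 / r by rewrite addr_ge0// divr_ge0// ltW.
have := @ge0_integral_le_lin _ _ _ P setT nat (iota 0 5) c (fun i w => (g i w)%:E)
  (fun w => (`|F w|)%:E) measurableT.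
rewrite /= !big_cons big_nil /c /g/= adde0 integral_prob_cst => H; apply: le_trans (H _ _ _ _ _) _.
- by move=> w _.
- case=> [|[|[|[|[|i]]]]] //=; rewrite ?rV ?invr_ge0 ?exprn_ge0 ?(ltW r0)//.
  by rewrite nth_nil.
- move=> i; apply/measurable_EFinP; case: i => [|[|[|[|[|i]]]]] /=.
  + exact: measurable_funX.
  + exact: measurable_funX.
  + exact: measurable_funX.
  + exact: measurable_cst.
  + by apply: measurable_funX; exact: measurable_funB.
  + by under eq_fun do rewrite nth_nil; exact: measurable_cst.
- by case=> [|[|[|[|[|i]]]]] w //=; rewrite lee_fin ?sqr_ge0// nth_nil.
- move=> w _; rewrite !big_cons big_nil/= adde0 -!EFinM -!EFinD lee_fin mulr1.
  exact: pointwise_error.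
have h1 := lee_wpmul2l (_ : 0 <= (2 + 2 / r)%:E)%E A_sqr.
have h2 := lee_wpmul2l (_ : 0 <= (2 + 2 / r)%:E)%E (D_sqr HJ).
have h3 := lee_wpmul2l (_ : 0 <= r%:E)%E J_sqr.
have h4 := lee_wpmul2l (_ : 0 <= ((r ^+ 3)^-1)%:E)%E V_sqr.
apply: le_trans (leeD (h1 _) (leeD (h2 _) (leeD (h3 _) (leeD (lexx _) (h4 _))))) _;
  rewrite ?lee_fin ?invr_ge0 ?exprn_ge0 ?(ltW r0)//.
rewrite mulr1 bar etar.
have e1 : (2 + 2 / r) * (M * (r ^+ 2) ^+ 2) = 2 * M * r ^+ 4 + 2 * M * r ^+ 3 by field; rewrite gt_eqF.
have e2 : (2 + 2 / r) * (4 * r ^+ 4) = 8 * r ^+ 4 + 8 * r ^+ 3 by field; rewrite gt_eqF.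
have e4 : (r ^+ 3)^-1 * (r ^+ 2 * r ^+ 4) = r ^+ 3 by field; rewrite gt_eqF.
have e3 : r * (2 * M * r ^+ 2 + 2 * r ^+ 4) = 2 * M * r ^+ 3 + 2 * r ^+ 5 by ring.
rewrite e1 e2 e3 e4.
exact: final_bound.
Qed.

End CellError.

(** * Localisation at tau *)

Lemma normr_Rintegral_le_ereal d (T : measurableType d) (R : realType)
    (P : probability T R) (f g : T -> R) (c : R) :
  P.-integrable setT (EFin \o f) -> (forall w, `|f w| <= g w) ->
  (\int[P]_w (g w)%:E <= c%:E)%E -> `|\int[P]_w f w| <= c.
Proof.
move=> fi fg gc; apply: le_trans (le_normr_Rintegral measurableT fi) _.
have ni : P.-integrable setT (EFin \o (fun w => `|f w|)) by exact: integrable_norm.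
rewrite -lee_fin -(EFin_Rintegral ni); apply: le_trans gc.
by apply: ge0_le_integral_nonmeas => w; rewrite lee_fin.
Qed.

(** * Comparison with deterministic weights *)

Section GaussianMixtureLimit.
Context (R : realType).

(** A relative discrepancy [th] between [p] and [q] costs at most [th], however large they are,
    because [x e^(-x) <= 1]; only the additive part [w] remains to be integrated. *)
Lemma expRN_dist_le (a p q w th : R) : 0 <= a -> 0 <= p -> 0 <= q -> 0 <= w -> 0 < th ->
  p <= (1 + th) * q + (1 + th^-1) * w -> q <= (1 + th) * p + (1 + th^-1) * w ->
  `|expR (- (a * p)) - expR (- (a * q))| <= th + a * (1 + th^-1) * w.
Proof.
move=> a0; wlog qp : p q / q <= p => [H p0 q0 w0 th0 h1 h2|p0 q0 w0 th0 h1 h2].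
  have [qp|/ltW pq] := leP q p; first exact: H.
  by rewrite distrC; exact: H.
rewrite distrC ger0_norm; last first.
  by rewrite subr_ge0 ler_expR lerN2 ler_wpM2l.
have aq0 : 0 <= a * q by rewrite mulr_ge0.
have e0 := expR_gt0 (- (a * q)).
have e1 : expR (- (a * q)) <= 1 by rewrite -expR0 ler_expR oppr_le0.
have -> : expR (- (a * p)) = expR (- (a * q)) * expR (- (a * (p - q))).
  by rewrite -expRD; congr expR; ring.
have h3 : 1 - expR (- (a * (p - q))) <= a * (p - q).
  by have := expR_ge1Dx (- (a * (p - q))); lra.
have h4 : (a * q) * expR (- (a * q)) <= 1.
  rewrite expRN ler_pdivrMr ?expR_gt0// mul1r.
  by have := expR_ge1Dx (a * q); lra.
have k0 : 0 <= (1 + th^-1) * w by rewrite mulr_ge0// addr_ge0// invr_ge0 ltW.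
have h5 : a * (p - q) <= th * (a * q) + a * ((1 + th^-1) * w).
  have -> : th * (a * q) + a * ((1 + th^-1) * w) = a * (th * q + (1 + th^-1) * w) by ring.
  by rewrite ler_wpM2l//; lra.
have ak0 : 0 <= a * ((1 + th^-1) * w) by rewrite mulr_ge0.
have -> : expR (- (a * q)) - expR (- (a * q)) * expR (- (a * (p - q))) =
  expR (- (a * q)) * (1 - expR (- (a * (p - q)))) by ring.
apply: (@le_trans _ _ (expR (- (a * q)) * (th * (a * q) + a * ((1 + th^-1) * w)))).
  by rewrite ler_wpM2l ?(ltW e0)//; exact: le_trans h3 h5.
rewrite mulrDr; apply: lerD.
  have -> : expR (- (a * q)) * (th * (a * q)) = th * (a * q * expR (- (a * q))) by ring.
  by rewrite -[leRHS]mulr1 ler_wpM2l// ltW.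
by rewrite -[a * (1 + th^-1) * w]mulrA -[leRHS]mul1r ler_wpM2r.
Qed.

Lemma sqr_sum_le n (x y : 'I_n -> R) (th : R) : 0 < th ->
  \sum_i x i ^+ 2 <= (1 + th) * (\sum_i y i ^+ 2) + (1 + th^-1) * \sum_i (x i - y i) ^+ 2.
Proof.
move=> th0; rewrite !mulr_sumr -big_split/=; apply: ler_sum => i _.
have : 0 <= th^-1 * (th * y i - (x i - y i)) ^+ 2 by rewrite mulr_ge0 ?sqr_ge0 ?invr_ge0 ?(ltW th0).
have -> : th^-1 * (th * y i - (x i - y i)) ^+ 2 =
  th * y i ^+ 2 - 2 * (y i * (x i - y i)) + th^-1 * (x i - y i) ^+ 2 by field; rewrite gt_eqF.
by lra.
Qed.

(** If the squared distance [w] exceeds 1, the cap 2 is already below [2 * w]. Otherwise each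
    difference is at most 1, its cube is below its square, and [(a + b)^3 <= 4 a^3 + 4 b^3]. *)
Lemma cube_sum_le n (x y : 'I_n -> R) (C : R) : 0 <= C ->
  Num.min 2 (C * \sum_i `|x i| ^+ 3) <=
  (4 * C + 2) * (\sum_i (x i - y i) ^+ 2) + Num.min 2 (4 * C * \sum_i `|y i| ^+ 3).
Proof.
move=> C0; set w := \sum_i (x i - y i) ^+ 2.
have w0 : 0 <= w by apply: sumr_ge0 => i _; exact: sqr_ge0.
have y0 : 0 <= \sum_i `|y i| ^+ 3 by apply: sumr_ge0 => i _; rewrite exprn_ge0.
have Cw0 : 0 <= C * w by rewrite mulr_ge0.
have Cy0 : 0 <= 4 * C * \sum_i `|y i| ^+ 3 by rewrite !mulr_ge0.
have [w1|w1] := leP w 1; last first.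
  apply: (@le_trans _ _ 2); first by rewrite ge_min lexx.
  have : 0 <= Num.min 2 (4 * C * \sum_i `|y i| ^+ 3) by rewrite le_min Cy0 ler0n.
  lra.
have h : \sum_i `|x i| ^+ 3 <= 4 * w + 4 * \sum_i `|y i| ^+ 3.
  rewrite !mulr_sumr -big_split/=; apply: ler_sum => i _.
  set z := x i - y i.
  have xyz : `|x i| <= `|z| + `|y i| by rewrite -[x i](subrK (y i)) ler_normD.
  have z1 : `|z| <= 1.
    have : z ^+ 2 <= 1.
      apply: le_trans w1; rewrite /w (bigD1 i)//= lerDl.
      by apply: sumr_ge0 => j _; exact: sqr_ge0.
    by rewrite -[z ^+ 2]real_normK ?num_real// expr_le1.
  have z3 : `|z| ^+ 3 <= z ^+ 2.
    by rewrite -[z ^+ 2]real_normK ?num_real// ler_wiXn2l.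
  apply: (@le_trans _ _ ((`|z| + `|y i|) ^+ 3)); first by rewrite lerXn2r ?nnegrE// addr_ge0.
  have : (`|z| + `|y i|) ^+ 3 <= 4 * `|z| ^+ 3 + 4 * `|y i| ^+ 3.
    have a0 := normr_ge0 z; have b0 := normr_ge0 (y i).
    have -> : 4 * `|z| ^+ 3 + 4 * `|y i| ^+ 3 = (`|z| + `|y i|) ^+ 3 +
      3 * (`|z| + `|y i|) * (`|z| - `|y i|) ^+ 2 by ring.
    by rewrite lerDl mulr_ge0 ?sqr_ge0// mulr_ge0// addr_ge0.
  lra.
have h' : C * \sum_i `|x i| ^+ 3 <= 4 * (C * w) + 4 * C * \sum_i `|y i| ^+ 3.
  by have := ler_wpM2l C0 h; lra.
have [m1|m1] := leP 2 (4 * C * \sum_i `|y i| ^+ 3).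
  by rewrite ge_min; apply/orP; left; lra.
by rewrite ge_min; apply/orP; right; lra.
Qed.

Context d (Omega : measurableType d) (P : probability Omega R).
Variables (V : Omega -> R) (x : forall n, 'I_n -> Omega -> R) (k : forall n, 'I_n -> R).
Variables (W : nat -> R) (kappa : R).
Hypotheses (mV : measurable_fun setT V) (mx : forall n i, measurable_fun setT (@x n i)).
Hypothesis xW : \forall n \near \oo,
  (\int[P]_w (\sum_i (@x n i w - k i * V w) ^+ 2)%:E <= (W n)%:E)%E.
Hypothesis W0 : W n @[n --> \oo] --> (0 : R).
Hypothesis k2 : \sum_i (@k n i) ^+ 2 @[n --> \oo] --> kappa.
Hypothesis k3 : \sum_i `|@k n i| ^+ 3 @[n --> \oo] --> (0 : R).

Let werr n w := \sum_i (@x n i w - k i * V w) ^+ 2.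

Let mwerr n : measurable_fun setT (werr n).
Proof.
apply: measurable_sum => i; apply: measurable_funX; apply: measurable_funB => //.
exact: measurable_funM.
Qed.

Let werr0 n w : 0 <= werr n w.
Proof. by apply: sumr_ge0 => i _; exact: sqr_ge0. Qed.

Let affine_bound n (c e : R) : 0 <= c -> 0 <= e ->
  (\int[P]_w (werr n w)%:E <= (W n)%:E)%E -> (\int[P]_w (e + c * werr n w)%:E <= (e + c * W n)%:E)%E.
Proof.
move=> c0 e0 wW; rewrite (_ : (fun w => _) = (fun w => e%:E + c%:E * (werr n w)%:E)%E)//.
rewrite ge0_integralD//; last 2 first.
- by move=> w _; rewrite mule_ge0 ?lee_fin.
- by apply: measurable_funeM; exact/measurable_EFinP.
rewrite integral_prob_cst ge0_integralZl_EFin//.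
- by rewrite EFinD EFinM; apply: leeD => //; apply: lee_wpmul2l.
- by move=> w _; rewrite lee_fin.
- exact/measurable_EFinP.
Qed.

Let expRN_int (f : Omega -> R) : measurable_fun setT f -> (forall w, 0 <= f w) ->
  P.-integrable setT (EFin \o (fun w => expR (- f w))).
Proof.
move=> mf f0; apply: (@bounded_integrable _ _ _ P _ 1).
  by apply: measurableT_comp => //; exact: measurableT_comp.
by move=> w; rewrite ger0_norm ?expR_ge0// -expR0 ler_expR oppr_le0.
Qed.

(** Intended instance: [V] is the squared volatility at [tau], [x n i] the weighted cell variance,
    and [k n i] the same weight with unit volatility. The sum of squares is compared with the
    deterministic sum times [V^2], whose limit is then taken pointwise. *)
Lemma mixture_exp_limit (a : R) : 0 <= a ->
  \int[P]_w expR (- (a * \sum_i (@x n i w) ^+ 2)) @[n --> \oo] -->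
  \int[P]_w expR (- (a * (kappa * V w ^+ 2))).
Proof.
move=> a0.
pose q n w := (\sum_i (@k n i) ^+ 2) * V w ^+ 2.
have q0 n w : 0 <= q n w.
  by rewrite mulr_ge0 ?sqr_ge0//; apply: sumr_ge0 => i _; exact: sqr_ge0.
have mq n : measurable_fun setT (q n).
  by apply: measurable_funM => //; exact: measurable_funX.
have p0 n w : 0 <= \sum_i (@x n i w) ^+ 2 by apply: sumr_ge0 => i _; exact: sqr_ge0.
have mp n : measurable_fun setT (fun w => \sum_i (@x n i w) ^+ 2).
  by apply: measurable_sum => i; exact: measurable_funX.
have cq : \int[P]_w expR (- (a * q n w)) @[n --> \oo] --> \int[P]_w expR (- (a * (kappa * V w ^+ 2))).
  apply: (@bounded_cvg_Rintegral _ _ _ P _ _ 1).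
  - by move=> n; apply: measurableT_comp => //; apply: measurableT_comp => //; exact: measurable_funM.
  - apply: measurableT_comp => //; apply: measurableT_comp => //; apply: measurable_funM => //.
    by apply: measurable_funM => //; exact: measurable_funX.
  - move=> w.
    have H : - (a * q n w) @[n --> \oo] --> - (a * (kappa * V w ^+ 2)).
      apply: cvgN; apply: cvgM; first exact: cvg_cst.
      by apply: cvgM; [exact: k2|exact: cvg_cst].
    exact: (cvg_comp _ _ H (@continuous_expR R _)).
  - by move=> n w; rewrite ger0_norm ?expR_ge0// -expR0 ler_expR oppr_le0 mulr_ge0.
apply/cvgrPdist_le => e e0.
have e3 : 0 < e / 3 by rewrite divr_gt0.
(* [e / 3] serves as the relative error in [expRN_dist_le], so [c] multiplies the squared distance;
   the other two thirds go to [c * W n] and to the bounded convergence. *)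
pose c := a * (1 + (e / 3)^-1).
have c0 : 0 <= c by rewrite mulr_ge0// addr_ge0// invr_ge0 ltW.
have cW : c * W n @[n --> \oo] --> (0 : R).
  by rewrite -(mulr0 c); apply: cvgM => //; exact: cvg_cst.
have N2 : \forall n \near \oo, c * W n <= e / 3 by exact: cvgr_le cW _ e3.
have N3 : \forall n \near \oo, `|\int[P]_w expR (- (a * (kappa * V w ^+ 2))) -
    \int[P]_w expR (- (a * q n w))| <= e / 3 by move/cvgrPdist_le : cq => /(_ _ e3).
near=> n.
have h2 : c * W n <= e / 3 by near: n.
have h3 : `|\int[P]_w expR (- (a * (kappa * V w ^+ 2))) -
    \int[P]_w expR (- (a * q n w))| <= e / 3 by near: n.
have h1 : (\int[P]_w (werr n w)%:E <= (W n)%:E)%E by near: n.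
have h4 : `|\int[P]_w expR (- (a * \sum_i (@x n i w) ^+ 2)) - \int[P]_w expR (- (a * q n w))| <=
    e / 3 + c * W n.
  have i1 : P.-integrable setT (EFin \o (fun w => expR (- (a * \sum_i (@x n i w) ^+ 2)))).
    by apply: expRN_int => [|w]; [exact: measurable_funM|rewrite mulr_ge0].
  have i2 : P.-integrable setT (EFin \o (fun w => expR (- (a * q n w)))).
    by apply: expRN_int => [|w]; [exact: measurable_funM|rewrite mulr_ge0].
  rewrite -RintegralB//.
  apply: (normr_Rintegral_le_ereal (g := fun w => e / 3 + c * werr n w)).
  - exact: (integrableB _ i1 i2).
  - move=> w; apply: expRN_dist_le => //.
      have := @sqr_sum_le n (fun i => x i w) (fun i => k i * V w) _ e3.
      rewrite /q mulr_suml; under [X in _ <= (_ * X) + _ -> _]eq_bigr do rewrite exprMn.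
      exact.
    have := @sqr_sum_le n (fun i => k i * V w) (fun i => x i w) _ e3.
    rewrite /q mulr_suml; under [X in X <= _ -> _]eq_bigr do rewrite exprMn.
    move=> /le_trans; apply; rewrite lerD2l ler_wpM2l ?addr_ge0 ?invr_ge0 ?(ltW e3)//.
    by rewrite le_eqVlt; apply/orP; left; apply/eqP; apply: eq_bigr => i _; rewrite -sqrrN opprB.
  - exact: (affine_bound c0 (ltW e3) h1).
rewrite distrC.
have -> : \int[P]_w expR (- (a * \sum_i (@x n i w) ^+ 2)) - \int[P]_w expR (- (a * (kappa * V w ^+ 2))) =
  (\int[P]_w expR (- (a * \sum_i (@x n i w) ^+ 2)) - \int[P]_w expR (- (a * q n w))) -
  (\int[P]_w expR (- (a * (kappa * V w ^+ 2))) - \int[P]_w expR (- (a * q n w))) by ring.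
apply: le_trans (ler_normB _ _) _; lra.
Unshelve. all: by end_near. Qed.

(** After [cube_sum_le] the remaining term tends to 0 at each sample point; the cap permits bounded
    convergence although no moment of [V] of order three is assumed. *)
Lemma mixture_cube_limit (C : R) : 0 <= C ->
  \int[P]_w Num.min 2 (C * \sum_i `|@x n i w| ^+ 3) @[n --> \oo] --> (0 : R).
Proof.
move=> C0.
pose y n w := Num.min 2 (4 * C * \sum_i `|@k n i * V w| ^+ 3).
have yE n w : y n w = Num.min 2 (4 * C * ((\sum_i `|@k n i| ^+ 3) * `|V w| ^+ 3)).
  by rewrite /y mulr_suml; under eq_bigr do rewrite normrM exprMn.
have y0 n w : 0 <= y n w.
  by rewrite /y le_min ler0n !mulr_ge0//; apply: sumr_ge0 => i _; rewrite exprn_ge0.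
have y2 n w : y n w <= 2 by rewrite /y ge_min lexx.
have my n : measurable_fun setT (y n).
  rewrite (_ : y n = fun w => Num.min 2 (4 * C * ((\sum_i `|@k n i| ^+ 3) * `|V w| ^+ 3))); last first.
    by apply/funext => w; exact: yE.
  apply: measurable_minr => //; apply: measurable_funM => //; apply: measurable_funM => //.
  by apply: measurable_funX; exact: measurableT_comp.
have cy : \int[P]_w y n w @[n --> \oo] --> (0 : R).
  rewrite -(Rintegral_prob_cst P 0).
  apply: (@bounded_cvg_Rintegral _ _ _ P _ _ 2) => //.
  - move=> w; under eq_fun do rewrite yE.
    apply: (@squeeze_cvgr _ _ _ _ (fun=> 0) (fun n => 4 * C * ((\sum_i `|@k n i| ^+ 3) * `|V w| ^+ 3))).
    + near=> n; rewrite ge_min lexx orbT andbT le_min ler0n !mulr_ge0//.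
      by apply: sumr_ge0 => i _; rewrite exprn_ge0.
    + exact: cvg_cst.
    + have H : 4 * C * ((\sum_i `|@k n i| ^+ 3) * `|V w| ^+ 3) @[n --> \oo] -->
          4 * C * (0 * `|V w| ^+ 3).
        by apply: cvgM; [exact: cvg_cst|apply: cvgM; [exact: k3|exact: cvg_cst]].
      by move: H; rewrite mul0r mulr0.
  - by move=> n w; rewrite ger0_norm.
have s0 n w : 0 <= \sum_i `|@x n i w| ^+ 3 by apply: sumr_ge0 => i _; rewrite exprn_ge0.
have mz n : measurable_fun setT (fun w => Num.min 2 (C * \sum_i `|@x n i w| ^+ 3)).
  apply: measurable_minr => //; apply: measurable_funM => //; apply: measurable_sum => i.
  by apply: measurable_funX; exact: measurableT_comp.
have z0 n w : 0 <= Num.min 2 (C * \sum_i `|@x n i w| ^+ 3) by rewrite le_min ler0n mulr_ge0.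
have K0 : 0 <= 4 * C + 2 by rewrite addr_ge0// mulr_ge0.
apply: (@squeeze_cvgr _ _ _ _ (fun=> 0) (fun n => (4 * C + 2) * W n + \int[P]_w y n w)); last 2 first.
- exact: cvg_cst.
- rewrite -[X in _ --> X](addr0 0); apply: cvgD => //.
  by rewrite -(mulr0 (4 * C + 2)); apply: cvgM => //; exact: cvg_cst.
near=> n; apply/andP; split; first exact: Rintegral_ge0.
have h1 : (\int[P]_w (werr n w)%:E <= (W n)%:E)%E by near: n.
have iz : P.-integrable setT (EFin \o (fun w => Num.min 2 (C * \sum_i `|@x n i w| ^+ 3))).
  by apply: (@bounded_integrable _ _ _ P _ 2) => // w; rewrite ger0_norm// ge_min lexx.
have iy : P.-integrable setT (EFin \o y n).
  by apply: (@bounded_integrable _ _ _ P _ 2) => // w; rewrite ger0_norm.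
apply: le_trans (ler_norm _) _.
apply: (normr_Rintegral_le_ereal (g := fun w => (4 * C + 2) * werr n w + y n w)) => //.
  by move=> w; rewrite ger0_norm//; exact: (@cube_sum_le n (fun i => x i w) (fun i => k i * V w) _ C0).
rewrite (_ : (fun w => _) = (fun w => (4 * C + 2)%:E * (werr n w)%:E + (y n w)%:E)%E)//.
rewrite ge0_integralD//; last 4 first.
- by move=> w _; rewrite mule_ge0 ?lee_fin.
- by apply: measurable_funeM; exact/measurable_EFinP.
- by move=> w _; rewrite lee_fin.
- exact/measurable_EFinP.
rewrite (EFin_Rintegral iy) ge0_integralZl_EFin//; last 2 first.
- by move=> w _; rewrite lee_fin.
- exact/measurable_EFinP.
by rewrite (EFinD ((4 * C + 2) * W n)) (EFinM (4 * C + 2)); apply: leeD => //; apply: lee_wpmul2l.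
Unshelve. all: by end_near. Qed.

End GaussianMixtureLimit.

(** * Limits of kernel sums *)

Section KernelSums.
Context (R : realType).
Notation leb := (@lebesgue_measure R).
Variables (T tau : R) (h : nat -> R).
Hypotheses (T0 : 0 < T) (Htau : 0 < tau < T).
Hypotheses (h0 : forall n, 0 < h n) (hlim : h n @[n --> \oo] --> (0 : R)).
Hypothesis Dh : (T / n%:R) / h n @[n --> \oo] --> (0 : R).
Variables (K Psi : R -> R) (M : R).
Hypotheses (mK : measurable_fun setT K) (iK : leb.-integrable setT (EFin \o K)).
Hypothesis dv : dominated_variation K Psi M.

Definition kernel_at n i : R := K ((obs_time T n i - tau) / h n).
(** This is [a_i] times the mesh, that is, the weighted cell variance for unit volatility. *)
Definition kernel_weight n i : R := Num.sqrt ((T / n%:R) / h n) * kernel_at n i.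

Lemma obs_timeS n i : obs_time T n i.+1 - obs_time T n i = T / n%:R.
Proof. by rewrite /obs_time -!mulrBl -natrB// subSnn mul1r. Qed.

Lemma obs_time_lt n i : (0 < n)%N -> obs_time T n i < obs_time T n i.+1.
Proof. by move=> n0; rewrite -subr_gt0 obs_timeS divr_gt0// ltr0n. Qed.

Lemma obs_time_ge0 n i : 0 <= obs_time T n i.
Proof. by rewrite /obs_time !mulr_ge0 ?invr_ge0// ltW. Qed.

Lemma obs_time_le n i : (i <= n)%N -> obs_time T n i <= T.
Proof.
case: n => [|n]; first by rewrite leqn0 => /eqP ->; rewrite /obs_time !mul0r ltW.
by move=> ni; rewrite /obs_time ler_pdivrMr ?ltr0n// mulrC ler_wpM2l ?ler_nat// ltW.
Qed.

Let eps_ge0 n : 0 <= (T / n%:R) / h n.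
Proof. by rewrite !divr_ge0// ltW. Qed.

Let CK := `|K 0| + M.

Let KC x : `|K x| <= CK. Proof. exact: (dominated_variation_bounded dv). Qed.

Let CK0 : 0 <= CK := le_trans (normr_ge0 _) (KC 0).

Let iK2 : leb.-integrable setT (EFin \o (fun x => K x ^+ 2)).
Proof.
rewrite (_ : (fun x => _) = (fun x => K x * K x)); last by apply/funext => x; rewrite expr2.
exact: (integrable_mul_bounded (G := CK)).
Qed.

Let iKn : leb.-integrable setT (EFin \o (fun x => `|K x|)).
Proof. exact: (integrable_norm iK). Qed.

Let cell_cst n i : (0 < n)%N ->
  \int[leb]_(s in `]obs_time T n i, obs_time T n i.+1]) (1 : R) = T / n%:R.
Proof.
move=> n0; rewrite Rintegral_cst// leb_itv_oc ?mul1r ?obs_timeS//.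
exact: ltW (obs_time_lt _ n0).
Qed.

Lemma kernel_local_limit (g : R -> R) (G g0 : R) :
  measurable_fun setT g -> (forall x, 0 <= g x <= G) -> g x @[x --> tau] --> g0 ->
  (h n)^-1 * \sum_(i < n) kernel_at n i ^+ 2 *
     \int[leb]_(s in `]obs_time T n i, obs_time T n i.+1]) g s @[n --> \oo]
  --> g0 * \int[leb]_x K x ^+ 2.
Proof.
move=> mg gG gt.
apply: (riemann_local_limit T0 Htau h0 hlim Dh (phi := fun x => K x ^+ 2)
  (Psi := fun x => 2 * CK * Psi x) (M := 2 * CK * M) (G := G)) => //.
- by move=> x; rewrite sqr_ge0.
- exact: measurable_funX.
- exact: dominated_variation_sqr.
Qed.

Lemma kernel_sqr_limit :
  \sum_(i < n) kernel_weight n i ^+ 2 @[n --> \oo] --> \int[leb]_x K x ^+ 2.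
Proof.
have g1 (x : R) : 0 <= (1 : R) <= 1 by rewrite ler01 lexx.
have c1 : (fun=> 1 : R) x @[x --> tau] --> (1 : R) by exact: cvg_cst.
have := @kernel_local_limit (fun=> 1) 1 1 (measurable_cst _) g1 c1.
rewrite mul1r => H; apply: cvg_trans H; apply: near_eq_cvg; near=> n.
have n0 : (0 < n)%N by near: n; exists 1%N.
rewrite mulr_sumr; apply: eq_bigr => i _; rewrite cell_cst// /kernel_weight exprMn sqr_sqrtr//; ring.
Unshelve. all: by end_near. Qed.

(** Every weight is at most the bound of the kernel times [sqrt eps], which tends to 0, while the
    sum of squares converges. *)
Lemma kernel_cube_limit :
  \sum_(i < n) `|kernel_weight n i| ^+ 3 @[n --> \oo] --> (0 : R).
Proof.
have se : Num.sqrt ((T / n%:R) / h n) @[n --> \oo] --> (0 : R).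
  by rewrite -[X in _ --> X](sqrtr0 R); exact: (cvg_comp _ _ Dh (@sqrt_continuous R 0)).
apply: (@squeeze_cvgr _ _ _ _ (fun=> 0)
  (fun n => CK * (Num.sqrt ((T / n%:R) / h n) * \sum_(i < n) kernel_weight n i ^+ 2))).
- near=> n; apply/andP; split; first by apply: sumr_ge0 => i _; rewrite exprn_ge0.
  rewrite mulrA mulr_sumr; apply: ler_sum => i _.
  rewrite exprS real_normK ?num_real// ler_wpM2r ?sqr_ge0// /kernel_weight normrM mulrC.
  rewrite (ger0_norm (sqrtr_ge0 _)); apply: ler_wpM2r; first exact: sqrtr_ge0.
  exact: KC.
- exact: cvg_cst.
- have H : CK * (Num.sqrt ((T / n%:R) / h n) * \sum_(i < n) kernel_weight n i ^+ 2) @[n --> \oo]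
      --> CK * (0 * \int[leb]_x K x ^+ 2).
    by apply: cvgM; [exact: cvg_cst|apply: cvgM; [exact: se|exact: kernel_sqr_limit]].
  by move: H; rewrite mul0r mulr0.
Unshelve. all: by end_near. Qed.

(** Up to a constant, this is the total of the cell errors weighted by the absolute values of the
    [a_i]: a Riemann sum for the integral of [|K|], times the square root of the bandwidth. *)
Lemma kernel_abs_limit :
  Num.sqrt (h n) * ((h n)^-1 * \sum_(i < n) `|kernel_at n i| * (T / n%:R)) @[n --> \oo] --> (0 : R).
Proof.
have sh : Num.sqrt (h n) @[n --> \oo] --> (0 : R).
  by rewrite -[X in _ --> X](sqrtr0 R); exact: (cvg_comp _ _ hlim (@sqrt_continuous R 0)).
have g1 (x : R) : 0 <= (1 : R) <= 1 by rewrite ler01 lexx.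
have c1 : (fun=> 1 : R) x @[x --> tau] --> (1 : R) by exact: cvg_cst.
have H := @riemann_local_limit _ _ _ _ T0 Htau h0 hlim Dh (fun x => `|K x|) Psi (fun=> 1) M 1 1
  (fun x => normr_ge0 _) (measurableT_comp (@normr_measurable R setT) mK) iKn
  (dominated_variation_norm dv) (measurable_cst _) g1 c1.
have E : (h n)^-1 * \sum_(i < n) `|kernel_at n i| * (T / n%:R) @[n --> \oo] --> 1 * \int[leb]_x `|K x|.
  apply: cvg_trans H; apply: near_eq_cvg; near=> n.
  have n0 : (0 < n)%N by near: n; exists 1%N.
  by congr (_ * _); apply: eq_bigr => i _; rewrite cell_cst.
have H2 : Num.sqrt (h n) * ((h n)^-1 * \sum_(i < n) `|kernel_at n i| * (T / n%:R)) @[n --> \oo]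
    --> 0 * (1 * \int[leb]_x `|K x|).
  by apply: cvgM; [exact: sh|exact: E].
by move: H2; rewrite mul0r.
Unshelve. all: by end_near. Qed.

End KernelSums.

(** * Continuity of the volatility and the limit law *)

Lemma powR_small (R : realType) (s e : R) : 0 < s -> 0 < e ->
  exists2 dl, 0 < dl & forall x, 0 <= x <= dl -> x `^ s <= e.
Proof.
move=> s0 e0; exists (e `^ s^-1); first by rewrite powR_gt0.
move=> x /andP[x0 xe].
apply: le_trans (ge0_ler_powR (ltW s0) _ _ xe) _; rewrite ?nnegrE ?powR_ge0//.
by rewrite -powRrM mulVf ?gt_eqF// powRr1// ltW.
Qed.

Section VolatilityContinuity.
Context d (Omega : measurableType d) (R : realType) (P : probability Omega R).
Variables (T : R) (sigma : R -> Omega -> R) (gamma : R) (L : R -> R) (C : R -> R -> R).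
Hypothesis Hscal : scaling_condition P T sigma gamma L C.

Definition volatility_gap tau t : R :=
  \int[P]_w ((sigma t w ^+ 2 - sigma tau w ^+ 2) ^+ 2).

(** The scaling expansion on the diagonal expresses the gap as [L tau * C r r] plus a remainder, and
    homogeneity makes [C r r] of order [|r|^gamma]. *)
Lemma volatility_gap_cvg tau : 0 < tau < T ->
  volatility_gap tau t @[t --> tau] --> (0 : R).
Proof.
move=> tauT; have g0 := scaling_gamma Hscal.
have /eqoP/(_ 1 ltr01) := scaling_expansion Hscal tauT.
move=> /nbhs_ballP[dl dl0 Hdl]; rewrite /= in dl0.
pose Cm := `|C 1 1| + `|C (-1) (-1)|.
(* Homogeneity concerns positive factors, so the two signs of [r] are rescaled to [C 1 1] and
   [C (-1) (-1)]; at [r = 0] the gap itself vanishes. *)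
have Cr r : `|C r r| <= `|r| `^ gamma * Cm \/ r = 0.
  have [r0|r0|->] := ltgtP r 0; [left|left|by right].
    have -> : C r r = C (- r * -1) (- r * -1) by rewrite mulrN1 opprK.
    have nr0 : 0 < - r by rewrite oppr_gt0.
    rewrite (scaling_homogeneous Hscal (-1) (-1) nr0) (ltr0_norm r0) normrM (ger0_norm (powR_ge0 _ _)).
    by rewrite ler_wpM2l ?powR_ge0// /Cm lerDr.
  have -> : C r r = C (r * 1) (r * 1) by rewrite mulr1.
  rewrite (scaling_homogeneous Hscal 1 1 r0) (gtr0_norm r0) normrM (ger0_norm (powR_ge0 _ _)).
  by rewrite ler_wpM2l ?powR_ge0// /Cm lerDl.
have L0 : 0 <= L tau := scaling_L Hscal tau.
have Cm0 : 0 <= Cm by rewrite addr_ge0.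
have LC : 0 < L tau * Cm + 1 by rewrite ltr_wpDl// mulr_ge0.
apply/cvgrPdist_le => e e0.
have e1 : 0 < e / (2 * (L tau * Cm + 1)) by rewrite divr_gt0// mulr_gt0.
have e2 : 0 < e / 2 by rewrite divr_gt0.
have [d1 d10 H1] := powR_small g0 e1.
have g20 : 0 < gamma / 2 by rewrite divr_gt0.
have [d2 d20 H2] := powR_small g20 e2.
(* The last two bounds give [2 r^2 <= 2 |r| <= d2], as needed for the remainder. *)
pose m := Num.min dl (Num.min d1 (Num.min 1 (d2 / 2))).
have m0 : 0 < m by rewrite !lt_min dl0 d10 ltr01 divr_gt0.
near=> t; rewrite sub0r normrN.
have tm : `|t - tau| < m.
  by near: t; apply/nbhs_ballP; exists m => // x; rewrite /ball/= distrC.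
move: tm; rewrite !lt_min => /and4P[t1 t2 t3 t4].
set r := t - tau in t1 t2 t3 t4.
have := Hdl (r, r); rewrite /ball/= /prod_ball/= => /(_ _).
have br : ball (0 : R) dl r by rewrite /ball/= sub0r normrN.
move=> /(_ (conj br br)); rewrite mul1r.
have -> : fine 'E_P[fun w => ((sigma (tau + r) w ^+ 2 - sigma tau w ^+ 2) *
     (sigma (tau + r) w ^+ 2 - sigma tau w ^+ 2))%R]%E = volatility_gap tau t.
  rewrite unlock /volatility_gap /Rintegral; congr fine; apply: eq_integral => w _.
  by rewrite (_ : tau + r = t) ?expr2// /r addrC subrK.
rewrite [`|_ `^ _|]ger0_norm ?powR_ge0// => H.
have h2 : (r ^+ 2 + r ^+ 2) `^ (gamma / 2) <= e / 2.
  apply: H2; rewrite addr_ge0 ?sqr_ge0//=.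
  rewrite -[r ^+ 2]real_normK ?num_real//; have := normr_ge0 r; nra.
have [Ch|r0] := Cr r; last first.
  rewrite (_ : t = tau); last by move: r0; rewrite /r => /eqP; rewrite subr_eq0 => /eqP.
  rewrite /volatility_gap (_ : \int[P]_w _ = 0) ?normr0 ?ltW//.
  rewrite -[RHS](Rintegral_prob_cst P); apply: eq_Rintegral => w _.
  by rewrite subrr expr0n.
have h1 : `|r| `^ gamma <= e / (2 * (L tau * Cm + 1)) by apply: H1; rewrite normr_ge0/= ltW.
have h3 : `|L tau * C r r| <= e / 2.
  rewrite normrM ger0_norm//.
  apply: (@le_trans _ _ (L tau * (e / (2 * (L tau * Cm + 1)) * Cm))).
    by rewrite ler_wpM2l//; apply: le_trans Ch _; rewrite ler_wpM2r.
  have -> : L tau * (e / (2 * (L tau * Cm + 1)) * Cm) = e / 2 * (L tau * Cm / (L tau * Cm + 1)).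
    by field; rewrite gt_eqF.
  rewrite -[leRHS]mulr1 ler_wpM2l ?(ltW e2)// ler_pdivrMr// mul1r lerDl ler01//.
have -> : volatility_gap tau t = (volatility_gap tau t - L tau * C r r) + L tau * C r r by rewrite subrK.
by apply: le_trans (ler_normD _ _) _; move: H h2 h3; lra.
Unshelve. all: by end_near. Qed.

End VolatilityContinuity.

(** * Characteristic function of the mixed normal limit *)

Section TargetCharacteristic.
Context d (Omega : measurableType d) (R : realType) (P : probability Omega R).
Variables (FF : R -> set (set Omega)) (B : R -> Omega -> R).
Hypotheses (HFF : complete_filtration P FF) (HB : brownian_motion P FF B).
Context d' (Omega' : measurableType d') (P' : probability Omega' R).
Variables (delta xi : Omega' -> R).
Hypotheses (mdelta : measurable_fun setT delta) (Hxi : normal_rv P' xi 0 1).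
Hypothesis ind : indep_events P' (rv_events delta) (rv_events xi).

Let mxi : measurable_fun setT xi := Hxi.1.

Let gxi : gaussian P' 1 xi.
Proof. by have := normal_rv_gaussian (P := P') ltr01 Hxi; rewrite expr1n. Qed.

Let indr : indep_rv P' delta xi.
Proof.
move=> A C mA mC; apply: ind.
  by exists A => //; rewrite setTI.
by exists C => //; rewrite setTI.
Qed.

Lemma mixture_cos (l : R) :
  \int[P']_w cos (l * (delta w * xi w)) = \int[P']_w expR (- (l ^+ 2 * (delta w ^+ 2 / 2))).
Proof.
have mF : measurable_fun setT (fun z : R * R => cos (l * (z.1 * z.2))).
  by apply: measurableT_comp; [exact: measurable_cos|apply: measurable_funM => //; exact: measurable_funM].
rewrite (indep_Rintegral mdelta mxi indr mF (fun z => cos_max _)).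
apply: eq_Rintegral => w _ /=.
have mf : measurable_fun setT (fun y : R => cos (l * (delta w * y))).
  by apply: (measurableT_comp (@measurable_cosM R l)); exact: measurable_funM.
have mf' : measurable_fun setT (fun x : R => cos (l * (delta w * (Num.sqrt 1 * x)))).
  by apply: (measurableT_comp mf); exact: measurable_funM.
have [_ ->] := gaussian_integral gxi mf
  (@bounded_integrable _ _ _ (std_normal R) _ 1 mf' (fun x => cos_max _)).
have <- : expR (- ((l * delta w) ^+ 2 / 2)) = expR (- (l ^+ 2 * (delta w ^+ 2 / 2))).
  by congr expR; rewrite exprMn; ring.
rewrite -(normal_cos HFF HB (l * delta w)).
by apply: eq_Rintegral => x _; congr cos; rewrite sqrtr1; ring.
Qed.

Lemma mixture_sin (l : R) : \int[P']_w sin (l * (delta w * xi w)) = 0.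
Proof.
have mF : measurable_fun setT (fun z : R * R => sin (l * (z.1 * z.2))).
  by apply: measurableT_comp; [exact: measurable_sin|apply: measurable_funM => //; exact: measurable_funM].
rewrite (indep_Rintegral mdelta mxi indr mF (fun z => sin_max _)).
rewrite -(Rintegral_prob_cst P' 0); apply: eq_Rintegral => w _ /=.
have mf : measurable_fun setT (fun y : R => sin (l * (delta w * y))).
  by apply: (measurableT_comp (@measurable_sinM R l)); exact: measurable_funM.
have mf' : measurable_fun setT (fun x : R => sin (l * (delta w * (Num.sqrt 1 * x)))).
  by apply: (measurableT_comp mf); exact: measurable_funM.
have [_ ->] := gaussian_integral gxi mf
  (@bounded_integrable _ _ _ (std_normal R) _ 1 mf' (fun x => sin_max _)).
rewrite -(normal_sin (l * delta w)).
by apply: eq_Rintegral => x _; congr sin; rewrite sqrtr1; ring.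
Qed.

End TargetCharacteristic.

Lemma extension_Rintegral (R : realType) d (Omega : measurableType d) (P : probability Omega R)
    d' (Omega' : measurableType d') (P' : probability Omega' R) (rho : Omega' -> Omega)
    (f : Omega -> R) : extension P P' rho -> measurable_fun setT f -> (forall w, 0 <= f w) ->
  \int[P']_w f (rho w) = \int[P]_w f w.
Proof.
move=> [mrho Prho] mf f0; rewrite /Rintegral; congr fine.
have mfr : measurable_fun setT (EFin \o f) by exact/measurable_EFinP.
pose mR : {mfun Omega' >-> Omega} := HB.pack rho (isMeasurableFun.Build _ _ _ _ _ mrho).
transitivity (\int[distribution P' mR]_x (EFin \o f) x)%E.
  by rewrite ge0_integral_distribution// => x; rewrite lee_fin.
by apply: eq_measure_integral => A mA _; exact: Prho.
Qed.

(** * Convergence of the statistics *)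

Section CharacteristicTransfer.
Context (R : realType).

(** The crude constant 4 comes from the cubic Taylor bounds for increments up to 1 and from
    boundedness beyond; any Lipschitz constant would serve. *)
Lemma cos_dist_le (x y : R) : `|cos x - cos y| <= 4 * `|x - y|.
Proof.
set u := x - y; have [u1|u1] := leP `|u| 1; last first.
  by apply: le_trans (ler_normB _ _) _; have := cos_max x; have := cos_max y; lra.
have -> : cos x = cos (y + u) by congr cos; rewrite /u addrC subrK.
have -> : cos (y + u) - cos y = cos y * (cos u - 1) - sin y * sin u by rewrite cosD; ring.
have u0 := normr_ge0 u.
have hc : `|cos u - 1| <= `|u| + `|u|.
  have -> : cos u - 1 = (cos u - 1 + u ^+ 2 / 2) - u ^+ 2 / 2 by ring.
  apply: le_trans (ler_normB _ _) _; apply: lerD.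
    by apply: le_trans (normr_cosB u) _; rewrite -[leRHS]expr1 ler_wiXn2l.
  by rewrite ger0_norm ?divr_ge0 ?sqr_ge0// -[u ^+ 2]real_normK ?num_real//; nra.
have hs : `|sin u| <= `|u| + `|u|.
  rewrite -[sin u](subrK u); apply: le_trans (ler_normD _ _) _; rewrite lerD2r.
  by apply: le_trans (normr_sinB u) _; rewrite -[leRHS]expr1 ler_wiXn2l.
apply: le_trans (ler_normB _ _) _; rewrite !normrM.
have h1 : `|cos y| * `|cos u - 1| <= `|cos u - 1| by rewrite -[leRHS]mul1r ler_wpM2r// cos_max.
have h2 : `|sin y| * `|sin u| <= `|sin u| by rewrite -[leRHS]mul1r ler_wpM2r// sin_max.
lra.
Qed.

Lemma sin_dist_le (x y : R) : `|sin x - sin y| <= 4 * `|x - y|.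
Proof.
have E z : sin z = cos (z - pi / 2) by rewrite -[z in LHS](subrK (pi / 2)) sinDpihalf.
rewrite !E; apply: le_trans (cos_dist_le _ _) _.
by have -> : x - pi / 2 - (y - pi / 2) = x - y by ring.
Qed.

Context d (Omega : measurableType d) (P : probability Omega R).

Lemma characteristic_transfer (f : R -> R) (Y U : nat -> Omega -> R) (e : nat -> R) (c l : R) :
  measurable_fun setT f -> (forall x, `|f x| <= 1) -> (forall x y, `|f x - f y| <= 4 * `|x - y|) ->
  (forall n, measurable_fun setT (Y n)) -> (forall n, measurable_fun setT (U n)) ->
  (\forall n \near \oo, (\int[P]_w (`|Y n w - U n w|)%:E <= (e n)%:E)%E) ->
  e n @[n --> \oo] --> (0 : R) ->
  \int[P]_w f (l * U n w) @[n --> \oo] --> c ->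
  \int[P]_w f (l * Y n w) @[n --> \oo] --> c.
Proof.
move=> mf f1 flip mY mU YU e0 fU.
have mfl (Z : Omega -> R) : measurable_fun setT Z -> measurable_fun setT (fun w => f (l * Z w)).
  by move=> mZ; apply: measurableT_comp => //; exact: measurable_funM.
have ifl (Z : Omega -> R) : measurable_fun setT Z -> P.-integrable setT (EFin \o (fun w => f (l * Z w))).
  by move=> mZ; apply: (@bounded_integrable _ _ _ P _ 1) => //; exact: mfl.
have cl : 4 * `|l| * e n @[n --> \oo] --> (0 : R).
  by rewrite -(mulr0 (4 * `|l|)); apply: cvgM => //; exact: cvg_cst.
have dl : \int[P]_w f (l * Y n w) - \int[P]_w f (l * U n w) @[n --> \oo] --> (0 : R).
  apply/norm_cvg0P.
  apply: (@squeeze_cvgr _ _ _ _ (fun=> 0) (fun n => 4 * `|l| * e n)) => //; last exact: cvg_cst.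
  near=> n; rewrite normr_ge0/= -RintegralB//; [|exact: ifl|exact: ifl].
  apply: (normr_Rintegral_le_ereal (g := fun w => 4 * `|l| * `|Y n w - U n w|)).
  - exact: (integrableB _ (ifl _ (mY n)) (ifl _ (mU n))).
  - by move=> w; apply: le_trans (flip _ _) _; rewrite -mulrBr normrM mulrA.
  - rewrite (_ : (fun w => _) = (fun w => (4 * `|l|)%:E * (`|Y n w - U n w|)%:E)%E)//.
    have l0 : 0 <= 4 * `|l| by rewrite mulr_ge0.
    rewrite ge0_integralZl_EFin//; last first.
      apply/measurable_EFinP.
      have m1 : measurable_fun setT (fun w => Y n w - U n w) by exact: measurable_funB.
      exact: (measurableT_comp (@normr_measurable R setT) m1).
    by rewrite (EFinM (4 * `|l|)); apply: lee_wpmul2l => //; near: n.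
rewrite -[c]add0r.
have -> : (fun n => \int[P]_w f (l * Y n w)) =
    (fun n => (\int[P]_w f (l * Y n w) - \int[P]_w f (l * U n w)) + \int[P]_w f (l * U n w)).
  by apply/funext => n; rewrite subrK.
exact: cvgD.
Unshelve. all: by end_near. Qed.

End CharacteristicTransfer.

(** Counterpart of [riemann_sum_close] for one path of the squared volatility, which has no uniform
    bound: the cell integrals of [g] stay on the right, to be bounded in mean afterwards. *)
Lemma riemann_sum_path (R : realType) (phi Psi g : R -> R) (C : R) (t : nat -> R) (n : nat) :
  (forall x y, x <= y -> `|phi x - phi y| <= Psi y - Psi x) ->
  measurable_fun setT phi -> (forall x, `|phi x| <= C) -> (forall x, 0 <= g x) ->
  (forall i, t i <= t i.+1) ->
  (@lebesgue_measure R).-integrable `]t 0%N, t n] (EFin \o g) ->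
  `|\sum_(i < n) phi (t i) * \int[@lebesgue_measure R]_(s in `]t i, t i.+1]) g s -
     \int[@lebesgue_measure R]_(s in `]t 0%N, t n]) (phi s * g s)| <=
  \sum_(i < n) (Psi (t i.+1) - Psi (t i)) * \int[@lebesgue_measure R]_(s in `]t i, t i.+1]) g s.
Proof.
move=> dv mphi phiC g0 t_nd.
have t_mono i j : (i <= j)%N -> t i <= t j by exact: (homo_leq (@lexx _ _) (@le_trans _ _) t_nd).
have mul_int (S : set R) (f : R -> R) (D : R) : measurable S -> measurable_fun setT f ->
    (forall x, S x -> `|f x| <= D) -> (@lebesgue_measure R).-integrable S (EFin \o g) ->
    (@lebesgue_measure R).-integrable S (EFin \o (fun s => f s * g s)).
  move=> mS mf fD ig.
  have mg : measurable_fun S g by have /measurable_EFinP := measurable_int _ ig.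
  apply: (@le_integrable _ _ _ (@lebesgue_measure R) S mS _ (fun x => (`|D| * g x)%:E)).
  - by apply/measurable_EFinP; apply: measurable_funM => //; exact: measurable_funTS.
  - move=> x Sx; rewrite lee_fin !normrM normr_id ler_wpM2r//.
    exact: le_trans (fD x Sx) (ler_norm _).
  - exact: (integrableZl _ `|D| ig).
elim: n => [|n IH] ig.
  by rewrite !big_ord0 set_itv_ge ?bnd_simp ?ltxx// Rintegral_set0 subrr normr0.
have ign : (@lebesgue_measure R).-integrable `]t 0%N, t n] (EFin \o g).
  by apply: integrableS ig => //; apply: subset_itvl; rewrite bnd_simp t_mono.
have igS : (@lebesgue_measure R).-integrable `]t n, t n.+1] (EFin \o g).
  by apply: integrableS ig => //; apply: subset_itvr; rewrite bnd_simp t_mono.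
have {}IH := IH ign.
rewrite !big_ord_recr/=.
have iphi S : measurable S -> (@lebesgue_measure R).-integrable S (EFin \o g) ->
    (@lebesgue_measure R).-integrable S (EFin \o (fun s => phi s * g s)).
  by move=> mS; apply: (mul_int S phi C).
have -> : \int[@lebesgue_measure R]_(s in `]t 0%N, t n.+1]) (phi s * g s) =
    \int[@lebesgue_measure R]_(s in `]t 0%N, t n]) (phi s * g s) +
    \int[@lebesgue_measure R]_(s in `]t n, t n.+1]) (phi s * g s).
  rewrite -(@Rintegral_itvB _ _ (BRight (t 0%N)) (BRight (t n.+1)) (t n)) ?bnd_simp//.
  - by rewrite addrC subrK.
  - exact: iphi.
  - exact: t_mono.
set S1 := \sum_(i < n) phi (t i) * _; set I1 := \int[@lebesgue_measure R]_(s in _) (phi s * g s).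
set I2 := \int[@lebesgue_measure R]_(s in _) (phi s * g s).
have ic (c : R) : (@lebesgue_measure R).-integrable `]t n, t n.+1] (EFin \o (fun s => c * g s)).
  exact: (integrableZl _ c igS).
have E : phi (t n) * \int[@lebesgue_measure R]_(s in `]t n, t n.+1]) g s - I2 =
    \int[@lebesgue_measure R]_(s in `]t n, t n.+1]) ((phi (t n) - phi s) * g s).
  rewrite -RintegralZl// -RintegralB//; last exact: iphi.
  by apply: eq_Rintegral => s _; rewrite mulrBl.
have -> : S1 + phi (t n) * \int[@lebesgue_measure R]_(s in `]t n, t n.+1]) g s - (I1 + I2) =
    (S1 - I1) + (phi (t n) * \int[@lebesgue_measure R]_(s in `]t n, t n.+1]) g s - I2) by ring.
rewrite E; apply: le_trans (ler_normD _ _) _; apply: lerD => //.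
have dphi s : `]t n, t n.+1]%classic s -> `|phi (t n) - phi s| <= Psi (t n.+1) - Psi (t n).
  rewrite /= in_itv/= => /andP[ts st]; apply: le_trans (dv _ _ (ltW ts)) _; rewrite lerD2r.
  by rewrite -subr_ge0; exact: le_trans (normr_ge0 _) (dv _ _ st).
have iE : (@lebesgue_measure R).-integrable `]t n, t n.+1] (EFin \o (fun s => (phi (t n) - phi s) * g s)).
  by apply: (mul_int _ _ (Psi (t n.+1) - Psi (t n))) => //; exact: measurable_funB.
apply: le_trans (le_normr_Rintegral _ iE) _ => //.
rewrite -RintegralZl//; apply: le_Rintegral => //.
- exact: integrable_norm.
- by move=> s Ss; rewrite normrM (ger0_norm (g0 s)) ler_wpM2r// dphi.
Qed.

(** * The decoupled Gaussian sum over all cells *)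

Section Observations.
Context d (Omega : measurableType d) (R : realType) (P : probability Omega R).
Notation leb := (@lebesgue_measure R).
Variables (FF : R -> set (set Omega)) (B : R -> Omega -> R).
Hypotheses (HFF : complete_filtration P FF) (HB : brownian_motion P FF B).
Variables (T M : R) (mu sigma X : R -> Omega -> R).
Hypothesis HT : 0 < T.
Hypotheses (mu_measurable : measurable_process mu) (sigma_measurable : measurable_process sigma).
Hypothesis sigma_adapted : adapted FF sigma.
Hypothesis HX : ito_process P FF B T mu sigma X.
Hypothesis Hlev : non_leverage P mu sigma B.
Hypothesis M1 : 1 <= M.
Hypothesis mu4 : forall t, 0 <= t <= T -> (\int[P]_w (mu t w ^+ 4)%:E <= M%:E)%E.
Hypothesis sigma4 : forall t, 0 <= t <= T -> (\int[P]_w (sigma t w ^+ 4)%:E <= M%:E)%E.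
Variables (tau : R) (h : nat -> R).
Hypothesis Htau : 0 < tau < T.
Hypotheses (h0 : forall n, 0 < h n) (hlim : h n @[n --> \oo] --> (0 : R)).
Hypothesis Dh : (T / n%:R) / h n @[n --> \oo] --> (0 : R).
Variables (K Psi : R -> R) (MK : R).
Hypotheses (mK : measurable_fun setT K) (iK : leb.-integrable setT (EFin \o K)).
Hypothesis dv : dominated_variation K Psi MK.
Hypothesis gap : volatility_gap P sigma tau t @[t --> tau] --> (0 : R).

Local Notation t n i := (obs_time T n i).
Let r n := Num.sqrt (T / n%:R).

Variables (N : nat -> nat -> R) (m : nat -> nat -> nat) (s : nat -> nat -> nat -> R).
Hypothesis N0 : forall n i, 0 <= N n i.
Hypothesis s_nd : forall n i j, s n i j <= s n i j.+1.
Hypothesis ts : forall n i, t n i <= s n i 0%N.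
Hypothesis st : forall n i, s n i (m n i) = t n i.+1.
Hypothesis approx : forall n i, (i < n)%N ->
  let S := step_path (m n i) (s n i) (fun u w => clip (N n i) (sigma u w)) in
  (\int[P]_w \int[leb]_(u in `]t n i, t n i.+1]) ((S u w - sigma u w) ^+ 2 +
     (S u w ^+ 2 - sigma u w ^+ 2) ^+ 2)%:E <= (r n ^+ 4)%:E)%E.

Let dt_gt0 n : (0 < n)%N -> 0 < T / n%:R.
Proof. by move=> n0; rewrite divr_gt0// ltr0n. Qed.

Let dt_ge0 n : 0 <= T / n%:R. Proof. by rewrite divr_ge0// ltW. Qed.

Let t_ge0 n i : 0 <= t n i := obs_time_ge0 HT n i.

Let t_le n i : (i <= n)%N -> t n i <= T := @obs_time_le _ _ HT n i.

Let sqr_r n : r n ^+ 2 = T / n%:R.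
Proof. by rewrite sqr_sqrtr. Qed.

Let v n i j w := clip (N n i) (sigma (s n i j) w).
Let Jn n i w := cell_integral B (m n) (s n) (v n) i w.
Let In n i w := cell_var (m n) (s n) (v n) i w.
Let coef n i := (Num.sqrt ((T / n%:R) / h n))^-1 * (kernel_at T tau h K n i / h n).

Definition gaussian_sum n w := cell_quad B (m n) (s n) (v n) (coef n) n w.

Let s_mono n i j k : (j <= k)%N -> s n i j <= s n i k.
Proof. exact: (homo_leq (@lexx _ _) (@le_trans _ _) (s_nd n i)). Qed.

Let s_ge0 n i j : 0 <= s n i j.
Proof. exact: le_trans (t_ge0 n i) (le_trans (ts n i) (s_mono n i (leq0n j))). Qed.

Let mv n i j : measurable_fun setT (v n i j).
Proof. exact: (measurableT_comp (measurable_clip _) (process_at sigma_measurable (s_ge0 n i j))). Qed.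

Let mB u : 0 <= u -> measurable_fun setT (B u).
Proof. by move=> u0; exact: (at_time_measurable HFF u0 (brownian_measurable HFF HB u0 (lexx u))). Qed.

Let mJn n i : measurable_fun setT (Jn n i).
Proof.
by apply: measurable_sum => j; apply: measurable_funM => //; apply: measurable_funB; exact: mB.
Qed.

Let mIn n i : measurable_fun setT (In n i).
Proof. by apply: measurable_sum => j; apply: measurable_funM => //; exact: measurable_funX. Qed.

Let mU n : measurable_fun setT (gaussian_sum n).
Proof.
apply: measurable_sum => i; apply: measurable_funM => //; apply: measurable_funB.
  by apply: measurable_funX; exact: mJn.
exact: mIn.
Qed.

Let eps_gt0 n : (0 < n)%N -> 0 < (T / n%:R) / h n.
Proof. by move=> n0; rewrite divr_gt0 ?dt_gt0. Qed.

Let coefE n i : (0 < n)%N -> coef n i * (T / n%:R) = kernel_weight T tau h K n i.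
Proof.
move=> n0; rewrite /coef /kernel_weight.
have e0 := eps_gt0 n0; have se0 : 0 < Num.sqrt ((T / n%:R) / h n) by rewrite sqrtr_gt0.
have -> : (Num.sqrt (T / n%:R / h n))^-1 * (kernel_at T tau h K n i / h n) * (T / n%:R) =
  (Num.sqrt (T / n%:R / h n))^-1 * (T / n%:R / h n) * kernel_at T tau h K n i.
  by ring.
by rewrite -[X in _ * X * _ = _](sqr_sqrtr (ltW e0)) expr2 mulrA mulVf ?gt_eqF// mul1r.
Qed.

Let coef_sqr n i : (0 < n)%N -> coef n i ^+ 2 * (T / n%:R) = (h n)^-1 * kernel_at T tau h K n i ^+ 2.
Proof.
move=> n0; have e0 := eps_gt0 n0; have d0 := dt_gt0 n0; have hn := h0 n.
rewrite /coef exprMn exprVn sqr_sqrtr ?(ltW e0)// exprMn exprVn invf_div.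
by move: d0 hn; set D := T / n%:R; move=> d0 hn; field; rewrite !gt_eqF.
Qed.

(** Cutting the gap off outside [[0, T]] makes it bounded and measurable on the line, as
    [kernel_local_limit] requires, without changing it near [tau]. *)
Let g u : R := volatility_gap P sigma tau u * \1_(`[0, T]) u.

Let gap_bound u : 0 <= u <= T ->
  (\int[P]_w ((sigma u w ^+ 2 - sigma tau w ^+ 2) ^+ 2)%:E <= (4 * M)%:E)%E.
Proof.
move=> uT; have tau01 : 0 <= tau <= T by case/andP: Htau => h1 h2; rewrite !ltW.
have mu_ : measurable_fun setT (sigma u) by apply: process_at => //; case/andP: uT.
have mtau : measurable_fun setT (sigma tau) by apply: process_at => //; case/andP: tau01.
have arith (x y : R) : (x ^+ 2 - y ^+ 2) ^+ 2 <= 2 * x ^+ 4 + 2 * y ^+ 4.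
  have -> : 2 * x ^+ 4 + 2 * y ^+ 4 = (x ^+ 2 - y ^+ 2) ^+ 2 + (x ^+ 2 + y ^+ 2) ^+ 2 by ring.
  by rewrite lerDl sqr_ge0.
apply: (@le_trans _ _ (\sum_(c <- [:: u; tau]) 2%:E * \int[P]_w (sigma c w ^+ 4)%:E)%E); last first.
  rewrite !big_cons big_nil adde0.
  apply: (@le_trans _ _ (2%:E * M%:E + 2%:E * M%:E)%E).
    by apply: leeD; apply: lee_wpmul2l => //; exact: sigma4.
  by rewrite -!EFinM -EFinD lee_fin; lra.
pose G (c : bool) w := ((if c then sigma u w else sigma tau w) ^+ 4)%:E.
have := @ge0_integral_le_lin _ _ _ P setT bool [:: true; false] (fun=> 2) G
  (fun w => ((sigma u w ^+ 2 - sigma tau w ^+ 2) ^+ 2)%:E) measurableT.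
rewrite !big_cons !big_nil/=; apply.
- by move=> w _; rewrite lee_fin sqr_ge0.
- by [].
- by case; apply/measurable_EFinP; exact: measurable_funX.
- by case=> w; rewrite lee_fin exprn_even_ge0.
- by move=> w _; rewrite !big_cons big_nil adde0 -!EFinM -EFinD lee_fin.
Qed.

Let gapE u : 0 <= u <= T ->
  (\int[P]_w ((sigma u w ^+ 2 - sigma tau w ^+ 2) ^+ 2)%:E = (volatility_gap P sigma tau u)%:E)%E.
Proof.
move=> uT; rewrite /volatility_gap /Rintegral fineK// ge0_fin_numE.
  by apply: le_lt_trans (gap_bound uT) _; rewrite ltry.
by apply: integral_ge0 => w _; rewrite lee_fin sqr_ge0.
Qed.

Let g_bound u : 0 <= g u <= 4 * M.
Proof.
rewrite /g indicE; case: (boolP (u \in _)) => [|_]; last first.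
  by rewrite mulr0 lexx mulr_ge0// (le_trans _ M1).
rewrite inE/= in_itv/= => uT; rewrite mulr1 -!lee_fin -gapE// gap_bound// andbT.
by apply: integral_ge0 => w _; rewrite lee_fin sqr_ge0.
Qed.

Let mg : measurable_fun setT g.
Proof.
pose F (z : R * Omega) := ((sigma z.1 z.2 ^+ 2 - sigma tau z.2 ^+ 2) ^+ 2)%:E.
have tau0 : 0 <= tau by case/andP: Htau => /ltW.
have mF : measurable_fun (`[0, T] `*` setT) F.
  apply/measurable_EFinP; apply: measurable_funX; apply: measurable_funB.
    apply: measurable_funX; apply: measurable_funS sigma_measurable.
      rewrite (_ : [set z | _] = (`[0, +oo[ `*` setT)%classic); first exact: measurableX.
      by apply/seteqP; split=> -[x y]/=; rewrite in_itv/= andbT => //; case.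
    by move=> -[u w] [/=]; rewrite in_itv/= => /andP[].
  apply: measurable_funX; apply: measurable_funTS.
  exact: (measurableT_comp (process_at sigma_measurable tau0) measurable_snd).
have [_ [_ H]] := Tonelli_restrict P (measurable_itv `[0, T]) mF (fun z => sqr_ge0 _).
have H1 : measurable_fun `[0, T] (volatility_gap P sigma tau).
  by apply: (measurableT_comp _ H).
have H2 := (measurable_restrictT _ (measurable_itv `[0, T])).1 H1.
rewrite (_ : g = volatility_gap P sigma tau \_ `[0, T])//.
by apply/funext => u; rewrite /g indicE patchE; case: ifPn => _; rewrite ?mulr1 ?mulr0.
Qed.

Let g_cvg : g u @[u --> tau] --> (0 : R).
Proof.
case/andP: Htau => h1 h2.
have H : volatility_gap P sigma tau u @[u --> tau] --> (0 : R) by exact: gap.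
apply: cvg_trans H; apply: near_eq_cvg; near=> u.
rewrite /g indicE mem_set ?mulr1//= in_itv/=; apply/andP; split.
  by apply: ltW; near: u; exact: lt_nbhsr.
by apply: ltW; near: u; exact: lt_nbhsl.
Unshelve. all: by end_near. Qed.

Let x n (i : 'I_n) w := coef n i * In n i w.
Let k n (i : 'I_n) := kernel_weight T tau h K n i.
(** A bound for the mean squared distance between the weighted cell variances and [kernel_weight]
    times the squared volatility at [tau]. The first term comes from the tolerance [r n ^+ 4] of the
    step approximation, the second from the volatility gap averaged by the squared kernel. *)
Let W n := 2 * ((T / n%:R) * \sum_(i < n) kernel_weight T tau h K n i ^+ 2) +
  2 * ((h n)^-1 * \sum_(i < n) kernel_at T tau h K n i ^+ 2 *
     \int[leb]_(u in `]t n i, t n i.+1]) g u).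

Let mx n (i : 'I_n) : measurable_fun setT (x i).
Proof. by apply: measurable_funM. Qed.

Let mVtau : measurable_fun setT (fun w => sigma tau w ^+ 2).
Proof. by apply: measurable_funX; apply: process_at => //; case/andP: Htau => /ltW. Qed.

Let dt_cvg : T / n%:R @[n --> \oo] --> (0 : R).
Proof.
have H : (T / n%:R) / h n * h n @[n --> \oo] --> (0 * 0 : R) by apply: cvgM.
move: H; rewrite mulr0; apply: cvg_trans; apply: near_eq_cvg; near=> n.
by rewrite divfK// gt_eqF.
Unshelve. all: by end_near. Qed.

Let W_cvg : W n @[n --> \oo] --> (0 : R).
Proof.
have k2 := kernel_sqr_limit HT Htau h0 hlim Dh mK iK dv.
have kg := kernel_local_limit HT Htau h0 hlim Dh mK iK dv mg g_bound g_cvg.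
have H : W n @[n --> \oo] --> 2 * (0 * \int[leb]_y K y ^+ 2) + 2 * (0 * \int[leb]_y K y ^+ 2).
  apply: cvgD; apply: cvgM; [exact: cvg_cst| |exact: cvg_cst|exact: kg].
  by apply: cvgM; [exact: dt_cvg|exact: k2].
by move: H; rewrite !mul0r mulr0 addr0.
Qed.

Let cell_gap n i : (i < n)%N ->
  (\int[leb]_(u in `]t n i, t n i.+1]) \int[P]_w ((sigma u w ^+ 2 - sigma tau w ^+ 2) ^+ 2)%:E =
   (\int[leb]_(u in `]t n i, t n i.+1]) g u)%:E)%E.
Proof.
move=> ni; have n0 : (0 < n)%N by exact: leq_ltn_trans ni.
have uT u : `]t n i, t n i.+1]%classic u -> 0 <= u <= T.
  rewrite /= in_itv/= => /andP[u1 u2]; rewrite (le_trans (t_ge0 n i) (ltW u1))/=.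
  exact: le_trans u2 (t_le ni).
have -> : (\int[leb]_(u in `]t n i, t n i.+1]) \int[P]_w ((sigma u w ^+ 2 - sigma tau w ^+ 2) ^+ 2)%:E =
    \int[leb]_(u in `]t n i, t n i.+1]) (g u)%:E)%E.
  apply: eq_integral => u; rewrite inE => /uT uT'; rewrite gapE// /g indicE mem_set ?mulr1//.
rewrite /Rintegral fineK// ge0_fin_numE; last first.
  by apply: integral_ge0 => u _; rewrite lee_fin; case/andP: (g_bound u).
apply: (@le_lt_trans _ _ (\int[leb]_(u in `]t n i, t n i.+1]) (4 * M)%:E)%E).
  apply: ge0_le_integral => //.
  - by move=> u _; rewrite lee_fin; case/andP: (g_bound u).
  - by apply/measurable_EFinP; exact: measurable_funTS.
  - by move=> u _; rewrite lee_fin; case/andP: (g_bound u).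
by rewrite (itv_integral_cst (obs_time_lt HT i n0)) ltry.
Qed.

Let xW : \forall n \near \oo,
  (\int[P]_w (\sum_(i < n) (x i w - k i * sigma tau w ^+ 2) ^+ 2)%:E <= (W n)%:E)%E.
Proof.
near=> n; have n0 : (0 < n)%N by near: n; exists 1%N.
have tau0 : 0 <= tau by case/andP: Htau => /ltW.
pose D i w := (In n i w - (T / n%:R) * sigma tau w ^+ 2) ^+ 2.
have mD i : measurable_fun setT (D i).
  by apply: measurable_funX; apply: measurable_funB => //; exact: measurable_funM.
have E w : (\sum_(i < n) (x i w - k i * sigma tau w ^+ 2) ^+ 2)%:E =
    (\sum_(i < n) (coef n i ^+ 2)%:E * (D i w)%:E)%E.
  rewrite -sumEFin; apply: eq_bigr => i _; rewrite -EFinM; congr EFin.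
  by rewrite /x /k -coefE// /D -exprMn; congr (_ ^+ 2); ring.
rewrite (eq_integral _ _ (fun w _ => E w)) ge0_integral_sum//; last 2 first.
- by move=> i; apply: measurable_funeM; exact/measurable_EFinP.
- by move=> i w _; rewrite -EFinM lee_fin mulr_ge0 ?sqr_ge0.
have -> : W n = \sum_(i < n) (coef n i ^+ 2 * (T / n%:R)) * (2 * r n ^+ 4 +
    2 * \int[leb]_(u in `]t n i, t n i.+1]) g u).
  rewrite /W !mulr_sumr -big_split/=; apply: eq_bigr => i _.
  have r4 : r n ^+ 4 = (T / n%:R) ^+ 2 by rewrite -sqr_r -exprM.
  rewrite coef_sqr// r4 /kernel_weight exprMn.
  by rewrite (sqr_sqrtr (ltW (eps_gt0 n0))); ring.
rewrite -sumEFin; apply: lee_sum => i _.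
rewrite ge0_integralZl_EFin ?sqr_ge0//; last 2 first.
- by move=> w _; rewrite lee_fin sqr_ge0.
- exact/measurable_EFinP.
rewrite -mulrA (EFinM (coef n i ^+ 2)); apply: lee_wpmul2l; first by rewrite lee_fin sqr_ge0.
have ni := ltn_ord i.
have H := @cell_var_error _ _ _ P sigma sigma_measurable (t n i) (t n i.+1) (t_ge0 n i)
  (obs_time_lt HT i n0) (N n i) (m n i) (s n i) (s_nd n i) (ts n i) (st n i) (r n ^+ 4)
  (approx ni) tau tau0.
have {}H : (\int[P]_w (D i w)%:E <= (T / n%:R)%:E * (2%:E * (r n ^+ 4)%:E +
    2%:E * (\int[leb]_(u in `]t n i, t n i.+1]) g u)%:E))%E.
  by move: H; rewrite cell_gap// obs_timeS.
apply: le_trans H _; rewrite -!EFinM.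
exact: lexx.
Unshelve. all: by end_near. Qed.

Let kappa := \int[leb]_y K y ^+ 2.

Let lindeberg n l := decoupled_lindeberg HFF HB (fun u u0 => process_at mu_measurable u0)
  (fun u u0 => process_at sigma_measurable u0) Hlev (t := fun i => t n i) (m := m n) (s := s n) (v := v n)
  (t_ge0 n) (s_nd n) (ts n) (st n)
  (fun i j => measurableT_comp (measurable_clip (N n i)) (@sigma_coefficient _ _ _ mu sigma _ (s_ge0 n i j)))
  (coef n) n l.

Let rate_cvg (l : R) : \int[P]_w Num.min 2 (2 * (chi_moment3 R + 1) * (`|l| ^+ 3 * \sum_(i < n) `|x i w| ^+ 3))
  @[n --> \oo] --> (0 : R).
Proof.
have c0 : 0 <= 2 * (chi_moment3 R + 1) * `|l| ^+ 3.
  by rewrite mulr_ge0 ?exprn_ge0// mulr_ge0// addr_ge0// chi_moment3_ge0.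
have H := mixture_cube_limit mVtau mx xW W_cvg (kernel_cube_limit HT Htau h0 hlim Dh mK iK dv) c0.
apply: cvg_trans H; apply: near_eq_cvg; near=> n.
by apply: eq_Rintegral => w _; congr (Num.min 2 _); exact/esym/mulrA.
Unshelve. all: by end_near. Qed.

Lemma gaussian_sum_cos l : \int[P]_w cos (l * gaussian_sum n w) @[n --> \oo] -->
  \int[P]_w expR (- (l ^+ 2 * (kappa * (sigma tau w ^+ 2) ^+ 2))).
Proof.
have H := mixture_exp_limit mVtau mx xW W_cvg (kernel_sqr_limit HT Htau h0 hlim Dh mK iK dv) (sqr_ge0 l).
have D : \int[P]_w cos (l * gaussian_sum n w) - \int[P]_w expR (- (l ^+ 2 * \sum_(i < n) x i w ^+ 2))
    @[n --> \oo] --> (0 : R).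
  apply/norm_cvg0P; apply: (@squeeze_cvgr _ _ _ _ (fun=> 0) _ _ _ _ _ (rate_cvg l)); last exact: cvg_cst.
  by near=> n; rewrite normr_ge0/=; have [] := lindeberg n l.
rewrite -[X in _ --> X]add0r.
have -> : (fun n => \int[P]_w cos (l * gaussian_sum n w)) = (fun n => (\int[P]_w cos (l * gaussian_sum n w) -
    \int[P]_w expR (- (l ^+ 2 * \sum_(i < n) x i w ^+ 2))) +
    \int[P]_w expR (- (l ^+ 2 * \sum_(i < n) x i w ^+ 2))).
  by apply/funext => n; rewrite subrK.
exact: cvgD.
Unshelve. all: by end_near. Qed.

Lemma gaussian_sum_sin l : \int[P]_w sin (l * gaussian_sum n w) @[n --> \oo] --> (0 : R).
Proof.
apply/norm_cvg0P; apply: (@squeeze_cvgr _ _ _ _ (fun=> 0) _ _ _ _ _ (rate_cvg l)); last exact: cvg_cst.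
by near=> n; rewrite normr_ge0/=; have [] := lindeberg n l.
Unshelve. all: by end_near. Qed.

End Observations.

(** * Distance from the statistics to the decoupled sum *)

Section ObservationErrors.
Context d (Omega : measurableType d) (R : realType) (P : probability Omega R).
Notation leb := (@lebesgue_measure R).
Variables (FF : R -> set (set Omega)) (B : R -> Omega -> R).
Hypotheses (HFF : complete_filtration P FF) (HB : brownian_motion P FF B).
Variables (T M : R) (mu sigma X : R -> Omega -> R).
Hypothesis HT : 0 < T.
Hypotheses (mu_measurable : measurable_process mu) (sigma_measurable : measurable_process sigma).
Hypothesis sigma_adapted : adapted FF sigma.
Hypothesis HX : ito_process P FF B T mu sigma X.
Hypothesis M1 : 1 <= M.
Hypothesis mu4 : forall t, 0 <= t <= T -> (\int[P]_w (mu t w ^+ 4)%:E <= M%:E)%E.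
Hypothesis sigma4 : forall t, 0 <= t <= T -> (\int[P]_w (sigma t w ^+ 4)%:E <= M%:E)%E.
Variables (tau : R) (h : nat -> R).
Hypothesis Htau : 0 < tau < T.
Hypotheses (h0 : forall n, 0 < h n) (hlim : h n @[n --> \oo] --> (0 : R)).
Hypothesis Dh : (T / n%:R) / h n @[n --> \oo] --> (0 : R).
Variables (K Psi : R -> R) (MK : R).
Hypotheses (mK : measurable_fun setT K) (iK : leb.-integrable setT (EFin \o K)).
Hypothesis dv : dominated_variation K Psi MK.

Local Notation t n i := (obs_time T n i).
Let r n := Num.sqrt (T / n%:R).
Let coef n i := (Num.sqrt ((T / n%:R) / h n))^-1 * (kernel_at T tau h K n i / h n).
Let cell_defect n i w := (X (t n i.+1) w - X (t n i) w) ^+ 2 -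
  \int[leb]_(u in `[t n i, t n i.+1]) sigma u w ^+ 2.

Let dt_gt0 n : (0 < n)%N -> 0 < T / n%:R.
Proof. by move=> n0; rewrite divr_gt0// ltr0n. Qed.

Let dt_ge0 n : 0 <= T / n%:R. Proof. by rewrite divr_ge0// ltW. Qed.

Let eps_ge0 n : 0 <= (T / n%:R) / h n.
Proof. by rewrite divr_ge0// ltW. Qed.

Let t_ge0 n i : 0 <= t n i := obs_time_ge0 HT n i.

Let t_le n i : (i <= n)%N -> t n i <= T := @obs_time_le _ _ HT n i.

Let t_nd n i : t n i <= t n i.+1.
Proof. by rewrite -subr_ge0 obs_timeS. Qed.

Let local_sumE n w :
  local_sum T tau K sigma X n (h n) w = \sum_(i < n) coef n i * cell_defect n i w.
Proof.
rewrite /local_sum powRN powR12_sqrt// big_add1/= big_mkord mulr_sumr.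
by apply: eq_bigr => i _; rewrite /incr_sq/= mulrA.
Qed.

(** The squared increments cancel, so the two statistics differ only by the Riemann sum error for
    the squared volatility. *)
Let kernel_sumE n w :
  kernel_error T tau K sigma X n (h n) w - local_sum T tau K sigma X n (h n) w =
  (Num.sqrt ((T / n%:R) / h n))^-1 *
    (\sum_(i < n) rescale K (h n) (t n i - tau) * \int[leb]_(u in `[t n i, t n i.+1]) sigma u w ^+ 2 -
     \int[leb]_(u in `[0, T]) (rescale K (h n) (u - tau) * sigma u w ^+ 2)).
Proof.
rewrite /local_sum /kernel_error powRN powR12_sqrt// !big_add1/= !big_mkord -mulrBr.
congr (_ * _); rewrite addrAC; congr (_ - _).
rewrite -sumrB; apply: eq_bigr => i _.
by rewrite mulrBr opprB addrC subrK.
Qed.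

Let mX u : 0 <= u <= T -> measurable_fun setT (X u).
Proof.
move=> /andP[u0 uT]; apply: (at_time_measurable HFF u0); apply: sub_measurable_fun.
  exact: (filtration_sigma HFF).
by case: HX => H _ _ _; apply: H; rewrite u0.
Qed.

Let m_sqr_path (a b : R) (f : R -> R) : 0 <= a -> measurable_fun setT f ->
  measurable_fun setT (fun w => \int[leb]_(u in `[a, b]) (f u * sigma u w ^+ 2)).
Proof.
move=> a0 mf; apply: (@measurable_path_Rintegral _ _ _ (fun z => f z.1 * sigma z.1 z.2 ^+ 2)) => //.
apply: measurable_funM.
  by apply: measurable_funTS; exact: (measurableT_comp mf measurable_fst).
apply: measurable_funX; apply: process_on => // u /=.
by rewrite in_itv/= => /andP[au _]; exact: le_trans au.
Qed.

Let m_defect n i : (i < n)%N -> measurable_fun setT (cell_defect n i).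
Proof.
move=> ni; apply: measurable_funB.
  apply: measurable_funX; apply: measurable_funB; apply: mX; rewrite t_ge0/= t_le//.
  exact: ltnW.
have := m_sqr_path (t n i.+1) (t_ge0 n i) (@measurable_cst _ _ _ _ setT (1 : R)).
by under eq_fun do under eq_Rintegral do rewrite mul1r.
Qed.

Let m_local n : measurable_fun setT (local_sum T tau K sigma X n (h n)).
Proof.
rewrite (_ : local_sum _ _ _ _ _ _ _ = (fun w => \sum_(i < n) coef n i * cell_defect n i w)).
  by apply: measurable_sum => i; apply: measurable_funM => //; exact: m_defect.
by apply/funext => w; exact: local_sumE.
Qed.

Let m_rescale n : measurable_fun setT (fun u : R => rescale K (h n) (u - tau)).
Proof.
apply: measurable_funM => //; apply: (measurableT_comp mK).
by apply: measurable_funM => //; exact: measurable_funB.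
Qed.

Let m_kernel n : measurable_fun setT (kernel_error T tau K sigma X n (h n)).
Proof.
have -> : kernel_error T tau K sigma X n (h n) = (fun w => local_sum T tau K sigma X n (h n) w +
    (kernel_error T tau K sigma X n (h n) w - local_sum T tau K sigma X n (h n) w)).
  by apply/funext => w; rewrite addrC subrK.
apply: measurable_funD; first exact: m_local.
rewrite (_ : (fun w => _) = fun w => (Num.sqrt ((T / n%:R) / h n))^-1 *
    (\sum_(i < n) rescale K (h n) (t n i - tau) * \int[leb]_(u in `[t n i, t n i.+1]) sigma u w ^+ 2 -
     \int[leb]_(u in `[0, T]) (rescale K (h n) (u - tau) * sigma u w ^+ 2))); last first.
  by apply/funext => w; exact: kernel_sumE.
apply: measurable_funM => //; apply: measurable_funB; last exact: m_sqr_path.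
apply: measurable_sum => i; apply: measurable_funM => //.
have := m_sqr_path (t n i.+1) (t_ge0 n i) (@measurable_cst _ _ _ _ setT (1 : R)).
by under eq_fun do under eq_Rintegral do rewrite mul1r.
Qed.

Lemma measurable_statistics :
  (forall n, measurable_fun setT (local_sum T tau K sigma X n (h n))) /\
  (forall n, measurable_fun setT (kernel_error T tau K sigma X n (h n))).
Proof. by split; [exact: m_local|exact: m_kernel]. Qed.

Let mPsi u v : u <= v -> 0 <= Psi v - Psi u.
Proof. by move=> uv; apply: le_trans (normr_ge0 _) (dv.2 _ _ uv). Qed.

(** Each cell contributes its increment of the rescaled [Psi] times a mean integrated variance of at
    most [M] times the mesh; the increments telescope to at most [MK / h n], and the prefactor
    [eps^(-1/2)] leaves [M * MK * sqrt eps]. *)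
Let kernel_error_bound n : (0 < n)%N ->
  (\int[P]_w (`|kernel_error T tau K sigma X n (h n) w - local_sum T tau K sigma X n (h n) w|)%:E
    <= (M * MK * Num.sqrt ((T / n%:R) / h n))%:E)%E.
Proof.
move=> n0; have hn := h0 n; have e0 : 0 < (T / n%:R) / h n by rewrite divr_gt0// dt_gt0.
set eps := (T / n%:R) / h n in e0 *; have se0 : 0 < Num.sqrt eps by rewrite sqrtr_gt0.
have t00 : t n 0%N = 0 by rewrite /obs_time !mul0r.
have tnn : t n n = T by rewrite /obs_time mulrAC divff ?mul1r// pnatr_eq0 -lt0n.
pose Psih u := Psi ((u - tau) / h n) / h n.
have scale_le u v : u <= v -> (u - tau) / h n <= (v - tau) / h n.
  by move=> uv; rewrite ler_pM2r ?invr_gt0// lerD2r.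
have dvh u v : u <= v -> `|rescale K (h n) (u - tau) - rescale K (h n) (v - tau)| <= Psih v - Psih u.
  move=> uv; rewrite /rescale /Psih -!mulrBl normrM (gtr0_norm (x := (h n)^-1)) ?invr_gt0//.
  by rewrite ler_wpM2r ?invr_ge0 ?(ltW hn)//; exact/dv.2/scale_le.
have Kb u : `|rescale K (h n) (u - tau)| <= (`|K 0| + MK) / h n.
  rewrite /rescale normrM (gtr0_norm (x := (h n)^-1)) ?invr_gt0//.
  by rewrite ler_wpM2r ?invr_ge0 ?(ltW hn)//; exact: dominated_variation_bounded dv _.
pose c i := (Num.sqrt eps)^-1 * (Psih (t n i.+1) - Psih (t n i)).
have c0 i : 0 <= c i.
  rewrite /c mulr_ge0 ?invr_ge0 ?(ltW se0)// /Psih -mulrBl mulr_ge0 ?invr_ge0 ?(ltW hn)//.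
  exact/mPsi/scale_le/t_nd.
pose V i w := (\int[leb]_(u in `]t n i, t n i.+1]) (sigma u w ^+ 2)%:E)%E.
have cellV (i : 'I_n) := sqr_moment_itv M1 sigma_measurable sigma4 (t_ge0 n i)
  (obs_time_lt HT i n0) (t_le (ltn_ord i)).
have [V0 mV0] := sqr_moment_itv M1 sigma_measurable sigma4 (lexx 0) HT (lexx T).
have V0_ge0 w : (0 <= \int[leb]_(u in `]0%R, T]) (sigma u w ^+ 2)%:E)%E.
  by apply: integral_ge0 => u _; rewrite lee_fin sqr_ge0.
(* Paths of the squared volatility are known to be integrable almost surely only, by finiteness of
   the mean; hence the comparison below is almost everywhere. *)
have aefin : {ae P, forall w, (\int[leb]_(u in `]0%R, T]) (sigma u w ^+ 2)%:E)%E \is a fin_num}.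
  have : P.-integrable setT (fun w => \int[leb]_(u in `]0%R, T]) (sigma u w ^+ 2)%:E)%E.
    apply/integrableP; split=> //.
    under eq_integral do rewrite gee0_abs//.
    exact: le_lt_trans V0 (ltry _).
  move=> /(integrable_ae measurableT).
  by apply: filterS => w /(_ I).
have mVi (i : 'I_n) : measurable_fun setT (V i) by have [] := cellV i.
apply: (@le_trans _ _ (\int[P]_w \sum_(i < n) (c i)%:E * V i w)%E).
  apply: ae_ge0_le_integral => //.
  - apply/measurable_EFinP.
    have m1 := measurable_funB (m_kernel n) (m_local n).
    exact: (measurableT_comp (@normr_measurable R setT) m1).
  - move=> w _; apply: sume_ge0 => i _; apply: mule_ge0; first by rewrite lee_fin.
    by apply: integral_ge0 => u _; rewrite lee_fin sqr_ge0.
  - by apply: emeasurable_sum => i; exact: measurable_funeM.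
  move: aefin; apply: filterS => w wfin _.
  have ms : measurable_fun `]0, T] (sigma ^~ w).
    by apply: process_section => // u /=; rewrite in_itv/= => /andP[/ltW].
  have iw : leb.-integrable `]0, T] (EFin \o (fun u => sigma u w ^+ 2)).
    apply/integrableP; split; first by apply/measurable_EFinP; exact: measurable_funX.
    under eq_integral => u _ do rewrite gee0_abs ?lee_fin ?sqr_ge0//.
    by rewrite ltey_eq wfin.
  have iS (a b : R) : 0 <= a -> b <= T -> leb.-integrable `]a, b] (EFin \o (fun u => sigma u w ^+ 2)).
    move=> a0 bT; apply: integrableS iw => // u /=; rewrite !in_itv/= => /andP[au ub].
    by rewrite (le_lt_trans a0 au) (le_trans ub bT).
  have iwt : leb.-integrable `]t n 0%N, t n n] (EFin \o (fun u => sigma u w ^+ 2)).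
    by rewrite t00 tnn.
  have H := riemann_sum_path dvh (m_rescale n) Kb (fun u => sqr_ge0 (sigma u w)) (t_nd n) iwt.
  rewrite t00 tnn in H.
  rewrite kernel_sumE normrM gtr0_norm ?invr_gt0//.
  have -> : (\sum_(i < n) (c i)%:E * V i w =
      ((Num.sqrt eps)^-1 * \sum_(i < n) (Psih (t n i.+1) - Psih (t n i)) *
        \int[leb]_(u in `]t n i, t n i.+1]) sigma u w ^+ 2)%:E)%E.
    rewrite mulr_sumr -sumEFin; apply: eq_bigr => i _; rewrite mulrA (EFinM ((Num.sqrt eps)^-1 * _)); congr (_ * _)%E.
    by rewrite /Rintegral fineK//; apply: (integrable_fin_num _ (iS _ _ _ _)) => //; exact: t_le.
  rewrite lee_fin ler_wpM2l ?invr_ge0 ?(ltW se0)//; apply: le_trans _ H.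
  rewrite le_eqVlt; apply/orP; left; apply/eqP; congr (`|_ - _|).
    apply: eq_bigr => i _; congr (_ * _); apply/esym/Rintegral_itv_obnd_cbnd.
    by apply: iS => //; exact: t_le.
  apply/esym/Rintegral_itv_obnd_cbnd.
  have mf : measurable_fun `]0, T] (fun u => rescale K (h n) (u - tau) * sigma u w ^+ 2).
    by apply: measurable_funM; [exact: measurable_funTS|exact: measurable_funX].
  apply: (@le_integrable _ _ _ leb _ _ _ (fun u => (`|(`|K 0| + MK) / h n| * sigma u w ^+ 2)%:E)) => //.
  - exact/measurable_EFinP.
  - move=> u _; rewrite lee_fin (normrM (rescale _ _ _)) (normrM `|_|) normr_id ler_wpM2r//.
    exact: le_trans (Kb u) (ler_norm _).
  - exact: (integrableZl _ _ iw).
rewrite ge0_integral_sum//; last 2 first.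
- by move=> i; exact: measurable_funeM.
- move=> i w _; apply: mule_ge0; first by rewrite lee_fin.
  by apply: integral_ge0 => u _; rewrite lee_fin sqr_ge0.
apply: (@le_trans _ _ (\sum_(i < n) (c i * (M * (T / n%:R)))%:E)%E).
  apply: lee_sum => i _.
  rewrite ge0_integralZl_EFin//; last first.
    by move=> w _; apply: integral_ge0 => u _; rewrite lee_fin sqr_ge0.
  rewrite (EFinM (c i)); apply: lee_wpmul2l; first by rewrite lee_fin.
  by have [+ _] := cellV i; rewrite obs_timeS.
rewrite sumEFin lee_fin -mulr_suml /c -mulr_sumr.
rewrite -(big_mkord xpredT (fun i => Psih (t n i.+1) - Psih (t n i))) telescope_sumr//.
have PM : Psih (t n n) - Psih (t n 0%N) <= MK / h n.
  rewrite /Psih -mulrBl ler_wpM2r ?invr_ge0 ?(ltW hn)//.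
  have := dv.1 ((t n n - tau) / h n); have := dv.1 ((t n 0%N - tau) / h n).
  by move=> /andP[a1 _] /andP[_ a2]; rewrite lerBlDr (le_trans a2)// lerDl.
have M0 : 0 <= M by exact: le_trans M1.
apply: (@le_trans _ _ ((Num.sqrt eps)^-1 * (MK / h n) * (M * (T / n%:R)))).
  apply: ler_wpM2r; first by rewrite mulr_ge0.
  by apply: ler_wpM2l => //; rewrite invr_ge0 ltW.
have -> : (Num.sqrt eps)^-1 * (MK / h n) * (M * (T / n%:R)) = M * MK * ((Num.sqrt eps)^-1 * eps).
  by rewrite /eps; ring.
by rewrite -[X in _^-1 * X](sqr_sqrtr (ltW e0)) expr2 mulKf ?gt_eqF.
Qed.

Variables (N : nat -> nat -> R) (m : nat -> nat -> nat) (s : nat -> nat -> nat -> R).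
Hypothesis N0 : forall n i, 0 <= N n i.
Hypothesis s_nd : forall n i j, s n i j <= s n i j.+1.
Hypothesis ts : forall n i, t n i <= s n i 0%N.
Hypothesis st : forall n i, s n i (m n i) = t n i.+1.
Hypothesis approx : forall n i, (i < n)%N ->
  let S := step_path (m n i) (s n i) (fun u w => clip (N n i) (sigma u w)) in
  (\int[P]_w \int[leb]_(u in `]t n i, t n i.+1]) ((S u w - sigma u w) ^+ 2 +
     (S u w ^+ 2 - sigma u w ^+ 2) ^+ 2)%:E <= (r n ^+ 4)%:E)%E.

Let v n i j w := clip (N n i) (sigma (s n i j) w).
Let Gn := gaussian_sum B T sigma tau h K N m s.

Let s_ge0 n i j : 0 <= s n i j.
Proof.
apply: le_trans (t_ge0 n i) (le_trans (ts n i) _).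
exact: (homo_leq (@lexx _ _) (@le_trans _ _) (s_nd n i)).
Qed.

Let mv n i j : measurable_fun setT (v n i j).
Proof. exact: (measurableT_comp (measurable_clip _) (process_at sigma_measurable (s_ge0 n i j))). Qed.

Let mB u : 0 <= u -> measurable_fun setT (B u).
Proof. by move=> u0; exact: (at_time_measurable HFF u0 (brownian_measurable HFF HB u0 (lexx u))). Qed.

Let mQ n i : measurable_fun setT (fun w => cell_integral B (m n) (s n) (v n) i w ^+ 2 -
  cell_var (m n) (s n) (v n) i w).
Proof.
apply: measurable_funB.
  apply: measurable_funX; apply: measurable_sum => j; apply: measurable_funM => //.
  by apply: measurable_funB; exact: mB.
by apply: measurable_sum => j; apply: measurable_funM => //; exact: measurable_funX.
Qed.

Let mG n : measurable_fun setT (Gn n).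
Proof. by apply: measurable_sum => i; apply: measurable_funM => //; exact: mQ. Qed.

(** The cell error has order [r n ^+ 3]; multiplied by the weight, it becomes the summand of
    [kernel_abs_limit]. *)
Let coef_cube n i : (0 < n)%N -> `|coef n i| * r n ^+ 3 =
  Num.sqrt (h n) * ((h n)^-1 * (`|kernel_at T tau h K n i| * (T / n%:R))).
Proof.
move=> n0; have hn := h0 n; have dn := dt_gt0 n0.
have sh : 0 < Num.sqrt (h n) by rewrite sqrtr_gt0.
have sr : 0 < r n by rewrite sqrtr_gt0.
have E : (Num.sqrt ((T / n%:R) / h n))^-1 = Num.sqrt (h n) / r n.
  by rewrite (sqrtrM _ (ltW dn)) sqrtrV ?(ltW hn)// invfM invrK mulrC.
rewrite /coef E !normrM !normfV (gtr0_norm sh) (gtr0_norm sr) (gtr0_norm hn).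
rewrite exprS -[T / n%:R](sqr_sqrtr (ltW dn)) -/(r n).
by field; rewrite !gt_eqF.
Qed.

Let local_error_bound n : (0 < n)%N -> r n <= 1 ->
  (\int[P]_w (`|local_sum T tau K sigma X n (h n) w - Gn n w|)%:E <=
   ((6 * M + 20) * (Num.sqrt (h n) *
     ((h n)^-1 * \sum_(i < n) `|kernel_at T tau h K n i| * (T / n%:R))))%:E)%E.
Proof.
move=> n0 r1; have r0 : 0 < r n by rewrite sqrtr_gt0 dt_gt0.
pose D (i : 'I_n) w := (`|cell_defect n i w - (cell_integral B (m n) (s n) (v n) i w ^+ 2 -
  cell_var (m n) (s n) (v n) i w)|)%:E.
have mD (i : 'I_n) : measurable_fun setT (D i).
  apply/measurable_EFinP.
  have m1 := measurable_funB (m_defect (ltn_ord i)) (mQ n i).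
  exact: (measurableT_comp (@normr_measurable R setT) m1).
apply: (@le_trans _ _ (\sum_(i < n) (`|coef n i|)%:E * \int[P]_w D i w)%E).
  apply: ge0_integral_le_lin => //; first by move=> i w; rewrite lee_fin.
  move=> w _; rewrite /D; under eq_bigr do rewrite -EFinM; rewrite sumEFin lee_fin.
  rewrite local_sumE /Gn /gaussian_sum /cell_quad -sumrB.
  apply: le_trans (ler_norm_sum _ _ _) _; apply: ler_sum => i _.
  by rewrite -mulrBr normrM.
apply: (@le_trans _ _ (\sum_(i < n) (`|coef n i| * ((6 * M + 20) * r n ^+ 3))%:E)%E).
  apply: lee_sum => i _; rewrite (EFinM `|coef n i|); apply: lee_wpmul2l; first by rewrite lee_fin.
  have ni := ltn_ord i.
  apply: (cell_error HFF HB mu_measurable sigma_measurable sigma_adapted HX M1 mu4 sigma4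
    (t_ge0 n i) (obs_time_lt HT i n0) (t_le ni) (N0 n i) (s_nd n i) (ts n i) (st n i) (approx ni)) => //.
    by rewrite r0.
  by rewrite obs_timeS sqr_sqrtr.
rewrite sumEFin lee_fin !mulr_sumr; apply: ler_sum => i _.
by rewrite mulrCA coef_cube.
Qed.

(** [f] stands for cosine or sine. The local sum is compared in L1 with the Gaussian sum, and the
    kernel statistic with the local sum. *)
Lemma statistics_transfer (f : R -> R) (l c : R) :
  measurable_fun setT f -> (forall x, `|f x| <= 1) -> (forall x y, `|f x - f y| <= 4 * `|x - y|) ->
  \int[P]_w f (l * Gn n w) @[n --> \oo] --> c ->
  \int[P]_w f (l * local_sum T tau K sigma X n (h n) w) @[n --> \oo] --> c /\
  \int[P]_w f (l * kernel_error T tau K sigma X n (h n) w) @[n --> \oo] --> c.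
Proof.
move=> mf f1 flip fG.
have dt_cvg : T / n%:R @[n --> \oo] --> (0 : R).
  have H : (T / n%:R) / h n * h n @[n --> \oo] --> 0 * (0 : R) by exact: cvgM.
  move: H; rewrite mul0r; apply: cvg_trans; apply: near_eq_cvg; near=> n.
  by rewrite -mulrA mulVf ?mulr1// gt_eqF.
have H1 : \int[P]_w f (l * local_sum T tau K sigma X n (h n) w) @[n --> \oo] --> c.
  apply: (characteristic_transfer mf f1 flip m_local mG _ _ fG (e := fun n => (6 * M + 20) *
    (Num.sqrt (h n) * ((h n)^-1 * \sum_(i < n) `|kernel_at T tau h K n i| * (T / n%:R))))).
    near=> n; apply: local_error_bound; first by near: n; exists 1%N.
    have dt1 : T / n%:R <= 1 by near: n; exact: cvgr_le dt_cvg _ ltr01.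
    by rewrite -[leRHS]sqrtr1 ler_wsqrtr.
  rewrite -[X in _ --> X](mulr0 (6 * M + 20)); apply: cvgM; first exact: cvg_cst.
  exact: (kernel_abs_limit HT Htau h0 hlim Dh mK iK dv).
split=> //.
apply: (characteristic_transfer mf f1 flip m_kernel m_local _ _ H1 (e := fun n => M * MK *
  Num.sqrt ((T / n%:R) / h n))).
  by near=> n; apply: kernel_error_bound; near: n; exists 1%N.
rewrite -[X in _ --> X](mulr0 (M * MK)); apply: cvgM; first exact: cvg_cst.
by rewrite -[X in _ --> X](sqrtr0 R); exact: (cvg_comp _ _ Dh (@sqrt_continuous R 0)).
Unshelve. all: by end_near. Qed.

End ObservationErrors.

Theorem theorem6p1 (R : realType)
    (d : measure_display) (Omega : measurableType d) (P : probability Omega R)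
    (FF : R -> set (set Omega)) (HFF : complete_filtration P FF)
    (B : R -> Omega -> R) (HB : brownian_motion P FF B)
    (T : R) (HT : 0 < T)
    (mu sigma X : R -> Omega -> R)
    (mu_adapted : adapted FF mu) (mu_measurable : measurable_process mu)
    (sigma_adapted : adapted FF sigma)
    (sigma_measurable : measurable_process sigma)
    (HX : ito_process P FF B T mu sigma X)
    (Hlev : non_leverage P mu sigma B)
    (Hmom : moment_bound P T mu sigma)
    (gamma : R) (L : R -> R) (C : R -> R -> R)
    (Hscal : scaling_condition P T sigma gamma L C)
    (K : R -> R) (HK : admissible_kernel gamma C K)
    (tau : R) (Htau : 0 < tau < T)
    (h : nat -> R) (h_gt0 : forall n, 0 < h n)
    (h_to0 : h n @[n --> \oo] --> (0 : R))
    (Dh_to0 : (T / n%:R) / h n @[n --> \oo] --> (0 : R))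
    (* an extension of the probability space carrying xi *)
    (d' : measure_display) (Omega' : measurableType d')
    (P' : probability Omega' R)
    (rho : Omega' -> Omega) (Hrho : extension P P' rho)
    (delta1 xi : Omega' -> R)
    (delta1_measurable : measurable_fun setT delta1)
    (Hdelta1 : forall w, delta1 w ^+ 2 =
       2 * sigma tau (rho w) ^+ 4 * \int[lebesgue_measure]_x (K x ^+ 2))
    (Hxi : normal_rv P' xi 0 1)
    (Hindep : indep_events P' (rv_events delta1) (rv_events xi)) :
  cvg_in_distribution P P' (fun n => local_sum T tau K sigma X n (h n))
                           (fun w => delta1 w * xi w) /\
  cvg_in_distribution P P' (fun n => kernel_error T tau K sigma X n (h n))
                           (fun w => delta1 w * xi w).
Proof.
have [M M1 Hmo] := Hmom.
have M1' := ltW M1.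
have moment4 (Y : R -> Omega -> R) : measurable_process Y ->
    (forall t w, Y t w ^+ 4 <= mu t w ^+ 4 + sigma t w ^+ 4) ->
    forall t, 0 <= t <= T -> (\int[P]_w (Y t w ^+ 4)%:E <= M%:E)%E.
  move=> mY Yle t tT; have t0 : 0 <= t by case/andP: tT.
  have := ltW (Hmo t tT); rewrite unlock; apply: le_trans.
  apply: ge0_le_integral => //.
  - by move=> w _; rewrite lee_fin exprn_even_ge0.
  - by apply/measurable_EFinP; apply: measurable_funX; exact: process_at.
  - apply/measurable_EFinP; apply: measurable_funD; apply: measurable_funX; exact: process_at.
  - by move=> w _; rewrite lee_fin.
have mu4 : forall t, 0 <= t <= T -> (\int[P]_w (mu t w ^+ 4)%:E <= M%:E)%E.
  by apply: moment4 => // t w; rewrite lerDl exprn_even_ge0.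
have sigma4 : forall t, 0 <= t <= T -> (\int[P]_w (sigma t w ^+ 4)%:E <= M%:E)%E.
  by apply: moment4 => // t w; rewrite lerDr exprn_even_ge0.
have [Psi [MK dv]] := admissible_variation HK.
have mK := dominated_variation_measurable dv.
have iK : (@lebesgue_measure R).-integrable setT (EFin \o K).
  by case: HK => A0 [B0 [K' [_ K1 _ _ _]]]; exact: integrable_of_integral1 mK K1.
have gap := volatility_gap_cvg Hscal Htau.
(* Truncation level, number of steps and grid for every cell, to be extracted by [choice]. For
   [i >= n] no approximation is demanded, and a constant grid with no step meets the other
   clauses. *)
have grid (p : nat * nat) : exists q : R * nat * (nat -> R),
  [/\ 0 <= q.1.1, forall j, q.2 j <= q.2 j.+1, obs_time T p.1 p.2 <= q.2 0%N,
      q.2 q.1.2 = obs_time T p.1 p.2.+1 & (p.2 < p.1)%N ->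
      let S := step_path q.1.2 q.2 (fun u w => clip q.1.1 (sigma u w)) in
      (\int[P]_w \int[lebesgue_measure]_(u in `]obs_time T p.1 p.2, obs_time T p.1 p.2.+1])
        ((S u w - sigma u w) ^+ 2 + (S u w ^+ 2 - sigma u w ^+ 2) ^+ 2)%:E <=
        (Num.sqrt (T / p.1%:R) ^+ 4)%:E)%E].
  case: p => n i /=; have [ni|ni] := ltnP i n; last first.
    exists (0, 0%N, fun=> obs_time T n i.+1); split=> //=.
    by rewrite -subr_ge0 obs_timeS divr_ge0// ltW.
  have n0 : (0 < n)%N by exact: leq_ltn_trans ni.
  have d0 : 0 < T / n%:R by rewrite divr_gt0// ltr0n.
  have eps0 : 0 < Num.sqrt (T / n%:R) ^+ 4 by rewrite exprn_gt0// sqrtr_gt0.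
  have [N [m [s [N0 s_nd s0 sm approx]]]] := volatility_approximation sigma_measurable sigma4
    (obs_time_ge0 HT n i) (obs_time_lt HT i n0) (obs_time_le HT ni) eps0.
  by exists (N, m, s); split.
have [q Hq] := choice grid.
pose N n i := (q (n, i)).1.1; pose m n i := (q (n, i)).1.2; pose s n i := (q (n, i)).2.
have N0 n i : 0 <= N n i by have [] := Hq (n, i).
have s_nd n i j : s n i j <= s n i j.+1 by have [_ H _ _ _] := Hq (n, i); exact: H.
have ts n i : obs_time T n i <= s n i 0%N by have [] := Hq (n, i).
have st n i : s n i (m n i) = obs_time T n i.+1 by have [] := Hq (n, i).
have approx n i : (i < n)%N ->
    let S := step_path (m n i) (s n i) (fun u w => clip (N n i) (sigma u w)) in
    (\int[P]_w \int[lebesgue_measure]_(u in `]obs_time T n i, obs_time T n i.+1])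
      ((S u w - sigma u w) ^+ 2 + (S u w ^+ 2 - sigma u w ^+ 2) ^+ 2)%:E <=
      (Num.sqrt (T / n%:R) ^+ 4)%:E)%E by have [] := Hq (n, i).
have tau0 : 0 <= tau by case/andP: Htau => /ltW.
(* Half of [delta1 ^+ 2] is [sigma tau ^+ 4] times the integral of [K ^+ 2], a function of [rho w],
   so its exponential can be integrated over [Omega] instead of the extension. *)
have target l : \int[P']_w cos (l * (delta1 w * xi w)) =
    \int[P]_w expR (- (l ^+ 2 * (\int[lebesgue_measure]_y (K y ^+ 2) * (sigma tau w ^+ 2) ^+ 2))).
  rewrite (mixture_cos HFF HB delta1_measurable Hxi Hindep).
  rewrite -(extension_Rintegral Hrho (f := fun w => expR (- (l ^+ 2 *
    (\int[lebesgue_measure]_y (K y ^+ 2) * (sigma tau w ^+ 2) ^+ 2)))))//; last first.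
    apply: measurableT_comp => //; apply: measurableT_comp => //; apply: measurable_funM => //.
    apply: measurable_funM => //; apply: measurable_funX; apply: measurable_funX.
    exact: process_at.
  apply: eq_Rintegral => w _; congr (expR (- (_ * _))).
  by rewrite Hdelta1; field.
have mZ : measurable_fun setT (fun w => delta1 w * xi w).
  exact: measurable_funM delta1_measurable Hxi.1.
have transfer := statistics_transfer HFF HB HT mu_measurable sigma_measurable sigma_adapted HX M1'
  mu4 sigma4 Htau h_gt0 h_to0 Dh_to0 mK iK dv N0 s_nd ts st approx.
have gcos := gaussian_sum_cos HFF HB HT mu_measurable sigma_measurable Hlev M1' sigma4 Htau h_gt0
  h_to0 Dh_to0 mK iK dv gap s_nd ts st approx.
have gsin := gaussian_sum_sin HFF HB HT mu_measurable sigma_measurable Hlev M1' sigma4 Htau h_gt0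
  h_to0 Dh_to0 mK iK dv gap s_nd ts st approx.
have ncos := normal_cos HFF HB.
have tcos l := transfer _ l _ (@measurable_cos R) (fun x => cos_max x) (@cos_dist_le R) (gcos l).
have tsin l := transfer _ l _ (@measurable_sin R) (fun x => sin_max x) (@sin_dist_le R) (gsin l).
have [mlocal mkernel] := measurable_statistics HFF HT sigma_measurable HX tau h_gt0 mK.
split; apply: continuity_theorem => // l.
- by rewrite target; have [] := tcos l.
- by rewrite (mixture_sin delta1_measurable Hxi Hindep); have [] := tsin l.
- by rewrite target; have [] := tcos l.
- by rewrite (mixture_sin delta1_measurable Hxi Hindep); have [] := tsin l.
Qed.
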